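(* Let $\eta$ be a stationary and ergodic point process on $\mathbb{R}^d$ with positive intensity and local second moments, whose Bartlett measure satisfies $\sigma_\eta\ll\lambda_d$, with structure factor $S_\eta$. Assume that the Fourier condition (F) (stated in the context, for the fixed test function $h$) holds. Let $0<\alpha<\beta$, $L,r_0>0$, and assume that for some $s\ge 0$ and $c\in\mathbb{R}$, \[ A_r=s+c\,r^\alpha+\varepsilon_r,\qquad |\varepsilon_r|\le L r^\beta,\qquad 0<r\le r_0 , \] and that \[ \int_{B_{r_0}}S_\eta(\xi)^2\,d\lambda_d(\xi)<\infty . \] Fix $\gamma\in(0,1)$ and $\kappa>1$, and for integers $m\ge2$ write \[ \pi_{R,m}(r):=\mathbb{P}\bigl(\operatorname{Rej}_r(Y^{(R)};\gamma)\bigr). \] For every fixed $0<r\le r_0/\kappa$: 1. if $s=0$, then \[ \limsup_{m\to\infty}\limsup_{R\to\infty}\pi_{R,m}(r)\le\gamma ; \] 2. if $s_r>b_r$, in particular if $s>2b_r$, then \[ \liminf_{m\to\infty}\liminf_{R\to\infty}\pi_{R,m}(r)=1 . \] Consequently, for every sequence $r_n\downarrow0$ with $\kappa r_n\le r_0$: if $s=0$, then \[ \limsup_{n\to\infty}\limsup_{m\to\infty}\limsup_{R\to\infty}\pi_{R,m}(r_n)\le\gamma , \] while for every fixed $s>0$, \[ \lim_{n\to\infty}\liminf_{m\to\infty}\liminf_{R\to\infty}\pi_{R,m}(r_n)=1 . \]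
   Context: $\lambda_d$ is Lebesgue measure on $\mathbb{R}^d$; $B_R=B(0,R)$ is the ball of radius $R$ centred at the origin. Fourier transform and characters: $\hat f(\xi)=\int_{\mathbb{R}^d}f(x)e^{-2\pi i\langle x,\xi\rangle}\,d\lambda_d(x)$ and $\chi_\xi(x)=e^{2\pi i\langle x,\xi\rangle}$. **Point process.** $\eta$ is a point process (locally finite) on $\mathbb{R}^d$; stationary and ergodic refer to translations. Its intensity is $\rho_\eta$, so $\mathbb{E}\,\eta(B)=\rho_\eta\lambda_d(B)$; local second moments means $\mathbb{E}[\eta(B)^2]<\infty$ for bounded Borel $B$. Put $M(f):=\sum_{x\in\eta}f(x)-\rho_\eta\int f\,d\lambda_d$. The Bartlett measure $\sigma_\eta$ is the nonnegative measure on $\mathbb{R}^d$ defined by $\mathbb{E}[M(f)\overline{M(g)}]=\int\hat f\,\overline{\hat g}\,d\sigma_\eta$ for Schwartz $f,g$. If $\sigma_\eta\ll\lambda_d$, the structure factor $S_\eta$ is defined by $d\sigma_\eta=\rho_\eta S_\eta\,d\lambda_d$, with a fixed nonnegative Borel representative. For $r>0$, \[ A_r:=\frac{\sigma_\eta(B_r)}{\rho_\eta\lambda_d(B_r)}=\frac1{\lambda_d(B_r)}\int_{B_r}S_\eta\,d\lambda_d . \] **Fourier condition (F).** Fix $h\in C_c^\infty(B_1;\mathbb{C})$ (supported in $B_1$) with $\int|h|^2\,d\lambda_d=1$ and put $Z_R(\xi):=R^{-d/2}M(h(\cdot/R)\chi_\xi)$. Condition (F): for every $n\ge1$ there is a Borel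 set $\Omega_\eta^{(n)}\subset(\mathbb{R}^d)^n$ of full Lebesgue measure, contained in $\{(u_1,\dots,u_n):u_i\ne0,\ u_i\ne\pm u_j\text{ for }i\ne j\}$, such that for every $(u_1,\dots,u_n)\in\Omega_\eta^{(n)}$, as $R\to\infty$, $(Z_R(u_1),\dots,Z_R(u_n))$ converges in distribution to $(G_{u_1},\dots,G_{u_n})$, where the $G_{u_j}$ are independent centered circularly symmetric complex Gaussian variables (real and imaginary parts are independent centered Gaussians of equal variance) with $\mathbb{E}|G_{u_j}|^2=\rho_\eta S_\eta(u_j)$ and $\mathbb{E}G_{u_j}^2=0$. **Extrapolated intercept and bias bound.** For $\kappa>1$ and $0<r\le r_0/\kappa$, \[ D_{\alpha,\beta}(\kappa):=\frac{\kappa^\alpha+\kappa^\beta}{\kappa^\alpha-1},\qquad s_r:=\frac{\kappa^\alpha A_r-A_{\kappa r}}{\kappa^\alpha-1},\qquad b_r:=L\,D_{\alpha,\beta}(\kappa)\,r^\beta . \] **Two-radius rule.** For real arrays $y=(y_{a,j}:a\in\{r,\kappa r\},1\le j\le m)$ with $m\ge2$, put $\bar y_a:=\frac1m\sum_j y_{a,j}$, $v_a^2(y):=\frac1{m-1}\sum_j(y_{a,j}-\bar y_a)^2$, \[ \widehat s_r(y):=\frac{\kappa^\alpha\bar y_r-\bar y_{\kappa r}}{\kappa^\alpha-1},\qquad \operatorname{se}_r(y)\ge0,\quad \operatorname{se}_r^2(y):=\frac{\kappa^{2\alpha}v_r^2(y)+v_{\kappa r}^2(y)}{m(\kappa^\alpha-1)^2},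 \] and $\operatorname{Rej}_r(y;\gamma):=\{\widehat s_r(y)>b_r+z_{1-\gamma}\operatorname{se}_r(y)\}$, where $z_{1-\gamma}$ is the $(1-\gamma)$-quantile of $N(0,1)$. **Observed array.** With $\widehat\rho_R:=\eta(B_R)/\lambda_d(B_R)$, the windowed periodogram is \[ I_{R,h}(u):=\widehat\rho_R^{-1}R^{-d}\Bigl|\sum_{x\in\eta\cap B_R}h(x/R)\chi_u(x)\Bigr|^2 \] on $\{\widehat\rho_R>0\}$, and $0$ otherwise. For $a\in\{r,\kappa r\}$ and $1\le j\le m$ the frequencies $U_{a,j}$ are mutually independent, independent of $\eta$, with $U_{a,j}$ uniform on $B_a$, and $Y^{(R)}_{a,j}:=I_{R,h}(U_{a,j})$. *)

(* Defs.v *)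
From HB Require Import structures.
From mathcomp Require Import all_boot all_order all_algebra.
From mathcomp Require Import complex.
From mathcomp Require Import all_classical all_reals all_analysis.
From mathcomp Require Import measurable_realfun.

Set Implicit Arguments.
Unset Strict Implicit.
Unset Printing Implicit Defensive.

Import Order.TTheory GRing.Theory Num.Theory.
Import numFieldNormedType.Exports.

Local Open Scope classical_set_scope.
Local Open Scope ring_scope.

Definition rV_display : measure_display -> measure_display.
Proof. exact. Qed.

Section measurable_rV.
Context {R : realType} (n : nat).

Let coord (i : 'I_n) (v : 'rV[R]_n) : R := v ord0 i.

Let rV_set0 : g_sigma_preimage coord set0.
Proof. exact: sigma_algebra0. Qed.

Let rV_setC A : g_sigma_preimage coord A -> g_sigma_preimage coord (~` A).
Proof. exact: sigma_algebraC. Qed.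

Let rV_bigcup (F : _^nat) : (forall i, g_sigma_preimage coord (F i)) ->
  g_sigma_preimage coord (\bigcup_i (F i)).
Proof. exact: sigma_algebra_bigcup. Qed.

(* The Borel sigma-algebra of R^n, generated by the coordinates. *)
HB.instance Definition _ := @isMeasurable.Build (rV_display default_measure_display)
  'rV[R]_n (g_sigma_preimage coord) rV_set0 rV_setC rV_bigcup.

End measurable_rV.


Section rV_maps.
Context {R : realType} {n : nat}.

Lemma measurable_coord (i : 'I_n) :
  measurable_fun setT (fun v : 'rV[R]_n => v ord0 i).
Proof.
move=> _ Y mY; rewrite setTI; apply: sub_sigma_algebra => /=.
rewrite -bigcup_seq/=; exists i => /=; first by rewrite mem_index_enum.
by exists Y => //; rewrite setTI.
Qed.

Lemma measurable_fun_rVP d (T : measurableType d) (f : T -> 'rV[R]_n) :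
  (forall i, measurable_fun setT (fun x => f x ord0 i)) -> measurable_fun setT f.
Proof.
move=> mf.
have : <<s \big[setU/set0]_(i < n) preimage_set_system setT
    (fun v : 'rV[R]_n => v ord0 i) measurable >> `<=`
    [set A : set 'rV[R]_n | measurable (f @^-1` A)].
  apply: smallest_sub; last first.
    rewrite -bigcup_seq/=; apply: bigcup_sub => i _ A [B mB <-] /=.
    by rewrite setTI -[X in measurable X]setTI; exact: mf.
  split => /=.
  - by rewrite preimage_set0.
  - by move=> A mA; rewrite setTD preimage_setC; exact: measurableC.
  - by move=> F mF; rewrite preimage_bigcup; exact: bigcup_measurable.
by move=> sub _ A mA; rewrite setTI; exact: sub.
Qed.

Definition row_of_tuple (t : n.-tuple (measurableTypeR R)) : 'rV[R]_n := \row_i tnth t i.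

Definition tuple_of_row (v : 'rV[R]_n) : n.-tuple (measurableTypeR R) := [tuple v ord0 i | i < n].

Lemma tuple_of_rowK : cancel tuple_of_row row_of_tuple.
Proof. by move=> v; apply/rowP => i; rewrite mxE tnth_mktuple. Qed.

Lemma row_of_tupleK : cancel row_of_tuple tuple_of_row.
Proof. by move=> t; apply/eq_from_tnth => i; rewrite tnth_mktuple mxE. Qed.

Lemma measurable_row_of_tuple : measurable_fun setT row_of_tuple.
Proof.
apply: measurable_fun_rVP => i; under eq_fun do rewrite mxE.
exact: (@measurable_tnth _ (measurableTypeR R)).
Qed.

Lemma measurable_tuple_of_row : measurable_fun setT tuple_of_row.
Proof.
apply/measurable_fun_tnthP => i.
rewrite [X in measurable_fun _ X](_ : _ = fun v : 'rV[R]_n => v ord0 i).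
  exact: measurable_coord.
by apply/funext => v /=; rewrite tnth_mktuple.
Qed.

Lemma measurable_shift (v : 'rV[R]_n) : measurable_fun setT (shift v).
Proof.
apply: measurable_fun_rVP => i; under eq_fun do rewrite mxE.
apply: (measurable_funD (measurable_coord i)).
exact: measurable_cst.
Qed.

HB.instance Definition _ := @isMeasurableFun.Build _ _ _ _ row_of_tuple
  measurable_row_of_tuple.

HB.instance Definition _ (v : 'rV[R]_n) := @isMeasurableFun.Build _ _ _ _
  (shift v) (measurable_shift v).

End rV_maps.

Lemma pushforward_sigma_finite d1 d2 (T1 : measurableType d1)
    (T2 : measurableType d2) (R : realType)
    (mu : set T1 -> \bar R) (f : T1 -> T2) (g : T2 -> T1) :
  sigma_finite setT mu -> measurable_fun setT g -> cancel f g -> sigma_finite setT (pushforward mu f).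
Proof.
move=> [F TF mF] mg fgK.
exists (fun k => g @^-1` F k).
  by rewrite -preimage_bigcup -TF preimage_setT.
move=> k; have [mFk Fkoo] := mF k; split.
  by rewrite -[X in measurable X]setTI; exact: mg.
by rewrite /pushforward -comp_preimage (_ : g \o f = id)// funeqE.
Qed.

Lemma product_sigma_finite d1 d2 (T1 : measurableType d1)
    (T2 : measurableType d2) (R : realType)
    (m1 : {sigma_finite_measure set T1 -> \bar R})
    (m2 : {sigma_finite_measure set T2 -> \bar R}) :
  sigma_finite setT (m1 \x m2)%E.
Proof.
have /sigma_finiteP[F [TF ndF Foo]] := sigma_finiteT m1.
have /sigma_finiteP[G [TG ndG Goo]] := sigma_finiteT m2.
exists (fun n => F n `*` G n).
  rewrite -setXTT TF TG predeqE => -[x y]; split.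
    move=> [/= [n _ Fnx] [k _ Gky]]; exists (maxn n k) => //; split.
    - by move: x Fnx; exact/subsetPset/ndF/leq_maxl.
    - by move: y Gky; exact/subsetPset/ndG/leq_maxr.
  by move=> [n _ []/= ? ?]; split; exists n.
move=> k; have [? ?] := Foo k; have [? ?] := Goo k.
split; first exact: measurableX.
by rewrite product_measure1E// lte_mul_pinfty// ge0_fin_numE.
Qed.

Section tuple_measure.
Context d (T : measurableType d) (R : realType).
Variable mu : {sigma_finite_measure set T -> \bar R}.

Definition cons_pair n (p : T * n.-tuple T) : n.+1.-tuple T := [tuple of p.1 :: p.2].

Lemma measurable_cons_pair n : measurable_fun setT (@cons_pair n).
Proof. exact: measurable_cons. Qed.

HB.instance Definition _ n := @isMeasurableFun.Build _ _ _ _ (@cons_pair n)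
  (@measurable_cons_pair n).

Definition cons_measure n (nu : {sigma_finite_measure set (n.-tuple T) -> \bar R}) :=
  pushforward (mu \x nu)%E (@cons_pair n).

Section cons_measure.
Variables (n : nat) (nu : {sigma_finite_measure set (n.-tuple T) -> \bar R}).

Let m0 : cons_measure nu set0 = 0%E.
Proof. exact: measure0. Qed.

Let m_ge0 A : (0 <= cons_measure nu A)%E.
Proof. exact: measure_ge0. Qed.

Let m_sigma_additive : semi_sigma_additive (cons_measure nu).
Proof. exact: measure_semi_sigma_additive. Qed.

HB.instance Definition _ := isMeasure.Build _ _ _ (cons_measure nu)
  m0 m_ge0 m_sigma_additive.


Lemma cons_measure_sigma_finite : sigma_finite setT (cons_measure nu).
Proof.
apply: (@pushforward_sigma_finite _ _ (T * n.-tuple T)%type _ R _ _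
  (fun t : n.+1.-tuple T => (thead t, [tuple of behead t]))).
- exact: product_sigma_finite.
- by apply: measurable_fun_pair; [exact: measurable_tnth|exact: measurable_behead].
- by move=> [x t]; congr pair; apply/val_inj.
Qed.

HB.instance Definition _ := Measure_isSigmaFinite.Build _ _ _ (cons_measure nu)
  cons_measure_sigma_finite.

End cons_measure.

Fixpoint tuple_measure n : {sigma_finite_measure set (n.-tuple T) -> \bar R} :=
  if n is n'.+1 then cons_measure (tuple_measure n') else dirac [tuple].

End tuple_measure.

Definition lebesgue_rV (R : realType) (n : nat) : set 'rV[R]_n -> \bar R :=
  pushforward (tuple_measure (@lebesgue_measure R) n) row_of_tuple.
Arguments lebesgue_rV : clear implicits.

Section lebesgue_rV.
Variables (R : realType) (n : nat).

Let m0 : lebesgue_rV R n set0 = 0%E.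
Proof. exact: measure0. Qed.

Let m_ge0 A : (0 <= lebesgue_rV R n A)%E.
Proof. exact: measure_ge0. Qed.

Let m_sigma_additive : semi_sigma_additive (lebesgue_rV R n).
Proof. exact: measure_semi_sigma_additive. Qed.

HB.instance Definition _ := isMeasure.Build _ _ _ (lebesgue_rV R n)
  m0 m_ge0 m_sigma_additive.


Let lebesgue_rV_sigma_finite : sigma_finite setT (lebesgue_rV R n).
Proof.
exact: pushforward_sigma_finite (sigma_finiteT _) measurable_tuple_of_row row_of_tupleK.
Qed.

HB.instance Definition _ := Measure_isSigmaFinite.Build _ _ _ (lebesgue_rV R n)
  lebesgue_rV_sigma_finite.

End lebesgue_rV.

Section fourier.
Context {R : realType} {d : nat}.
Local Notation lambda := (lebesgue_rV R d).
Implicit Types (x xi : 'rV[R]_d) (f g : 'rV[R]_d -> R[i]).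

Definition dotr x xi : R := \sum_i x ord0 i * xi ord0 i.

(* The library norm on 'rV[R]_d is the sup norm, hence an explicit Euclidean one. *)
Definition enorm x : R := Num.sqrt (dotr x x).

Definition eball (r : R) : set 'rV[R]_d := [set x | enorm x < r].

Definition cintegral d' (T : measurableType d') (mu : {measure set T -> \bar R})
    (D : set T) (f : T -> R[i]) : R[i] :=
  ((\int[mu]_(x in D) complex.Re (f x)) +i* (\int[mu]_(x in D) complex.Im (f x)))%C.

Definition csqnorm (z : R[i]) : R := complex.Re z ^+ 2 + complex.Im z ^+ 2.

Definition chi xi x : R[i] :=
  (cos (2 * pi * dotr x xi) +i* sin (2 * pi * dotr x xi))%C.

Definition fourier f xi : R[i] := cintegral lambda setT (fun x => f x * chi (- xi) x).

Definition partials (s : seq 'I_d) (f : 'rV[R]_d -> R) : 'rV[R]_d -> R :=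
  foldr (fun i (g : 'rV[R]_d -> R) => 'D_(delta_mx ord0 i) g) f s.

Definition smooth (f : 'rV[R]_d -> R) : Prop :=
  forall s, continuous (partials s f) /\
    forall x i, derivable (partials s f) x (delta_mx ord0 i).

Definition schwartz_real (f : 'rV[R]_d -> R) : Prop :=
  smooth f /\
  forall (k : nat) s, exists C : R, forall x, enorm x ^+ k * `|partials s f x| <= C.

Definition schwartz f : Prop :=
  schwartz_real (fun x => complex.Re (f x)) /\
  schwartz_real (fun x => complex.Im (f x)).

Definition test_function f : Prop :=
  [/\ smooth (fun x => complex.Re (f x)), smooth (fun x => complex.Im (f x)),
      closure [set x | f x != 0] `<=` eball 1 &
      (\int[lambda]_x (csqnorm (f x))%:E = 1)%E].

End fourier.

Definition translate (R : realType) (d : nat) (v : 'rV[R]_d)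
    (mu : {measure set 'rV[R]_d -> \bar R}) : set 'rV[R]_d -> \bar R :=
  pushforward mu (shift v).

Section translate_measure.
Variables (R : realType) (d : nat) (v : 'rV[R]_d).
Variable mu : {measure set 'rV[R]_d -> \bar R}.

Let m0 : translate v mu set0 = 0%E.
Proof. exact: measure0. Qed.

Let m_ge0 A : (0 <= translate v mu A)%E.
Proof. exact: measure_ge0. Qed.

Let m_sigma_additive : semi_sigma_additive (translate v mu).
Proof. exact: measure_semi_sigma_additive. Qed.

HB.instance Definition _ := isMeasure.Build _ _ _ (translate v mu)
  m0 m_ge0 m_sigma_additive.

End translate_measure.

(* A point process is a random measure all of whose values are configurations,
   that is, measures with finite integer values on bounded Borel sets (points may
   be multiple); the sum of f over the points is the integral of f. *)
Definition configuration (R : realType) (d : nat)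
    (mu : {measure set 'rV[R]_d -> \bar R}) : Prop :=
  forall B : set 'rV[R]_d, measurable B -> bounded_set B -> exists k : nat, mu B = k%:R%:E.

(* The sigma-algebra generated by the evaluations mu |-> mu B, B Borel. *)
Definition configuration_events (R : realType) (d : nat) :
    set (set {measure set 'rV[R]_d -> \bar R}) :=
  <<s [set E | exists (B : set 'rV[R]_d) (Y : set (\bar R)),
        [/\ measurable B, measurable Y & E = [set mu : {measure set 'rV[R]_d -> \bar R} | Y (mu B)]]] >>.

Section point_process.
Context {R : realType} {d : nat} {dO : measure_display} {Omega : measurableType dO}.
Variables (P : probability Omega R) (eta : R.-ker Omega ~> 'rV[R]_d).
Local Notation lambda := (lebesgue_rV R d).

Definition point_process : Prop := forall w, configuration (eta w).

Definition stationary : Prop := forall v E, configuration_events E ->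
  P [set w | E (translate v (eta w))] = P [set w | E (eta w)].

Definition ergodic : Prop := forall E, configuration_events E ->
  (forall v mu, configuration mu -> E (translate v mu) <-> E mu) ->
  (P [set w | E (eta w)] = 0 \/ P [set w | E (eta w)] = 1)%E.

Definition has_intensity (rho : R) : Prop := forall B : set 'rV[R]_d, measurable B ->
  (\int[P]_w eta w B = rho%:E * lambda B)%E.

Definition local_second_moments : Prop := forall B : set 'rV[R]_d, measurable B ->
  bounded_set B -> (\int[P]_w (eta w B ^+ 2) < +oo)%E.

Variable rho : R.

Definition compensated_sum (f : 'rV[R]_d -> R[i]) (w : Omega) : R[i] :=
  cintegral (eta w) setT f - (rho%:C)%C * cintegral lambda setT f.

(* The integrability clause makes the right-hand side of the second clause a genuine
   integral, the integral of a non-integrable function being a default value. *)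
Definition bartlett_measure (sigma : {measure set 'rV[R]_d -> \bar R}) : Prop :=
  (forall f, schwartz f ->
    sigma.-integrable setT (fun xi => (csqnorm (fourier f xi))%:E)) /\
  forall f g, schwartz f -> schwartz g ->
    cintegral P setT
      (fun w => compensated_sum f w * (compensated_sum g w)^*%C) =
    cintegral sigma setT (fun xi => fourier f xi * (fourier g xi)^*%C).

Definition structure_factor (sigma : {measure set 'rV[R]_d -> \bar R})
    (S : 'rV[R]_d -> R) : Prop :=
  [/\ measurable_fun setT S, forall xi, 0 <= S xi &
      forall B : set 'rV[R]_d, measurable B ->
        (sigma B = \int[lambda]_(xi in B) (rho * S xi)%:E)%E].

Definition ball_average (sigma : {measure set 'rV[R]_d -> \bar R}) (r : R) : R :=
  fine (sigma (eball r)) / (rho * fine (lambda (eball r))).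

Definition scaled_sum (h : 'rV[R]_d -> R[i]) (T : R) (xi : 'rV[R]_d) (w : Omega) :
    R[i] :=
  ((T `^ (- (d%:R / 2)))%:C)%C *
    compensated_sum (fun x => h (T^-1 *: x) * chi xi x) w.

End point_process.

(* The identification of C^n with R^(n+n). *)
Definition complex_row (R : realType) (n : nat) (z : 'I_n -> R[i]) : 'rV[R]_(n + n) :=
  row_mx (\row_j complex.Re (z j)) (\row_j complex.Im (z j)).

(* Convergence in distribution as T tends to infinity of the random vectors Z T,
   defined on (Omega, P), to the random vector G, defined on (Omega', Q). *)
Definition cvg_in_distribution (R : realType) (k : nat)
    dO (Omega : measurableType dO) (P : probability Omega R)
    (Z : R -> Omega -> 'rV[R]_k)
    dO' (Omega' : measurableType dO') (Q : {measure set Omega' -> \bar R})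
    (G : Omega' -> 'rV[R]_k) : Prop :=
  forall phi : 'rV[R]_k -> R, continuous phi ->
    (exists C : R, forall x, `|phi x| <= C) ->
    \int[P]_w phi (Z T w) @[T --> +oo] --> \int[Q]_t phi (G t).

(* Under the law of n+n independent standard normal variables, the coordinates of
   [circular_gaussian v] are independent and the j-th one is a centered circularly
   symmetric complex Gaussian variable of second absolute moment v j; v j = 0 is
   allowed. *)
Definition circular_gaussian (R : realType) (n : nat) (v : 'I_n -> R)
    (t : (n + n).-tuple (measurableTypeR R)) : 'rV[R]_(n + n) :=
  complex_row (fun j => (Num.sqrt (v j / 2) * (tnth t (lshift n j) : R) +i*
                         (Num.sqrt (v j / 2) * (tnth t (rshift n j) : R)))%C).

Definition fourier_condition (R : realType) (d : nat) dO
    (Omega : measurableType dO) (P : probability Omega R)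
    (eta : R.-ker Omega ~> 'rV[R]_d) (rho : R) (S : 'rV[R]_d -> R)
    (h : 'rV[R]_d -> R[i]) : Prop :=
  forall n : nat, (0 < n)%N -> exists D : set (n.-tuple 'rV[R]_d),
    [/\ measurable D,
        tuple_measure (lebesgue_rV R d) n (~` D) = 0%E,
        forall u, D u ->
          (forall i, tnth u i != 0) /\
          (forall i j, i != j -> tnth u i != tnth u j /\ tnth u i != - tnth u j) &
        forall u, D u ->
          cvg_in_distribution P
            (fun T w => complex_row (fun j => scaled_sum eta rho h T (tnth u j) w))
            (tuple_measure (normal_prob (0 : R) 1) (n + n))
            (circular_gaussian (fun j => rho * S (tnth u j)))].

Section two_radius_rule.
Context {R : realType}.
Variables (alpha beta L kappa : R).

Definition extrapolate (Ar Akr : R) : R :=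
  (kappa `^ alpha * Ar - Akr) / (kappa `^ alpha - 1).

Definition bias_bound (r : R) : R :=
  L * ((kappa `^ alpha + kappa `^ beta) / (kappa `^ alpha - 1)) * r `^ beta.

Definition normal_quantile (p : R) : R :=
  inf [set x : R | (p%:E <= normal_prob (0 : R) 1 `]-oo, x])%E].

(* In an array indexed by a : bool, the index false stands for the radius r and true
   for kappa * r. *)
Definition array_radius (r : R) (a : bool) : R := if a then kappa * r else r.

Section array.
Variables (m : nat) (y : bool -> 'I_m -> R).

Definition array_mean (a : bool) : R := (\sum_(j < m) y a j) / m%:R.

Definition array_var (a : bool) : R :=
  (\sum_(j < m) (y a j - array_mean a) ^+ 2) / (m%:R - 1).

Definition intercept_estimate : R :=
  extrapolate (array_mean false) (array_mean true).

Definition standard_error : R :=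
  Num.sqrt ((kappa `^ (2 * alpha) * array_var false + array_var true) /
            (m%:R * (kappa `^ alpha - 1) ^+ 2)).

Definition rejects (gamma r : R) : Prop :=
  intercept_estimate > bias_bound r + normal_quantile (1 - gamma) * standard_error.

End array.
End two_radius_rule.

Section observed_array.
Context {R : realType} {d : nat} {dO : measure_display} {Omega : measurableType dO}.
Variables (P : probability Omega R) (eta : R.-ker Omega ~> 'rV[R]_d).
Local Notation lambda := (lebesgue_rV R d).

Definition empirical_intensity (T : R) (w : Omega) : R :=
  fine (eta w (eball T)) / fine (lambda (eball T)).

Definition periodogram (h : 'rV[R]_d -> R[i]) (T : R) (u : 'rV[R]_d) (w : Omega) : R :=
  if 0 < empirical_intensity T w then
    (empirical_intensity T w)^-1 * T ^- d *
      csqnorm (cintegral (eta w) (eball T) (fun x => h (T^-1 *: x) * chi u x))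
  else 0.

(* The frequencies U a j are uniform on the ball of radius [array_radius kappa r a], mutually
   independent, and independent of eta (taking sets equal to setT yields the product
   rule for every subfamily). *)
Definition random_frequencies (kappa r : R) (m : nat)
    (U : bool -> 'I_m -> {RV P >-> 'rV[R]_d}) : Prop :=
  (forall a j C, measurable C ->
    P (U a j @^-1` C) = (fine (lambda (C `&` eball (array_radius kappa r a))) /
                         fine (lambda (eball (array_radius kappa r a))))%:E) /\
  (forall E (C : bool -> 'I_m -> set 'rV[R]_d), configuration_events E ->
    (forall a j, measurable (C a j)) ->
    P [set w | E (eta w) /\ forall a j, C a j (U a j w)] =
    (P [set w | E (eta w)] * \prod_(a : bool) \prod_(j < m) P (U a j @^-1` C a j))%E).

Definition rejection_probability (h : 'rV[R]_d -> R[i]) (alpha beta L kappa gamma : R)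
    (U : R -> forall m, bool -> 'I_m -> {RV P >-> 'rV[R]_d}) (T : R) (m : nat) (r : R) :
    \bar R :=
  P [set w | rejects alpha beta L kappa
    (fun a (j : 'I_m) => periodogram h T (U r m a j w) w) gamma r].

End observed_array.

(* Main.v *)
Require Import Defs.
From HB Require Import structures.
From mathcomp Require Import all_boot all_order all_algebra.
From mathcomp Require Import complex.
From mathcomp Require Import all_classical all_reals all_analysis.
From mathcomp Require Import measurable_realfun.
From mathcomp Require Import ring lra.

Import Order.TTheory GRing.Theory Num.Theory.
Import numFieldNormedType.Exports.

Set Implicit Arguments.
Unset Strict Implicit.
Unset Printing Implicit Defensive.

Local Open Scope classical_set_scope.
Local Open Scope ring_scope.

(** Fix a radius r and a sample size m. Given the frequencies, the periodograms are, as
    the window grows, asymptotically independent exponential variables with means S (u),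
    where S is the structure factor: their numerators are squared moduli of exponential
    sums with a circular Gaussian limit, and the empirical intensity that normalizes them
    converges to rho. Averaging over the uniform frequencies, the observed array converges
    in law to m independent pairs (f, g) = (S (U) E, S (U') E'), with U and U' uniform in
    the balls of radius r and kappa r and E, E' exponential of mean 1. The means of f and
    g are the ball averages of the Bartlett measure at the two radii, and their second
    moments are finite because S is square integrable. It remains to study the rule for
    such samples as m grows.

    Let s_r be the value extrapolated from the two means and b_r the bias bound. If s_r <
    b_r or s_r > b_r, the law of large numbers decides (margin_lln). If s_r = b_r, the
    studentized contrast is asymptotically standard Gaussian, whence the level gamma
    (margin_boundary), provided that its variance is positive. It is: since E z^4 > 1 for
    a standard Gaussian z, a vanishing variance forces both means to vanish
    (exp_power_sqr), and then s_r = 0 < b_r (limit_var_gt0). The extrapolation cancels the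
    term of order alpha, so that |s_r - s| <= b_r (extrapolation_bias); hence s_r <= b_r
    if s = 0, and s_r > b_r if s > 2 b_r, which holds for small r when s > 0.

    Three ingredients are of independent interest.

    The convergence of the empirical intensity (empirical_lln) is deduced from the
    Bartlett measure sigma, which determines the variance of a smooth linear statistic at
    scale T as the integral of a power spectrum evaluated at T xi. The spectrum tends to 0
    away from the origin, which has no mass, but dominated convergence needs an integrable
    majorant. Such a majorant is built from the spectra of dyadic contractions of the same
    function (power_dyadic), whose integrals are bounded because the variance of a
    statistic supported in the unit ball is (power_growth). The indicator functions of
    balls are then compared with smooth bumps.

    Random frequencies are reduced to deterministic ones by independence (conditioning),
    which involves only the sigma-algebra generated by the point process; the periodogram
    is therefore shown to be jointly measurable for this sigma-algebra
    (measurable_joint_periodogram). The law of the frequencies has a density, so that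
    convergence at almost all frequencies suffices (rejection_limit).

    The law of large numbers and the central limit theorem for independent samples (wlln,
    clt_tail) are proved by comparing powers of commuting contractions (trotter): adding
    an independent variable acts on bounded functions by a shift operator, and the
    Gaussian variable is itself a sum of n independent ones (iter_gauss). The logistic
    function and its rescalings serve as test functions. *)

(** * Product measures on tuples *)

Section tuple_fubini.
Context d (T : measurableType d) (R : realType).

(** The inductive definition of the product measure, read as an iterated integral; every
    computation with an integral over tuples is an induction through this step. *)
Lemma ge0_integral_tupleS (mu : {sigma_finite_measure set T -> \bar R}) n
    (F : n.+1.-tuple T -> \bar R) :
  measurable_fun setT F -> (forall t, (0 <= F t)%E) ->
  (\int[tuple_measure mu n.+1]_t F t =
   \int[mu]_x \int[tuple_measure mu n]_t F (cons_pair (x, t)))%E.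
Proof.
move=> mF F0.
transitivity (\int[(mu \x tuple_measure mu n)%E]_p F (cons_pair p))%E.
  by rewrite /= /cons_measure ge0_integral_pushforward.
rewrite fubini_tonelli1//.
by apply: measurableT_comp => //; exact: measurable_cons_pair.
Qed.

Lemma measurable_rect n (C : 'I_n -> set T) : (forall i, measurable (C i)) ->
  measurable [set t : n.-tuple T | forall i, C i (tnth t i)].
Proof.
move=> mC; rewrite [X in measurable X](_ : _ =
    \big[setI/setT]_(i < n) ((fun t : n.-tuple T => tnth t i) @^-1` C i)).
  apply: bigsetI_measurable => i _.
  by rewrite -[X in measurable X]setTI; exact: measurable_tnth.
apply/seteqP; split=> [t /= tC|t]; first by rewrite -bigcap_seq => i _; exact: tC.
by rewrite -bigcap_seq => tC i; apply: tC => /=; exact: mem_index_enum.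
Qed.

Lemma tuple_measure_rect (mu : {sigma_finite_measure set T -> \bar R}) n
    (C : 'I_n -> set T) : (forall i, measurable (C i)) ->
  tuple_measure mu n [set t | forall i, C i (tnth t i)] = (\prod_(i < n) mu (C i))%E.
Proof.
elim: n C => [|n IH] C mC.
  rewrite big_ord0 /= diracE (_ : [set t | _] = setT); first by rewrite in_setT.
  by apply/seteqP; split => // t _ [].
rewrite big_ord_recl /= /cons_measure /pushforward.
rewrite (_ : _ @^-1` _ = C ord0 `*` [set t | forall i : 'I_n, C (lift ord0 i) (tnth t i)]).
  rewrite product_measure1E//; last exact: (@measurable_rect n (fun i => C (lift ord0 i))).
  by rewrite (IH (fun i => C (lift ord0 i))).
apply/seteqP; split=> -[x t] /=.
  move=> H; split; first by have := H ord0.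
  by move=> i; have := H (lift ord0 i); rewrite tnthS.
move=> [H0 H1] i; have [->//|i0] := eqVneq i ord0.
have [j ->] : exists j, i = lift ord0 j.
  by case: (unliftP ord0 i) i0 => [j ->|-> /eqP//]; exists j.
by rewrite tnthS.
Qed.

(** Rectangles are closed under intersection and generate the product sigma-algebra, so that
    laws of random tuples can be identified by their values on rectangles. *)
Lemma tuple_measure_unique n (m1 m2 : {measure set (n.-tuple T) -> \bar R}) :
  (m1 setT < +oo)%E ->
  (forall C : 'I_n -> set T, (forall i, measurable (C i)) ->
    m1 [set t | forall i, C i (tnth t i)] = m2 [set t | forall i, C i (tnth t i)]) ->
  forall A, measurable A -> m1 A = m2 A.
Proof.
move=> m1oo m12 A mA.
(* the pi-system of measurable rectangles *)
pose G : set (set (n.-tuple T)) :=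
  [set B | exists C : 'I_n -> set T, (forall i, measurable (C i)) /\
     B = [set t | forall i, C i (tnth t i)]].
apply: (measure_unique G (fun=> setT)) => //.
- apply/seteqP; split; last first.
    apply: smallest_sub; first exact: sigma_algebra_measurable.
    by move=> _ [C [mC ->]]; exact: measurable_rect.
  apply: smallest_sub; first exact: smallest_sigma_algebra.
  rewrite -bigcup_seq; apply: bigcup_sub => i _ _ [B mB <-].
  apply: sub_sigma_algebra; exists (fun j => if j == i then B else setT); split.
    by move=> j; case: ifP.
  rewrite setTI; apply/seteqP; split=> [t /= Bt j|t /= /(_ i)]; last by rewrite eqxx.
  by case: ifPn => // /eqP ->.
- move=> _ _ [C [mC ->]] [C' [mC' ->]]; exists (fun i => C i `&` C' i); split.
    by move=> i; exact: measurableI.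
  apply/seteqP; split=> [t [/= H H'] i|t /= H]; first by split.
  by split=> i; have [] := H i.
- by move=> _; exists (fun=> setT); split => //; apply/seteqP; split.
- by apply/seteqP; split => // t _; exists 0%N.
- by move=> _ [C [mC ->]]; exact: m12.
Qed.

End tuple_fubini.

Section iid.
Context d (T : measurableType d) (R : realType) (mu : probability T R) (n : nat).

Definition iid : set (n.-tuple T) -> \bar R := tuple_measure mu n.

HB.instance Definition _ := Measure.on iid.

Let iid_setT : iid setT = 1%E.
Proof.
rewrite /iid (_ : setT = [set t | forall i : 'I_n, (fun=> setT) i (tnth t i)]).
  rewrite (@tuple_measure_rect _ _ _ mu n (fun=> setT))// big1// => i _.
  exact: probability_setT.
by apply/seteqP; split.
Qed.

HB.instance Definition _ := Measure_isProbability.Build _ _ _ iid iid_setT.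

End iid.
Arguments iid {d T R} mu n.

Section finite_integrals.
Context d (T : measurableType d) (R : realType).

Lemma bounded_integrable (mu : {measure set T -> \bar R}) (f : T -> R) (C : R) :
  (mu setT < +oo)%E ->
  measurable_fun setT f -> (forall x, `|f x| <= C) ->
  mu.-integrable setT (EFin \o f).
Proof.
move=> moo mf fC; apply: measurable_bounded_integrable => //.
exists C; split; first exact: num_real.
by move=> x Cx y _ /=; exact: le_trans (fC y) (ltW Cx).
Qed.

Lemma Rintegral_prob_cst (P : probability T R) (c : R) : \int[P]_x c = c.
Proof. by rewrite Rintegral_cst//= (@probability_setT _ _ _ P) mulr1. Qed.

Lemma EFin_Rintegral (mu : {measure set T -> \bar R}) (f : T -> R) :
  mu.-integrable setT (EFin \o f) ->
  ((\int[mu]_x f x)%:E = \int[mu]_x (f x)%:E)%E.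
Proof.
by move=> fi; rewrite /Rintegral fineK//; exact: integrable_fin_num.
Qed.

End finite_integrals.

(** * Borel functions and affine changes of variables *)

Section rV_measurability.
Context {R : realType} {n : nat}.

Let round (k : nat) (z : 'rV[int]_n) : 'rV[R]_n := \row_i ((z ord0 i)%:~R / k.+1%:R).
Let flo (k : nat) (x : 'rV[R]_n) : 'rV[int]_n := \row_i Num.floor (k.+1%:R * x ord0 i).

(** The sigma-algebra of 'rV[R]_n is generated by the coordinates, not by the open sets. A
    continuous f is the pointwise limit of its values at the points of finer and finer
    grids, and each of these approximations is constant on countably many boxes. *)
Lemma continuous_rV_measurable (f : 'rV[R]_n -> R) : continuous f ->
  measurable_fun setT f.
Proof.
move=> cf.
apply: (@measurable_fun_cvg _ _ _ setT (fun k x => f (round k (flo k x)))).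
  move=> k _ Y mY; rewrite setTI.
  rewrite [X in measurable X](_ : _ =
     \bigcup_z ([set x | flo k x = z] `&` [set _ | Y (f (round k z))])).
    apply: countable_bigcupT_measurable; first exact: countableP.
    move=> z; apply: measurableI; last first.
      have [YY|YY] := pselect (Y (f (round k z))).
        by rewrite (_ : [set _ | _] = setT)//; apply/seteqP; split.
      by rewrite (_ : [set _ | _] = set0)//; apply/seteqP; split.
    rewrite [X in measurable X](_ : _ = \big[setI/setT]_(i < n)
       ((fun x : 'rV[R]_n => x ord0 i) @^-1`
          ((fun y : R => Num.floor (k.+1%:R * y)) @^-1` [set z ord0 i]))).
      apply: bigsetI_measurable => i _.
      rewrite -[X in measurable X]setTI.
      apply: measurable_coord => //.
      rewrite (_ : _ @^-1` _ = `[(z ord0 i)%:~R / k.+1%:R, (z ord0 i + 1)%:~R / k.+1%:R[%classic).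
        exact: measurable_itv.
      apply/seteqP; split=> y /=; rewrite in_itv /= ler_pdivrMr// ltr_pdivlMr//
        [y * _]mulrC.
        by move=> <-; exact: Num.Theory.floor_itv.
      by move=> H; apply/eqP; rewrite Num.Theory.floor_eq.
    apply/seteqP; split=> [x /= <-|x].
      by rewrite -bigcap_seq => i _ /=; rewrite mxE.
    rewrite -bigcap_seq => H /=; apply/rowP => i; rewrite mxE.
    by apply: H => /=; exact: mem_index_enum.
  by apply/seteqP; split=> [x Yx|x [z _ [/= <-]]//]; exists (flo k x).
move=> x _.
suff : round k (flo k x) @[k --> \oo] --> x by move=> /(continuous_cvg _ (cf x)).
apply/cvgrPdist_le => e e0.
near=> k.
rewrite [leLHS]mx_normrE; apply/bigmax_leP; split; first exact: ltW.
move=> [i j] _ /=; rewrite ord1 !mxE.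
have k0 : 0 < k.+1%:R :> R by [].
have -> : x ord0 j - (Num.floor (k.+1%:R * x ord0 j))%:~R / k.+1%:R =
  (k.+1%:R * x ord0 j - (Num.floor (k.+1%:R * x ord0 j))%:~R) / k.+1%:R.
  by field; rewrite ?pnatr_eq0.
set y := _ * _.
rewrite ger0_norm; last by rewrite divr_ge0// subr_ge0 Num.Theory.floor_le.
rewrite ler_pdivrMr//; apply: (@le_trans _ _ 1).
  by rewrite lerBlDl ltW// -[1]/(1%:~R) -intrD Num.Theory.floorD1_gt.
rewrite -ler_pdivrMl// mulr1.
apply: (@le_trans _ _ k%:R); last by rewrite ler_nat.
by near: k; exact: nbhs_infty_ger.
Unshelve. all: by end_near. Qed.

End rV_measurability.

Section affine_change.
Context {R : realType}.
Local Notation leb := (@lebesgue_measure R).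

Definition affine (a b : R) (x : measurableTypeR R) : measurableTypeR R := a * x + b.

Lemma measurable_affine (a b : R) : measurable_fun setT (affine a b).
Proof. by apply: measurable_funD => //; exact: measurable_funM. Qed.

HB.instance Definition _ a b := isMeasurableFun.Build _ _ _ _ (affine a b)
  (measurable_affine a b).

(** The image of Lebesgue measure under the affine map, multiplied by a, has the right value
    on intervals, hence is Lebesgue measure. *)
Lemma ge0_integral_affine (a b : R) (f : R -> \bar R) : 0 < a ->
  measurable_fun setT f -> (forall x, (0 <= f x)%E) ->
  (\int[leb]_x f (a * x + b)%R = a^-1%:E * \int[leb]_x f x)%E.
Proof.
move=> a0 mf f0.
pose nu : {measure set (measurableTypeR R) -> \bar R} :=
  mscale (NngNum (ltW a0)) (measure_function_pushforward__canonical__measure_function_Measure leb (measurable_affine a b)).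
have nuE A : measurable A -> leb A = nu A.
  apply: lebesgue_measure_unique => _ [[x y] _ <-] /=.
  rewrite /nu /= /mscale /= /pushforward /affine.
  rewrite (_ : _ @^-1` _ = `](x - b) / a, (y - b) / a]%classic); last first.
    apply/seteqP; split=> z /=; rewrite !in_itv /= ltr_pdivrMr// ler_pdivlMr//
      ltrBlDr lerBrDr [a * z]mulrC//.
  rewrite !lebesgue_measure_itv /= !lte_fin ltr_pM2r ?invr_gt0// ltrD2r.
  case: ifPn => _; last by rewrite mule0.
  by rewrite -!EFinB -EFinM; congr (_%:E); field; rewrite gt_eqF.
have -> : (\int[leb]_x f x = \int[nu]_x f x)%E.
  by apply: eq_measure_integral => A mA _; exact: nuE.
rewrite ge0_integral_mscale//= ge0_integral_pushforward//= muleA -EFinM mulVf ?gt_eqF//.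
by rewrite mul1e.
Qed.

Lemma ge0_integral_tuple_affine n (a : R) (b : n.-tuple R)
    (F : n.-tuple (measurableTypeR R) -> \bar R) : 0 < a ->
  measurable_fun setT F -> (forall t, (0 <= F t)%E) ->
  (\int[tuple_measure leb n]_t F [tuple (a * tnth t i + tnth b i : measurableTypeR R)%R | i < n]
   = (a ^- n)%:E * \int[tuple_measure leb n]_t F t)%E.
Proof.
move=> a0; elim: n b F => [|n IH] b F mF F0.
  rewrite expr0 invr1 mul1e; apply: eq_integral => t _.
  by congr (F _); apply/eq_from_tnth => -[].
rewrite !ge0_integral_tupleS//; last first.
  apply: measurableT_comp => //; apply/measurable_fun_tnthP => i /=.
  rewrite (_ : _ \o _ = fun t : n.+1.-tuple (measurableTypeR R) => a * tnth t i + tnth b i).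
    apply: (measurableT_comp (measurable_affine a (tnth b i))).
    exact: measurable_tnth.
  by apply/funext => t /=; rewrite tnth_mktuple.
pose G x := (\int[tuple_measure leb n]_t F (cons_pair (x, t)))%E.
have mc x : measurable_fun setT (fun t : n.-tuple (measurableTypeR R) => F (cons_pair (x, t))).
  apply: (measurableT_comp mF).
  by apply: (@measurable_cons _ _ _ _ (fun=> x) n id) => //; exact: measurable_cst.
have mG : measurable_fun setT G.
  apply: (@measurable_fun_fubini_tonelli_F _ _ _ _ _ _ (fun p => F (cons_pair p))) => //.
  by apply: measurableT_comp => //; exact: measurable_cons_pair.
have G0 x : (0 <= G x)%E by apply: integral_ge0.
transitivity (\int[leb]_x ((a ^- n)%:E * G (a * x + thead b)%R))%E.
  apply: eq_integral => x _.
  rewrite -(IH [tuple of behead b])//; apply: eq_integral => t _; congr (F _).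
  apply/eq_from_tnth => i; rewrite tnth_mktuple.
  have [->|i0] := eqVneq i ord0; first by rewrite !tnth0.
  have [j ->] : exists j, i = lift ord0 j.
    by case: (unliftP ord0 i) i0 => [j ->|-> /eqP//]; exists j.
  rewrite !tnthS tnth_mktuple; congr (_ + _).
  by rewrite (tuple_eta b) tnthS; congr tnth; apply/val_inj.
have mG' : measurable_fun setT (fun x : R => G (a * x + thead b)).
  exact: (measurableT_comp mG (measurable_affine a (thead b))).
rewrite (ge0_integralZl leb measurableT mG'); last 2 first.
- by move=> x _; exact: G0.
- by rewrite lee_fin invr_ge0 exprn_ge0// ltW.
rewrite (ge0_integral_affine (thead b) a0 mG G0) muleA -EFinM; congr ((_%:E) * _)%E.
by rewrite exprS invfM mulrC.
Qed.

Lemma ge0_integral_rV_tuple d (F : 'rV[R]_d -> \bar R) :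
  measurable_fun setT F -> (forall t, (0 <= F t)%E) ->
  (\int[lebesgue_rV R d]_x F x = \int[tuple_measure leb d]_t F (row_of_tuple t))%E.
Proof. by move=> mF F0; rewrite ge0_integral_pushforward. Qed.

Lemma ge0_integral_rV_affine d (a : R) (v : 'rV[R]_d) (F : 'rV[R]_d -> \bar R) : 0 < a ->
  measurable_fun setT F -> (forall t, (0 <= F t)%E) ->
  (\int[lebesgue_rV R d]_x F (a *: x + v)%R = (a ^- d)%:E * \int[lebesgue_rV R d]_x F x)%E.
Proof.
move=> a0 mF F0.
rewrite !ge0_integral_rV_tuple//; last first.
  apply: measurableT_comp => //; apply: measurable_fun_rVP => i.
  under eq_fun do rewrite !mxE.
  apply: measurable_funD => //; apply: measurable_funM => //.
  exact: measurable_coord.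
rewrite -(ge0_integral_tuple_affine (tuple_of_row v))//; last first.
  by apply: measurableT_comp => //; exact: measurable_row_of_tuple.
apply: eq_integral => t _; congr (F _); apply/rowP => i.
by rewrite !mxE !tnth_mktuple.
Qed.

Lemma measurable_rV_affine d (a : R) (v : 'rV[R]_d) :
  measurable_fun setT (fun x : 'rV[R]_d => a *: x + v).
Proof.
apply: measurable_fun_rVP => i; under eq_fun do rewrite !mxE.
by apply: measurable_funD => //; apply: measurable_funM => //; exact: measurable_coord.
Qed.

(** The infinite cases make it possible to scale the integral of a function that is not
    integrable. *)
Lemma fine_scaleB (k : R) (p q : \bar R) : 0 < k -> (0 <= p)%E -> (0 <= q)%E ->
  fine (k%:E * p - k%:E * q) = k * fine (p - q).
Proof.
move=> k0; case: p q => [p| |] [q| |] //= _ _.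
- by rewrite mulrBr.
- by rewrite gt0_muley ?lte_fin//= mulr0.
- by rewrite gt0_muley ?lte_fin//= mulr0.
- by rewrite gt0_muley ?lte_fin//= mulr0.
Qed.

(** The positive and the negative part of the integral are scaled by the same factor,
    infinite values included. *)
Lemma Rintegral_rV_affine d (a : R) (v : 'rV[R]_d) (f : 'rV[R]_d -> R) : 0 < a ->
  measurable_fun setT f ->
  \int[lebesgue_rV R d]_x f (a *: x + v) = a ^- d * \int[lebesgue_rV R d]_x f x.
Proof.
move=> a0 mf; rewrite /Rintegral [X in fine X = _]integralE [X in _ = _ * fine X]integralE.
have mp : measurable_fun setT (EFin \o f)^\+%E by apply: measurable_funepos; exact/measurable_EFinP.
have mn : measurable_fun setT (EFin \o f)^\-%E by apply: measurable_funeneg; exact/measurable_EFinP.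
have Ep := ge0_integral_rV_affine v a0 mp (fun _ => funepos_ge0 _ _).
have En := ge0_integral_rV_affine v a0 mn (fun _ => funeneg_ge0 _ _).
rewrite -fine_scaleB; first congr (fine (_ - _)).
- by rewrite -Ep; apply: eq_integral => x _; rewrite !funeposE.
- by rewrite -En; apply: eq_integral => x _; rewrite !funenegE.
- by rewrite invr_gt0 exprn_gt0.
- by apply: integral_ge0 => x _; exact: funepos_ge0.
- by apply: integral_ge0 => x _; exact: funeneg_ge0.
Qed.

End affine_change.

(** * Euclidean balls *)

Section balls.
Context {R : realType} {d : nat}.
Local Notation lambda := (lebesgue_rV R d).

Lemma measurable_dotr (xi : 'rV[R]_d) : measurable_fun setT (fun x => dotr x xi).
Proof.
apply: measurable_sum => i; apply: measurable_funM => //; exact: measurable_coord.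
Qed.

Lemma dotr_sqr_ge0 (x : 'rV[R]_d) : 0 <= dotr x x.
Proof. by apply: sumr_ge0 => i _; rewrite -expr2 sqr_ge0. Qed.

Lemma enorm_ge0 (x : 'rV[R]_d) : 0 <= enorm x. Proof. exact: sqrtr_ge0. Qed.

Lemma measurable_enorm : measurable_fun setT (@enorm R d).
Proof.
apply: (@measurableT_comp _ _ _ _ _ _ (@Num.sqrt R)).
  by apply: continuous_measurable_fun; exact: sqrt_continuous.
by apply: measurable_sum => i; apply: measurable_funM; exact: measurable_coord.
Qed.

Lemma measurable_eball (r : R) : measurable (@eball R d r).
Proof.
rewrite (_ : eball r = (@enorm R d) @^-1` `]-oo, r[%classic).
  by rewrite -[X in measurable X]setTI; exact: measurable_enorm.
by apply/seteqP; split=> x /=; rewrite in_itv.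
Qed.

Lemma dotrZ (a : R) (x y : 'rV[R]_d) : dotr (a *: x) y = a * dotr x y.
Proof. by rewrite /dotr mulr_sumr; apply: eq_bigr => i _; rewrite mxE mulrA. Qed.

Lemma dotrC (x y : 'rV[R]_d) : dotr x y = dotr y x.
Proof. by apply: eq_bigr => i _; rewrite mulrC. Qed.

Lemma enormZ (a : R) (x : 'rV[R]_d) : 0 <= a -> enorm (a *: x) = a * enorm x.
Proof.
move=> a0; rewrite /enorm dotrZ dotrC dotrZ mulrA -expr2 sqrtrM ?sqr_ge0//.
by rewrite sqrtr_sqr ger0_norm.
Qed.

Lemma eballZ (a r : R) (x : 'rV[R]_d) : 0 < a -> eball r (a^-1 *: x) <-> eball (a * r) x.
Proof.
move=> a0; rewrite /eball /= enormZ ?invr_ge0 ?ltW//.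
by rewrite mulrC ltr_pdivrMr// mulrC.
Qed.

Lemma coord_le_enorm (x : 'rV[R]_d) i : `|x ord0 i| <= enorm x.
Proof.
rewrite -sqrtr_sqr ler_sqrt ?dotr_sqr_ge0// /dotr (bigD1 i)//= -expr2 lerDl.
by apply: sumr_ge0 => j _; rewrite -expr2 sqr_ge0.
Qed.

Lemma norm_le_enorm (x : 'rV[R]_d) : `|x| <= enorm x.
Proof.
rewrite [leLHS]mx_normrE; apply/bigmax_leP; split; first exact: enorm_ge0.
by move=> [i j] _ /=; rewrite ord1 coord_le_enorm.
Qed.

Lemma coord_le_norm (x : 'rV[R]_d) i : `|x ord0 i| <= `|x|.
Proof. by rewrite [leRHS]mx_normrE (le_bigmax _ _ (ord0, i)). Qed.

(** Together with norm_le_enorm, the comparison of the Euclidean norm with the sup norm that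
    is used for all topological purposes. *)
Lemma enorm_le_norm (x : 'rV[R]_d) : enorm x <= d%:R * `|x|.
Proof.
rewrite /enorm -[leRHS]ger0_norm ?mulr_ge0// -sqrtr_sqr ler_sqrt ?sqr_ge0//.
apply: (@le_trans _ _ (\sum_(i < d) `|x| ^+ 2)).
  apply: ler_sum => i _; rewrite -expr2 -real_normK ?num_real//.
  by rewrite lerXn2r// ?nnegrE// coord_le_norm.
rewrite sumr_const card_ord -[leLHS]mulr_natl exprMn ler_wpM2r ?sqr_ge0//.
by rewrite -natrX ler_nat; case: (d) => // k; rewrite expnS expn1 leq_pmulr.
Qed.

Lemma eball_box (r : R) : eball r `<=` [set x : 'rV[R]_d | forall i, `[- r, r]%classic (x ord0 i)].
Proof.
move=> x /= xr i; rewrite in_itv /= -ler_norml.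
by rewrite (le_trans (coord_le_enorm x i))// ltW.
Qed.

Lemma measurable_box (r : R) :
  measurable [set x : 'rV[R]_d | forall i, `[- r, r]%classic (x ord0 i)].
Proof.
rewrite (_ : [set x | _] = tuple_of_row @^-1` [set t : d.-tuple (measurableTypeR R) |
   forall i, (fun=> `[- r, r]%classic) i (tnth t i)]).
  rewrite -[X in measurable X]setTI; apply: measurable_tuple_of_row => //.
  exact: (@measurable_rect _ _ _ (fun=> `[- r, r]%classic)).
by apply/seteqP; split=> t /= H i; have := H i; rewrite tnth_mktuple.
Qed.

Lemma lebesgue_rV_box (r : R) : 0 < r ->
  lambda [set x | forall i, `[- r, r]%classic (x ord0 i)] = ((2 * r) ^+ d)%:E.
Proof.
move=> r0; rewrite /lebesgue_rV /pushforward.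
rewrite (_ : _ @^-1` _ = [set t : d.-tuple (measurableTypeR R) |
   forall i, (fun=> `[- r, r]%classic) i (tnth t i)]); last first.
  by apply/seteqP; split=> t /= H i; have := H i; rewrite mxE.
transitivity (\prod_(i < d) @lebesgue_measure R [set` `[- r, r]%R])%E.
  apply: (@tuple_measure_rect _ _ R (@lebesgue_measure R) d (fun=> [set` `[- r, r]%R])) => i.
  exact: measurable_itv.
under eq_bigr do rewrite lebesgue_measure_itv /= lte_fin gtrN// -EFinD.
by rewrite prodEFin prodr_const card_ord opprK -mulr2n mulr_natl.
Qed.

Lemma lebesgue_rV_eball_lty (r : R) : (lambda (eball r) < +oo)%E.
Proof.
have [r0|r0] := ltP 0 r; last first.
  rewrite (_ : eball r = set0) ?measure0// -subset0 => x /= xr.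
  by have := enorm_ge0 x; rewrite leNgt (lt_le_trans xr r0).
apply: (@le_lt_trans _ _ (lambda [set x | forall i, `[- r, r]%classic (x ord0 i)])).
  by apply: le_measure; rewrite ?inE; [exact: measurable_eball|exact: measurable_box|exact: eball_box].
by rewrite lebesgue_rV_box// ltry.
Qed.

Lemma lebesgue_rV_eball_scale (r : R) : 0 < r ->
  lambda (eball r) = ((r ^+ d)%:E * lambda (eball 1))%E.
Proof.
move=> r0.
have mi A : measurable A -> (\int[lambda]_x (\1_A x)%:E = lambda A)%E.
  by move=> mA; rewrite integral_indic// setIT.
have := @ge0_integral_rV_affine R d r^-1 0 (fun x => (\1_(eball 1) x)%:E).
rewrite (_ : (r^-1 ^- d) = r ^+ d); last by rewrite exprVn invrK.
have -> : (\int[lambda]_x (\1_(eball 1) x)%:E = lambda (eball 1))%E.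
  by apply: mi; exact: measurable_eball.
move=> <-; last 3 first.
- by rewrite invr_gt0.
- by apply/measurable_EFinP; apply: measurable_indic; exact: measurable_eball.
- by move=> t; rewrite lee_fin.
rewrite -(mi _ (measurable_eball r)); apply: eq_integral => x _; congr (_%:E).
rewrite addr0 !indicE; congr (_%:R); congr nat_of_bool.
by apply/idP/idP; rewrite !inE eballZ// mulr1.
Qed.

Lemma lebesgue_rV_eball_gt0 (r : R) : 0 < r -> (0 < lambda (eball r))%E.
Proof.
move=> r0; pose e := r / (d.+1)%:R.
have e0 : 0 < e by rewrite divr_gt0.
apply: (@lt_le_trans _ _ (lambda [set x | forall i, `[- e, e]%classic (x ord0 i)])).
  by rewrite lebesgue_rV_box// lte_fin exprn_gt0// mulr_gt0.
apply: le_measure; rewrite ?inE; [exact: measurable_box|exact: measurable_eball|].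
move=> x /= H; apply: (le_lt_trans (enorm_le_norm x)).
apply: (@le_lt_trans _ _ (d%:R * e)).
  rewrite ler_wpM2l// [leLHS]mx_normrE; apply/bigmax_leP; split; first exact: ltW.
  by move=> [i j] _ /=; rewrite ord1 ler_norml; have := H j; rewrite in_itv.
by rewrite /e mulrA ltr_pdivrMr// mulrC ltr_pM2l// ltr_nat.
Qed.

End balls.

(** * Shift operators and sums of independent variables *)

Section real_integrals.
Import HBNNSimple.
Context d (T : measurableType d) (R : realType).

Lemma Rintegral_dct (mu : {measure set T -> \bar R}) (f_ : (T -> R)^nat) (f g : T -> R) :
  (forall n, measurable_fun setT (f_ n)) ->
  (forall x, f_ ^~ x @ \oo --> f x) ->
  mu.-integrable setT (EFin \o g) -> (forall n x, `|f_ n x| <= g x) ->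
  \int[mu]_x f_ n x @[n --> \oo] --> \int[mu]_x f x.
Proof.
move=> mf ff gi fg.
have mF : measurable_fun setT f by exact: measurable_fun_cvg (fun x _ => ff x).
have [|||||fi _ H] := @dominated_convergence _ _ _ mu setT measurableT
   (fun n => EFin \o f_ n) (EFin \o f) (EFin \o g).
- by move=> n; exact/measurable_EFinP.
- exact/measurable_EFinP.
- apply: aeW => x _; apply/cvg_EFin; [exact: nearW|exact: ff].
- exact: gi.
- by apply: aeW => x n _; rewrite lee_fin.
rewrite /Rintegral; apply: fine_cvg; rewrite fineK; last exact: integrable_fin_num.
exact: H.
Qed.

(** For simple functions this is additivity; the general case follows by monotone
    approximation. *)
Lemma ge0_integral_density (mu nu : {measure set T -> \bar R}) (p : T -> R)
    (f : T -> \bar R) :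
  measurable_fun setT p -> (forall x, 0 <= p x) ->
  (forall A, measurable A -> nu A = \int[mu]_(x in A) (p x)%:E)%E ->
  measurable_fun setT f -> (forall x, 0 <= f x)%E ->
  (\int[nu]_x f x = \int[mu]_x (f x * (p x)%:E))%E.
Proof.
move=> mp p0 nuE mf f0.
have mpE : measurable_fun setT (EFin \o p) by exact/measurable_EFinP.
have mE : measurable [set: T] by [].
have simple (g : {nnsfun T >-> R}) : (\int[nu]_x (g x)%:E = \int[mu]_x ((g x)%:E * (p x)%:E))%E.
  pose B y : set T := g @^-1` [set y].
  have mB y : measurable (B y) by exact: measurable_sfunP.
  have layer0 y x : (0 <= (y * \1_(B y) x * p x)%:E)%E.
    by rewrite EFinM mule_ge0 ?lee_fin//; exact: nnfun_muleindic_ge0.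
  have mlayer y : measurable_fun setT (fun x => (y * \1_(B y) x * p x)%:E).
    by apply/measurable_EFinP; apply: measurable_funM => //; exact: measurable_funM.
  rewrite integralT_nnsfun sintegralE.
  transitivity (\sum_(y \in range g) \int[mu]_x (y * \1_(B y) x * p x)%:E)%E.
    apply: eq_fsbigr => y; rewrite inE => -[t _ gt]; have y0 : 0 <= y by rewrite -gt.
    rewrite nuE//; under [RHS]eq_integral do rewrite -mulrA EFinM.
    rewrite ge0_integralZl//; last 2 first.
    - by apply/measurable_EFinP; exact: measurable_funM.
    - by move=> x _; rewrite lee_fin mulr_ge0.
    congr (_ * _)%E; rewrite integral_mkcond; apply: eq_integral => x _.
    by rewrite patchE indicE; case: ifPn; rewrite ?mul1r ?mul0r.
  rewrite -ge0_integral_fsum//; apply: eq_integral => x _.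
  rewrite -EFinM fsumEFin//; congr (_%:E).
  by rewrite [in RHS]fimfunE mulr_fsuml.
pose h := nnsfun_approx mE mf.
have hf x : (h n x)%:E @[n --> \oo] --> f x by exact: cvg_nnsfun_approx.
have nd x n m : (n <= m)%N -> h n x <= h m x by move=> nm; exact/lefP/nd_nnsfun_approx.
have mh n : measurable_fun setT (EFin \o h n) by apply/measurable_EFinP; exact/measurable_funP.
have fE : (\int[nu]_x f x)%E = (\int[nu]_x limn (fun n => (h n x)%:E))%E.
  by apply: eq_integral => x _; apply/esym/cvg_lim.
have fpE : (\int[mu]_x (f x * (p x)%:E))%E = (\int[mu]_x limn (fun n => ((h n x)%:E * (p x)%:E)%E))%E.
  by apply: eq_integral => x _; apply/esym/cvg_lim => //; apply: cvgeZr => //; exact: hf.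
rewrite fE fpE !monotone_convergence//.
- by under eq_fun do rewrite simple.
- by move=> n; exact: emeasurable_funM (mh n) mpE.
- by move=> n x _; rewrite mule_ge0// lee_fin.
- by move=> x _ n m nm; rewrite lee_wpmul2r ?lee_fin// nd.
- by move=> n x _; rewrite lee_fin.
- by move=> x _ n m nm; rewrite lee_fin nd.
Qed.

End real_integrals.

Section shift_operator.
Context {R : realType}.

Definition bounded_meas (g : R -> R) (C : R) :=
  measurable_fun setT g /\ forall x, `|g x| <= C.

Context d (T : measurableType d) (mu : probability T R) (f : T -> R).
Hypothesis mf : measurable_fun setT f.

(** The convolution operator g |-> E g(x + f): the law of a sum of n independent copies of f
    acts on functions as the n-th iterate of this operator, which turns limit theorems into
    comparisons of powers of contractions. *)
Definition shift_mean (g : R -> R) (x : R) : R := \int[mu]_t g (x + f t).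

Lemma prob_bounded_integrable (h : T -> R) (C : R) : measurable_fun setT h ->
  (forall t, `|h t| <= C) -> mu.-integrable setT (EFin \o h).
Proof.
move=> mh hC; apply: bounded_integrable mh hC.
exact: (le_lt_trans (probability_le1 mu measurableT) (ltry 1)).
Qed.

Lemma measurable_shiftf (g : R -> R) x : measurable_fun setT g ->
  measurable_fun setT (fun t => g (x + f t)).
Proof. by move=> mg; apply: (measurableT_comp mg); exact: measurable_funD. Qed.

Lemma shift_mean_integrable g C x : bounded_meas g C ->
  mu.-integrable setT (EFin \o (fun t => g (x + f t))).
Proof.
move=> [mg gC]; apply: (@prob_bounded_integrable _ C) => //.
exact: measurable_shiftf.
Qed.

Lemma le_Rintegral_prob (h : T -> R) (C : R) : measurable_fun setT h ->
  (forall t, `|h t| <= C) -> `|\int[mu]_t h t| <= C.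
Proof.
move=> mh hC; have hi := prob_bounded_integrable mh hC.
apply: (le_trans (le_normr_Rintegral measurableT hi)).
rewrite -[leRHS](Rintegral_prob_cst mu); apply: le_Rintegral => //.
- apply: (@prob_bounded_integrable _ C); first exact: measurableT_comp.
  by move=> t; rewrite normr_id.
- apply: (@prob_bounded_integrable _ `|C|) => // t; exact: lexx.
Qed.

Lemma shift_mean_bounded g C : bounded_meas g C -> bounded_meas (shift_mean g) C.
Proof.
move=> [mg gC]; split; last first.
  move=> x; apply: le_Rintegral_prob => //; exact: measurable_shiftf.
have C0 : 0 <= C := le_trans (normr_ge0 _) (gC 0).
have mG : measurable_fun setT (fun x : R => (\int[mu]_t (g (x + f t) + C)%:E)%E).
  apply: (@measurable_fun_fubini_tonelli_F _ _ _ _ _ _ (fun p : measurableTypeR R * T => (g (p.1 + f p.2) + C)%:E)).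
  - apply/measurable_EFinP; apply: measurable_funD => //; apply: (measurableT_comp mg).
    by apply: measurable_funD => //; exact: (measurableT_comp mf).
  - move=> p; rewrite lee_fin -lerBlDr sub0r.
    by have := gC (p.1 + f p.2); rewrite ler_norml => /andP[].
rewrite (_ : shift_mean g = fun x => fine (\int[mu]_t (g (x + f t) + C)%:E)%E - C).
  apply: measurable_funB => //.
  exact: (measurableT_comp (fine_measurable _)).
apply/funext => x; apply/eqP; rewrite eq_sym subr_eq; apply/eqP.
transitivity (\int[mu]_t (g (x + f t) + C)) => //.
rewrite RintegralD ?Rintegral_prob_cst//; first exact: shift_mean_integrable.
by apply: (@prob_bounded_integrable _ `|C|).
Qed.

Lemma shift_mean_dist g1 g2 C1 C2 D : bounded_meas g1 C1 -> bounded_meas g2 C2 ->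
  (forall x, `|g1 x - g2 x| <= D) ->
  forall x, `|shift_mean g1 x - shift_mean g2 x| <= D.
Proof.
move=> b1 b2 gD x.
have i1 := shift_mean_integrable x b1; have i2 := shift_mean_integrable x b2.
rewrite -RintegralB//; apply: le_Rintegral_prob => //.
apply: measurable_funB; apply: measurable_shiftf.
  by case: b1.
by case: b2.
Qed.

Lemma iter_shift_mean_bounded n g C : bounded_meas g C ->
  bounded_meas (iter n shift_mean g) C.
Proof. by move=> gC; elim: n => //= n IH; exact: shift_mean_bounded. Qed.

Lemma iter_shift_mean_dist n g1 g2 C1 C2 D : bounded_meas g1 C1 -> bounded_meas g2 C2 ->
  (forall x, `|g1 x - g2 x| <= D) ->
  forall x, `|iter n shift_mean g1 x - iter n shift_mean g2 x| <= D.
Proof.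
move=> b1 b2 gD; elim: n => //= n IH x.
by apply: (shift_mean_dist (iter_shift_mean_bounded n b1) (iter_shift_mean_bounded n b2)).
Qed.

Lemma prob_cst_integrable c : mu.-integrable setT (EFin \o (fun=> c : R)).
Proof. by apply: (@prob_bounded_integrable _ `|c|). Qed.

End shift_operator.

Section iid_sum.
Context {R : realType} d (T : measurableType d) (mu : probability T R) (f : T -> R).
Hypothesis mf : measurable_fun setT f.

Lemma measurable_iid_sum n : measurable_fun setT
  (fun t : n.-tuple T => \sum_(i < n) f (tnth t i)).
Proof.
apply: measurable_sum => i; apply: (measurableT_comp mf); exact: measurable_tnth.
Qed.

Lemma Rintegral_iidS n (F : n.+1.-tuple T -> R) (C : R) : 0 <= C -> measurable_fun setT F ->
  (forall t, `|F t| <= C) ->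
  \int[iid mu n.+1]_t F t = \int[mu]_x \int[iid mu n]_t F (cons_pair (x, t)).
Proof.
move=> C0 mF FC.
have mc x : measurable_fun setT (fun t : n.-tuple T => F (cons_pair (x, t))).
  apply: (measurableT_comp mF).
  by apply: (@measurable_cons _ _ _ _ (fun=> x) n id) => //; exact: measurable_cst.
have FC0 t : 0 <= F t + C.
  by rewrite -lerBlDr sub0r; have := FC t; rewrite ler_norml => /andP[].
have H := ge0_integral_tupleS mu (F := fun t => (F t + C)%:E).
have {}H := H ((measurable_EFinP _ _).2 (measurable_funD mF (measurable_cst C))) FC0.
have cst_int n' : (iid mu n').-integrable setT (EFin \o (fun=> C)).
  by apply: (@prob_bounded_integrable _ _ _ (iid mu n') (fun=> C) `|C|).
have E1 n' (G : n'.-tuple T -> R) : measurable_fun setT G -> (forall t, `|G t| <= C) ->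
    (\int[iid mu n']_t (G t + C)%:E = (\int[iid mu n']_t G t + C)%:E)%E.
  move=> mG GC.
  rewrite -{2}(Rintegral_prob_cst (iid mu n') C) -RintegralD//; last exact: prob_bounded_integrable mG GC.
  rewrite EFin_Rintegral//; apply: (@prob_bounded_integrable _ _ _ (iid mu n') _ (C + C)).
    exact: measurable_funD.
  by move=> t; rewrite (le_trans (ler_normD _ _))// lerD// ger0_norm.
rewrite -[LHS](addrK C); apply/eqP; rewrite subr_eq; apply/eqP.
apply: EFin_inj; rewrite -E1// [LHS]H.
under eq_integral do rewrite E1//.
have mG : measurable_fun setT (fun x => \int[iid mu n]_t F (cons_pair (x, t))).
  have mG : measurable_fun setT (fun x => (\int[iid mu n]_t (F (cons_pair (x, t)) + C)%:E)%E).
    apply: (@measurable_fun_fubini_tonelli_F _ _ _ _ _ _ (fun p => (F (cons_pair p) + C)%:E)) => //.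
      apply/measurable_EFinP; apply: measurable_funD => //; apply: (measurableT_comp mF).
      exact: measurable_cons_pair.
    by move=> p; rewrite lee_fin.
  rewrite (_ : (fun x => _) = fun x => fine (\int[iid mu n]_t (F (cons_pair (x, t)) + C)%:E)%E - C).
    apply: measurable_funB => //; exact: (measurableT_comp (fine_measurable _)).
  by apply/funext => x; rewrite E1//= addrK.
have GC x : `|\int[iid mu n]_t F (cons_pair (x, t))| <= C by exact: le_Rintegral_prob.
rewrite -{2}(Rintegral_prob_cst mu C) -RintegralD//; last 2 first.
- exact: prob_bounded_integrable mG GC.
- by apply: (@prob_bounded_integrable _ _ _ _ _ `|C|).
rewrite EFin_Rintegral//; apply: (@prob_bounded_integrable _ _ _ _ _ (C + C)).
  exact: measurable_funD.
by move=> t; rewrite (le_trans (ler_normD _ _))// lerD// ger0_norm.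
Qed.

(** Integrating out the coordinates one at a time applies the shift operator once for each
    of them. *)
Lemma iid_sumE n g (C : R) x : bounded_meas g C ->
  \int[iid mu n]_t g (x + \sum_(i < n) f (tnth t i)) = iter n (shift_mean mu f) g x.
Proof.
move=> gC; elim: n x => [|n IH] x.
  under eq_Rintegral do rewrite big_ord0 addr0.
  by rewrite Rintegral_prob_cst.
rewrite (@Rintegral_iidS _ _ C); last 3 first.
- by case: gC => _ gC; exact: le_trans (normr_ge0 _) (gC 0).
- case: gC => mg _; apply: (measurableT_comp mg); apply: measurable_funD => //.
  exact: measurable_iid_sum.
- by move=> t; case: gC.
rewrite iterS; apply: eq_Rintegral => y _; rewrite -IH; apply: eq_Rintegral => t _.
rewrite big_ord_recl/= addrA; congr (g (_ + _)).
by apply: eq_bigr => i _; rewrite tnthS.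
Qed.

End iid_sum.

Section trotter.
Context {R : realType} d (T : measurableType d) (mu : probability T R) (f : T -> R)
  d' (T' : measurableType d') (nu : probability T' R) (h : T' -> R).
Hypotheses (mf : measurable_fun setT f) (mh : measurable_fun setT h).

(** Fubini: the two variables may be integrated in either order. *)
Lemma shift_meanC g (C : R) x : bounded_meas g C ->
  shift_mean mu f (shift_mean nu h g) x = shift_mean nu h (shift_mean mu f g) x.
Proof.
move=> bg; have [mg gC] := bg.
rewrite /shift_mean; apply: EFin_inj.
rewrite !EFin_Rintegral; last 2 first.
- exact: (shift_mean_integrable nu mh x (shift_mean_bounded mu mf bg)).
- exact: (shift_mean_integrable mu mf x (shift_mean_bounded nu mh bg)).
under eq_integral.
  move=> t _; rewrite EFin_Rintegral; last exact: (shift_mean_integrable nu mh _ bg).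
  over.
under [RHS]eq_integral.
  move=> t _; rewrite EFin_Rintegral; last exact: (shift_mean_integrable mu mf _ bg).
  under eq_integral do rewrite addrAC.
  over.
apply: (@Fubini _ _ _ _ R mu nu (fun p => (g (x + f p.1 + h p.2))%:E)).
apply: (@bounded_integrable _ _ _ _ (fun p => g (x + f p.1 + h p.2)) C) => //.
  have H : (mu \x nu)%E (setT `*` setT) = 1%E.
    by rewrite product_measure1E//; apply: etrans (mule1 1%E); congr (_ * _)%E; exact: probability_setT.
  by rewrite -setXTT; apply: (@le_lt_trans _ _ 1%E); [rewrite -H|rewrite ltry].
apply: (measurableT_comp mg); apply: measurable_funD; last exact: (measurableT_comp mh).
by apply: measurable_funD => //; exact: (measurableT_comp mf).
Qed.

(** Replacing the n factors one by one: all the operators commute and are contractions, so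
    each replacement costs at most the error D made at the first step. *)
Lemma trotter (D : R) n g (C : R) : bounded_meas g C ->
  (forall x, `|shift_mean mu f g x - shift_mean nu h g x| <= D) ->
  forall x, `|iter n (shift_mean mu f) g x - iter n (shift_mean nu h) g x| <= n%:R * D.
Proof.
elim: n g => [|n IH] g bg gD x; first by rewrite /= subrr normr0 mul0r.
rewrite !iterSr.
have bf := shift_mean_bounded mu mf bg; have bh := shift_mean_bounded nu mh bg.
have -> : iter n (shift_mean mu f) (shift_mean mu f g) x -
   iter n (shift_mean nu h) (shift_mean nu h g) x =
  (iter n (shift_mean mu f) (shift_mean mu f g) x - iter n (shift_mean mu f) (shift_mean nu h g) x) +
  (iter n (shift_mean mu f) (shift_mean nu h g) x - iter n (shift_mean nu h) (shift_mean nu h g) x) by ring.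
apply: (le_trans (ler_normD _ _)).
rewrite -natr1 mulrDl mul1r addrC lerD//; last exact: (iter_shift_mean_dist mu mf n bf bh).
apply: IH => // y; rewrite (shift_meanC _ bg).
exact: (shift_mean_dist nu mh bf bh gD).
Qed.

End trotter.

(** * Taylor expansions of the logistic function *)

Section logistic.
Context {R : realType}.

(** The mean value theorem on the segment from 0 to y; each application raises the order of
    a Taylor remainder by one. *)
Lemma mvt_pow (u du : R -> R) (B : R) k : (forall t, is_derive t (1 : R) u (du t)) ->
  u 0 = 0 -> (forall t, `|du t| <= B * `|t| ^+ k) -> forall y, `|u y| <= B * `|y| ^+ k.+1.
Proof.
move=> du_ u0 duB y.
have cu : continuous u.
  by move=> t; apply/differentiable_continuous/derivable1_diffP; have [] := du_ t.
have key c : `|c| <= `|y| -> `|du c| * `|y| <= B * `|y| ^+ k.+1.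
  move=> cy; rewrite exprSr mulrA ler_wpM2r// (le_trans (duB c))//.
  have [B0|B0] := leP 0 B; first by rewrite ler_wpM2l// lerXn2r ?nnegrE.
  have := le_trans (normr_ge0 _) (duB 1); rewrite normr1 expr1n mulr1.
  by rewrite leNgt B0.
have [y0|y0] := leP 0 y.
  have [c cy] := MVT_segment y0 (fun t _ => du_ t) (continuous_subspaceT cu).
  rewrite u0 !subr0 => ->; rewrite normrM; apply: key.
  by move: cy; rewrite in_itv /= => /andP[? ?]; rewrite !ger0_norm.
have [c cy] := MVT_segment (ltW y0) (fun t _ => du_ t) (continuous_subspaceT cu).
rewrite u0 !sub0r => /eqP; rewrite eqr_oppLR => /eqP ->; rewrite normrN normrM normrN; apply: key.
by move: cy; rewrite in_itv /= => /andP[? ?]; rewrite !ler0_norm ?lerN2// ltW.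
Qed.

(** A smooth bounded increasing function whose derivatives are polynomials in itself. Since
    logistic (a * y) tends to the indicator function of the positive half-line as a grows,
    testing convergence in law against its rescalings is enough to control tails. *)
Definition logistic (y : R) : R := (1 + expR (- y))^-1.
Definition logistic1 (y : R) : R := logistic y * (1 - logistic y).
Definition logistic2 (y : R) : R := logistic1 y * (1 - 2 * logistic y).
Definition logistic3 (y : R) : R := logistic1 y * (1 - 6 * logistic y + 6 * logistic y ^+ 2).

Lemma logistic_gt0 y : 0 < logistic y.
Proof. by rewrite invr_gt0 addr_gt0// expR_gt0. Qed.

Lemma logistic_lt1 y : logistic y < 1.
Proof. by rewrite invf_lt1 ?addr_gt0// ?expR_gt0// ltrDl expR_gt0. Qed.

Lemma logistic1_le y : 0 <= logistic1 y <= 1.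
Proof.
have := logistic_gt0 y; have := logistic_lt1 y; rewrite /logistic1.
set l := logistic y => ? ?; apply/andP; split; nra.
Qed.

Lemma logistic2_le y : `|logistic2 y| <= 1.
Proof.
have := logistic_gt0 y; have := logistic_lt1 y; have := logistic1_le y; rewrite /logistic2.
set l1 := logistic1 y; set l := logistic y => /andP[? ?] ? ?.
rewrite ler_norml; apply/andP; split; nra.
Qed.

Lemma logistic3_le y : `|logistic3 y| <= 1.
Proof.
have := logistic_gt0 y; have := logistic_lt1 y; have := logistic1_le y; rewrite /logistic3.
set l1 := logistic1 y; set l := logistic y => /andP[? ?] ? ?.
rewrite normrM -[leRHS]mulr1 ler_pM// ?ler_norml; apply/andP; split; nra.
Qed.

Lemma is_derive_logistic y : is_derive y (1 : R) logistic (logistic1 y).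
Proof.
have H0 : 1 + expR (- y) != 0 by rewrite gt_eqF// addr_gt0// expR_gt0.
have HE : is_derive y (1 : R) (fun y => 1 + expR (- y)) (- expR (- y)).
  rewrite (_ : (fun _ => _) = cst 1 + (expR \o -%R))//.
  by apply: is_derive_eq; rewrite add0r mulrN1.
rewrite (_ : logistic1 y = - (1 + expR (- y)) ^- 2 *: - expR (- y)).
  have := @is_deriveV R (fun y => 1 + expR (- y)) y (- expR (- y)) 1 H0 HE.
  exact.
rewrite /logistic1 /logistic; set e := expR (- y).
by rewrite /GRing.scale /=; field; exact: H0.
Qed.

Lemma is_derive_logistic1 y : is_derive y (1 : R) logistic1 (logistic2 y).
Proof.
have H := is_derive_logistic y.
rewrite (_ : logistic1 = logistic * (cst 1 - logistic))//.
apply: is_derive_eq; rewrite /logistic2 /logistic1 /GRing.scale /= /cst /=.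
rewrite !fctE /=; ring.
Qed.

Lemma is_derive_logistic2 y : is_derive y (1 : R) logistic2 (logistic3 y).
Proof.
have H := is_derive_logistic y; have H1 := is_derive_logistic1 y.
rewrite (_ : logistic2 = logistic1 * (cst 1 - 2 \*: logistic))//.
apply: is_derive_eq; rewrite /logistic3 /logistic2 /GRing.scale /= /cst /=.
set w := (_ - _) y; have -> : w = 1 - 2 * logistic y by [].
rewrite /logistic1; ring.
Qed.

Lemma is_derive_translate (g dg : R -> R) (x : R) :
  (forall t, is_derive t (1 : R) g (dg t)) ->
  forall y, is_derive y (1 : R) (fun y => g (x + y)) (dg (x + y)).
Proof.
move=> H y; have Hx := H (x + y).
rewrite (_ : (fun _ => _) = g \o (cst x + id))//.
have E : is_derive y (1 : R) (cst x + id) 1 by apply: is_derive_eq; rewrite add0r.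
by rewrite -[X in is_derive _ _ _ X]mulr1; apply: is_derive1_comp.
Qed.

Lemma logistic2_lip x y : `|logistic2 (x + y) - logistic2 x| <= `|y|.
Proof.
rewrite -[leRHS]mul1r -[`|y|]expr1.
apply: (@mvt_pow (fun y => logistic2 (x + y) - logistic2 x) (fun y => logistic3 (x + y)) 1 0).
- move=> t; have H := is_derive_translate x is_derive_logistic2 t.
  rewrite (_ : (fun _ => _) = (fun y => logistic2 (x + y)) - cst (logistic2 x))//.
  by apply: is_derive_eq; rewrite subr0.
- by rewrite addr0 subrr.
- by move=> t; rewrite expr0 mulr1 logistic3_le.
Qed.

Lemma logistic2_dist x y : `|logistic2 (x + y) - logistic2 x| <= 2.
Proof.
rewrite (le_trans (ler_normB _ _))// -[leRHS](_ : 1 + 1 = 2 :> R)// ?lerD//; exact: logistic2_le.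
Qed.

Lemma logistic1_taylor (B : R) k x : (forall y, `|logistic2 (x + y) - logistic2 x| <= B * `|y| ^+ k) ->
  forall y, `|logistic1 (x + y) - logistic1 x - logistic2 x * y| <= B * `|y| ^+ k.+1.
Proof.
move=> H; apply: (@mvt_pow _ (fun y => logistic2 (x + y) - logistic2 x)) => //.
- move=> t; have Ht := is_derive_translate x is_derive_logistic1 t.
  rewrite (_ : (fun _ => _) = (fun y => logistic1 (x + y)) - cst (logistic1 x) - (logistic2 x) \*: id)//.
  by apply: is_derive_eq; rewrite subr0 /GRing.scale /= mulr1.
- by rewrite addr0 subrr mulr0 subr0.
Qed.

Lemma logistic_taylor (B : R) k x :
  (forall y, `|logistic1 (x + y) - logistic1 x - logistic2 x * y| <= B * `|y| ^+ k) ->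
  forall y, `|logistic (x + y) - logistic x - logistic1 x * y - logistic2 x * (y ^+ 2 / 2)| <= B * `|y| ^+ k.+1.
Proof.
move=> H; apply: (@mvt_pow _ (fun y => logistic1 (x + y) - logistic1 x - logistic2 x * y)) => //.
- move=> t; have Ht := is_derive_translate x is_derive_logistic t.
  rewrite (_ : (fun _ => _) = (fun y => logistic (x + y)) - cst (logistic x) - (logistic1 x) \*: id
      - (logistic2 x / 2) \*: (id ^+ 2)).
    by apply: is_derive_eq; rewrite /GRing.scale /= subr0; field.
  apply/funext => y.
  by transitivity (logistic (x + y) - logistic x - logistic1 x * y - (logistic2 x / 2) * y ^+ 2); [field|].
- rewrite addr0; ring.
Qed.

(** The cubic bound comes from the third derivative. The quadratic one holds at all
    distances, and makes the remainder integrable when only two moments are assumed. *)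
Lemma logistic_taylor3 x y :
  `|logistic (x + y) - logistic x - logistic1 x * y - logistic2 x * (y ^+ 2 / 2)|
    <= 2 * Num.min (y ^+ 2) (`|y| ^+ 3).
Proof.
rewrite minr_pMr// le_min; apply/andP; split.
  rewrite -[X in _ <= _ * X]real_normK ?num_real//; apply: logistic_taylor; apply: (@logistic1_taylor _ 0) => z.
  by rewrite expr0 mulr1 logistic2_dist.
apply: (@le_trans _ _ (1 * `|y| ^+ 3)); last by rewrite ler_wpM2r ?exprn_ge0// ler1n.
apply: logistic_taylor; apply: logistic1_taylor => z.
by rewrite expr1 mul1r logistic2_lip.
Qed.

Lemma logistic_lip1 x y : `|logistic1 (x + y) - logistic1 x| <= `|y|.
Proof.
rewrite -[leRHS]mul1r -[`|y|]expr1.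
apply: (@mvt_pow (fun y => logistic1 (x + y) - logistic1 x) (fun y => logistic2 (x + y)) 1 0).
- move=> t; have H := is_derive_translate x is_derive_logistic1 t.
  rewrite (_ : (fun _ => _) = (fun y => logistic1 (x + y)) - cst (logistic1 x))//.
  by apply: is_derive_eq; rewrite subr0.
- by rewrite addr0 subrr.
- by move=> t; rewrite expr0 mulr1 logistic2_le.
Qed.

Lemma logistic_taylor1 (B : R) k x : (forall y, `|logistic1 (x + y) - logistic1 x| <= B * `|y| ^+ k) ->
  forall y, `|logistic (x + y) - logistic x - logistic1 x * y| <= B * `|y| ^+ k.+1.
Proof.
move=> H; apply: (@mvt_pow _ (fun y => logistic1 (x + y) - logistic1 x)) => //.
- move=> t; have Ht := is_derive_translate x is_derive_logistic t.
  rewrite (_ : (fun _ => _) = (fun y => logistic (x + y)) - cst (logistic x) - (logistic1 x) \*: id)//.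
  by apply: is_derive_eq; rewrite subr0 /GRing.scale /= mulr1.
- by rewrite addr0 subrr mulr0 subr0.
Qed.

(** As for the expansion to second order, the linear bound makes the remainder integrable
    when only one moment is assumed. *)
Lemma logistic_taylor2 x y :
  `|logistic (x + y) - logistic x - logistic1 x * y| <= Num.min (y ^+ 2) (`|y|).
Proof.
rewrite le_min; apply/andP; split.
  rewrite -real_normK ?num_real// -[leRHS]mul1r; apply: logistic_taylor1 => z.
  by rewrite expr1 mul1r logistic_lip1.
rewrite -[leRHS]mul1r -[`|y|]expr1; apply: logistic_taylor1 => z.
rewrite expr0 mulr1 ler_norml; have /andP[a b] := logistic1_le (x + z).
by have /andP[c e] := logistic1_le x; apply/andP; split; lra.
Qed.

Lemma measurable_logistic : measurable_fun setT logistic.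
Proof.
have c : continuous logistic.
  by move=> t; apply/differentiable_continuous/derivable1_diffP; have [] := is_derive_logistic t.
exact: continuous_measurable_fun.
Qed.

Lemma logistic_bounded_meas : bounded_meas logistic 1.
Proof.
split; first exact: measurable_logistic.
by move=> x; rewrite ger0_norm ltW ?logistic_gt0 ?logistic_lt1.
Qed.


End logistic.

(** * Moments and stability of the Gaussian law *)

Section gaussian.
Context {R : realType}.
Local Notation leb := (@lebesgue_measure R).
Local Notation gauss := (normal_prob (0 : R) 1).
Local Notation phi := (normal_pdf (0 : R) 1).

Lemma ge0_integral_gauss (f : R -> \bar R) : measurable_fun setT f -> (forall x, 0 <= f x)%E ->
  (\int[gauss]_x f x = \int[leb]_x (f x * (phi x)%:E))%E.
Proof.
move=> mf f0; apply: ge0_integral_density => //; first exact: measurable_normal_pdf.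
exact: normal_pdf_ge0.
Qed.

Lemma normal_peak_scale (s : R) : 0 < s -> normal_peak s = s^-1 * normal_peak 1.
Proof.
move=> s0; rewrite /normal_peak expr1n mul1r -mulrnAr sqrtrM ?sqr_ge0//.
by rewrite sqrtr_sqr gtr0_norm// invfM.
Qed.

Lemma normal_pdf_eq (m s x : R) : 0 < s ->
  normal_pdf m s x = s^-1 * normal_peak 1 * expR (- ((x - m) ^+ 2 / (2 * s ^+ 2))).
Proof.
move=> s0; rewrite normal_pdfE ?gt_eqF// normal_peak_scale//; congr (_ * expR _).
by rewrite mulNr -mulr_natl.
Qed.

(** For s > 0, multiplying the standard Gaussian density by this exponential gives s times
    the Gaussian density of variance s^2, whose total mass is known. *)
Lemma gauss_exp_sqr (s : R) : 0 < s ->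
  (\int[gauss]_z (expR ((1 - s ^- 2) / 2 * z ^+ 2))%:E = s%:E)%E.
Proof.
move=> s0; rewrite ge0_integral_gauss; last 2 first.
- apply/measurable_EFinP; apply: measurableT_comp => //; exact: measurable_funM.
- by move=> x; rewrite lee_fin expR_ge0.
transitivity (\int[leb]_x (s%:E * (normal_pdf 0 s x)%:E))%E.
  apply: eq_integral => x _; rewrite -!EFinM; congr (_%:E).
  rewrite !normal_pdf_eq// invr1 mul1r !subr0.
  set p := normal_peak 1; set E := expR (- (x ^+ 2 / (2 * s ^+ 2))).
  have -> : s * (s^-1 * p * E) = p * E by field; rewrite gt_eqF.
  rewrite mulrCA /E.
  rewrite -expRD; congr (_ * expR _); field.
  by rewrite gt_eqF.
rewrite ge0_integralZl//.
- by rewrite integral_normal_pdf mule1.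
- by apply/measurable_EFinP; exact: measurable_normal_pdf.
- by move=> x _; rewrite lee_fin normal_pdf_ge0.
- by rewrite lee_fin ltW.
Qed.

Lemma measurable_pow k : measurable_fun setT (fun z : R => z ^+ k).
Proof. exact: measurable_funX. Qed.

(** z^4 is dominated by a multiple of exp (3 z^2 / 8), which is integrable by gauss_exp_sqr
    at s = 2. *)
Lemma gauss_pow4_integrable : gauss.-integrable setT (fun z => (z ^+ 4)%:E).
Proof.
apply/integrableP; split; first by apply/measurable_EFinP; exact: measurable_pow.
apply: (@le_lt_trans _ _ (\int[gauss]_z ((128 / 9)%:E * (expR ((1 - 2 ^- 2) / 2 * z ^+ 2))%:E))%E); last first.
  have mE : measurable_fun setT (fun z : R => (expR ((1 - 2 ^- 2) / 2 * z ^+ 2))%:E).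
    by apply/measurable_EFinP; apply: measurableT_comp => //; exact: measurable_funM.
  rewrite (ge0_integralZl gauss measurableT mE); last 2 first.
  - by move=> x _; rewrite lee_fin expR_ge0.
  - by rewrite lee_fin divr_ge0.
  by rewrite gauss_exp_sqr// -EFinM ltry.
apply: ge0_le_integral => //.
- by apply: measurableT_comp => //; apply/measurable_EFinP; exact: measurable_pow.
- apply/measurable_EFinP; apply: measurable_funM => //; apply: measurableT_comp => //.
  exact: measurable_funM.
- move=> z _; rewrite abse_EFin -EFinM lee_fin ger0_norm ?exprn_even_ge0//.
  have h : 0 <= (1 - 2 ^- 2) / 2 * z ^+ 2 :> R.
    by rewrite mulr_ge0 ?sqr_ge0// divr_ge0//; lra.
  have := expR_ge1Dxn 1 h; rewrite (_ : 2`! = 2)//.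
  set E := expR _; set w := z ^+ 2; rewrite (_ : z ^+ 4 = w ^+ 2); last by rewrite -exprM.
  by rewrite (_ : (1 - 2 ^- 2) / 2 * w = 3 / 8 * w); [nra|field].
Qed.

Lemma gauss_pow2_integrable : gauss.-integrable setT (fun z => (z ^+ 2)%:E).
Proof.
have i1 : gauss.-integrable setT (fun z => (1 + z ^+ 4)%:E).
  apply: (@integrableD _ _ _ gauss setT measurableT (cst 1%E) (fun z => (z ^+ 4)%:E)).
    exact: (prob_cst_integrable gauss 1).
  exact: gauss_pow4_integrable.
apply: (@le_integrable _ _ _ gauss setT measurableT _ _ _ _ i1).
  by apply/measurable_EFinP; exact: measurable_pow.
move=> z _; rewrite !abse_EFin lee_fin !ger0_norm ?sqr_ge0 ?addr_ge0 ?exprn_even_ge0//.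
rewrite (_ : z ^+ 4 = (z ^+ 2) ^+ 2); last by rewrite -exprM.
set w := z ^+ 2; nra.
Qed.

Lemma gauss_pow1_integrable : gauss.-integrable setT (fun z => z%:E).
Proof.
have i1 : gauss.-integrable setT (fun z => (1 + z ^+ 2)%:E).
  apply: (@integrableD _ _ _ gauss setT measurableT (cst 1%E) (fun z => (z ^+ 2)%:E)).
    exact: (prob_cst_integrable gauss 1).
  exact: gauss_pow2_integrable.
apply: (@le_integrable _ _ _ gauss setT measurableT _ _ _ _ i1).
  exact/measurable_EFinP.
move=> z _; rewrite !abse_EFin lee_fin [leRHS]ger0_norm ?addr_ge0 ?sqr_ge0//.
rewrite -real_normK ?num_real//; set w := `|z|; nra.
Qed.

(** Integrating e^x >= 1 + x at x = (1 - s^-2) z^2 / 2 and using gauss_exp_sqr gives 1 + (1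
    - s^-2) m / 2 <= s for the second moment m. Letting s tend to 1 from above bounds m by
    1, and from below bounds it below by 1. *)
Lemma gauss_variance : \int[gauss]_z (z ^+ 2) = 1.
Proof.
set m := Rintegral _ _ _.
have key (s : R) : 0 < s -> m * (s ^+ 2 - 1) <= 2 * s ^+ 2 * (s - 1).
  move=> s0; pose h := (1 - s ^- 2) / 2.
  have H : 1 + h * m <= s.
    have ih : gauss.-integrable setT (fun z => (h * z ^+ 2)%:E).
      under eq_fun do rewrite EFinM.
      by apply: integrableZl => //; exact: gauss_pow2_integrable.
    have i1 : gauss.-integrable setT (fun=> 1%:E).
      exact: (prob_cst_integrable gauss 1).
    have i1h : gauss.-integrable setT (fun z => (1 + h * z ^+ 2)%:E).
      exact: (integrableD measurableT i1 ih).
    have -> : 1 + h * m = \int[gauss]_z (1 + h * z ^+ 2).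
      rewrite (RintegralD measurableT i1 ih) Rintegral_prob_cst RintegralZl//.
      exact: gauss_pow2_integrable.
    rewrite -lee_fin -(gauss_exp_sqr s0) (EFin_Rintegral i1h).
    apply: le_integral => //.
      apply/integrableP; split.
        by apply/measurable_EFinP; apply: measurableT_comp => //; exact: measurable_funM.
      under eq_integral do rewrite abse_EFin ger0_norm ?expR_ge0//.
      by rewrite gauss_exp_sqr// ltry.
    by move=> z _; rewrite lee_fin expR_ge1Dx.
  have s20 : 0 < s ^+ 2 by rewrite exprn_gt0.
  have : s ^+ 2 * (1 + h * m) <= s ^+ 2 * s by rewrite ler_wpM2l// ltW.
  rewrite (_ : s ^+ 2 * (1 + h * m) = s ^+ 2 + (s ^+ 2 - 1) / 2 * m); last first.
    by rewrite /h; field; rewrite gt_eqF.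
  by move=> ?; nra.
apply/eqP; rewrite eq_le; apply/andP; split; apply/ler_addgt0Pl => e e0.
- pose t := Num.min e 1 / 4.
  have t0 : 0 < t by rewrite divr_gt0// lt_min e0/=.
  have te : t <= e / 4 by rewrite ler_pM2r// ge_min lexx.
  have t1 : t <= 1 / 4 by rewrite ler_pM2r// ge_min lexx orbT.
  have := key (1 + t) (addr_gt0 ltr01 t0).
  have -> : m * ((1 + t) ^+ 2 - 1) = t * (m * (2 + t)) by ring.
  have -> : 2 * (1 + t) ^+ 2 * (1 + t - 1) = t * (2 * (1 + t) ^+ 2) by ring.
  by rewrite ler_pM2l// => H; nra.
- pose t := Num.min e 1 / 4.
  have t0 : 0 < t by rewrite divr_gt0// lt_min e0/=.
  have te : t <= e / 4 by rewrite ler_pM2r// ge_min lexx.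
  have t1 : t <= 1 / 4 by rewrite ler_pM2r// ge_min lexx orbT.
  have := key (1 - t) ltac:(lra).
  have -> : m * ((1 - t) ^+ 2 - 1) = t * (- (m * (2 - t))) by ring.
  have -> : 2 * (1 - t) ^+ 2 * (1 - t - 1) = t * (- (2 * (1 - t) ^+ 2)) by ring.
  by rewrite ler_pM2l// => H; nra.
Qed.

Lemma ge0_integral_leb_opp (f : R -> \bar R) :
  measurable_fun setT f -> (forall x, (0 <= f x)%E) ->
  (\int[leb]_x f (- x)%R = \int[leb]_x f x)%E.
Proof.
move=> mf f0.
have mN : measurable_fun setT (-%R : measurableTypeR R -> measurableTypeR R).
  exact: oppr_measurable.
pose nu : {measure set (measurableTypeR R) -> \bar R} :=
  measure_function_pushforward__canonical__measure_function_Measure leb mN.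
have nuE A : measurable A -> leb A = nu A.
  apply: lebesgue_measure_unique => _ [[x y] _ <-] /=.
  rewrite /pushforward (_ : _ @^-1` _ = `[- y, - x[%classic); last first.
    by apply/seteqP; split=> z /=; rewrite !in_itv /= lerNl ltrNr => /andP[-> ->].
  rewrite !lebesgue_measure_itv /= !lte_fin ltrN2.
  by case: ifPn => // _; rewrite -!EFinB opprK addrC.
have -> : (\int[leb]_x f x = \int[nu]_x f x)%E.
  by apply: eq_measure_integral => A mA _; exact: nuE.
by rewrite ge0_integral_pushforward.
Qed.

(** The Gaussian law is symmetric and z is integrable. *)
Lemma gauss_mean : \int[gauss]_z z = 0.
Proof.
have sym (f : R -> \bar R) : measurable_fun setT f -> (forall x, (0 <= f x)%E) ->
    (\int[gauss]_x f (- x)%R = \int[gauss]_x f x)%E.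
  move=> mf f0; rewrite !ge0_integral_gauss//; last first.
    by apply: (measurableT_comp mf); exact: oppr_measurable.
  rewrite -(ge0_integral_leb_opp (f := fun x => f x * (phi x)%:E)%E).
  - apply: eq_integral => x _; congr (_ * _%:E)%E.
    by rewrite !normal_pdf_eq// !subr0 sqrrN.
  - by apply: emeasurable_funM => //; apply/measurable_EFinP; exact: measurable_normal_pdf.
  - by move=> x; rewrite mule_ge0// lee_fin normal_pdf_ge0.
rewrite /Rintegral integralE.
rewrite (_ : (\int[gauss]_x (EFin \o id)^\-%E x = \int[gauss]_x (EFin \o id)^\+%E x)%E); last first.
  rewrite -(sym (EFin \o id)^\+%E).
  - by apply: eq_integral => x _; rewrite funenegE funeposE /= EFinN.
  - by apply: measurable_funepos; exact/measurable_EFinP.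
  - by move=> x; exact: funepos_ge0.
rewrite subee//.
have := integrable_pos_fin_num measurableT gauss_pow1_integrable; exact.
Qed.

End gaussian.

Section gaussian_stability.
Context {R : realType}.
Local Notation leb := (@lebesgue_measure R).
Local Notation gauss := (normal_prob (0 : R) 1).
Local Notation phi := (normal_pdf (0 : R) 1).

Let mlin (a b : R) : measurable_fun setT (fun p : measurableTypeR R * measurableTypeR R => a * p.1 + b * p.2).
Proof.
by apply: measurable_funD; exact: measurable_funM.
Qed.

(** Writing c u = a z + b w turns the double integral over (z, w) into one over (u, w);
    completing the square in w leaves the density of u times a Gaussian density in w of mean
    b u / c and deviation a / c, which integrates to one. *)
Lemma ge0_gauss_stable (a b c : R) (G : R -> \bar R) : 0 < a -> 0 < c ->
  c ^+ 2 = a ^+ 2 + b ^+ 2 -> measurable_fun setT G -> (forall y, 0 <= G y)%E ->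
  (\int[gauss]_w \int[gauss]_z G (a * z + b * w)%R = \int[gauss]_u G (c * u)%R)%E.
Proof.
move=> a0 c0 cab mG G0.
have mphi : measurable_fun setT (EFin \o phi) by apply/measurable_EFinP; exact: measurable_normal_pdf.
have mGw w : measurable_fun setT (fun z : R => G (a * z + b * w)).
  by apply: (measurableT_comp mG); apply: measurable_funD => //; exact: measurable_funM.
have mI : measurable_fun setT (fun w : R => \int[gauss]_z G (a * z + b * w)%R)%E.
  apply: (@measurable_fun_fubini_tonelli_F _ _ _ _ R gauss
     (fun p : measurableTypeR R * measurableTypeR R => G (a * p.2 + b * p.1)%R)) => //.
  by apply: (measurableT_comp mG); under eq_fun do rewrite addrC; exact: mlin.
rewrite ge0_integral_gauss//; last by move=> w; apply: integral_ge0.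
pose K (u w : R) : \bar R := (G (c * u)%R * (c / a * phi ((c * u - b * w) / a) * phi w)%:E)%E.
have inner w : (\int[gauss]_z G (a * z + b * w)%R * (phi w)%:E = \int[leb]_u K u w)%E.
  rewrite ge0_integral_gauss//.
  have := @ge0_integral_affine R (c / a) (- (b * w / a)) (fun z => G (a * z + b * w)%R * (phi z)%:E)%E (divr_gt0 c0 a0).
  move=> H.
  have {}H : (\int[leb]_x (G (c * x)%R * (phi ((c * x - b * w) / a))%:E) =
     (c / a)^-1%:E * \int[leb]_x (G (a * x + b * w)%R * (phi x)%:E))%E.
    rewrite -H; last 2 first.
    - by apply: emeasurable_funM.
    - by move=> z; rewrite mule_ge0// lee_fin normal_pdf_ge0.
    apply: eq_integral => u _; congr (G _ * (phi _)%:E)%E; field; by rewrite gt_eqF.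
  have -> : (\int[leb]_x (G (a * x + b * w)%R * (phi x)%:E) = (c / a)%:E *
     \int[leb]_x (G (c * x)%R * (phi ((c * x - b * w) / a))%:E))%E.
    by rewrite H muleA -EFinM mulfV ?mul1e// gt_eqF// divr_gt0.
  have mGc : measurable_fun setT (fun x : R => G (c * x)%R * (phi ((c * x - b * w) / a))%:E)%E.
    apply: emeasurable_funM.
      by apply: (measurableT_comp mG); exact: measurable_funM.
    apply: (measurableT_comp mphi); apply: measurable_funM => //.
    by apply: measurable_funB => //; exact: measurable_funM.
  rewrite -muleA -[in LHS]muleC -muleA -EFinM -(ge0_integralZr leb measurableT mGc); last 2 first.
  - by move=> x _; rewrite mule_ge0// lee_fin normal_pdf_ge0.
  - by rewrite lee_fin mulr_ge0 ?normal_pdf_ge0// divr_ge0// ltW.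
  apply: eq_integral => u _; rewrite /K -muleA -EFinM; congr (_ * _%:E)%E; ring.
under eq_integral do rewrite inner.
have mK : measurable_fun setT (fun p : measurableTypeR R * measurableTypeR R => K p.1 p.2).
  apply: emeasurable_funM.
    by apply: (measurableT_comp mG); apply: measurable_funM => //; exact: measurable_fst.
  apply/measurable_EFinP; apply: measurable_funM.
    apply: measurable_funM => //; apply: (measurableT_comp (measurable_normal_pdf 0 1)).
    apply: measurable_funM => //; under eq_fun do rewrite -mulNr; exact: mlin.
  by apply: (measurableT_comp (measurable_normal_pdf 0 1)); exact: measurable_snd.
have K0 u w : (0 <= K u w)%E.
  by rewrite mule_ge0// lee_fin !mulr_ge0 ?normal_pdf_ge0 ?invr_ge0// ltW.
rewrite -(@fubini_tonelli _ _ _ _ R leb leb (fun p => K p.1 p.2))//.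
rewrite ge0_integral_gauss//; last by apply: (measurableT_comp mG); exact: measurable_funM.
apply: eq_integral => u _.
transitivity (\int[leb]_w (G (c * u)%R * (phi u)%:E * (normal_pdf (b / c * u) (a / c) w)%:E))%E.
  apply: eq_integral => w _; rewrite /K -muleA -EFinM; congr (_ * _%:E)%E.
  rewrite !normal_pdf_eq ?divr_gt0// !subr0 !invr1 !mul1r !expr1n !mulr1.
  set p := normal_peak 1.
  rewrite [LHS](_ : _ = c / a * p * p * (expR (- (((c * u - b * w) / a) ^+ 2 / 2)) * expR (- (w ^+ 2 / 2)))); last by ring.
  rewrite [RHS](_ : _ = c / a * p * p * (expR (- (u ^+ 2 / 2)) *
     expR (- ((w - b / c * u) ^+ 2 / (2 * (a / c) ^+ 2))))); last by rewrite invf_div; ring.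
  rewrite -!expRD; congr (_ * expR _).
  have b2 : b ^+ 2 = c ^+ 2 - a ^+ 2 by rewrite cab; ring.
  have an : a != 0 by rewrite gt_eqF.
  have cn : c != 0 by rewrite gt_eqF.
  apply: (@mulIf _ (2 * a ^+ 2)); first by rewrite mulf_neq0 ?expf_neq0 ?pnatr_eq0.
  rewrite [LHS](_ : _ = - (c ^+ 2 * u ^+ 2 - 2 * c * b * u * w + b ^+ 2 * w ^+ 2) - a ^+ 2 * w ^+ 2); last by field.
  rewrite [RHS](_ : _ = - a ^+ 2 * u ^+ 2 - (c ^+ 2 * w ^+ 2 - 2 * c * b * u * w + b ^+ 2 * u ^+ 2)); last by field; rewrite an cn.
  rewrite b2; ring.
rewrite ge0_integralZl//; last 3 first.
- by apply/measurable_EFinP; exact: measurable_normal_pdf.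
- by move=> w _; rewrite lee_fin normal_pdf_ge0.
- by rewrite mule_ge0// lee_fin normal_pdf_ge0.
by rewrite integral_normal_pdf mule1.
Qed.

Lemma gauss_stable (a b c : R) g (C : R) x : 0 < a -> 0 < c ->
  c ^+ 2 = a ^+ 2 + b ^+ 2 -> bounded_meas g C ->
  shift_mean gauss ( *%R b) (shift_mean gauss ( *%R a) g) x = shift_mean gauss ( *%R c) g x.
Proof.
move=> a0 c0 cab bg; have [mg gC] := bg.
have ml (e : R) : measurable_fun setT ( *%R e : measurableTypeR R -> R) by exact: measurable_funM.
have C0 : 0 <= C := le_trans (normr_ge0 _) (gC 0).
pose G y := (g (x + y) + C)%:E.
have G0 y : (0 <= G y)%E.
  by rewrite lee_fin -lerBlDr sub0r; have := gC (x + y); rewrite ler_norml => /andP[].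
have mG : measurable_fun setT G.
  apply/measurable_EFinP; apply: measurable_funD => //; apply: (measurableT_comp mg).
  exact: measurable_funD.
have E (e : R) y : (\int[gauss]_z (g (y + e * z) + C)%:E = (shift_mean gauss ( *%R e) g y + C)%:E)%E.
  rewrite -{2}(Rintegral_prob_cst gauss C) -RintegralD//; last 2 first.
  - exact: (shift_mean_integrable gauss (ml e) y bg).
  - exact: prob_cst_integrable.
  rewrite EFin_Rintegral//.
  exact: (integrableD measurableT (shift_mean_integrable gauss (ml e) y bg) (prob_cst_integrable gauss C)).
have := ge0_gauss_stable a0 c0 cab mG G0.
rewrite /G E.
under eq_integral.
  move=> w _; under eq_integral do rewrite (addrC (a * _)) addrA.
  rewrite E.
  over.
have bg' := shift_mean_bounded gauss (ml a) bg.
move=> H; apply: (@addIr _ C); apply: EFin_inj; rewrite -H.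
rewrite -{1}(Rintegral_prob_cst gauss C) -RintegralD//; last 2 first.
- exact: (shift_mean_integrable gauss (ml b) x bg').
- exact: prob_cst_integrable.
rewrite EFin_Rintegral//.
exact: (integrableD measurableT (shift_mean_integrable gauss (ml b) x bg') (prob_cst_integrable gauss C)).
Qed.

(** Stability iterated: n + 1 independent Gaussian steps of deviation s amount to one of
    deviation s sqrt (n + 1). *)
Lemma iter_gauss (s : R) g (C : R) n x : 0 < s -> bounded_meas g C ->
  iter n.+1 (shift_mean gauss ( *%R s)) g x = shift_mean gauss ( *%R (s * Num.sqrt n.+1%:R)) g x.
Proof.
move=> s0 bg; elim: n x => [|n IH] x; first by rewrite /= sqrtr1 mulr1.
rewrite iterS.
rewrite (funext IH).
apply: (gauss_stable _ _ _ _ bg).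
- by rewrite mulr_gt0// sqrtr_gt0.
- by rewrite mulr_gt0// sqrtr_gt0.
- by rewrite !exprMn !sqr_sqrtr// -[n.+2%:R]natr1; ring.
Qed.

End gaussian_stability.

(** * Weak law of large numbers and central limit theorem *)

Section local_expansion.
Context {R : realType} d (T : measurableType d) (mu : probability T R).

Lemma sqr_integrable_integrable (f : T -> R) : measurable_fun setT f ->
  mu.-integrable setT (fun t => (f t ^+ 2)%:E) -> mu.-integrable setT (EFin \o f).
Proof.
move=> mf if2.
have i1 : mu.-integrable setT (fun z => (1 + f z ^+ 2)%:E).
  exact: (integrableD measurableT (prob_cst_integrable mu 1) if2).
apply: (@le_integrable _ _ _ mu setT measurableT _ _ _ _ i1).
  exact/measurable_EFinP.
move=> z _; rewrite !abse_EFin lee_fin [leRHS]ger0_norm ?addr_ge0 ?sqr_ge0//.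
rewrite -real_normK ?num_real//; set w := `|f z|; nra.
Qed.

(** One step of the central limit theorem: for a small centered y, the shift operator acts
    on the logistic function through the variance of y only. *)
Lemma local_expansion2 (y : T -> R) x : measurable_fun setT y ->
  mu.-integrable setT (fun t => (y t ^+ 2)%:E) -> \int[mu]_t y t = 0 ->
  `|shift_mean mu y logistic x - (logistic x + logistic2 x * ((\int[mu]_t (y t ^+ 2)) / 2))|
    <= \int[mu]_t (2 * Num.min (y t ^+ 2) (`|y t| ^+ 3)).
Proof.
move=> my iy2 y0; have iy := sqr_integrable_integrable my iy2.
have il := shift_mean_integrable mu my x logistic_bounded_meas.
have i1 := prob_cst_integrable mu (logistic x).
have i2 : mu.-integrable setT (EFin \o (fun t => logistic1 x * y t)).
  under [X in _.-integrable _ X]eq_fun do rewrite /= EFinM.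
  exact: integrableZl.
have i3 : mu.-integrable setT (EFin \o (fun t => logistic2 x / 2 * y t ^+ 2)).
  under [X in _.-integrable _ X]eq_fun do rewrite /= EFinM.
  exact: integrableZl.
have E : shift_mean mu y logistic x - (logistic x + logistic2 x * ((\int[mu]_t (y t ^+ 2)) / 2)) =
   \int[mu]_t (logistic (x + y t) - logistic x - logistic1 x * y t - logistic2 x / 2 * y t ^+ 2).
  have i12 := integrableB measurableT il i1.
  have i123 := integrableB measurableT i12 i2.
  rewrite (RintegralB measurableT i123 i3) (RintegralB measurableT i12 i2) (RintegralB measurableT il i1).
  rewrite Rintegral_prob_cst !RintegralZl// y0 /shift_mean; by field.
have i4 := integrableB measurableT (integrableB measurableT (integrableB measurableT il i1) i2) i3.
rewrite E (le_trans (le_normr_Rintegral measurableT i4))//.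
apply: le_Rintegral => //.
- by apply: (@eq_integrable _ _ _ mu setT measurableT _ _ _ (integrable_abse i4)).
- have i5 : mu.-integrable setT (EFin \o (fun t => 2 * y t ^+ 2)).
    under [X in _.-integrable _ X]eq_fun do rewrite /= EFinM.
    exact: integrableZl.
  apply: (@le_integrable _ _ _ mu setT measurableT _ _ _ _ i5).
    apply/measurable_EFinP; apply: measurable_funM => //; apply: measurable_minr.
      exact: measurable_funX.
    by apply: measurable_funX; exact: measurableT_comp.
  move=> t _; have m0 : 0 <= Num.min (y t ^+ 2) (`|y t| ^+ 3) by rewrite le_min sqr_ge0 exprn_ge0.
  rewrite !abse_EFin lee_fin ger0_norm ?(mulr_ge0 _ m0)// ger0_norm ?(mulr_ge0 _ (sqr_ge0 _))//.
  by rewrite ler_wpM2l// ge_min lexx.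
- move=> t _; have := logistic_taylor3 x (y t).
  by rewrite (_ : logistic2 x / 2 * y t ^+ 2 = logistic2 x * (y t ^+ 2 / 2))//; field.
Qed.

(** One step of the law of large numbers: a centered y moves the logistic function by a
    quantity of higher order. *)
Lemma local_expansion1 (y : T -> R) x : measurable_fun setT y ->
  mu.-integrable setT (EFin \o y) -> \int[mu]_t y t = 0 ->
  `|shift_mean mu y logistic x - logistic x| <= \int[mu]_t Num.min (y t ^+ 2) `|y t|.
Proof.
move=> my iy y0.
have il := shift_mean_integrable mu my x logistic_bounded_meas.
have i1 := prob_cst_integrable mu (logistic x).
have i2 : mu.-integrable setT (EFin \o (fun t => logistic1 x * y t)).
  under [X in _.-integrable _ X]eq_fun do rewrite /= EFinM.
  exact: integrableZl.
have E : shift_mean mu y logistic x - logistic x =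
   \int[mu]_t (logistic (x + y t) - logistic x - logistic1 x * y t).
  have i12 := integrableB measurableT il i1.
  rewrite (RintegralB measurableT i12 i2) (RintegralB measurableT il i1).
  by rewrite Rintegral_prob_cst !RintegralZl// y0 /shift_mean mulr0 subr0.
have i4 := integrableB measurableT (integrableB measurableT il i1) i2.
rewrite E (le_trans (le_normr_Rintegral measurableT i4))//.
apply: le_Rintegral => //.
- by apply: (@eq_integrable _ _ _ mu setT measurableT _ _ _ (integrable_abse i4)).
- apply: (@le_integrable _ _ _ mu setT measurableT _ _ _ _ iy).
    apply/measurable_EFinP; apply: measurable_minr; first exact: measurable_funX.
    exact: measurableT_comp.
  move=> t _; rewrite !abse_EFin lee_fin ger0_norm ?le_min ?sqr_ge0//=.
  by rewrite ge_min lexx orbT.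
- by move=> t _; exact: logistic_taylor2.
Qed.

End local_expansion.

Lemma cvg_inv_sqrtn (R : realType) : (Num.sqrt n%:R : R)^-1 @[n --> \oo] --> (0 : R).
Proof.
apply/cvgrPdist_le => e e0; near=> n.
have n0 : 0 < n%:R :> R by near: n; exact: nbhs_infty_gtr.
rewrite sub0r normrN ger0_norm ?invr_ge0 ?sqrtr_ge0// -[e]invrK lef_pV2 ?posrE ?sqrtr_gt0 ?invr_gt0//.
rewrite -ler_sqr ?nnegrE ?sqrtr_ge0 ?invr_ge0 ?ltW// sqr_sqrtr//.
by near: n; exact: nbhs_infty_gtr.
Unshelve. all: by end_near. Qed.

Section remainders.
Context {R : realType} d (T : measurableType d) (mu : probability T R).

(** The integrand times n is dominated by 2 f^2, by the quadratic bound, and tends to 0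
    pointwise, by the cubic one: this is Lindeberg's condition for identically distributed
    variables. *)
Lemma remainder2 (f : T -> R) : measurable_fun setT f ->
  mu.-integrable setT (fun t => (f t ^+ 2)%:E) ->
  n%:R * \int[mu]_t (2 * Num.min ((f t / Num.sqrt n%:R) ^+ 2) (`|f t / Num.sqrt n%:R| ^+ 3))
    @[n --> \oo] --> 0.
Proof.
move=> mf if2.
pose r (n : nat) t := n%:R * (2 * Num.min ((f t / Num.sqrt n%:R) ^+ 2) (`|f t / Num.sqrt n%:R| ^+ 3)).
have i5 : mu.-integrable setT (EFin \o (fun t => 2 * f t ^+ 2)).
  under [X in _.-integrable _ X]eq_fun do rewrite /= EFinM.
  exact: integrableZl.
have r0 n t : 0 <= r n t.
  by rewrite mulr_ge0// mulr_ge0// le_min sqr_ge0 exprn_ge0.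
have rn0 t : r 0%N t = 0 by rewrite /r mul0r.
have s0 n : 0 < Num.sqrt n.+1%:R :> R by rewrite sqrtr_gt0.
have s2 n : Num.sqrt n.+1%:R ^+ 2 = n.+1%:R :> R by rewrite sqr_sqrtr.
have rle n t : r n t <= 2 * f t ^+ 2.
  case: n => [|n]; first by rewrite rn0 mulr_ge0// sqr_ge0.
  apply: (@le_trans _ _ (n.+1%:R * (2 * (f t / Num.sqrt n.+1%:R) ^+ 2))).
    by rewrite !ler_wpM2l// ge_min lexx.
  by rewrite exprMn exprVn s2 le_eqVlt; apply/orP; left; apply/eqP; field.
have rle3 n t : r n t <= 2 * `|f t| ^+ 3 * (Num.sqrt n%:R)^-1.
  case: n => [|n]; first by rewrite rn0 sqrtr0 invr0 mulr0.
  apply: (@le_trans _ _ (n.+1%:R * (2 * `|f t / Num.sqrt n.+1%:R| ^+ 3))).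
    by rewrite !ler_wpM2l// ge_min lexx orbT.
  rewrite normrM normfV (gtr0_norm (s0 n)) exprMn -{1}s2.
  by rewrite le_eqVlt; apply/orP; left; apply/eqP; field; rewrite gt_eqF.
have mr n : measurable_fun setT (r n).
  apply: measurable_funM => //; apply: measurable_funM => //; apply: measurable_minr.
    by apply: measurable_funX; exact: measurable_funM.
  by apply: measurable_funX; apply: measurableT_comp => //; exact: measurable_funM.
have ir n : mu.-integrable setT (EFin \o (fun t => 2 * Num.min ((f t / Num.sqrt n%:R) ^+ 2) (`|f t / Num.sqrt n%:R| ^+ 3))).
  have i6 : mu.-integrable setT (EFin \o (fun t => 2 * ((Num.sqrt n%:R)^-1 ^+ 2) * f t ^+ 2)).
    under [X in _.-integrable _ X]eq_fun do rewrite /= EFinM.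
    exact: integrableZl.
  apply: (@le_integrable _ _ _ mu setT measurableT _ _ _ _ i6).
    apply/measurable_EFinP; apply: measurable_funM => //; apply: measurable_minr.
      by apply: measurable_funX; exact: measurable_funM.
    by apply: measurable_funX; apply: measurableT_comp => //; exact: measurable_funM.
  move=> t _; have m0 : 0 <= Num.min ((f t / Num.sqrt n%:R) ^+ 2) (`|f t / Num.sqrt n%:R| ^+ 3).
    by rewrite le_min sqr_ge0 exprn_ge0.
  rewrite !abse_EFin lee_fin ger0_norm ?(mulr_ge0 _ m0)// ger0_norm; last first.
    by rewrite mulr_ge0 ?sqr_ge0// mulr_ge0// sqr_ge0.
  by rewrite -mulrA ler_wpM2l// -exprMn [_^-1 * _]mulrC ge_min lexx.
under eq_fun do rewrite -RintegralZl//.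
rewrite -(Rintegral_prob_cst mu 0).
apply: (@Rintegral_dct _ _ _ mu r (fun=> 0) (fun t => 2 * f t ^+ 2)) => //; last first.
  by move=> n t; rewrite ger0_norm.
move=> t; apply: (@squeeze_cvgr _ _ _ _ (fun=> 0) (fun n => 2 * `|f t| ^+ 3 * (Num.sqrt n%:R)^-1)).
- by apply: nearW => n; rewrite r0 rle3.
- exact: cvg_cst.
- rewrite -[X in _ --> X](mulr0 (2 * `|f t| ^+ 3)).
  by apply: cvgMr; exact: cvg_inv_sqrtn.
Qed.

(** As in remainder2, with domination by |f|. *)
Lemma remainder1 (f : T -> R) : measurable_fun setT f ->
  mu.-integrable setT (EFin \o f) ->
  n%:R * \int[mu]_t (Num.min ((f t / n%:R) ^+ 2) `|f t / n%:R|) @[n --> \oo] --> 0.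
Proof.
move=> mf if1.
pose r (n : nat) t := n%:R * (Num.min ((f t / n%:R) ^+ 2) `|f t / n%:R|).
have r0 n t : 0 <= r n t.
  by rewrite mulr_ge0// le_min sqr_ge0 normr_ge0.
have rle n t : r n t <= `|f t|.
  case: n => [|n]; first by rewrite /r mul0r.
  apply: (@le_trans _ _ (n.+1%:R * `|f t / n.+1%:R|)).
    by rewrite !ler_wpM2l// ge_min lexx orbT.
  rewrite normrM normfV (@ger0_norm _ n.+1%:R)//.
  by rewrite le_eqVlt; apply/orP; left; apply/eqP; field.
have rle3 n t : r n t <= f t ^+ 2 * n%:R^-1.
  case: n => [|n]; first by rewrite /r mul0r invr0 mulr0.
  apply: (@le_trans _ _ (n.+1%:R * (f t / n.+1%:R) ^+ 2)).
    by rewrite !ler_wpM2l// ge_min lexx.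
  by rewrite le_eqVlt; apply/orP; left; apply/eqP; field.
have mr n : measurable_fun setT (r n).
  apply: measurable_funM => //; apply: measurable_minr.
    by apply: measurable_funX; exact: measurable_funM.
  by apply: measurableT_comp => //; exact: measurable_funM.
have ir n : mu.-integrable setT (EFin \o (fun t => Num.min ((f t / n%:R) ^+ 2) `|f t / n%:R|)).
  have i6 : mu.-integrable setT (EFin \o (fun t => n%:R^-1 * f t)).
    under [X in _.-integrable _ X]eq_fun do rewrite /= EFinM.
    exact: integrableZl.
  apply: (@le_integrable _ _ _ mu setT measurableT _ _ _ _ i6).
    apply/measurable_EFinP; apply: measurable_minr.
      by apply: measurable_funX; exact: measurable_funM.
    by apply: measurableT_comp => //; exact: measurable_funM.
  move=> t _; rewrite !abse_EFin lee_fin ger0_norm ?le_min ?sqr_ge0 ?normr_ge0//=.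
  by rewrite [_^-1 * _]mulrC ge_min lexx orbT.
under eq_fun do rewrite -RintegralZl//.
rewrite -(Rintegral_prob_cst mu 0).
apply: (@Rintegral_dct _ _ _ mu r (fun=> 0) (fun t => `|f t|)) => //; last first.
- by move=> n t; rewrite ger0_norm.
- exact: (integrable_abse if1).
move=> t; apply: (@squeeze_cvgr _ _ _ _ (fun=> 0) (fun n => f t ^+ 2 * n%:R^-1)).
- by apply: nearW => n; rewrite r0 rle3.
- exact: cvg_cst.
- rewrite -[X in _ --> X](mulr0 (f t ^+ 2)).
  apply: cvgMr; apply/gtr0_cvgV0; last exact: cvgr_idn.
  by exists 1%N => // n /=; rewrite ltr0n.
Unshelve. all: by end_near. Qed.

End remainders.

Section limit_theorems.
Context {R : realType} d (T : measurableType d) (mu : probability T R).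
Local Notation gauss := (normal_prob (0 : R) 1).

(** By trotter, the error after n steps is n times that of one step, which tends to 0 by
    remainder1; the limit is the n-th power of the identity. *)
Lemma logistic_wlln (f : T -> R) x : measurable_fun setT f ->
  mu.-integrable setT (EFin \o f) -> \int[mu]_t f t = 0 ->
  \int[iid mu n]_t logistic (x + (\sum_(i < n) f (tnth t i)) / n%:R) @[n --> \oo] --> logistic x.
Proof.
move=> mf if1 f0.
apply/cvgrPdist_le => e e0; near=> n.
have mfn : measurable_fun setT (fun t => f t / n%:R) by exact: measurable_funM.
have -> : \int[iid mu n]_t logistic (x + (\sum_(i < n) f (tnth t i)) / n%:R) =
    iter n (shift_mean mu (fun t => f t / n%:R)) logistic x.
  rewrite -(iid_sumE mu mfn n x logistic_bounded_meas).
  by apply: eq_Rintegral => t _; rewrite mulr_suml.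
pose D := \int[mu]_t (Num.min ((f t / n%:R) ^+ 2) `|f t / n%:R|).
apply: (@le_trans _ _ (n%:R * D)); last first.
  rewrite -[leLHS]ger0_norm; last first.
    by rewrite mulr_ge0//; apply: Rintegral_ge0 => t _; rewrite le_min sqr_ge0 normr_ge0.
  rewrite -normrN -[- _]sub0r /D; near: n.
  by move: (e) e0; apply/cvgrPdist_le; exact: (remainder1 mf if1).
have id0 k : iter k (shift_mean mu (fun=> 0)) logistic = logistic.
  elim: k => //= k ->; apply/funext => y; rewrite /shift_mean.
  by under eq_Rintegral do rewrite addr0; rewrite Rintegral_prob_cst.
rewrite distrC -[in X in `|_ - X|](id0 n).
apply: (@trotter _ _ _ mu (fun t => f t / n%:R) _ _ mu (fun=> 0) mfn _ D n _ 1) => //.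
  exact: logistic_bounded_meas.
move=> y; have := id0 1%N => /= ->; apply: local_expansion1 => //.
- under [X in _.-integrable _ X]eq_fun do rewrite /= EFinM.
  exact: integrableZr.
- by rewrite RintegralZr// f0 mul0r.
Unshelve. all: by end_near. Qed.

(** The Gaussian variable is itself a sum of n independent Gaussian variables (iter_gauss)
    with the same variance as the summands, so that the second order terms of the two
    expansions cancel and the n errors of one step tend to 0 by remainder2. *)
Lemma logistic_clt (f : T -> R) (s : R) x : measurable_fun setT f ->
  mu.-integrable setT (fun t => (f t ^+ 2)%:E) -> \int[mu]_t f t = 0 ->
  0 < s -> \int[mu]_t (f t ^+ 2) = s ^+ 2 ->
  \int[iid mu n]_t logistic (x + (\sum_(i < n) f (tnth t i)) / Num.sqrt n%:R) @[n --> \oo]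
    --> \int[gauss]_z logistic (x + s * z).
Proof.
move=> mf if2 f0 s0 fs.
have if1 := sqr_integrable_integrable mf if2.
have mgs : measurable_fun setT (fun z : R => s * z) by exact: measurable_funM.
have igs : gauss.-integrable setT (fun z => ((s * z) ^+ 2)%:E).
  under [X in _.-integrable _ X]eq_fun do rewrite exprMn EFinM.
  by apply: integrableZl => //; exact: gauss_pow2_integrable.
apply/cvgrPdist_le => e e0; near=> n.
have n0 : (0 < n)%N by near: n; exact: nbhs_infty_gt.
have sn0 : 0 < Num.sqrt n%:R :> R by rewrite sqrtr_gt0 ltr0n.
have sn2 : Num.sqrt n%:R ^+ 2 = n%:R :> R by rewrite sqr_sqrtr.
have mfn : measurable_fun setT (fun t => f t / Num.sqrt n%:R) by exact: measurable_funM.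
have mgn : measurable_fun setT ( *%R (s / Num.sqrt n%:R) : measurableTypeR R -> R) by exact: measurable_funM.
have -> : \int[iid mu n]_t logistic (x + (\sum_(i < n) f (tnth t i)) / Num.sqrt n%:R) =
    iter n (shift_mean mu (fun t => f t / Num.sqrt n%:R)) logistic x.
  rewrite -(iid_sumE mu mfn n x logistic_bounded_meas).
  by apply: eq_Rintegral => t _; rewrite mulr_suml.
have -> : \int[gauss]_z logistic (x + s * z) = iter n (shift_mean gauss ( *%R (s / Num.sqrt n%:R))) logistic x.
  have := iter_gauss n.-1 x (divr_gt0 s0 sn0) logistic_bounded_meas.
  by rewrite (prednK n0) => ->; rewrite divfK// gt_eqF.
pose D1 := \int[mu]_t (2 * Num.min ((f t / Num.sqrt n%:R) ^+ 2) (`|f t / Num.sqrt n%:R| ^+ 3)).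
pose D2 := \int[gauss]_z (2 * Num.min ((s * z / Num.sqrt n%:R) ^+ 2) (`|s * z / Num.sqrt n%:R| ^+ 3)).
apply: (@le_trans _ _ (n%:R * (D1 + D2))); last first.
  rewrite mulrDr [leRHS](splitr e) lerD//.
    rewrite -[leLHS]ger0_norm; last first.
      rewrite mulr_ge0//; apply: Rintegral_ge0 => t _.
      by rewrite mulr_ge0// le_min sqr_ge0 exprn_ge0.
    rewrite -normrN -[- _]sub0r /D1; near: n.
    by move: (e / 2) (divr_gt0 e0 (ltr0Sn R 1)); apply/cvgrPdist_le; exact: (remainder2 mf if2).
  rewrite -[leLHS]ger0_norm; last first.
    rewrite mulr_ge0//; apply: Rintegral_ge0 => t _.
    by rewrite mulr_ge0// le_min sqr_ge0 exprn_ge0.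
  rewrite -normrN -[- _]sub0r /D2; near: n.
  by move: (e / 2) (divr_gt0 e0 (ltr0Sn R 1)); apply/cvgrPdist_le; exact: (@remainder2 _ _ _ gauss (fun z => s * z) mgs igs).
rewrite distrC.
apply: (@trotter _ _ _ mu (fun t => f t / Num.sqrt n%:R) _ _ gauss _ mfn mgn (D1 + D2) n _ 1) => //.
  exact: logistic_bounded_meas.
move=> y.
have v : s ^+ 2 / n%:R = (s / Num.sqrt n%:R) ^+ 2 by rewrite exprMn exprVn sn2.
have e1 : `|shift_mean mu (fun t => f t / Num.sqrt n%:R) logistic y - (logistic y + logistic2 y * (s ^+ 2 / n%:R / 2))| <= D1.
  have := @local_expansion2 _ _ _ mu (fun t => f t / Num.sqrt n%:R) y mfn.
  under [X in _.-integrable _ X]eq_fun do rewrite exprMn EFinM.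
  under [X in X / 2]eq_Rintegral do rewrite exprMn.
  rewrite !RintegralZr// f0 fs mul0r exprVn sn2; apply => //.
  exact: integrableZr.
have e2 : `|shift_mean gauss ( *%R (s / Num.sqrt n%:R)) logistic y - (logistic y + logistic2 y * (s ^+ 2 / n%:R / 2))| <= D2.
  have := @local_expansion2 _ _ _ gauss ( *%R (s / Num.sqrt n%:R)) y mgn.
  have -> : \int[gauss]_z (s / Num.sqrt n%:R * z) = 0.
    by rewrite RintegralZl// ?gauss_mean ?mulr0//; exact: gauss_pow1_integrable.
  have -> : \int[gauss]_z ((s / Num.sqrt n%:R * z) ^+ 2) = s ^+ 2 / n%:R.
    under eq_Rintegral do rewrite exprMn.
    by rewrite RintegralZl// ?gauss_variance ?mulr1//; exact: gauss_pow2_integrable.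
  rewrite /D2.
  have -> : (fun z => 2 * Num.min ((s * z / Num.sqrt n%:R) ^+ 2) (`|s * z / Num.sqrt n%:R| ^+ 3)) =
      (fun z => 2 * Num.min ((s / Num.sqrt n%:R * z) ^+ 2) (`|s / Num.sqrt n%:R * z| ^+ 3)).
    by apply/funext => z; rewrite mulrAC.
  apply => //.
  under [X in _.-integrable _ X]eq_fun do rewrite exprMn EFinM.
  by apply: integrableZl => //; exact: gauss_pow2_integrable.
have := lerD e1 e2; apply: le_trans.
rewrite [X in _ <= _ + X]distrC; apply: le_trans (ler_normD _ _).
by rewrite addrA subrK.
Unshelve. all: by end_near. Qed.

End limit_theorems.

Section tails.
Context {R : realType} d (T : measurableType d) (P : probability T R).

Lemma prob_fin A : measurable A -> P A = (fine (P A))%:E.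
Proof. by move=> mA; rewrite fineK// fin_num_measure. Qed.

Lemma fine_prob_ge0 A : 0 <= fine (P A).
Proof. exact: fine_ge0. Qed.

Lemma fine_prob_le1 A : measurable A -> fine (P A) <= 1.
Proof. by move=> mA; rewrite -lee_fin -prob_fin//; exact: probability_le1. Qed.

Lemma fine_prob_le A B : measurable A -> measurable B -> A `<=` B ->
  fine (P A) <= fine (P B).
Proof. by move=> mA mB AB; rewrite -lee_fin -!prob_fin// le_measure ?inE. Qed.

Lemma fine_probU A B : measurable A -> measurable B ->
  fine (P (A `|` B)) <= fine (P A) + fine (P B).
Proof.
move=> mA mB; rewrite -lee_fin EFinD -!prob_fin//; last exact: measurableU.
exact: measureU2.
Qed.

Lemma measurable_ge (S : T -> R) x : measurable_fun setT S -> measurable [set t | x <= S t].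
Proof.
move=> mS; rewrite (_ : [set _ | _] = S @^-1` `[x, +oo[%classic).
  by rewrite -[X in measurable X]setTI; exact: mS.
by apply/seteqP; split=> t /=; rewrite in_itv /= andbT.
Qed.

Lemma prob_le_Rintegral A (f : T -> R) : measurable A -> P.-integrable setT (EFin \o f) ->
  (forall t, 0 <= f t) -> (forall t, A t -> 1 <= f t) -> fine (P A) <= \int[P]_t f t.
Proof.
move=> mA fi f0 f1; rewrite -lee_fin -prob_fin// EFin_Rintegral//.
rewrite -(setIT A) -integral_indic//; apply: ge0_le_integral => //.
- by apply/measurable_EFinP; exact: measurable_indic.
- by case/integrableP: fi.
- move=> t _; rewrite lee_fin indicE; case: (boolP (t \in A)) => [|_]; last exact: f0.
  by rewrite inE => /f1.
Qed.

Lemma prob_ge_Rintegral A (f : T -> R) (q : R) : measurable A -> P.-integrable setT (EFin \o f) ->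
  0 <= q -> (forall t, A t -> f t <= 1) -> (forall t, f t <= 1) -> (forall t, ~ A t -> f t <= q) ->
  \int[P]_t f t <= fine (P A) + q.
Proof.
move=> mA fi q0 fA f1 fq.
have iA : P.-integrable setT (EFin \o (\1_A : T -> R)).
  by apply: (@prob_bounded_integrable _ _ _ P _ 1) => // t; rewrite ger0_norm// indicE lern1 leq_b1.
have -> : fine (P A) + q = \int[P]_t (\1_A t + q).
  rewrite (RintegralD measurableT iA (prob_cst_integrable P q)) Rintegral_prob_cst; congr (_ + _).
  by rewrite /Rintegral integral_indic// setIT.
apply: le_Rintegral => //; first exact: (integrableD measurableT iA (prob_cst_integrable P q)).
move=> t _; rewrite indicE; case: (boolP (t \in A)) => tA.
  by rewrite (le_trans (f1 t))// lerDl.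
by rewrite add0r; apply: fq => At; move: tA; rewrite mem_set.
Qed.

Lemma markov_ge (f : T -> R) (x : R) : 0 < x -> P.-integrable setT (EFin \o f) ->
  (forall t, 0 <= f t) -> fine (P [set t | x <= f t]) <= (\int[P]_t f t) / x.
Proof.
move=> x0 fi f0.
have mf : measurable_fun setT f by apply/measurable_EFinP; case/integrableP: fi.
rewrite -RintegralZr//; apply: prob_le_Rintegral.
- exact: measurable_ge.
- under [X in _.-integrable _ X]eq_fun do rewrite /= EFinM.
  exact: integrableZr.
- by move=> t; rewrite divr_ge0// ltW.
- by move=> t /= xf; rewrite ler_pdivlMr// mul1r.
Qed.

Context (S : T -> R) (mS : measurable_fun setT S).
Variables (a x dl : R) (a0 : 0 < a).

Let il y : P.-integrable setT (EFin \o (fun t => logistic (y + a * S t))).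
Proof.
have mS' : measurable_fun setT (fun t => a * S t) by exact: measurable_funM.
exact: (shift_mean_integrable P mS' y logistic_bounded_meas).
Qed.

(** On the event, the logistic factor is at least (1 + e^(- a dl))^-1. *)
Lemma logistic_tail : 
  fine (P [set t | x <= S t]) <=
  (1 + expR (- (a * dl))) * \int[P]_t logistic (- (a * (x - dl)) + a * S t).
Proof.
have q0 : 0 < 1 + expR (- (a * dl)) by rewrite addr_gt0// expR_gt0.
rewrite -RintegralZl//; apply: prob_le_Rintegral.
- exact: measurable_ge.
- under [X in _.-integrable _ X]eq_fun do rewrite /= EFinM.
  by apply: integrableZl => //; exact: il.
- by move=> t; rewrite mulr_ge0 ?ltW// logistic_gt0.
- move=> t /= xt; rewrite /logistic ler_pdivlMr ?addr_gt0 ?expR_gt0// mul1r lerD2l ler_expR.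
  have : a * x <= a * S t by rewrite ler_pM2l.
  by rewrite mulrBr; lra.
Qed.

(** Off the event, the logistic factor is at most e^(- a dl). *)
Lemma logistic_head :
  \int[P]_t logistic (- (a * x) + a * S t) <= fine (P [set t | x - dl <= S t]) + expR (- (a * dl)).
Proof.
apply: prob_ge_Rintegral.
- exact: measurable_ge.
- exact: il.
- exact: expR_ge0.
- by move=> t _; rewrite ltW// logistic_lt1.
- by move=> t; rewrite ltW// logistic_lt1.
- move=> t /= /negP; rewrite -ltNge => St.
  rewrite /logistic -[leRHS]invrK lef_pV2 ?posrE ?invr_gt0 ?addr_gt0 ?expR_gt0//.
  rewrite -expRN opprK; apply: (@le_trans _ _ (expR (- (- (a * x) + a * S t)))); last by rewrite lerDr.
  have : a * S t < a * (x - dl) by rewrite ltr_pM2l.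
  by rewrite ler_expR mulrBr; lra.
Qed.

End tails.

Section limit_tails.
Context {R : realType} d (T : measurableType d) (mu : probability T R).
Local Notation gauss := (normal_prob (0 : R) 1).

Let scale (dl e : R) : 0 < dl -> 0 < e ->
  exists2 a, 0 < a & expR (- (a * dl)) <= e.
Proof.
move=> dl0 e0; exists (e^-1 / dl); first by rewrite divr_gt0// invr_gt0.
rewrite divfK ?gt_eqF// expRN -[leRHS]invrK lef_pV2 ?posrE ?invr_gt0 ?expR_gt0//.
by rewrite (le_trans _ (expR_ge1Dx _))// lerDr.
Qed.

(** The margin dl absorbs the width of the transition of the rescaled logistic function,
    which is used once as an upper bound for the sum and once as a lower bound for the
    Gaussian limit. *)
Lemma clt_tail (f : T -> R) (s x dl e : R) : measurable_fun setT f ->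
  mu.-integrable setT (fun t => (f t ^+ 2)%:E) -> \int[mu]_t f t = 0 ->
  0 < s -> \int[mu]_t (f t ^+ 2) = s ^+ 2 -> 0 < dl -> 0 < e ->
  \forall n \near \oo,
    fine (iid mu n [set t | x <= (\sum_(i < n) f (tnth t i)) / Num.sqrt n%:R]) <=
    fine (gauss [set z | x - dl <= s * z]) + e.
Proof.
move=> mf if2 f0 s0 fs dl0 e0.
have if1 := sqr_integrable_integrable mf if2.
pose e' := Num.min e 1 / 8.
have e'0 : 0 < e' by rewrite divr_gt0// lt_min e0/=.
have e'e : e' <= e / 8 by rewrite ler_pM2r// ge_min lexx.
have e'1 : e' <= 1 / 8 by rewrite ler_pM2r// ge_min lexx orbT.
have dl2 : 0 < dl / 2 by rewrite divr_gt0.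
have [a a0 qe] := scale dl2 e'0.
have maf : measurable_fun setT (fun t => a * f t) by exact: measurable_funM.
have := @logistic_clt _ _ _ mu (fun t => a * f t) (a * s) (- (a * (x - dl / 2))) maf.
have -> : \int[mu]_t (a * f t) = 0 by rewrite RintegralZl// f0 mulr0.
have -> : \int[mu]_t ((a * f t) ^+ 2) = (a * s) ^+ 2.
  under eq_Rintegral do rewrite exprMn.
  by rewrite RintegralZl// fs exprMn.
have iaf : mu.-integrable setT (fun t => ((a * f t) ^+ 2)%:E).
  under [X in _.-integrable _ X]eq_fun do rewrite exprMn EFinM.
  exact: integrableZl.
move=> /(_ iaf erefl (mulr_gt0 a0 s0) erefl) /cvgrPdist_le/(_ _ e'0) Hn.
have ms : measurable_fun setT (fun z : R => s * z) by exact: measurable_funM.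
have := @logistic_head _ _ _ gauss _ ms a (x - dl / 2) (dl / 2) a0.
under eq_Rintegral do rewrite mulrA.
rewrite (_ : x - dl / 2 - dl / 2 = x - dl); last by field.
set N := fine _; set G := Rintegral _ _ _ => GN.
have N1 : N <= 1 by apply: fine_prob_le1; exact: measurable_ge.
near=> n.
have mSn : measurable_fun setT (fun t : n.-tuple T => (\sum_(i < n) f (tnth t i)) / Num.sqrt n%:R).
  by apply: measurable_funM => //; exact: measurable_iid_sum.
have := @logistic_tail _ _ _ (iid mu n) _ mSn a x (dl / 2) a0.
set J := Rintegral _ _ _ => AJ.
have : `|G - J| <= e'.
  have : `|G - \int[iid mu n]_t logistic (- (a * (x - dl / 2)) + (\sum_(i < n) a * f (tnth t i)) / Num.sqrt n%:R)| <= e'.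
    by near: n; exact: Hn.
  rewrite /J; under eq_Rintegral do rewrite -mulr_sumr -mulrA.
  by [].
rewrite ler_norml => /andP[GJ _].
apply: (le_trans AJ); have q0 := expR_gt0 (- (a * (dl / 2))).
set q := expR _ in qe GN q0 *.
have JN : J <= N + q + e' by lra.
apply: (@le_trans _ _ ((1 + q) * (N + q + e'))); first by rewrite ler_wpM2l// addr_ge0// ltW.
have N0 : 0 <= N by exact: fine_prob_ge0.
nra.
Unshelve. all: by end_near. Qed.

Lemma wlln_tail (f : T -> R) (dl e : R) : measurable_fun setT f ->
  mu.-integrable setT (EFin \o f) -> \int[mu]_t f t = 0 -> 0 < dl -> 0 < e ->
  \forall n \near \oo,
    fine (iid mu n [set t | dl <= (\sum_(i < n) f (tnth t i)) / n%:R]) <= e.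
Proof.
move=> mf if1 f0 dl0 e0.
pose e' := Num.min e 1 / 8.
have e'0 : 0 < e' by rewrite divr_gt0// lt_min e0/=.
have e'e : e' <= e / 8 by rewrite ler_pM2r// ge_min lexx.
have e'1 : e' <= 1 / 8 by rewrite ler_pM2r// ge_min lexx orbT.
have dl2 : 0 < dl / 2 by rewrite divr_gt0.
have [a a0 qe] := scale dl2 e'0.
have maf : measurable_fun setT (fun t => a * f t) by exact: measurable_funM.
have iaf : mu.-integrable setT (EFin \o (fun t => a * f t)).
  under [X in _.-integrable _ X]eq_fun do rewrite /= EFinM.
  exact: integrableZl.
have := @logistic_wlln _ _ _ mu (fun t => a * f t) (- (a * (dl - dl / 2))) maf iaf.
rewrite RintegralZl// f0 mulr0 => /(_ erefl) /cvgrPdist_le/(_ _ e'0) Hn.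
have L : logistic (- (a * (dl - dl / 2))) <= expR (- (a * (dl / 2))).
  rewrite /logistic -[leRHS]invrK lef_pV2 ?posrE ?invr_gt0 ?addr_gt0 ?expR_gt0//.
  rewrite -expRN !opprK (_ : dl - dl / 2 = dl / 2); last by field.
  by rewrite lerDr.
near=> n.
have mSn : measurable_fun setT (fun t : n.-tuple T => (\sum_(i < n) f (tnth t i)) / n%:R).
  by apply: measurable_funM => //; exact: measurable_iid_sum.
have := @logistic_tail _ _ _ (iid mu n) _ mSn a dl (dl / 2) a0.
set J := Rintegral _ _ _ => AJ.
have : `|logistic (- (a * (dl - dl / 2))) - J| <= e'.
  have : `|logistic (- (a * (dl - dl / 2))) - \int[iid mu n]_t logistic (- (a * (dl - dl / 2)) + (\sum_(i < n) a * f (tnth t i)) / n%:R)| <= e'.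
    by near: n; exact: Hn.
  rewrite /J; under eq_Rintegral do rewrite -mulr_sumr -mulrA.
  by [].
rewrite ler_norml => /andP[GJ _].
apply: (le_trans AJ); have q0 := expR_gt0 (- (a * (dl / 2))).
set q := expR _ in qe L q0 *.
have JN : J <= q + e' by lra.
apply: (@le_trans _ _ ((1 + q) * (q + e'))); first by rewrite ler_wpM2l// addr_ge0// ltW.
nra.
Unshelve. all: by end_near. Qed.

(** Both tails come from wlln_tail, applied to f and to - f after centering. *)
Lemma wlln (f : T -> R) (dl e : R) : measurable_fun setT f ->
  mu.-integrable setT (EFin \o f) -> 0 < dl -> 0 < e ->
  \forall n \near \oo,
    fine (iid mu n [set t | dl <= `|(\sum_(i < n) f (tnth t i)) / n%:R - \int[mu]_t f t|]) <= e.
Proof.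
move=> mf if1 dl0 e0; set m := \int[mu]_t f t.
have mg1 : measurable_fun setT (fun t => f t - m) by exact: measurable_funB.
have mg2 : measurable_fun setT (fun t => m - f t) by exact: measurable_funB.
have im := prob_cst_integrable mu m.
have e2 : 0 < e / 2 by rewrite divr_gt0.
have := @wlln_tail (fun t => f t - m) dl (e / 2) mg1 (integrableB measurableT if1 im).
rewrite (RintegralB measurableT if1 im) Rintegral_prob_cst subrr => /(_ erefl dl0 e2) H1.
have := @wlln_tail (fun t => m - f t) dl (e / 2) mg2 (integrableB measurableT im if1).
rewrite (RintegralB measurableT im if1) Rintegral_prob_cst subrr => /(_ erefl dl0 e2) H2.
near=> n.
have n0 : n%:R != 0 :> R.
  by rewrite pnatr_eq0 -lt0n; near: n; exact: nbhs_infty_gt.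
have mS1 : measurable_fun setT (fun t : n.-tuple T => (\sum_(i < n) (f (tnth t i) - m)) / n%:R).
  by apply: measurable_funM => //; exact: (measurable_iid_sum mg1).
have mS2 : measurable_fun setT (fun t : n.-tuple T => (\sum_(i < n) (m - f (tnth t i))) / n%:R).
  by apply: measurable_funM => //; exact: (measurable_iid_sum mg2).
have -> : [set t : n.-tuple T | dl <= `|(\sum_(i < n) f (tnth t i)) / n%:R - m|] =
   [set t | dl <= (\sum_(i < n) (f (tnth t i) - m)) / n%:R] `|`
   [set t | dl <= (\sum_(i < n) (m - f (tnth t i))) / n%:R].
  have E1 (t : n.-tuple T) : (\sum_(i < n) (f (tnth t i) - m)) / n%:R = (\sum_(i < n) f (tnth t i)) / n%:R - m.
    by rewrite sumrB sumr_const card_ord -[m *+ n]mulr_natr mulrBl mulfK.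
  have E2 (t : n.-tuple T) : (\sum_(i < n) (m - f (tnth t i))) / n%:R = - ((\sum_(i < n) f (tnth t i)) / n%:R - m).
    by rewrite sumrB sumr_const card_ord -[m *+ n]mulr_natr mulrBl mulfK// opprB.
  by apply/seteqP; split=> t /=; rewrite E1 E2 ler_normr => /orP.
apply: (le_trans (fine_probU _ (measurable_ge _ mS1) (measurable_ge _ mS2))).
rewrite [leRHS](splitr e) lerD//; near: n; [exact: H1|exact: H2].
Unshelve. all: by end_near. Qed.

End limit_tails.

(** * Gaussian quantiles *)

Section quantile.
Context {R : realType}.
Local Notation leb := (@lebesgue_measure R).
Local Notation gauss := (normal_prob (0 : R) 1).

(** The standard Gaussian density is at most 1. *)
Lemma gauss_itv (a b : R) : a <= b -> fine (gauss `[a, b]) <= b - a.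
Proof.
move=> ab; rewrite -lee_fin -prob_fin//.
apply: (@le_trans _ _ (\int[leb]_(x in `[a, b]) 1%:E)%E).
  apply: ge0_le_integral => //.
  - by move=> x _; rewrite lee_fin normal_pdf_ge0.
  - by apply/measurable_EFinP; apply: measurable_funTS; exact: measurable_normal_pdf.
  - move=> x _; rewrite lee_fin (le_trans (normal_pdf_ub 0 x (oner_neq0 R)))//.
    rewrite /normal_peak invf_le1 ?sqrtr_gt0 ?expr1n ?mul1r; last by rewrite mulrn_wgt0 ?pi_gt0.
    rewrite -[leLHS]sqrtr1; apply: ler_wsqrtr.
    by rewrite -mulr_natl; have := pi_ge2 R; lra.
rewrite integral_cst// mul1e [X in (X <= _)%E](lebesgue_measure_itv `[a, b]%R) /= lte_fin.
by case: ifPn => // _; rewrite ?lee_fin ?subr_ge0// -EFinB.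
Qed.

(** The quantile z is an infimum, so that the distribution function reaches p just after z.
    Going back from there to z - dl costs at most 2 dl, by gauss_itv. *)
Lemma gauss_quantile (p dl : R) : 0 < p < 1 -> 0 < dl ->
  fine (gauss [set z | normal_quantile p - dl <= z]) <= 1 - p + 2 * dl.
Proof.
move=> /andP[p0 p1] dl0.
pose F (x : R) := fine (gauss `]-oo, x]).
have FE (x : R) : gauss `]-oo, x] = (F x)%:E by rewrite /F -prob_fin.
have Fmono (x y : R) : x <= y -> F x <= F y.
  by move=> xy; apply: fine_prob_le => // z; rewrite /= !in_itv /= => /le_trans; exact.
have tail (t : R) : 0 < t -> fine (gauss [set z | t <= z ^+ 2]) <= t^-1.
  move=> t0; have := @markov_ge _ _ _ gauss (fun z => z ^+ 2) t t0 gauss_pow2_integrable (@sqr_ge0 R).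
  by rewrite gauss_variance mul1r.
have mtail (t : R) : measurable [set z : R | t <= z ^+ 2] by apply: measurable_ge; exact: measurable_pow.
have split1 (x : R) : 1 <= F x + fine (gauss [set z | x <= z]).
  rewrite -lee_fin -(@probability_setT _ _ _ gauss).
  apply: (@le_trans _ _ (gauss (`]-oo, x] `|` [set z | x <= z]))).
    apply: le_measure; rewrite ?inE//.
      by apply: measurableU => //; exact: measurable_ge.
    by move=> z _ /=; rewrite in_itv /=; apply/orP; exact: le_total.
  rewrite EFinD -FE -prob_fin; last exact: measurable_ge.
  apply: measureU2 => //; exact: measurable_ge.
have small (t : R) : 0 < t -> F (- t) <= (t ^+ 2)^-1.
  move=> t0; apply: le_trans (tail _ (exprn_gt0 2 t0)); apply: fine_prob_le; [by []|exact: mtail|].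
  by move=> z /=; rewrite in_itv /= => zt; nra.
have big (t : R) : 0 < t -> 1 - (t ^+ 2)^-1 <= F t.
  move=> t0; rewrite lerBlDr (le_trans (split1 t))// lerD2l.
  apply: le_trans (tail _ (exprn_gt0 2 t0)); apply: fine_prob_le; [exact: measurable_ge|exact: mtail|].
  by move=> z /= zt; nra.
pose A := [set x : R | (p%:E <= gauss `]-oo, x])%E].
have AE x : A x <-> p <= F x by rewrite /A /= FE lee_fin.
have Ainf : has_inf A.
  split.
    pose t := (1 - p)^-1 + 1; have p1' : 0 < 1 - p by rewrite subr_gt0.
    have t1 : 1 < t by rewrite ltrDr invr_gt0.
    exists t; apply/AE; apply: le_trans (big t (lt_trans ltr01 t1)).
    have t2 : 0 < t ^+ 2 by rewrite exprn_gt0// (lt_trans ltr01).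
    suff : (t ^+ 2)^-1 <= 1 - p by lra.
    rewrite -[leRHS]invrK lef_pV2 ?posrE ?invr_gt0//.
    by apply: (@le_trans _ _ t); [rewrite lerDl|nra].
  pose t := p^-1 + 1.
  have t1 : 1 < t by rewrite ltrDr invr_gt0.
  exists (- t) => x /AE pF; rewrite leNgt; apply/negP => xt.
  have := le_trans (le_trans pF (Fmono _ _ (ltW xt))) (small t (lt_trans ltr01 t1)).
  have t2 : 0 < t ^+ 2 by rewrite exprn_gt0// (lt_trans ltr01).
  apply/negP; rewrite -ltNge -[ltRHS]invrK ltf_pV2 ?posrE ?invr_gt0//.
  by apply: (@lt_le_trans _ _ t); [rewrite ltrDl|nra].
set z := normal_quantile p.
(* just above the infimum the distribution function has reached p *)
have [x /AE px xz] : exists2 x, A x & x < z + dl by apply: (@inf_adherent _ A dl).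
have Fx : F x <= fine (gauss `]-oo, (z - dl)[) + 2 * dl.
  have -> : 2 * dl = (z + dl) - (z - dl) by ring.
  apply: (@le_trans _ _ (fine (gauss (`]-oo, (z - dl)[ `|` `[z - dl, z + dl])))).
    apply: fine_prob_le => //; first exact: measurableU.
    move=> y /=; rewrite !in_itv /= => yx.
    have [yz|zy] := ltP y (z - dl); [by left|right].
    by rewrite (le_trans yx (ltW xz)).
  apply: le_trans (fine_probU _ _ _) _ => //.
  by rewrite lerD2l gauss_itv//; lra.
have C : fine (gauss `]-oo, (z - dl)[) + fine (gauss [set y | z - dl <= y]) <= 1.
  rewrite -lee_fin EFinD -!prob_fin//; last exact: measurable_ge.
  rewrite -measureU//; last 2 first.
  - exact: measurable_ge.
  - by apply/seteqP; split => // y []/=; rewrite in_itv /= ltNge => /negP.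
  by apply: probability_le1; apply: measurableU => //; exact: measurable_ge.
lra.
Qed.

End quantile.

(** * Decay of the Fourier transform of smooth functions of compact support *)

Lemma indic_integrable dT (T : measurableType dT) (R : realType)
    (mu : {measure set T -> \bar R}) (B : set T) :
  measurable B -> (mu B < +oo)%E -> mu.-integrable setT (EFin \o (\1_B : T -> R)).
Proof.
move=> mB Boo; apply/integrableP; split; first by apply/measurable_EFinP; exact: measurable_indic.
by under eq_integral do rewrite /= ger0_norm//; rewrite integral_indic// setIT.
Qed.

Section directional.
Context {R : realType} {d : nat}.
Implicit Types (x v e : 'rV[R]_d) (F G : 'rV[R]_d -> R).

Lemma is_derive_line F x v (df : R) :
  is_derive (0 : R) (1 : R) (fun t : R => F (x + t *: v)) df <-> is_derive x v F df.
Proof.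
pose u := fun t : R => F (x + t *: v); rewrite -/u.
have E : (fun h : R^o => h^-1 *: ((u \o shift (0 : R^o)) (h *: (1 : R^o)) - u 0))
    = (fun h : R => h^-1 *: ((F \o shift x) (h *: v) - F x)).
  apply/funext => h; rewrite /u /= scale0r !addr0; congr (_ *: (F _ - _)).
  by rewrite addrC [h *: 1]mulr1.
have E1 : derivable u (0 : R^o) (1 : R^o) = derivable F x v by rewrite /derivable -E.
have E2 : 'D_(1 : R^o) u (0 : R^o) = 'D_v F x by rewrite /derive -E.
split=> -[a b].
  by split; [exact: (eq_ind _ id a _ E1)|rewrite -b; symmetry; exact: E2].
by split; [exact: (eq_ind_r id a E1)|rewrite -b; exact: E2].
Qed.

Lemma is_derive_shift F x v e (df : R) : is_derive (x + v) e F df ->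
  is_derive x e (fun y => F (y + v)) df.
Proof.
move=> /is_derive_line H; apply/is_derive_line.
by under eq_fun do rewrite addrAC.
Qed.

Lemma is_derive_along F x e (t df : R) : is_derive (x + t *: e) e F df ->
  is_derive t (1 : R) (fun s : R => F (x + s *: e)) df.
Proof.
move=> /is_derive_line H.
have E : (fun s : R => F (x + s *: e)) = (fun s : R => (fun s : R => F (x + t *: e + s *: e)) (s - t)).
  by apply/funext => s; rewrite -addrA -scalerDl [t + _]addrC subrK.
rewrite E -[df]mulr1.
have H2 : is_derive (t - t) (1 : R) (fun s : R => F (x + t *: e + s *: e)) df by rewrite subrr.
have H3 : is_derive t (1 : R) (fun s : R => s - t) 1.
  rewrite (_ : (fun _ => _) = id - cst t)//; by apply: is_derive_eq; rewrite subr0.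
exact: (@is_derive1_comp _ (fun s : R => F (x + t *: e + s *: e)) (fun s => s - t)).
Qed.

Definition fdiff (t : R) (e : 'rV[R]_d) F x : R := F (x + t *: e) - F x.

Lemma iter_fdiff_derive t e k F G : (forall x, is_derive x e F (G x)) ->
  forall x, is_derive x e (iter k (fdiff t e) F) (iter k (fdiff t e) G x).
Proof.
elim: k F G => //= k IH F G FG x.
rewrite (_ : fdiff t e _ = (fun y => iter k (fdiff t e) F (y + t *: e)) - iter k (fdiff t e) F)//.
rewrite [X in is_derive _ _ _ X](_ : _ = iter k (fdiff t e) G (x + t *: e) - iter k (fdiff t e) G x)//.
have H1 := is_derive_shift (IH _ _ FG (x + t *: e)).
exact: (@is_deriveB _ _ _ _ _ _ _ _ _ H1 (IH _ _ FG x)).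
Qed.

Lemma fdiff_bound t e F G (M : R) : (forall x, is_derive x e F (G x)) ->
  (forall x, `|G x| <= M) -> forall x, `|fdiff t e F x| <= `|t| * M.
Proof.
move=> FG GM x.
rewrite mulrC -[`|t|]expr1 /fdiff.
have := @mvt_pow R (fun s => F (x + s *: e) - F x) (fun s => G (x + s *: e)) M 0; apply.
- move=> s; rewrite (_ : (fun _ => _) = (fun s => F (x + s *: e)) - cst (F x))//.
  by rewrite -[G _]subr0; apply: is_deriveB; exact: is_derive_along.
- by rewrite scale0r addr0 subrr.
- by move=> s; rewrite expr0 mulr1.
Qed.

(** The mean value theorem, applied k times along the direction e. *)
Lemma iter_fdiff_bound t e (G : nat -> 'rV[R]_d -> R) k (M : R) :
  (forall j x, is_derive x e (G j) (G j.+1 x)) ->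
  forall j, (forall x, `|G (k + j)%N x| <= M) ->
  forall x, `|iter k (fdiff t e) (G j) x| <= `|t| ^+ k * M.
Proof.
move=> dG; elim: k => [|k IH] j GM x; first by rewrite expr0 mul1r; exact: GM.
rewrite iterS exprS -mulrA.
apply: (@fdiff_bound t e _ (iter k (fdiff t e) (G j.+1))).
  by apply: iter_fdiff_derive; exact: dG.
by apply: IH => y; rewrite addnS.
Qed.

(** Each difference enlarges the support by the length of the step, which is at most one. *)
Lemma iter_fdiff_supp t e k F : `|t *: e| <= 1 -> (forall x, 1 < `|x| -> F x = 0) ->
  forall x, k.+1%:R < `|x| -> iter k (fdiff t e) F x = 0.
Proof.
move=> te F0; elim: k => [|k IH] x xk; first exact: F0.
rewrite iterS /fdiff !IH ?subrr//; first by rewrite (lt_trans _ xk)// ltr_nat.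
have := ler_normB (x + t *: e) (t *: e); rewrite addrK.
by rewrite -natr1 in xk; move=> H; lra.
Qed.

Lemma iter_fdiff_measurable t e k F : measurable_fun setT F ->
  measurable_fun setT (iter k (fdiff t e) F).
Proof.
move=> mF; elim: k => //= k IH; apply: measurable_funB => //.
apply: (measurableT_comp IH).
by under eq_fun do rewrite -[X in X + _]scale1r; exact: measurable_rV_affine.
Qed.

Lemma norm_delta (i : 'I_d) : `|delta_mx ord0 i : 'rV[R]_d| <= 1.
Proof.
rewrite [leLHS]mx_normrE; apply/bigmax_leP; split => // -[a b] _ /=.
by rewrite mxE; case: (_ && _); rewrite ?normr1 ?normr0.
Qed.

End directional.

Section smooth_compact.
Context {R : realType} {d : nat}.
Implicit Types (x v e : 'rV[R]_d) (F G f : 'rV[R]_d -> R).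

Lemma smooth_is_derive f s i x : smooth f ->
  is_derive x (delta_mx ord0 i) (partials s f) (partials (i :: s) f x).
Proof. by move=> sf; have [_ /(_ x i)] := sf s; move/derivableP. Qed.

Lemma partials_supp f r s : (forall x, r < `|x| -> f x = 0) ->
  forall x, r < `|x| -> partials s f x = 0.
Proof.
move=> f0; elim: s => //= i s IH x rx.
have : \forall y \near x, cst 0 y = partials s f y.
  have op : open [set y : 'rV[R]_d | r < `|y|].
    rewrite (_ : [set _ | _] = (fun y : 'rV[R]_d => `|y|) @^-1` [set t | r < t])//.
    by apply: open_comp; [move=> y _; exact: norm_continuous|exact: open_gt].
  have : nbhs x [set y | r < `|y|] by apply: open_nbhs_nbhs; split.
  by apply: filterS => y /= /IH ->.
move=> /near_eq_derive <-.
  by rewrite derive_cst.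
Qed.

Lemma box_compact (r : R) : compact [set x : 'rV[R]_d | `|x| <= r].
Proof.
have [r0|r0] := ltP r 0.
  rewrite (_ : [set _ | _] = set0); first exact: compact0.
  by apply/seteqP; split => // x /=; rewrite leNgt (lt_le_trans r0).
rewrite (_ : [set _ | _] = [set x : 'rV[R]_d | forall i, `[-r, r]%classic (x ord0 i)]).
  by apply: (@rV_compact R d (fun=> `[-r, r]%classic)) => i; exact: segment_compact.
apply/seteqP; split=> x /= xr.
  by move=> i; rewrite in_itv /= -ler_norml (le_trans (coord_le_norm x i)).
rewrite [leLHS]mx_normrE; apply/bigmax_leP; split => // -[a b] _ /=.
by rewrite ord1 ler_norml; have := xr b; rewrite in_itv.
Qed.

Lemma continuous_supp_bounded f r : continuous f -> (forall x, r < `|x| -> f x = 0) ->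
  exists2 M, 0 <= M & forall x, `|f x| <= M.
Proof.
move=> cf f0.
have := compact_bounded (continuous_compact (continuous_subspaceT cf) (@box_compact r)).
move=> [M [_ HM]]; exists (`|M| + 1) => // x.
have [xr|rx] := leP `|x| r; last by rewrite f0 ?normr0.
by apply: HM; [rewrite ltr_pwDr// ler_norm|exists x].
Qed.

(** A partial derivative of a function supported in a ball is continuous and supported in
    the same ball, hence bounded even after multiplication by a power of the norm. *)
Lemma smooth_supp_schwartz f r : smooth f -> (forall x, r < `|x| -> f x = 0) ->
  schwartz_real f.
Proof.
move=> sf f0; split => // k s.
have [M M0 HM] := continuous_supp_bounded (sf s).1 (@partials_supp f r s f0).
exists ((d%:R * `|r|) ^+ k * M) => x.
have [xr|rx] := leP `|x| r; last first.
  by rewrite (@partials_supp f r s f0 _ rx) normr0 mulr0 mulr_ge0// exprn_ge0// mulr_ge0.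
rewrite ler_pM ?exprn_ge0 ?enorm_ge0// lerXn2r ?nnegrE ?enorm_ge0 ?mulr_ge0//.
by rewrite (le_trans (enorm_le_norm x))// ler_wpM2l// (le_trans xr)// ler_norm.
Qed.

End smooth_compact.

Section fourier_decay.
Context {R : realType} {d : nat}.
Local Notation lambda := (lebesgue_rV R d).
Implicit Types (x v e xi : 'rV[R]_d) (f : 'rV[R]_d -> R).

(** The real and the imaginary part of the Fourier transform of a real function are values
    of this integral, for th = 0 and th = - pi / 2 at the opposite frequency. The phase th
    allows both to be treated at once with real integrals only. *)
Definition cosint f xi (th : R) := \int[lambda]_x (f x * cos (2 * pi * dotr x xi + th)).

Lemma measurable_wave xi (th : R) : measurable_fun setT (fun x => cos (2 * pi * dotr x xi + th)).
Proof.
apply: (measurableT_comp (continuous_measurable_fun (@continuous_cos R))).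
apply: measurable_funD => //; apply: measurable_funM => //; exact: measurable_dotr.
Qed.

Lemma abs_cos_le1 (t : R) : `|cos t| <= 1.
Proof. by rewrite ler_norml cos_geN1 cos_le1. Qed.

Definition bsupp f (M r : R) :=
  [/\ measurable_fun setT f, forall x, `|f x| <= M & forall x, r < `|x| -> f x = 0].

Lemma box_normE (r : R) : 0 <= r -> [set x : 'rV[R]_d | forall i, `[- r, r]%classic (x ord0 i)] = [set x | `|x| <= r].
Proof.
move=> r0; apply/seteqP; split=> x /= xr.
  rewrite [leLHS]mx_normrE; apply/bigmax_leP; split => // -[a b] _ /=.
  by rewrite ord1 ler_norml; have := xr b; rewrite in_itv.
by move=> i; rewrite in_itv /= -ler_norml (le_trans (coord_le_norm x i)).
Qed.

Lemma measurable_normbox (r : R) : 0 <= r -> measurable [set x : 'rV[R]_d | `|x| <= r].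
Proof. by move=> r0; rewrite -box_normE//; exact: measurable_box. Qed.

Lemma lebesgue_normbox (r : R) : 0 < r -> lambda [set x : 'rV[R]_d | `|x| <= r] = ((2 * r) ^+ d)%:E.
Proof. by move=> r0; rewrite -box_normE ?ltW// lebesgue_rV_box. Qed.

Lemma normbox_lty (r : R) : 0 < r -> (lambda [set x : 'rV[R]_d | (`|x| <= r)%R] < +oo)%E.
Proof. by move=> r0; rewrite lebesgue_normbox// ltry. Qed.

Lemma bsupp_integrable f M r : 0 < r -> bsupp f M r -> lambda.-integrable setT (EFin \o f).
Proof.
move=> r0 [mf fM f0]; pose B := [set x : 'rV[R]_d | `|x| <= r].
have mB : measurable B by apply: measurable_normbox; exact: ltW.
have iB : lambda.-integrable setT (EFin \o (fun x => M * \1_B x)).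
  under [X in _.-integrable _ X]eq_fun do rewrite /= EFinM.
  apply: integrableZl => //; apply: indic_integrable => //.
  exact: normbox_lty.
apply: (le_integrable measurableT _ _ iB); first exact/measurable_EFinP.
move=> x _; rewrite !abse_EFin lee_fin indicE.
case: (boolP (x \in B)) => [xB|]; first by rewrite mulr1 (le_trans (fM x))// ler_norm.
by rewrite notin_setE /B /= => /negP; rewrite -ltNge => /f0 ->; rewrite normr0 mulr0 normr0.
Qed.

Lemma bsupp_Rintegral_le f M r : 0 < r -> bsupp f M r ->
  `|\int[lambda]_x f x| <= M * (2 * r) ^+ d.
Proof.
move=> r0 bf; have [mf fM f0] := bf; pose B := [set x : 'rV[R]_d | `|x| <= r].
have M0 : 0 <= M := le_trans (normr_ge0 _) (fM 0).
have mB : measurable B by apply: measurable_normbox; exact: ltW.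
have i1 : lambda.-integrable setT (EFin \o \1_B).
  by apply: indic_integrable => //; exact: normbox_lty.
have iB : lambda.-integrable setT (EFin \o (fun x => M * \1_B x)).
  under [X in _.-integrable _ X]eq_fun do rewrite /= EFinM.
  exact: integrableZl.
have fi := bsupp_integrable r0 bf.
apply: (le_trans (le_normr_Rintegral measurableT fi)).
have -> : M * (2 * r) ^+ d = \int[lambda]_x (M * \1_B x).
  rewrite RintegralZl// /Rintegral integral_indic// setIT; congr (M * _).
  by apply: EFin_inj; rewrite fineK ?ge0_fin_numE ?normbox_lty// -lebesgue_normbox.
apply: le_Rintegral => //; first exact: (integrable_abse fi).
move=> x _; rewrite indicE.
case: (boolP (x \in B)) => [xB|]; first by rewrite mulr1.
by rewrite notin_setE /B /= => /negP; rewrite -ltNge => /f0 ->; rewrite normr0 mulr0.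
Qed.

Lemma bsupp_wave f M r xi th : bsupp f M r ->
  bsupp (fun x => f x * cos (2 * pi * dotr x xi + th)) M r.
Proof.
move=> [mf fM f0]; split.
- by apply: measurable_funM => //; exact: measurable_wave.
- by move=> x; rewrite normrM (le_trans _ (fM x))// ler_piMr// abs_cos_le1.
- by move=> x /f0 ->; rewrite mul0r.
Qed.

Lemma cosint_le f M r xi th : 0 < r -> bsupp f M r -> `|cosint f xi th| <= M * (2 * r) ^+ d.
Proof. by move=> r0 bf; apply: bsupp_Rintegral_le => //; exact: bsupp_wave. Qed.

(** Translating x by half a wavelength along the i-th axis changes the sign of the wave.
    Averaging the integral with its translate therefore replaces f by a difference, whose
    step decreases with the frequency: this takes the place of an integration by parts. *)
Lemma cosint_fdiff f M r xi th i : 0 < r -> bsupp f M r -> xi ord0 i != 0 ->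
  2 * cosint f xi th = - cosint (fdiff (2 * xi ord0 i)^-1 (delta_mx ord0 i) f) xi th.
Proof.
move=> r0 bf xi0; have [mf fM f0] := bf.
set t := (2 * xi ord0 i)^-1; set e := delta_mx ord0 i.
(* half a wavelength *)
have dot x : dotr (x + t *: e) xi = dotr x xi + 2^-1.
  rewrite /dotr -(_ : \sum_j (t *: e) ord0 j * xi ord0 j = 2^-1).
    by rewrite -big_split /=; apply: eq_bigr => j _; rewrite mxE mulrDl.
  rewrite (bigD1 i)//= big1 ?addr0; last first.
    by move=> j ji; rewrite !mxE eqxx (negbTE ji) mulr0 mul0r.
  by rewrite !mxE !eqxx mulr1 /t; field.
have wav x : cos (2 * pi * dotr (x + t *: e) xi + th) = - cos (2 * pi * dotr x xi + th).
  rewrite dot mulrDr addrAC (_ : 2 * pi * 2^-1 = pi); last by field.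
  exact: cosDpi.
have bf' : bsupp (fun x => f (x + t *: e)) M (r + `|t *: e|).
  split.
  - apply: (measurableT_comp mf).
    by under eq_fun do rewrite -[X in X + _]scale1r; exact: measurable_rV_affine.
  - by move=> x; exact: fM.
  - move=> x rx; apply: f0; rewrite -(ltrD2r `|t *: e|); apply: (lt_le_trans rx).
    by have := ler_normB (x + t *: e) (t *: e); rewrite addrK.
have r0' : 0 < r + `|t *: e| by rewrite ltr_pwDl.
have i1 := bsupp_integrable r0' (bsupp_wave xi th bf').
have i2 := bsupp_integrable r0 (bsupp_wave xi th bf).
have -> : cosint (fdiff t e f) xi th = cosint (fun x => f (x + t *: e)) xi th - cosint f xi th.
  rewrite /cosint -(RintegralB measurableT i1 i2); apply: eq_Rintegral => x _.
  by rewrite /fdiff mulrBl.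
have -> : cosint f xi th = - cosint (fun x => f (x + t *: e)) xi th.
  have := @Rintegral_rV_affine R d 1 (t *: e) _ ltr01 (measurable_funM mf (measurable_wave xi th)).
  rewrite expr1n invr1 mul1r => E1; rewrite {1}/cosint -[LHS]E1.
  rewrite /cosint -[RHS]mulN1r -RintegralZl//; apply: eq_Rintegral => x _.
  by rewrite /= scale1r wav mulrN mulN1r.
ring.
Qed.

Lemma bsupp_fdiff f M r t e : bsupp f M r -> bsupp (fdiff t e f) (M + M) (r + `|t *: e|).
Proof.
move=> [mf fM f0]; split.
- exact: (iter_fdiff_measurable t e 1).
- by move=> x; rewrite (le_trans (ler_normB _ _))// lerD.
- move=> x rx; rewrite /fdiff !f0 ?subrr//; first by rewrite (le_lt_trans _ rx)// lerDl.
  rewrite -(ltrD2r `|t *: e|); apply: (lt_le_trans rx).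
  by have := ler_normB (x + t *: e) (t *: e); rewrite addrK.
Qed.

Lemma cosint_iter_fdiff k f M r xi th i : 0 < r -> bsupp f M r -> xi ord0 i != 0 ->
  2 ^+ k * `|cosint f xi th| = `|cosint (iter k (fdiff (2 * xi ord0 i)^-1 (delta_mx ord0 i)) f) xi th|.
Proof.
move=> + + xi0; elim: k f M r => [|k IH] f M r r0 bf; first by rewrite expr0 mul1r.
rewrite iterSr -(IH _ _ _ _ (bsupp_fdiff (2 * xi ord0 i)^-1 (delta_mx ord0 i) bf)); last by rewrite ltr_pwDl.
rewrite exprSr -mulrA; congr (_ * _).
by rewrite -[in RHS]normrN -(cosint_fdiff th r0 bf xi0) normrM (@ger0_norm _ 2).
Qed.

(** Iterating cosint_fdiff k times along the axis on which xi is largest expresses the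
    transform of f by that of a k-th difference with step of order 1 / |xi|, and such a
    difference is of order |xi|^-k. At frequencies of norm at most 1/2 the step may be long
    and the integral is bounded directly. *)
Lemma fourier_decay f k : smooth f -> (forall x, 1 < `|x| -> f x = 0) ->
  exists2 C, 0 <= C & forall xi th, `|cosint f xi th| * `|xi| ^+ k <= C.
Proof.
move=> sf f0.
have [M M0 HM] := continuous_supp_bounded (sf [::]).1 f0.
have Hi (i : 'I_d) : exists M, forall x, `|partials (nseq k i) f x| <= M.
  have [M' _ H] := continuous_supp_bounded (sf (nseq k i)).1 (@partials_supp _ _ f 1 (nseq k i) f0).
  by exists M'.
pose Mi i := sval (cid (Hi i)).
have HMi i x : `|partials (nseq k i) f x| <= Mi i by rewrite /Mi; case: cid.
have Mi0 i : 0 <= Mi i := le_trans (normr_ge0 _) (HMi i 0).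
pose N := \sum_i Mi i.
have N0 : 0 <= N by apply: sumr_ge0.
have MiN i : Mi i <= N by rewrite /N (bigD1 i)//= lerDl sumr_ge0.
have mf : measurable_fun setT f by apply: continuous_rV_measurable; exact: (sf [::]).1.
have bf : bsupp f M 1 by split.
exists (M * 2 ^+ d + N * (2 * k.+1%:R) ^+ d).
  by rewrite addr_ge0// mulr_ge0// exprn_ge0// mulr_ge0.
move=> xi th.
have [xi1|xi1] := leP `|xi| (1 / 2).
  apply: (@le_trans _ _ (M * 2 ^+ d)); last by rewrite lerDl mulr_ge0// exprn_ge0// mulr_ge0.
  have := cosint_le xi th ltr01 bf; rewrite mulr1; apply: le_trans.
  by rewrite ler_piMr// exprn_ile1//; lra.
apply: (@le_trans _ _ (N * (2 * k.+1%:R) ^+ d)); last by rewrite lerDr mulr_ge0// exprn_ge0.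
have xin : `|xi| != 0 by rewrite gt_eqF//; lra.
have [[a i] E] := mx_norm_neq0 xin.
have {}E : `|xi| = `|xi ord0 i| by rewrite -[LHS]/(mx_norm xi) E ord1.
have xi0 : xi ord0 i != 0 by rewrite -normr_gt0 -E; lra.
have t1 : `|(2 * xi ord0 i)^-1| = (2 * `|xi|)^-1 by rewrite normfV normrM (@ger0_norm _ 2)// E.
rewrite mulrC -(ler_pM2l (exprn_gt0 k (ltr0Sn R 1))) mulrCA (cosint_iter_fdiff k th ltr01 bf xi0).
have -> : 2 ^+ k * (N * (2 * k.+1%:R) ^+ d) = `|xi| ^+ k * (`|(2 * xi ord0 i)^-1| ^+ k * (2 ^+ k * 2 ^+ k) * (N * (2 * k.+1%:R) ^+ d)).
  rewrite [RHS]mulrA; congr (_ * _).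
  by rewrite -!exprMn; congr (_ ^+ k); rewrite t1; field.
rewrite ler_wpM2l ?exprn_ge0//.
apply: le_trans (_ : (`|(2 * xi ord0 i)^-1| ^+ k * N) * (2 * k.+1%:R) ^+ d <= _); last first.
  rewrite -!mulrA ler_wpM2l ?exprn_ge0// [leLHS](_ : _ = 1 * (N * (2 * k.+1%:R) ^+ d)) ?mul1r// ?mulrA ler_wpM2r ?exprn_ge0// -?mulrA.
  by rewrite mulrA ler_peMl// -exprMn exprn_ege1//; lra.
apply: cosint_le => //; split.
- exact: iter_fdiff_measurable.
- move=> x; apply: le_trans (_ : `|(2 * xi ord0 i)^-1| ^+ k * Mi i <= _); last by rewrite ler_wpM2l ?exprn_ge0.
  apply: (@iter_fdiff_bound _ _ _ _ (fun j => partials (nseq j i) f) k (Mi i) _ 0) => [j y|y].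
    exact: smooth_is_derive.
  by rewrite addn0.
- apply: iter_fdiff_supp => //.
  rewrite normrZ t1; apply: (@le_trans _ _ (1 * 1)); last by rewrite mulr1.
  rewrite ler_pM ?invr_ge0 ?mulr_ge0// ?norm_delta// invf_le1; lra.
Qed.

End fourier_decay.

(** * Smooth approximations of the indicator function of the unit ball *)

Section bump.
Context {R : realType}.

(** The derivatives of expR (- y^-1) on the positive half-line are linear combinations of
    these functions, extended by 0. *)
Definition theta (k : nat) (y : R) : R := if 0 < y then y^-1 ^+ k * expR (- y^-1) else 0.

Lemma theta_ge0 k y : 0 <= theta k y.
Proof. by rewrite /theta; case: ifP => // y0; rewrite mulr_ge0 ?expR_ge0// exprn_ge0// invr_ge0 ltW. Qed.

(** Since e^(1/y) exceeds each term of its power series, theta k vanishes to second order at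
    0, hence is differentiable there with derivative 0. *)
Lemma theta_le_sqr k y : theta k y <= (k.+2)`!%:R * y ^+ 2.
Proof.
rewrite /theta; case: ifP => [y0|_]; last by rewrite mulr_ge0 ?sqr_ge0.
have yi : 0 < y^-1 by rewrite invr_gt0.
have := expR_ge1Dxn k.+1 (ltW yi).
have k0 : 0 < (k.+2)`!%:R :> R by rewrite ltr0n fact_gt0.
move=> H; have {}H : y^-1 ^+ k.+2 <= (k.+2)`!%:R * expR y^-1.
  by rewrite mulrC -ler_pdivrMr//; apply: le_trans H; rewrite lerDr.
rewrite expRN ler_pdivrMr ?expR_gt0//.
rewrite (_ : y^-1 ^+ k = y ^+ 2 * y^-1 ^+ k.+2); last first.
  by rewrite -[k.+2]addn2 exprD !expr2 (mulrC (_ ^+ k)) mulrA mulrACA divff ?gt_eqF// !mul1r.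
rewrite [leRHS](_ : _ = y ^+ 2 * ((k.+2)`!%:R * expR y^-1)); last by ring.
by rewrite ler_pM2l ?exprn_gt0.
Qed.

Lemma is_derive_theta k (y : R) :
  is_derive y (1 : R) (theta k) (theta k.+2 y - k%:R * theta k.+1 y).
Proof.
have [y0|y0|->] := ltgtP y 0.
- have -> : theta k.+2 y - k%:R * theta k.+1 y = 0.
    by rewrite /theta ltNge (ltW y0) mulr0 subrr.
  apply: near_eq_is_derive (@is_derive_cst R R R (0 : R) y 1).
  by apply: filterS (lt_nbhsl y0) => z z0; rewrite /theta ltNge (ltW z0).
- have -> : theta k.+2 y - k%:R * theta k.+1 y = y^-1 ^+ k * (expR (- y^-1) * (y ^- 2))
       + expR (- y^-1) * (- k%:R * y^-1 ^+ k.+1).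
    rewrite /theta y0 -addn2 exprD -exprVn; ring.
  apply: (@near_eq_is_derive _ _ _ ((fun z => z^-1 ^+ k) * (fun z => expR (- z^-1)))).
    by apply: filterS (lt_nbhsr y0) => z z0; rewrite /theta z0.
  have yn : y != 0 by rewrite gt_eqF.
  have dV : is_derive y (1 : R) (fun z : R => z^-1) (- y ^- 2).
    have := @is_deriveV R id y 1 1 yn (is_derive_id _ _).
    by rewrite /GRing.scale /= mulr1.
  have dN : is_derive y (1 : R) (fun z : R => - z^-1) (y ^- 2).
    by have := @is_deriveN _ _ _ _ _ _ _ dV; rewrite opprK.
  have dE := @is_derive1_comp _ expR (fun z : R => - z^-1) y _ _ (is_derive_expR _) dN.
  apply: is_deriveM.
  rewrite (_ : - k%:R * y^-1 ^+ k.+1 = (k%:R * y^-1 ^+ k.-1) *: (- y ^- 2)).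
    rewrite (_ : (fun z : R => z^-1 ^+ k) = (fun z : R => z^-1) ^+ k); last first.
      by apply/funext => z; elim: k => [|k IH]; rewrite ?expr0// !exprS IH.
    exact: is_deriveX.
  case: k => [|k]; first by rewrite !mul0r oppr0 mul0r scale0r.
  rewrite /GRing.scale /= -exprVn -addn2 exprD; ring.
have -> : theta k.+2 0 - k%:R * theta k.+1 0 = 0 by rewrite /theta ltxx mulr0 subrr.
have K : (fun h : R => h^-1 *: ((theta k \o shift 0) (h *: (1 : R)) - theta k 0)) @ 0^' --> (0 : R).
  apply/cvgrPdist_le => e e0.
  have F0 : 0 < (k.+2)`!%:R :> R by rewrite ltr0n fact_gt0.
  near=> h.
  have h0 : h != 0 by near: h; exact: nbhs_dnbhs_neq.
  rewrite sub0r normrN /= addr0 /GRing.scale /= mulr1 {2}/theta ltxx subr0 normrM.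
  rewrite (ger0_norm (theta_ge0 _ _)) normfV mulrC ler_pdivrMr ?normr_gt0//.
  apply: (le_trans (theta_le_sqr k h)).
  rewrite -real_normK ?num_real// expr2 mulrA ler_wpM2r// -ler_pdivlMl//.
  near: h; apply: dnbhs0_le; by rewrite mulr_gt0// invr_gt0.
split; last exact: (cvg_lim _ K).
by apply/cvg_ex; exists 0.
Unshelve. all: by end_near. Qed.

Lemma continuous_theta k : continuous (theta k).
Proof.
move=> y; apply: differentiable_continuous; apply/derivable1_diffP.
by have [] := is_derive_theta k y.
Qed.

End bump.

Section smooth_algebra.
Context {R : realType} {d : nat}.
Implicit Types (x : 'rV[R]_d) (f g : 'rV[R]_d -> R).

(** An algebra of continuous functions closed under partial derivatives consists of smooth
    functions; this is the smallest one that contains the bump theta 0 (1 - |x|^2). *)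
Inductive bump_alg : ('rV[R]_d -> R) -> Prop :=
| bump_cst a : bump_alg (fun=> a)
| bump_coord i : bump_alg (fun x => x ord0 i)
| bump_theta k : bump_alg (fun x => theta k (1 - dotr x x))
| bump_add f g : bump_alg f -> bump_alg g -> bump_alg (fun x => f x + g x)
| bump_mul f g : bump_alg f -> bump_alg g -> bump_alg (fun x => f x * g x).

Lemma bump_continuous f : bump_alg f -> continuous f.
Proof.
elim=> {f} [a|i|k|f g _ cf _ cg|f g _ cf _ cg] x.
- exact: cst_continuous.
- exact: coord_continuous.
- apply: (@continuous_comp _ _ _ (fun x => 1 - dotr x x) (theta k)); last exact: continuous_theta.
  apply: continuousB; first exact: cst_continuous.
  apply: continuous_big; first exact: add_continuous.
  by move=> i _ z; apply: continuousM; exact: coord_continuous.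
- by apply: continuousD; [exact: cf|exact: cg].
- by apply: continuousM; [exact: cf|exact: cg].
Qed.

Lemma bump_derive f (i : 'I_d) : bump_alg f ->
  exists2 g, bump_alg g & forall x, is_derive x (delta_mx ord0 i) f (g x).
Proof.
elim=> {f} [a|j|k|f g bf [f' bf' df] bg [g' bg' dg]|f g bf [f' bf' df] bg [g' bg' dg]].
- by exists (fun=> 0); [exact: bump_cst|move=> x; exact: is_derive_cst].
- exists (fun=> (j == i)%:R); first exact: bump_cst.
  move=> x; apply/is_derive_line.
  rewrite (_ : (fun t : R => _) = cst (x ord0 j) + (j == i)%:R \*: id); last first.
    by apply/funext => t; rewrite !mxE eqxx /= mulrC.
  apply: is_derive_eq; by rewrite add0r /GRing.scale /= mulr1.
- exists (fun x => (theta k.+2 (1 - dotr x x) + (- k%:R) * theta k.+1 (1 - dotr x x)) * (- 2 * x ord0 i)).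
    apply: bump_mul; last by apply: bump_mul; [exact: bump_cst|exact: bump_coord].
    apply: bump_add; first exact: bump_theta.
    by apply: bump_mul; [exact: bump_cst|exact: bump_theta].
  move=> x; apply/is_derive_line; rewrite mulNr.
  (* along a coordinate axis the argument of theta is a quadratic polynomial *)
  pose u := fun t : R => 1 - (dotr x x + t * (2 * x ord0 i) + t ^+ 2).
  have Eu (t : R) : 1 - dotr (x + t *: delta_mx ord0 i) (x + t *: delta_mx ord0 i) = u t.
    rewrite /u /dotr; congr (1 - _).
    rewrite (bigD1 i)//= [in RHS](bigD1 i)//= !mxE !eqxx /= mulr1.
    rewrite (eq_bigr (fun j => x ord0 j * x ord0 j)); last first.
      by move=> j ji; rewrite !mxE (negbTE ji) andbF mulr0 addr0.
    ring.
  rewrite (_ : (fun t : R => _) = theta k \o u); last by apply/funext => t; rewrite /= -Eu.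
  have u0 : u 0 = 1 - dotr x x by rewrite /u; congr (1 - _); ring.
  rewrite -u0; apply: is_derive1_comp; first exact: is_derive_theta.
  have d1 := @is_deriveZ _ _ _ _ (2 * x ord0 i) _ _ _ (@is_derive_id R R (0 : R) (1 : R)).
  have d2 := is_deriveD (@is_derive_cst R R R (dotr x x) 0 1) d1.
  have d3 := is_deriveD d2 (is_deriveX 2 (@is_derive_id R R (0 : R) (1 : R))).
  have d4 := is_deriveB (@is_derive_cst R R R (1 : R) 0 1) d3.
  rewrite (_ : - 2 * x ord0 i = 0 - (0 + (2 * x ord0 i) *: (1 : R) + (2%:R * (0 : R) ^+ 1) *: (1 : R))).
    by rewrite (_ : u = cst 1 - (cst (dotr x x) + (2 * x ord0 i) \*: id + id ^+ 2))//;
      apply/funext => t; rewrite /u /= mulrC.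
  by rewrite /GRing.scale /=; ring.
- exists (fun x => f' x + g' x); first exact: bump_add.
  by move=> x; exact: (@is_deriveD _ _ _ _ _ _ _ _ _ (df x) (dg x)).
- exists (fun x => f x * g' x + g x * f' x).
    by apply: bump_add; apply: bump_mul.
  by move=> x; exact: (@is_deriveM _ _ _ _ _ _ _ _ (df x) (dg x)).
Qed.

Lemma bump_smooth f : bump_alg f -> smooth f.
Proof.
move=> bf s; suff bs : bump_alg (partials s f).
  split=> [|x i]; first exact: bump_continuous.
  by have [g _ /(_ x) []] := bump_derive i bs.
elim: s => //= i s IH; have [g bg dg] := bump_derive i IH.
by rewrite (_ : 'D_(_) _ = g)//; apply/funext => x; have [_ ->] := dg x.
Qed.

(** Powers of 1 - theta 0 < 1 tend to 0 inside the ball and are equal to 1 outside, so that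
    these bumps increase with N to the indicator function of the unit ball. *)
Definition unit_bump (N : nat) x : R := 1 - (1 - theta 0 (1 - dotr x x)) ^+ N.

Lemma smooth_bump N : smooth (unit_bump N).
Proof.
apply: bump_smooth; rewrite /unit_bump.
rewrite (_ : (fun x => _) = (fun x => 1 + -1 * (1 - theta 0 (1 - dotr x x)) ^+ N)); last first.
  by apply/funext => x; rewrite mulN1r.
apply: bump_add; first exact: bump_cst.
apply: bump_mul; first exact: bump_cst.
elim: N => [|N IH]; first exact: bump_cst.
rewrite (_ : (fun x => _) = (fun x => (1 + -1 * theta 0 (1 - dotr x x)) * (1 - theta 0 (1 - dotr x x)) ^+ N)); last first.
  by apply/funext => x; rewrite mulN1r exprS.
apply: bump_mul => //; apply: bump_add; first exact: bump_cst.
by apply: bump_mul; [exact: bump_cst|exact: bump_theta].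
Qed.

Lemma theta0_lt1 (y : R) : theta 0 y < 1.
Proof.
rewrite /theta; case: ifP => // y0; rewrite expr0 mul1r -expR0 ltr_expR oppr_lt0 invr_gt0//.
Qed.

Lemma bump_ge0 N x : 0 <= unit_bump N x.
Proof.
by rewrite subr_ge0 exprn_ile1// ?subr_ge0 ?(ltW (theta0_lt1 _))// gerBl theta_ge0.
Qed.

Lemma bump_le1 N x : unit_bump N x <= 1.
Proof. by rewrite gerBl exprn_ge0// subr_ge0 ltW// theta0_lt1. Qed.

Lemma bump_supp N x : 1 <= enorm x -> unit_bump N x = 0.
Proof.
move=> x1; rewrite /unit_bump /theta ifF ?subr0 ?expr1n ?subrr//.
apply/negbTE; rewrite -leNgt subr_le0 -(@sqr_sqrtr _ (dotr x x)) ?dotr_sqr_ge0//.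
by rewrite exprn_ege1.
Qed.

Lemma bump_eball N x : unit_bump N x <= \1_(eball 1) x.
Proof.
rewrite indicE; case: (boolP (x \in eball 1)); first by rewrite bump_le1.
by rewrite notin_setE /eball /= => /negP; rewrite -leNgt => /bump_supp ->.
Qed.

(** On a smaller concentric ball theta 0 (1 - |x|^2) is bounded below by its value at radius
    r, and a single power N serves for all x. *)
Lemma bump_near1 (r e : R) : 0 <= r -> r < 1 -> 0 < e ->
  exists N, forall x, enorm x <= r -> 1 - e <= unit_bump N x.
Proof.
move=> r0 r1 e0; pose q := 1 - theta 0 (1 - r ^+ 2).
have y0 : 0 < 1 - r ^+ 2 by rewrite subr_gt0 exprn_ilt1.
have q1 : `|q| < 1.
  rewrite ger0_norm ?subr_ge0 ?(ltW (theta0_lt1 _))// /q gtrBl /theta y0 expr0 mul1r expR_gt0//.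
have /cvgrPdist_le/(_ _ e0)[N _ HN] := cvg_expr q1.
exists N => x xr; rewrite /unit_bump lerD2l lerN2.
have {}HN := HN N (leqnn N); rewrite sub0r normrN in HN.
apply: le_trans (le_trans (ler_norm _) HN).
rewrite lerXn2r ?nnegrE ?subr_ge0 ?(ltW (theta0_lt1 _))// lerD2l lerN2.
have xr2 : dotr x x <= r ^+ 2.
  by rewrite -(@sqr_sqrtr _ (dotr x x)) ?dotr_sqr_ge0// lerXn2r ?nnegrE ?sqrtr_ge0.
have y1 : 1 - r ^+ 2 <= 1 - dotr x x by rewrite lerD2l lerN2.
rewrite /theta y0 (lt_le_trans y0 y1) !expr0 !mul1r ler_expR lerN2 lef_pV2 ?posrE//.
exact: lt_le_trans y1.
Qed.

End smooth_algebra.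

(** * Power spectra and their domination by dyadic contractions *)

Section power_spectrum.
Context {R : realType} {d : nat}.
Local Notation lambda := (lebesgue_rV R d).
Implicit Types (x xi : 'rV[R]_d) (f : 'rV[R]_d -> R).

Lemma fourierE f xi : fourier (fun x => (f x)%:C%C) xi =
  (cosint f (- xi) 0 +i* cosint f (- xi) (- (pi / 2)))%C.
Proof.
rewrite /fourier /cintegral /cosint; congr (_ +i* _)%C; apply: eq_Rintegral => x _ /=.
  by rewrite mul0r subr0 addr0.
by rewrite mul0r addr0 -cosN opprB addrC cosDpihalf sinN opprK.
Qed.

Definition power f xi : R := csqnorm (fourier (fun x => (f x)%:C%C) xi).

Lemma powerE f xi : power f xi = cosint f (- xi) 0 ^+ 2 + cosint f (- xi) (- (pi / 2)) ^+ 2.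
Proof. by rewrite /power fourierE. Qed.

Lemma power_ge0 f xi : 0 <= power f xi.
Proof. by rewrite powerE addr_ge0// sqr_ge0. Qed.

Lemma cosint_scale f (T : R) xi th : measurable_fun setT f -> 0 < T ->
  cosint (fun x => f (T^-1 *: x)) xi th = T ^+ d * cosint f (T *: xi) th.
Proof.
move=> mf T0; have T1 : 0 < T^-1 by rewrite invr_gt0.
have := @Rintegral_rV_affine R d T^-1 0 _ T1 (measurable_funM mf (measurable_wave (T *: xi) th)).
rewrite exprVn invrK => <-; rewrite /cosint; apply: eq_Rintegral => x _.
rewrite addr0; congr (_ * cos (_ * _ + _)).
by rewrite [RHS]dotrZ [X in _ = _ * X]dotrC dotrZ mulrA mulVf ?gt_eqF// mul1r dotrC.
Qed.

Lemma power_scale f (T : R) xi : measurable_fun setT f -> 0 < T ->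
  power (fun x => f (T^-1 *: x)) xi = T ^+ (d + d) * power f (T *: xi).
Proof.
move=> mf T0; rewrite !powerE !cosint_scale// scalerN !exprMn -mulrDr.
by rewrite -exprM addnn muln2.
Qed.

Lemma power_decay f k : smooth f -> (forall x, 1 < `|x| -> f x = 0) ->
  exists2 C, 0 <= C & forall xi, power f xi * (`|xi| ^+ k) ^+ 2 <= C.
Proof.
move=> sf f0; have [C C0 HC] := fourier_decay k sf f0.
exists (C ^+ 2 + C ^+ 2); first by rewrite addr_ge0// sqr_ge0.
move=> xi; rewrite powerE mulrDl -!exprMn lerD//.
  rewrite -real_normK ?num_real// lerXn2r ?nnegrE//.
  by rewrite normrM [X in _ * X]ger0_norm ?exprn_ge0// -(normrN xi).
rewrite -real_normK ?num_real// lerXn2r ?nnegrE//.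
by rewrite normrM [X in _ * X]ger0_norm ?exprn_ge0// -(normrN xi).
Qed.

Lemma abs_cosB1 (t : R) : `|cos t - 1| <= `|t|.
Proof.
have := @mvt_pow R (fun t => cos t - 1) (fun t => - sin t) 1 0.
move=> H; rewrite -[leRHS]mul1r -[`|t|]expr1; apply: H.
- move=> s; rewrite -[- sin s]subr0.
  exact: (@is_deriveB _ _ _ _ _ _ _ _ _ (is_derive_cos s) (@is_derive_cst R R R (1 : R) s 1)).
- by rewrite cos0 subrr.
- by move=> s; rewrite mul1r expr0 normrN ler_norml sin_geN1 sin_le1.
Qed.

(** Near the zero frequency all the waves are in phase on the support of f: the cosine is at
    least 1/2 there. *)
Lemma power_low f : (forall x, 0 <= f x) -> bsupp f 1 1 -> 0 < \int[lambda]_x f x ->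
  exists2 dl : R, 0 < dl & exists2 c : R, 0 < c & forall xi, `|xi| <= dl -> c <= power f xi.
Proof.
move=> f0 bf If; set I := \int[lambda]_x f x in If.
pose dl : R := (4 * pi * d.+1%:R)^-1.
have p0 : 0 < pi :> R := pi_gt0 R.
have dl0 : 0 < dl by rewrite invr_gt0 !mulr_gt0.
exists dl => //; exists ((I / 2) ^+ 2); first by rewrite exprn_gt0// divr_gt0.
move=> xi xidl; rewrite powerE -[leLHS]addr0 lerD ?sqr_ge0//.
have i1 := bsupp_integrable ltr01 bf.
have i2 := bsupp_integrable ltr01 (bsupp_wave (- xi) 0 bf).
suff H : I / 2 <= cosint f (- xi) 0.
  by rewrite lerXn2r ?nnegrE// ?(le_trans _ H)// ltW// divr_gt0.
rewrite /I mulrC -RintegralZl//; apply: le_Rintegral => //.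
  by under [X in _.-integrable _ X]eq_fun do rewrite /= EFinM; exact: integrableZl.
move=> x _; have [x1|x1] := leP `|x| 1; last by have [_ _ ->] := bf; rewrite ?mulr0 ?mul0r.
rewrite mulrC ler_wpM2l// addr0.
have dx : `|dotr x (- xi)| <= d%:R * dl.
  apply: le_trans (ler_norm_sum _ _ _) _.
  apply: (@le_trans _ _ (\sum_(i < d) dl)); last by rewrite sumr_const card_ord mulr_natl.
  apply: ler_sum => i _; rewrite normrM -[dl]mul1r ler_pM//.
    exact: le_trans (coord_le_norm x i) x1.
  by rewrite (le_trans (coord_le_norm _ i))// normrN.
have : `|2 * pi * dotr x (- xi)| <= 1 / 2.
  have pp : 0 <= 2 * pi :> R by rewrite mulr_ge0// ltW.
  rewrite normrM ger0_norm//.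
  apply: (@le_trans _ _ (2 * pi * (d%:R * dl))); first by rewrite ler_wpM2l.
  have E (a n p : R) : n != 0 -> p != 0 -> 2 * p * (a * (4 * p * n)^-1) = a / n * (1 / 2).
    move=> n0 q0; field.
    by rewrite n0 q0.
  rewrite E ?pnatr_eq0//; last by rewrite gt_eqF.
  by rewrite ler_piMl// ler_pdivrMr// mul1r ler_nat.
move/(le_trans (abs_cosB1 _)); rewrite ler_norml => /andP[+ _]; lra.
Qed.


(** With j the first index such that 2^-j xi is close to 0, the contracted spectrum is
    bounded below by power_low, and T xi is at least of order 2^j, so that power_decay of
    order d + 1 produces the factor 2^(- 2 j (d + 1)). The bound does not depend on T: this
    is what makes dominated convergence possible for a spectral measure about which only its
    action on Schwartz functions is known. *)
Lemma power_dyadic f : smooth f -> (forall x, 0 <= f x) -> bsupp f 1 1 -> 0 < \int[lambda]_x f x ->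
  exists2 C : R, 0 <= C & forall T xi, 1 <= T -> exists j : nat,
    power f (T *: xi) <= C * ((2 ^- j) ^+ d.+1) ^+ 2 * power f (2 ^- j *: xi).
Proof.
move=> sf f0 bf If; have [_ _ f1] := bf.
have [dl dl0 [c c0 Hc]] := power_low f0 bf If.
have [A0 A00 HA0] := power_decay 0 sf f1.
have [A1 A10 HA1] := power_decay d.+1 sf f1.
exists (A0 / c + A1 / c * ((2 / dl) ^+ d.+1) ^+ 2).
  apply: addr_ge0; [|apply: mulr_ge0; last exact: sqr_ge0]; by rewrite divr_ge0// ltW.
move=> T xi T1.
have ex : exists j : nat, `|xi| <= 2 ^+ j * dl.
  exists (Num.bound (`|xi| / dl)); rewrite -ler_pdivrMr// ltW//.
  exact: (upper_nthrootP (leqnn _)).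
case: (ex_minnP ex) => -[|j] Hj jmin.
  exists 0%N; rewrite expr0 invr1 !expr1n mulr1 scale1r.
  rewrite expr0 mul1r in Hj.
  have := HA0 (T *: xi); rewrite !expr0 expr1n mulr1 => /le_trans; apply.
  rewrite mulrDl -[leLHS]addr0 lerD//.
    by rewrite mulrAC ler_pdivlMr// ler_wpM2l// Hc.
  apply: mulr_ge0; last exact: power_ge0.
  by apply: mulr_ge0; [rewrite divr_ge0// ltW|exact: sqr_ge0].
have xij : 2 ^+ j * dl < `|xi| by rewrite ltNge; apply/negP => /jmin; rewrite ltnn.
have a0 : 0 < 2 ^+ j * dl by rewrite mulr_gt0// exprn_gt0.
exists j.+1.
have cj : c <= power f (2 ^- j.+1 *: xi).
  apply: Hc; rewrite normrZ ger0_norm ?invr_ge0 ?exprn_ge0//.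
  by rewrite mulrC ler_pdivrMr ?exprn_gt0// mulrC.
have Tx : 2 ^+ j * dl <= `|T *: xi|.
  rewrite normrZ (ger0_norm (le_trans ler01 T1)) (le_trans (ltW xij))//.
  by rewrite ler_peMl.
have p1 : power f (T *: xi) * ((2 ^+ j * dl) ^+ d.+1) ^+ 2 <= A1.
  apply: le_trans (HA1 (T *: xi)); rewrite ler_wpM2l ?power_ge0//.
  by rewrite !lerXn2r ?nnegrE ?exprn_ge0 ?normr_ge0// ltW.
rewrite -ler_pdivlMr in p1; last by rewrite !exprn_gt0.
apply: (le_trans p1).
have E : ((2 ^+ j * dl) ^+ d.+1) ^- 2 = ((2 / dl) ^+ d.+1) ^+ 2 * ((2 ^- j.+1) ^+ d.+1) ^+ 2 :> R.
  rewrite -!exprMn -!exprVn; congr ((_ ^+ _) ^+ _).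
  rewrite exprS invfM -exprVn; move: (2^-1 ^+ j) => q; field.
  by rewrite gt_eqF.
rewrite E [leRHS]mulrAC !mulrDl -[leLHS]add0r lerD//.
  apply: mulr_ge0; last exact: sqr_ge0.
  by apply: mulr_ge0; [rewrite divr_ge0// ltW|exact: power_ge0].
rewrite mulrA ler_wpM2r ?sqr_ge0// [leRHS]mulrAC ler_wpM2r ?sqr_ge0//.
by rewrite mulrAC ler_pdivlMr// ler_wpM2l.
Qed.

End power_spectrum.

Section smooth_scale.
Context {R : realType} {d : nat}.
Implicit Types (x e : 'rV[R]_d) (f g : 'rV[R]_d -> R).

Lemma is_derive_scale f x e (a df : R) : is_derive (a *: x) e f df ->
  is_derive x e (fun y => f (a *: y)) (a * df).
Proof.
move=> /is_derive_line H; apply/is_derive_line.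
rewrite (_ : (fun t => _) = (fun t : R => f (a *: x + t *: e)) \o (fun t : R => a * t)); last first.
  by apply/funext => t /=; rewrite scalerDr scalerA.
rewrite mulrC; apply: is_derive1_comp; first by rewrite mulr0.
have := @is_deriveZ _ _ _ _ a _ _ _ (@is_derive_id R R (0 : R) (1 : R)).
by rewrite /GRing.scale /= mulr1.
Qed.

Lemma partials_scale f s (a : R) : smooth f ->
  partials s (fun x => f (a *: x)) = (fun x => a ^+ size s * partials s f (a *: x)).
Proof.
move=> sf; elim: s => [|i s IH]; first by apply/funext => x; rewrite mul1r.
apply/funext => x; rewrite [LHS]/= IH.
have H := is_derive_scale (smooth_is_derive s i (a *: x) sf).
have := @is_deriveZ _ _ _ _ (a ^+ size s) _ _ _ H.
by move=> [_]; rewrite exprSr -mulrA.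
Qed.

Lemma smooth_scale f (a : R) : smooth f -> smooth (fun x => f (a *: x)).
Proof.
move=> sf s; rewrite partials_scale//; split.
  move=> x; apply: (@continuousM _ _ (fun=> a ^+ size s) (fun x => partials s f (a *: x))).
    exact: cst_continuous.
  apply: (@continuous_comp _ _ _ (fun x : 'rV[R]_d => a *: x) (partials s f)); last exact: (sf s).1.
  exact: scaler_continuous.
move=> x i.
have H := is_derive_scale (smooth_is_derive s i (a *: x) sf).
by have [] := @is_deriveZ _ _ _ _ (a ^+ size s) _ _ _ H.
Qed.

End smooth_scale.

(** * Variance of smooth linear statistics *)

Lemma sqrB_le (R : realType) (a b A B : R) : 0 <= a -> a <= A -> 0 <= b -> b <= B ->
  (a - b) ^+ 2 <= A ^+ 2 + B ^+ 2.
Proof. by nra. Qed.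

Lemma csqnormE (R : realType) (z : R[i]) : complex.Re (z * z^*%C) = csqnorm z.
Proof. by case: z => a b; rewrite /csqnorm /= mulrN opprK !expr2. Qed.

Lemma rV_set0E (R : realType) d : [set 0] = [set x : 'rV[R]_d | `|x| <= 0].
Proof. by apply/seteqP; split=> x /=; rewrite normr_le0 => /eqP. Qed.

Lemma measurable_rV_set0 (R : realType) d : measurable [set 0 : 'rV[R]_d].
Proof. by rewrite rV_set0E; exact: measurable_normbox. Qed.

Section linear_statistics.
Context {R : realType} {d : nat} {dO : measure_display} {Omega : measurableType dO}.
Variables (P : probability Omega R) (eta : R.-ker Omega ~> 'rV[R]_d).
Local Notation lambda := (lebesgue_rV R d).
Variables (rho : R) (sigma : {measure set 'rV[R]_d -> \bar R}).
Hypotheses (d_gt0 : (0 < d)%N) (rho_gt0 : 0 < rho) (eta_pp : point_process eta)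
  (eta_moments : local_second_moments P eta)
  (sigma_bartlett : bartlett_measure P eta rho sigma)
  (sigma0 : sigma [set 0] = 0%E).

Lemma bounded_eball (T : R) : bounded_set (eball T : set 'rV[R]_d).
Proof.
exists T; split=> [|M TM x /= xT]; first exact: num_real.
by rewrite (le_trans (norm_le_enorm x))// ltW// (lt_trans xT).
Qed.

Lemma eta_eball w (T : R) : eta w (eball T) = (fine (eta w (eball T)))%:E.
Proof.
by have [k ->] := eta_pp w (measurable_eball T) (bounded_eball T).
Qed.

Lemma eta_eball_lty w (T : R) : (eta w (eball T) < +oo)%E.
Proof. by rewrite eta_eball ltry. Qed.

Lemma measurable_count (B : set 'rV[R]_d) : measurable B ->
  measurable_fun setT (fun w => fine (eta w B)).
Proof.
by move=> mB; apply: (@measurableT_comp _ _ _ _ _ _ fine); [exact: fine_measurable|exact: measurable_kernel].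
Qed.

Lemma count_sqr_integrable (T : R) :
  P.-integrable setT (fun w => (fine (eta w (eball T)) ^+ 2)%:E).
Proof.
apply/integrableP; split.
  apply/measurable_EFinP; apply: measurable_funX; exact: measurable_count (measurable_eball T).
apply: le_lt_trans (eta_moments (measurable_eball T) (bounded_eball T)).
rewrite le_eqVlt; apply/orP; left; apply/eqP; apply: eq_integral => w _.
by rewrite [in RHS]eta_eball abse_EFin ger0_norm ?sqr_ge0// -EFin_expe.
Qed.

Variable f : 'rV[R]_d -> R.
Hypotheses (smooth_f : smooth f) (f_ge0 : forall x, 0 <= f x)
  (f_le : forall x, f x <= \1_(eball 1) x).

Let mf : measurable_fun setT f.
Proof. by apply: continuous_rV_measurable; exact: (smooth_f [::]).1. Qed.

Definition dilate (T : R) x := f (T^-1 *: x).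

Lemma measurable_dilate T : measurable_fun setT (dilate T).
Proof.
apply: (measurableT_comp mf).
rewrite (_ : *:%R T^-1 = fun x => T^-1 *: x + 0); first exact: measurable_rV_affine.
by apply/funext => x; rewrite addr0.
Qed.

Lemma dilate_ge0 T x : 0 <= dilate T x.
Proof. exact: f_ge0. Qed.

Lemma dilate_le T x : 0 < T -> dilate T x <= \1_(eball T) x.
Proof.
move=> T0; apply: (le_trans (f_le _)); rewrite !indicE ler_nat.
rewrite (_ : (_ \in eball 1) = (x \in eball T)) ?leqnn//.
have [] := eballZ 1 x T0; rewrite mulr1 => H1 H2.
by apply/idP/idP; rewrite !inE.
Qed.

Lemma f_bsupp : bsupp f 1 1.
Proof.
split=> // x.
  rewrite ger0_norm// (le_trans (f_le _))// indicE; by case: (_ \in _).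
move=> x1; apply/eqP; rewrite eq_le f_ge0 andbT (le_trans (f_le _))// indicE memNset// /eball /= => xe.
by have := lt_le_trans (lt_trans x1 (le_lt_trans (norm_le_enorm x) xe)) (lexx 1); rewrite ltxx.
Qed.

Definition lin T w : R := \int[eta w]_x dilate T x.

Lemma lin_integrable T w : 0 < T -> (eta w).-integrable setT (EFin \o dilate T).
Proof.
move=> T0; apply: (le_integrable measurableT _ _ (indic_integrable (measurable_eball T) (eta_eball_lty w T))).
  by apply/measurable_EFinP; exact: measurable_dilate.
by move=> x _; rewrite !abse_EFin lee_fin !ger0_norm ?dilate_ge0// dilate_le.
Qed.

Lemma lin_le T w (c : R) A : 0 < T -> measurable A -> (eta w A < +oo)%E ->
  (forall x, dilate T x <= c * \1_A x) -> lin T w <= c * fine (eta w A).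
Proof.
move=> T0 mA Aoo H.
have -> : c * fine (eta w A) = \int[eta w]_x (c * \1_A x).
  rewrite RintegralZl//; first by rewrite /Rintegral integral_indic// setIT.
  exact: indic_integrable.
apply: le_Rintegral => //; first exact: lin_integrable.
under [X in _.-integrable _ X]eq_fun do rewrite /= EFinM.
by apply: integrableZl => //; exact: indic_integrable.
Qed.

Lemma lin_ge T w (c : R) A : 0 < T -> measurable A -> (eta w A < +oo)%E ->
  (forall x, c * \1_A x <= dilate T x) -> c * fine (eta w A) <= lin T w.
Proof.
move=> T0 mA Aoo H.
have -> : c * fine (eta w A) = \int[eta w]_x (c * \1_A x).
  rewrite RintegralZl//; first by rewrite /Rintegral integral_indic// setIT.
  exact: indic_integrable.
apply: le_Rintegral => //; last exact: lin_integrable.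
under [X in _.-integrable _ X]eq_fun do rewrite /= EFinM.
by apply: integrableZl => //; exact: indic_integrable.
Qed.

Lemma lin_ge0 T w : 0 <= lin T w.
Proof. by apply: Rintegral_ge0 => x _; exact: dilate_ge0. Qed.

Lemma measurable_lin T : measurable_fun setT (lin T).
Proof.
apply: (@measurableT_comp _ _ _ _ _ _ fine); first exact: fine_measurable.
apply: measurable_fun_integral_kernel.
- by move=> U mU; exact: measurable_kernel.
- by move=> z; rewrite lee_fin dilate_ge0.
- by apply/measurable_EFinP; exact: measurable_dilate.
Qed.

Definition cent T w : R := lin T w - rho * \int[lambda]_x dilate T x.

Lemma measurable_cent T : measurable_fun setT (cent T).
Proof. by apply: measurable_funB => //; exact: measurable_lin. Qed.

Lemma int_dilate T : 0 < T -> \int[lambda]_x dilate T x = T ^+ d * \int[lambda]_x f x.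
Proof.
move=> T0; have T1 : 0 < T^-1 by rewrite invr_gt0.
have := @Rintegral_rV_affine R d T^-1 0 _ T1 mf.
rewrite exprVn invrK => <-; apply: eq_Rintegral => x _.
by rewrite addr0.
Qed.

Lemma int_f_le : \int[lambda]_x f x <= fine (lambda (eball 1)).
Proof.
rewrite -[leRHS](_ : \int[lambda]_x \1_(eball 1) x = _); last first.
  by rewrite /Rintegral integral_indic ?setIT//; exact: measurable_eball.
apply: le_Rintegral => //; first exact: bsupp_integrable f_bsupp.
by apply: indic_integrable; [exact: measurable_eball|exact: lebesgue_rV_eball_lty].
Qed.

Lemma int_f_ge0 : 0 <= \int[lambda]_x f x.
Proof. exact: Rintegral_ge0. Qed.

Lemma cent_sqr_le T w : 0 < T -> T <= 1 ->
  cent T w ^+ 2 <= fine (eta w (eball 1)) ^+ 2 + (rho * fine (lambda (eball 1))) ^+ 2.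
Proof.
move=> T0 T1; rewrite /cent int_dilate//.
have a0 := lin_ge0 T w.
have a1 : lin T w <= fine (eta w (eball 1)).
  rewrite -[leRHS]mul1r; apply: lin_le => //; [exact: measurable_eball|exact: eta_eball_lty|].
  move=> x; rewrite mul1r (le_trans (dilate_le _ T0))// !indicE ler_nat.
  case: (boolP (x \in eball T)) => // xT; rewrite mem_set//.
  by move: xT; rewrite inE /eball /= => /lt_le_trans; apply.
have Td : 0 <= T ^+ d <= 1 by rewrite exprn_ge0 ?exprn_ile1// ltW.
have b0 : 0 <= rho * (T ^+ d * \int[lambda]_x f x).
  by rewrite mulr_ge0 ?mulr_ge0 ?int_f_ge0 ?exprn_ge0// ltW.
have b1 : rho * (T ^+ d * \int[lambda]_x f x) <= rho * fine (lambda (eball 1)).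
  by rewrite ler_wpM2l ?(ltW rho_gt0)// -[leRHS]mul1r ler_pM ?int_f_ge0 ?int_f_le//; case/andP: Td.
exact: sqrB_le.
Qed.

Lemma cent_sqr_le' T w : 0 < T ->
  cent T w ^+ 2 <= fine (eta w (eball T)) ^+ 2 + (rho * \int[lambda]_x dilate T x) ^+ 2.
Proof.
move=> T0; rewrite /cent.
have a0 := lin_ge0 T w.
have a1 : lin T w <= fine (eta w (eball T)).
  rewrite -[leRHS]mul1r; apply: lin_le => //; [exact: measurable_eball|exact: eta_eball_lty|].
  by move=> x; rewrite mul1r dilate_le.
have b0 : 0 <= rho * \int[lambda]_x dilate T x.
  by rewrite mulr_ge0 ?(ltW rho_gt0)//; apply: Rintegral_ge0 => x _; exact: dilate_ge0.
exact: sqrB_le.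
Qed.

Lemma cent_sqr_integrable T : 0 < T -> P.-integrable setT (EFin \o (fun w => cent T w ^+ 2)).
Proof.
move=> T0; pose c := (rho * \int[lambda]_x dilate T x) ^+ 2.
have i1 := integrableD measurableT (count_sqr_integrable T) (prob_cst_integrable P c).
apply: (le_integrable measurableT _ _ i1).
  by apply/measurable_EFinP; apply: measurable_funX; exact: measurable_cent.
move=> w _; rewrite -EFinD !abse_EFin lee_fin !ger0_norm ?sqr_ge0 ?addr_ge0 ?sqr_ge0//.
exact: cent_sqr_le'.
Qed.

Lemma schwartz_dilate T : 0 < T -> schwartz (fun x => (dilate T x)%:C%C).
Proof.
move=> T0; split => /=.
  apply: (@smooth_supp_schwartz _ _ _ T); first exact: smooth_scale.
  move=> x Tx; apply/eqP; rewrite eq_le dilate_ge0 andbT (le_trans (dilate_le _ T0))//.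
  rewrite indicE memNset// /eball /= => xe.
  by have := lt_trans Tx (le_lt_trans (norm_le_enorm x) xe); rewrite ltxx.
apply: (@smooth_supp_schwartz _ _ (fun=> 0) 1); last by move=> x _.
by apply: bump_smooth; exact: bump_cst.
Qed.

Lemma cent_compensated T w : compensated_sum eta rho (fun x => (dilate T x)%:C%C) w = (cent T w)%:C%C.
Proof.
rewrite /compensated_sum /cintegral /= /cent /lin.
by apply/eqP; rewrite eq_complex /= !Rintegral_cst// !mul0r !subr0 mulr0 addr0 subrr !eqxx.
Qed.

Lemma power_integrable T : 0 < T -> sigma.-integrable setT (EFin \o power (dilate T)).
Proof. by move=> T0; have [+ _] := sigma_bartlett; apply; exact: schwartz_dilate. Qed.

(** The defining isometry of the Bartlett measure, applied to the dilated function. *)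
Lemma variance_power T : 0 < T ->
  \int[P]_w (cent T w ^+ 2) = \int[sigma]_xi power (dilate T) xi.
Proof.
move=> T0; have sc := schwartz_dilate T0.
have [_ /(_ _ _ sc sc) /(congr1 (@complex.Re R)) H] := sigma_bartlett.
transitivity (complex.Re (cintegral P setT (fun w =>
    compensated_sum eta rho (fun x => (dilate T x)%:C%C) w *
    (compensated_sum eta rho (fun x => (dilate T x)%:C%C) w)^*%C))).
  by apply: eq_Rintegral => w _; rewrite csqnormE cent_compensated /csqnorm /= expr0n /= addr0.
rewrite H; apply: eq_Rintegral => xi _; exact: csqnormE.
Qed.

Lemma power_dilateE T xi : 0 < T -> power f (T *: xi) = T ^- (d + d) * power (dilate T) xi.
Proof. by move=> T0; rewrite power_scale// mulKf// expf_neq0// gt_eqF. Qed.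

Lemma power_int_integrable T : 0 < T -> sigma.-integrable setT (EFin \o (fun xi => power f (T *: xi))).
Proof.
move=> T0; rewrite (_ : _ \o _ = fun xi => ((T ^- (d + d))%:E * (power (dilate T) xi)%:E)%E).
  by apply: integrableZl => //; exact: power_integrable.
by apply/funext => xi; rewrite -EFinM -power_dilateE.
Qed.

Lemma variance_powerE T : 0 < T ->
  \int[sigma]_xi power f (T *: xi) = T ^- (d + d) * \int[P]_w (cent T w ^+ 2).
Proof.
move=> T0; rewrite variance_power// -RintegralZl//; last exact: power_integrable.
by apply: eq_Rintegral => xi _; rewrite power_dilateE.
Qed.

(** At scales T at most 1 the statistic only involves the points of the unit ball, so its
    variance is bounded uniformly in T. This bounds the mass that sigma gives to large balls
    without any a priori growth condition. *)
Lemma power_growth : exists2 K : R, 0 <= K & forall T, 0 < T -> T <= 1 ->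
  \int[sigma]_xi power f (T *: xi) <= T ^- (d + d) * K.
Proof.
pose c := (rho * fine (lambda (eball 1))) ^+ 2.
have i1 := integrableD measurableT (count_sqr_integrable 1) (prob_cst_integrable P c).
exists (\int[P]_w (fine (eta w (eball 1)) ^+ 2 + c)).
  by apply: Rintegral_ge0 => w _; rewrite addr_ge0 ?sqr_ge0.
move=> T T0 T1; rewrite variance_powerE// ler_wpM2l ?invr_ge0 ?exprn_ge0 ?(ltW T0)//.
apply: le_Rintegral => //; first exact: cent_sqr_integrable.
by move=> w _; exact: cent_sqr_le.
Qed.


(** The sum over j of the bounds of power_dyadic. *)
Definition dyadic_majorant (C : R) xi : \bar R :=
  (\sum_(0 <= j <oo) (C * ((2 ^- j) ^+ d.+1) ^+ 2 * power f (2 ^- j *: xi))%:E)%E.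

(** Up to a constant, the j-th integral is at most 2^(- 2 j (d + 1)) times 2^(2 j d), by
    power_growth at the scale 2^-j: the extra dimension in the decay makes the series
    converge. *)
Lemma dyadic_majorant_integrable C : 0 <= C -> sigma.-integrable setT (dyadic_majorant C).
Proof.
move=> C0; have [K K0 HK] := power_growth.
have t0 (j : nat) : 0 < (2 : R) ^- j <= 1.
  by rewrite invr_gt0 exprn_gt0//= invf_le1 ?exprn_gt0// exprn_ege1// ler1n.
have c0 (j : nat) : 0 <= C * ((2 ^- j) ^+ d.+1) ^+ 2.
  by rewrite mulr_ge0// sqr_ge0.
have int (j : nat) : sigma.-integrable setT (fun xi => (C * ((2 ^- j) ^+ d.+1) ^+ 2 * power f (2 ^- j *: xi))%:E).
  under [X in _.-integrable _ X]eq_fun do rewrite /= EFinM.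
  apply: integrableZl => //; apply: power_int_integrable; by case/andP: (t0 j).
have p0 (j : nat) xi : (0 <= (C * ((2 ^- j) ^+ d.+1) ^+ 2 * power f (2 ^- j *: xi))%:E)%E.
  by rewrite lee_fin mulr_ge0// power_ge0.
have m j := measurable_int _ (int j).
apply/integrableP; split.
  by apply: ge0_emeasurable_sum => // j xi _ _; exact: p0.
rewrite (eq_integral (dyadic_majorant C)); last first.
  by move=> xi _; rewrite gee0_abs//; exact: nneseries_ge0.
rewrite /dyadic_majorant integral_nneseries//.
apply: (@le_lt_trans _ _ (\sum_(0 <= j <oo) ((2 * (C * K)) / (2 ^ j.+1)%:R)%:E)%E); last first.
  by apply: le_lt_trans (epsilon_trick0 xpredT _) (ltry _); rewrite !mulr_ge0.
apply: lee_nneseries => [j _ _|j _].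
  by apply: integral_ge0 => xi _; exact: p0.
rewrite -EFin_Rintegral//; last exact: int.
rewrite lee_fin RintegralZl//; last by apply: power_int_integrable; case/andP: (t0 j).
have [t1 t2] := andP (t0 j).
apply: (@le_trans _ _ (C * ((2 ^- j) ^+ d.+1) ^+ 2 * ((2 ^- j) ^- (d + d) * K))).
  by rewrite ler_wpM2l// HK.
set t : R := 2 ^- j in t1 t2 *.
have -> : C * (t ^+ d.+1) ^+ 2 * (t ^- (d + d) * K) = (C * K) * (t * t).
  have tn : t ^+ (d + d) != 0 by rewrite expf_neq0// gt_eqF.
  have -> : (t ^+ d.+1) ^+ 2 = t ^+ (d + d) * (t * t) by rewrite expr2 !exprS exprD; ring.
  by field.
have -> : 2 * (C * K) / (2 ^ j.+1)%:R = (C * K) * t.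
  rewrite natrX exprS invfM /t; field; by rewrite expf_neq0.
by rewrite ler_wpM2l ?mulr_ge0// -[leRHS]mul1r ler_wpM2r// ltW.
Qed.

Hypothesis int_f_gt0 : 0 < \int[lambda]_x f x.

Lemma power_cvg0 (u : R^nat) xi : u n @[n --> \oo] --> +oo -> (forall n, 1 <= u n) -> xi != 0 ->
  power f (u n *: xi) @[n --> \oo] --> (0 : R).
Proof.
move=> uoo u1 xi0; have [_ _ f1] := f_bsupp.
have [A A0 HA] := power_decay 1 smooth_f f1.
have x0 : 0 < `|xi| by rewrite normr_gt0.
have ui : (u n)^-1 @[n --> \oo] --> (0 : R).
  by apply/gtr0_cvgV0 => //; near=> n; rewrite (lt_le_trans ltr01).
have -> : (0 : R) = (A / `|xi| ^+ 2) * 0 by rewrite mulr0.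
apply: (@squeeze_cvgr _ _ _ _ (fun=> 0) (fun n => (A / `|xi| ^+ 2) * (u n)^-1)); last 2 first.
- by rewrite mulr0; exact: cvg_cst.
- by apply: cvgM ui; exact: cvg_cst.
near=> n; rewrite power_ge0 /=.
have un : 0 < u n := lt_le_trans ltr01 (u1 n).
have := HA (u n *: xi); rewrite normrZ gtr0_norm// expr1 exprMn => H.
rewrite -mulrA -invfM ler_pdivlMr ?mulr_gt0 ?exprn_gt0//.
apply: le_trans (_ : power f (u n *: xi) * (u n ^+ 2 * `|xi| ^+ 2) <= _).
  rewrite ler_wpM2l ?power_ge0// mulrC ler_pM2r ?exprn_gt0//.
  by rewrite expr2 ler_peMr// ltW.
exact: H.
Unshelve. all: by end_near. Qed.

(** Dominated convergence on the spectral side: the spectrum at T xi tends to 0 for xi other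
    than 0, the origin carries no mass, and power_dyadic provides an integrable majorant. *)
Lemma variance_cvg0 (u : R^nat) : u n @[n --> \oo] --> +oo -> (forall n, 1 <= u n) ->
  u n ^- (d + d) * \int[P]_w (cent (u n) w ^+ 2) @[n --> \oo] --> (0 : R).
Proof.
move=> uoo u1; have u0 n : 0 < u n := lt_le_trans ltr01 (u1 n).
have [C C0 HC] := power_dyadic smooth_f f_ge0 f_bsupp int_f_gt0.
have dom n xi : ((power f (u n *: xi))%:E <= dyadic_majorant C xi)%E.
  have [j Hj] := HC (u n) xi (u1 n).
  have t0 i : (0 <= (C * ((2 ^- i) ^+ d.+1) ^+ 2 * power f (2 ^- i *: xi))%:E)%E.
    by rewrite lee_fin mulr_ge0 ?power_ge0// mulr_ge0// sqr_ge0.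
  apply: le_trans (nneseries_lim_ge j.+1 (fun i _ _ => t0 i)).
  rewrite big_nat_recr//=; apply: (@le_trans _ _ (C * ((2 ^- j) ^+ d.+1) ^+ 2 * power f (2 ^- j *: xi))%:E).
    by rewrite lee_fin.
  apply: leeDr; apply: sume_ge0 => i _; exact: t0.
have ae : \forall xi \ae sigma, setT xi -> (power f (u n *: xi))%:E @[n --> \oo] --> (cst 0 xi : \bar R).
  exists [set 0]; split => //; first exact: measurable_rV_set0.
  move=> xi /= H; apply: contrapT => /eqP xi0; apply: H => _.
  by apply: cvg_EFin; [exact: nearW|exact: power_cvg0].
have bnd : \forall xi \ae sigma, forall n, setT xi -> (`|(power f (u n *: xi))%:E| <= dyadic_majorant C xi)%E.
  by apply: aeW => xi n _; rewrite /= ger0_norm ?power_ge0//; exact: dom.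
have [_ _] := dominated_convergence measurableT (fun n => measurable_int _ (power_int_integrable (u0 n)))
  (measurable_cst _) ae (dyadic_majorant_integrable C0)
  bnd.
rewrite integral0 => /fine_cvg /=.
apply: cvg_trans; apply: near_eq_cvg; near=> n => /=.
by rewrite -variance_powerE.
Unshelve. all: by end_near. Qed.

End linear_statistics.

(** * Consistency of the empirical intensity *)

Lemma cvg_pinfty_scale (R : realType) (f : R -> R) (a l : R) : 0 < a ->
  f x @[x --> +oo] --> l -> f (x * a) @[x --> +oo] --> l.
Proof.
move=> a0 /cvg_pinftyP H; apply/cvg_pinftyP => u uoo; apply: H.
apply/cvgryPge => A; near=> n; rewrite -ler_pdivrMr//.
by near: n; move: (A / a); apply/cvgryPge.
Unshelve. all: by end_near. Qed.

Lemma cvg_pinfty_add0 (R : realType) (f g : R -> R) :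
  f x @[x --> +oo] --> 0 -> g x @[x --> +oo] --> 0 -> f x + g x @[x --> +oo] --> 0.
Proof. by move=> f0 g0; rewrite -[X in _ --> X](addr0 (0 : R)); exact: cvgD. Qed.

Lemma bernoulli_ineq (R : realType) (x : R) n : 0 <= x <= 1 -> 1 - n%:R * x <= (1 - x) ^+ n.
Proof.
move=> /andP[x0 x1]; elim: n => [|n IH]; first by rewrite mul0r subr0.
rewrite exprS -natr1; apply: le_trans (_ : (1 - x) * (1 - n%:R * x) <= _).
  have : 0 <= n%:R * x * x by rewrite !mulr_ge0.
  lra.
by rewrite ler_wpM2l// subr_ge0.
Qed.

(** The arithmetic of the sandwich: x is the empirical intensity, v the volume of the unit
    ball, I the integral of the smooth function, X1 and X2 the normalized statistics at the
    two scales, and p the proportion of the ball on which the function is close to 1. *)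
Lemma empirical_arith (R : realType) (rho tau e p v I X1 X2 x : R) : 0 < rho -> 0 < v -> 0 < tau ->
  tau <= 1 / 2 -> tau * (4 * (rho + 1)) <= e -> X1 <= x * v -> x * p * v <= X2 ->
  rho * I - X1 < v * tau -> X2 - rho * I < v * tau -> p * v <= I -> I <= v -> 1 - tau <= p ->
  `|x - rho| < e.
Proof.
move=> rho0 v0 tau0 tau1 tau2 F1 F2 E1 E2 I0 I1 p1.
have G1 : rho * (1 - tau) - tau < x.
  rewrite -(ltr_pM2r v0).
  have : rho * ((1 - tau) * v) <= rho * I.
    by rewrite ler_pM2l// (le_trans _ I0)// ler_pM2r.
  lra.
have G2 : x * p < rho + tau.
  rewrite -(ltr_pM2r v0).
  have : rho * I <= rho * v by rewrite ler_pM2l.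
  lra.
have G3 : x - rho < 2 * tau * (rho + 1).
  have [x0|x0] := leP x 0; first by nra.
  have : x * (1 - tau) <= x * p by rewrite ler_pM2l.
  nra.
by rewrite ltr_norml; apply/andP; split; nra.
Qed.

Section empirical_intensity.
Context {R : realType} {d : nat} {dO : measure_display} {Omega : measurableType dO}.
Variables (P : probability Omega R) (eta : R.-ker Omega ~> 'rV[R]_d).
Local Notation lambda := (lebesgue_rV R d).
Variables (rho : R) (sigma : {measure set 'rV[R]_d -> \bar R}).
Hypotheses (rho_gt0 : 0 < rho) (eta_pp : point_process eta)
  (eta_moments : local_second_moments P eta)
  (sigma_bartlett : bartlett_measure P eta rho sigma)
  (sigma0 : sigma [set 0] = 0%E).

Lemma measurable_norm_ge (X : Omega -> R) e : measurable_fun setT X -> measurable [set w | e <= `|X w|].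
Proof. by move=> mX; apply: (@measurable_ge _ _ _ (fun w => `|X w|)); exact: measurableT_comp. Qed.

(** Chebyshev's inequality with the variance bound of variance_cvg0. *)
Lemma lin_lln f (e : R) : smooth f -> (forall x, 0 <= f x) -> (forall x, f x <= \1_(eball 1) x) ->
  0 < \int[lambda]_x f x -> 0 < e ->
  fine (P [set w | e <= `|T ^- d * cent eta rho f T w|]) @[T --> +oo] --> 0.
Proof.
move=> sf f0 f1 If e0; apply/cvg_pinftyP => u uoo.
pose v n := Num.max 1 (u n).
have v1 n : 1 <= v n by rewrite le_max lexx.
have u1 : \forall n \near \oo, 1 <= u n by move: (1 : R); apply/cvgryPge.
have uv : \forall n \near \oo, v n = u n by apply: filterS u1 => n; rewrite /v => /max_idPr.
have voo : v n @[n --> \oo] --> +oo.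
  by apply: cvg_trans uoo; apply: near_eq_cvg; apply: filterS uv => n ->.
have v0 n : 0 < v n := lt_le_trans ltr01 (v1 n).
have H := variance_cvg0 rho_gt0 eta_pp eta_moments sigma_bartlett sigma0 sf f0 f1 If voo v1.
have H2 : e ^- 2 * (v n ^- (d + d) * \int[P]_w (cent eta rho f (v n) w ^+ 2)) @[n --> \oo] --> (0 : R).
  by rewrite -(mulr0 (e ^- 2)); apply: cvgM H; exact: cvg_cst.
apply: (@squeeze_cvgr _ _ _ _ (fun=> 0) _ _ _ _ _ H2); last exact: cvg_cst.
near=> n; rewrite fine_prob_ge0 /=.
have -> : u n = v n by apply/esym; near: n.
have i1 : P.-integrable setT (EFin \o (fun w => (v n ^- d * cent eta rho f (v n) w) ^+ 2)).
  under [X in _.-integrable _ X]eq_fun do rewrite /= exprMn EFinM.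
  by apply: integrableZl => //; exact: (cent_sqr_integrable rho_gt0 eta_pp).
have := @markov_ge _ _ _ P _ (e ^+ 2) (exprn_gt0 2 e0) i1 (fun w => sqr_ge0 _).
have -> : [set t | e ^+ 2 <= (v n ^- d * cent eta rho f (v n) t) ^+ 2] =
    [set w | e <= `|v n ^- d * cent eta rho f (v n) w|].
  have Ez (z : R) : (e ^+ 2 <= z ^+ 2) = (e <= `|z|).
    rewrite -(real_normK (num_real z)).
    by apply: ler_sqr; rewrite nnegrE // ltW.
  by apply/seteqP; split=> w /=; rewrite Ez.
move/le_trans; apply.
under eq_Rintegral do rewrite exprMn.
rewrite RintegralZl//; last exact: (cent_sqr_integrable rho_gt0 eta_pp).
by rewrite mulrC [(v n ^- d) ^+ 2]expr2 -invfM -exprD.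
Unshelve. all: by end_near. Qed.

Lemma cent_dilateE f T w : smooth f -> 0 < T ->
  T ^- d * cent eta rho f T w = T ^- d * lin eta f T w - rho * \int[lambda]_x f x.
Proof.
move=> sf T0; have Tn : T ^+ d != 0 by rewrite expf_neq0// gt_eqF.
by rewrite /cent int_dilate// mulrBr (mulrCA _ rho) mulKf.
Qed.

Lemma lebesgue_eballE (T : R) : 0 < T -> fine (lambda (eball T)) = T ^+ d * fine (lambda (eball 1)).
Proof.
move=> T0; rewrite lebesgue_rV_eball_scale// fineM// ge0_fin_numE//.
exact: lebesgue_rV_eball_lty.
Qed.

Lemma fine_eball1_gt0 : 0 < fine (lambda (eball 1)).
Proof. by rewrite fine_gt0// lebesgue_rV_eball_gt0//= lebesgue_rV_eball_lty. Qed.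

Lemma measurable_empirical T : measurable_fun setT (empirical_intensity eta T).
Proof.
by apply: measurable_funM => //; apply: measurable_count; exact: measurable_eball.
Qed.

(** The number of points in the ball of radius T is at least the smooth statistic at scale
    T, whose function lies below the indicator function of the ball, and at most, up to 1 -
    en, the one at scale T / r, whose function is at least 1 - en on the ball. *)
Lemma empirical_close f (r en tau e T : R) w : smooth f -> (forall x, 0 <= f x) ->
  (forall x, f x <= \1_(eball 1) x) -> (forall x, enorm x <= r -> 1 - en <= f x) ->
  0 < T -> 0 < r -> 0 < tau -> tau <= 1 / 2 -> tau * (4 * (rho + 1)) <= e ->
  (1 - en) * r ^+ d * fine (lambda (eball 1)) <= \int[lambda]_x f x ->
  \int[lambda]_x f x <= fine (lambda (eball 1)) -> 1 - tau <= (1 - en) * r ^+ d ->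
  `|T ^- d * cent eta rho f T w| < fine (lambda (eball 1)) * tau ->
  `|(T * r^-1) ^- d * cent eta rho f (T * r^-1) w| < fine (lambda (eball 1)) * tau ->
  `|empirical_intensity eta T w - rho| < e.
Proof.
move=> sf f0 f1 Hf T0 r0 tau0 tau1 tau2.
have v10 : 0 < fine (lambda (eball 1)) := fine_eball1_gt0.
have Tr0 : 0 < T * r^-1 by rewrite mulr_gt0// invr_gt0.
rewrite !cent_dilateE//.
set v1 := fine (lambda (eball 1)) in v10 *; set I := \int[lambda]_x f x.
set X1 := T ^- d * lin eta f T w; set X2 := (T * r^-1) ^- d * lin eta f (T * r^-1) w.
set p := (1 - en) * r ^+ d.
set x := empirical_intensity eta T w.
move=> I0 I1 p1 E1 E2.
have Td0 : 0 < T ^+ d by rewrite exprn_gt0.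
have F1 : X1 <= x * v1.
  have -> : x * v1 = T ^- d * fine (eta w (eball T)).
    rewrite /x /empirical_intensity lebesgue_eballE// -/v1 invfM mulrCA.
    by rewrite -mulrA divfK// gt_eqF.
  apply: ler_wpM2l; first by rewrite invr_ge0 ltW.
  rewrite -[leRHS]mul1r; apply: (lin_le eta_pp sf f0 f1) => //; first exact: measurable_eball.
    exact: eta_eball_lty.
  by move=> y; rewrite mul1r dilate_le.
have F2 : x * p * v1 <= X2.
  have G : (1 - en) * fine (eta w (eball T)) <= lin eta f (T * r^-1) w.
    apply: (lin_ge eta_pp sf f0 f1) => //; first exact: measurable_eball.
      exact: eta_eball_lty.
    move=> y; rewrite indicE; case: (boolP (y \in eball T)) => [|_]; last by rewrite mulr0 f0.
    rewrite inE /eball /= mulr1 => yT; apply: Hf.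
    rewrite enormZ ?invr_ge0 ?(ltW Tr0)// invfM invrK mulrAC -[leRHS]mul1r.
    apply: ler_wpM2r; first exact: ltW.
    by rewrite mulrC ler_pdivrMr// mul1r ltW.
  have E' : (T * r^-1) ^- d = T ^- d * r ^+ d by rewrite exprMn invfM exprVn invrK.
  have -> : x * p * v1 = (T ^- d * r ^+ d) * ((1 - en) * fine (eta w (eball T))).
    rewrite /x /p /empirical_intensity lebesgue_eballE// -/v1; field.
    by rewrite !gt_eqF.
  rewrite /X2 E'; apply: ler_wpM2l G.
  by rewrite mulr_ge0 ?invr_ge0 ?exprn_ge0// ltW.
have [E1a E1b] : X1 - rho * I < v1 * tau /\ - (v1 * tau) < X1 - rho * I.
  by move: E1; rewrite ltr_norml => /andP[? ?].
have {}E2 := ltr_normlW E2; have {}E1 : rho * I - X1 < v1 * tau by rewrite -opprB ltrNl.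
apply: empirical_arith F1 F2 E1 E2 I0 I1 p1 => //.
Qed.

(** The indicator function of a ball is not smooth, so the isometry does not apply to it; it
    is compared with smooth bumps at the two scales T and T / r, with r close to 1, to which
    lin_lln applies. *)
Lemma empirical_lln (e : R) : 0 < e ->
  fine (P [set w | e <= `|empirical_intensity eta T w - rho|]) @[T --> +oo] --> 0.
Proof.
move=> e0; set v1 := fine (lambda (eball 1)).
have v10 : 0 < v1 := fine_eball1_gt0.
pose tau : R := Num.min (1 / 2) (e / (4 * (rho + 1))).
have r10 : 0 < 4 * (rho + 1) by rewrite mulr_gt0// addr_gt0.
have tau0 : 0 < tau by rewrite lt_min divr_gt0//= divr_gt0.
have tau1 : tau <= 1 / 2 by rewrite ge_min lexx.
have tau2 : tau * (4 * (rho + 1)) <= e by rewrite -ler_pdivlMr// ge_min lexx orbT.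
(* by the Bernoulli inequality, r ^+ d is then at least 1 - tau / 2 *)
pose t : R := tau / (2 * d.+1%:R).
have d0 : 0 < 2 * d.+1%:R :> R by [].
have t0 : 0 < t by rewrite divr_gt0.
have t1 : t <= tau / 2.
  by rewrite /t ler_pdivrMr// -mulrA ler_peMr// ?(ltW tau0)// mulrA mulVf// mul1r ler1n.
have td : d%:R * t <= tau / 2.
  rewrite /t mulrA ler_pdivrMr// mulrA -[tau / 2 * 2]mulrA mulVf// mulr1 mulrC ler_wpM2l ?(ltW tau0)//.
  by rewrite ler_nat.
pose r := 1 - t.
have r0 : 0 < r by rewrite /r; lra.
have r1 : r < 1 by rewrite /r; lra.
have rd : 1 - tau / 2 <= r ^+ d.
  apply: le_trans (_ : 1 - d%:R * t <= _); first by lra.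
  by apply: bernoulli_ineq; rewrite (ltW t0)/=; lra.
pose en := tau / 2.
have en0 : 0 < en by rewrite /en; lra.
have [f [sf f0 f1 Hf]] : exists f : 'rV[R]_d -> R, [/\ smooth f, forall x, 0 <= f x,
    forall x, f x <= \1_(eball 1) x & forall x, enorm x <= r -> 1 - en <= f x].
  have [N HN] := @bump_near1 R d r en (ltW r0) r1 en0; exists (unit_bump N).
  by split=> [|x|x|//]; [exact: smooth_bump|exact: bump_ge0|exact: bump_eball].
pose p := (1 - en) * r ^+ d.
have p1 : 1 - tau <= p.
  apply: le_trans (_ : (1 - en) * (1 - tau / 2) <= _); last by rewrite ler_wpM2l// /en; lra.
  by rewrite /en; nra.
have I1 : \int[lambda]_x f x <= v1 by exact: int_f_le.
have I0 : p * v1 <= \int[lambda]_x f x.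
  have -> : p * v1 = \int[lambda]_x ((1 - en) * \1_(eball r) x).
    have i1 : lambda.-integrable setT (EFin \o \1_(eball r)).
      by apply: indic_integrable; [exact: measurable_eball|exact: lebesgue_rV_eball_lty].
    rewrite RintegralZl// /Rintegral integral_indic//; last exact: measurable_eball.
    by rewrite setIT -mulrA -lebesgue_eballE.
  apply: le_Rintegral => //.
  - under [X in _.-integrable _ X]eq_fun do rewrite /= EFinM.
    apply: integrableZl => //; apply: indic_integrable; [exact: measurable_eball|exact: lebesgue_rV_eball_lty].
  - exact: bsupp_integrable (f_bsupp sf f0 f1).
  - move=> x _; rewrite indicE; case: (boolP (x \in eball r)) => [|_]; last by rewrite mulr0.
    by rewrite inE /eball /= mulr1 => /ltW; exact: Hf.
have If : 0 < \int[lambda]_x f x by apply: lt_le_trans I0; rewrite mulr_gt0//; lra.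
have vt : 0 < v1 * tau by rewrite mulr_gt0.
pose A T := [set w | v1 * tau <= `|T ^- d * cent eta rho f T w|].
have mA T : measurable (A T) by apply: measurable_norm_ge; apply: measurable_funM => //; exact: measurable_cent.
have L1 : fine (P (A T)) @[T --> +oo] --> 0 := lin_lln sf f0 f1 If vt.
have ri0 : 0 < r^-1 by rewrite invr_gt0.
have L2 := cvg_pinfty_scale ri0 L1.
have /cvgrPdist_le L := cvg_pinfty_add0 L1 L2.
apply/cvgrPdist_le => e' e'0; near=> T.
have LT : `|0 - (fine (P (A T)) + fine (P (A (T * r^-1))))| <= e' by near: T; exact: L.
rewrite sub0r normrN ger0_norm ?fine_prob_ge0//.
apply: le_trans LT; rewrite sub0r normrN ger0_norm; last by rewrite addr_ge0// fine_prob_ge0.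
have T0 : 0 < T by near: T; exact: nbhs_pinfty_gt.
have Tr0 : 0 < T * r^-1 by rewrite mulr_gt0.
apply: le_trans (fine_probU P (mA T) (mA (T * r^-1))).
apply: fine_prob_le.
- by apply: measurable_norm_ge; apply: measurable_funB => //; exact: measurable_empirical.
- exact: measurableU.
move=> w /= Hw; apply: contrapT => /not_orP[/negP]; rewrite -ltNge => H1 /negP; rewrite -ltNge => H2.
move: Hw; apply/negP; rewrite -ltNge.
exact: (empirical_close sf f0 f1 Hf T0 r0 tau0 tau1 tau2 I0 I1 p1 H1 H2).
Unshelve. all: by end_near. Qed.

End empirical_intensity.

(** * Windowed exponential sums and their drift *)

Lemma Rintegral_support dT (T : measurableType dT) (R : realType)
    (mu : {measure set T -> \bar R}) (D : set T) (f : T -> R) :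
  (forall x, ~ D x -> f x = 0) -> \int[mu]_(x in D) f x = \int[mu]_x f x.
Proof.
move=> f0; rewrite Rintegral_mkcond; apply: eq_Rintegral => x _.
by rewrite patchE; case: ifPn => //; rewrite notin_setE => /f0.
Qed.

Section windowed_sums.
Context {R : realType} {d : nat}.
Local Notation lambda := (lebesgue_rV R d).
Variable h : 'rV[R]_d -> R[i].
Hypothesis h_test : test_function h.

Lemma h_supp x : 1 < `|x| -> h x = 0.
Proof.
move=> x1; have [_ _ + _] := h_test; move=> /(_ x) H.
apply: contrapT => /eqP hx; have /H : closure [set x | h x != 0] x by exact: subset_closure.
by rewrite /eball /= => /(le_lt_trans (norm_le_enorm x)); rewrite ltNge ltW.
Qed.

Lemma h_esupp x : ~ eball 1 x -> h x = 0.
Proof.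
move=> x1; have [_ _ + _] := h_test; move=> /(_ x) H.
apply: contrapT => /eqP hx; apply/x1/H; exact: subset_closure.
Qed.

Lemma Re_h_supp x : 1 < `|x| -> complex.Re (h x) = 0.
Proof. by move/h_supp => ->. Qed.

Lemma Im_h_supp x : 1 < `|x| -> complex.Im (h x) = 0.
Proof. by move/h_supp => ->. Qed.

Lemma smooth_bsupp (f : 'rV[R]_d -> R) : smooth f -> (forall x, 1 < `|x| -> f x = 0) ->
  exists2 M, 0 <= M & bsupp f M 1.
Proof.
move=> sf f0; have [M M0 HM] := continuous_supp_bounded (sf [::]).1 f0.
by exists M => //; split => //; apply: continuous_rV_measurable; exact: (sf [::]).1.
Qed.

Lemma bsupp_dilate (f : 'rV[R]_d -> R) M T : 0 < T -> bsupp f M 1 -> bsupp (dilate f T) M T.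
Proof.
move=> T0 [mf fM f0]; split.
- apply: (measurableT_comp mf).
  rewrite (_ : *:%R T^-1 = fun x => T^-1 *: x + 0); first exact: measurable_rV_affine.
  by apply/funext => x; rewrite addr0.
- by move=> x; exact: fM.
- move=> x Tx; apply: f0; rewrite normrZ gtr0_norm ?invr_gt0//.
  by rewrite mulrC ltr_pdivlMr// mul1r.
Qed.

(** After scaling, the transform is evaluated at T u, with u different from 0, and decays
    faster than the power T^(d/2) that it is multiplied by. *)
Lemma cosint_dilate_cvg0 (f : 'rV[R]_d -> R) u th : smooth f -> (forall x, 1 < `|x| -> f x = 0) ->
  u != 0 -> T `^ (- (d%:R / 2)) * cosint (dilate f T) u th @[T --> +oo] --> 0.
Proof.
move=> sf f0 u0; have [M M0 [mf fM _]] := smooth_bsupp sf f0.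
have [C C0 HC] := fourier_decay d.+1 sf f0.
have nu : 0 < `|u| by rewrite normr_gt0.
have lim : C / `|u| ^+ d.+1 * T^-1 @[T --> +oo] --> 0.
  rewrite -(mulr0 (C / `|u| ^+ d.+1)); apply: cvgM; first exact: cvg_cst.
  by apply/gtr0_cvgV0; [exact: nbhs_pinfty_gt|exact: cvg_id].
apply/cvgr0Pnorm_le => e e0.
have /cvgr0Pnorm_le/(_ e e0) := lim; apply: filter_app; near=> T => H.
have T1 : 1 <= T by near: T; exact: nbhs_pinfty_ge.
have T0 : 0 < T := lt_le_trans ltr01 T1.
apply: le_trans H; rewrite normrM [leRHS]ger0_norm; last first.
  by rewrite mulr_ge0 ?divr_ge0 ?invr_ge0 ?exprn_ge0// ltW.
apply: (@le_trans _ _ (1 * `|cosint (dilate f T) u th|)).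
  rewrite ler_wpM2r// ger0_norm ?powR_ge0// powRN invf_le1 ?powR_gt0//.
  by rewrite -[leLHS](powRr0 T) ler_powR// divr_ge0.
rewrite mul1r /dilate cosint_scale// normrM (ger0_norm (exprn_ge0 d (ltW T0))).
have := HC (T *: u) th; rewrite normrZ (gtr0_norm T0) exprMn exprS => H.
rewrite mulrAC ler_pdivlMr ?exprn_gt0// ler_pdivlMr//.
by apply: le_trans H; rewrite le_eqVlt; apply/orP; left; apply/eqP; ring.
Unshelve. all: by end_near. Qed.

Definition hre T u x := complex.Re (h (T^-1 *: x) * chi u x).
Definition him T u x := complex.Im (h (T^-1 *: x) * chi u x).

Lemma hreE T u x : hre T u x = complex.Re (h (T^-1 *: x)) * cos (2 * pi * dotr x u + 0) +
  complex.Im (h (T^-1 *: x)) * cos (2 * pi * dotr x u + pi / 2).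
Proof. by rewrite /hre addr0 cosDpihalf mulrN /=; case: (h _). Qed.

Lemma himE T u x : him T u x = complex.Re (h (T^-1 *: x)) * cos (2 * pi * dotr x u + - (pi / 2)) +
  complex.Im (h (T^-1 *: x)) * cos (2 * pi * dotr x u + 0).
Proof. by rewrite /him addr0 cosBpihalf /=; case: (h _). Qed.

Lemma Re_h_bsupp : exists2 M, 0 <= M & bsupp (fun x => complex.Re (h x)) M 1.
Proof. by have [sr _ _ _] := h_test; apply: smooth_bsupp sr _; exact: Re_h_supp. Qed.

Lemma Im_h_bsupp : exists2 M, 0 <= M & bsupp (fun x => complex.Im (h x)) M 1.
Proof. by have [_ si _ _] := h_test; apply: smooth_bsupp si _; exact: Im_h_supp. Qed.

Lemma int_waves T u (th th' : R) : 0 < T ->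
  \int[lambda]_x (complex.Re (h (T^-1 *: x)) * cos (2 * pi * dotr x u + th) +
    complex.Im (h (T^-1 *: x)) * cos (2 * pi * dotr x u + th')) =
  cosint (dilate (fun x => complex.Re (h x)) T) u th + cosint (dilate (fun x => complex.Im (h x)) T) u th'.
Proof.
move=> T0; have [M M0 bM] := Re_h_bsupp; have [N N0 bN] := Im_h_bsupp.
by rewrite -RintegralD//; [exact: bsupp_integrable (bsupp_wave u th (bsupp_dilate T0 bM))|
  exact: bsupp_integrable (bsupp_wave u th' (bsupp_dilate T0 bN))].
Qed.

Lemma waves_cvg0 u (th th' : R) : u != 0 ->
  T `^ (- (d%:R / 2)) * \int[lambda]_x (complex.Re (h (T^-1 *: x)) * cos (2 * pi * dotr x u + th) +
    complex.Im (h (T^-1 *: x)) * cos (2 * pi * dotr x u + th')) @[T --> +oo] --> 0.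
Proof.
move=> u0; have [sr si _ _] := h_test.
have H := cvg_pinfty_add0 (cosint_dilate_cvg0 th sr Re_h_supp u0) (cosint_dilate_cvg0 th' si Im_h_supp u0).
apply: cvg_trans H; apply: near_eq_cvg; near=> T.
by rewrite int_waves// mulrDr.
Unshelve. all: by end_near. Qed.

Variables (dO : measure_display) (Omega : measurableType dO).
Variables (eta : R.-ker Omega ~> 'rV[R]_d) (rho : R).

(** The mean of a normalized exponential sum, which the compensator subtracts; the
    periodogram is computed from the uncompensated sum, which differs from the compensated
    one by this drift. *)
Definition drift_re T u := T `^ (- (d%:R / 2)) * (rho * \int[lambda]_x hre T u x).
Definition drift_im T u := T `^ (- (d%:R / 2)) * (rho * \int[lambda]_x him T u x).

Lemma drift_re_cvg0 u : u != 0 -> drift_re T u @[T --> +oo] --> 0.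
Proof.
move=> u0; have H := waves_cvg0 0 (pi / 2) u0.
rewrite -(mulr0 rho); under eq_fun do rewrite /drift_re mulrCA.
apply: cvgM; first exact: cvg_cst.
by under eq_fun do (under eq_Rintegral do rewrite hreE).
Qed.

Lemma drift_im_cvg0 u : u != 0 -> drift_im T u @[T --> +oo] --> 0.
Proof.
move=> u0; have H := waves_cvg0 (- (pi / 2)) 0 u0.
rewrite -(mulr0 rho); under eq_fun do rewrite /drift_im mulrCA.
apply: cvgM; first exact: cvg_cst.
by under eq_fun do (under eq_Rintegral do rewrite himE).
Qed.

Lemma scaled_sum_Re T u w : complex.Re (scaled_sum eta rho h T u w) + drift_re T u =
  T `^ (- (d%:R / 2)) * \int[eta w]_x hre T u x.
Proof.
rewrite /scaled_sum /compensated_sum /drift_re /cintegral /= !mul0r !subr0 -mulrDr subrK.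
by [].
Qed.

Lemma scaled_sum_Im T u w : complex.Im (scaled_sum eta rho h T u w) + drift_im T u =
  T `^ (- (d%:R / 2)) * \int[eta w]_x him T u x.
Proof.
rewrite /scaled_sum /compensated_sum /drift_im /cintegral /= !mul0r !addr0 -mulrDr subrK.
by [].
Qed.

Lemma hre_out T u x : 0 < T -> ~ eball T x -> hre T u x = 0.
Proof.
move=> T0 xT; rewrite /hre h_esupp ?mul0r// => H; apply: xT.
by have [+ _] := eballZ 1 x T0; rewrite mulr1; apply.
Qed.

Lemma him_out T u x : 0 < T -> ~ eball T x -> him T u x = 0.
Proof.
move=> T0 xT; rewrite /him h_esupp ?mul0r// => H; apply: xT.
by have [+ _] := eballZ 1 x T0; rewrite mulr1; apply.
Qed.

(** Since h is supported in the unit ball, restricting the points to the ball of radius T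
    changes nothing, and the periodogram is a function of the compensated sum, the drift and
    the empirical intensity. *)
Lemma periodogramE T u w : 0 < T -> 0 < empirical_intensity eta T w ->
  periodogram eta h T u w = (empirical_intensity eta T w)^-1 *
    ((complex.Re (scaled_sum eta rho h T u w) + drift_re T u) ^+ 2 +
     (complex.Im (scaled_sum eta rho h T u w) + drift_im T u) ^+ 2).
Proof.
move=> T0 e0; rewrite /periodogram e0 scaled_sum_Re scaled_sum_Im !exprMn -mulrDr -mulrA.
have -> : T `^ (- (d%:R / 2)) ^+ 2 = T ^- d.
  by rewrite -powR_mulrn ?powR_ge0// -powRrM mulNr divfK// powRN powR_mulrn// ltW.
congr (_ * (_ * _)); rewrite /csqnorm /cintegral /=.
by congr (_ ^+ 2 + _ ^+ 2); apply: Rintegral_support => x; [exact: hre_out|exact: him_out].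
Qed.

End windowed_sums.

(** * Joint measurability and independence of configuration and frequencies *)

Lemma measurable_pos_inv dT (T : measurableType dT) (R : realType) (f : T -> R) :
  measurable_fun setT f -> (forall x, 0 <= f x) -> measurable_fun setT (fun x => (f x)^-1).
Proof.
move=> mf f0; under eq_fun do rewrite -powR_inv1//.
by apply: (measurableT_comp (measurable_powR (-1))).
Qed.

Lemma bounded_integrable_on dT (T : measurableType dT) (R : realType)
    (mu : {measure set T -> \bar R}) (B : set T) (f : T -> R) (C : R) :
  measurable B -> (mu B < +oo)%E -> measurable_fun setT f -> (forall x, `|f x| <= C) ->
  mu.-integrable B (EFin \o f).
Proof.
move=> mB Boo mf fC; have mfB : measurable_fun B f by exact: measurable_funTS.
apply/integrableP; split; first exact/measurable_EFinP.
apply: (@le_lt_trans _ _ (\int[mu]_(x in B) C%:E)%E).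
  apply: ge0_le_integral => //.
    by apply/measurable_EFinP; apply: measurableT_comp.
  by move=> x _; rewrite lee_fin.
by rewrite integral_cst// lte_mul_pinfty// lee_fin (le_trans (normr_ge0 _) (fC point)).
Qed.

Section parametric_integral.
Context dX dY dZ (X : measurableType dX) (Y : measurableType dY) (Z : measurableType dZ)
  (R : realType).
Variables (l : X -> {measure set Y -> \bar R}) (B : set Y).
Hypotheses (ml : forall U, measurable U -> measurable_fun setT (l ^~ U)) (mB : measurable B)
  (lB : forall x, (l x B < +oo)%E).

Let mass x : R := fine (l x B).

Let mass_ge0 x : 0 <= mass x.
Proof. exact: fine_ge0. Qed.

Let measurable_mass : measurable_fun setT mass.
Proof. by apply: (@measurableT_comp _ _ _ _ _ _ fine); [exact: fine_measurable|exact: ml]. Qed.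

Let scale_ge0 x : 0 <= (1 + mass x)^-1.
Proof. by rewrite invr_ge0 addr_ge0. Qed.

(** Dividing the restriction of l x to B by 1 + l x B makes its mass at most 1: integrals
    against a uniformly bounded family of measures depend measurably on the parameter, and
    the division can be undone afterwards. *)
Definition bounded_kernel (p : X * Z) : {measure set Y -> \bar R} :=
  mscale (NngNum (scale_ge0 p.1)) (mrestr (l p.1) mB).

Let bounded_kernelE p U : bounded_kernel p U = ((1 + mass p.1)^-1%:E * l p.1 (U `&` B))%E.
Proof. by []. Qed.

Let measurable_scale : measurable_fun setT (fun x => (1 + mass x)^-1).
Proof.
apply: measurable_pos_inv => [|x]; last by rewrite addr_ge0.
by apply: measurable_funD.
Qed.

Let measurable_bounded_kernel U : measurable U -> measurable_fun setT (bounded_kernel ^~ U).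
Proof.
move=> mU; rewrite (_ : bounded_kernel ^~ U = fun p => ((1 + mass p.1)^-1%:E * l p.1 (U `&` B))%E)//.
apply: emeasurable_funM.
  apply/measurable_EFinP; apply: (measurableT_comp measurable_scale); exact: measurable_fst.
apply: (measurableT_comp (ml _)); last exact: measurable_fst.
exact: measurableI.
Qed.

HB.instance Definition _ := isKernel.Build _ _ _ _ _ bounded_kernel measurable_bounded_kernel.

Let bounded_kernel_uub : measure_fam_uub bounded_kernel.
Proof.
exists 2 => p; rewrite bounded_kernelE setTI.
rewrite -[X in (_ * X)%E]fineK ?ge0_fin_numE// -EFinM lte_fin mulrC ltr_pdivrMr ?ltr_wpDr//.
have := mass_ge0 p.1; rewrite /mass; lra.
Qed.

HB.instance Definition _ := Kernel_isFinite.Build _ _ _ _ _ bounded_kernel bounded_kernel_uub.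

(** The integral with respect to l x is recovered from the one with respect to
    bounded_kernel by multiplication by 1 + l x B; adding M to g makes the integrand
    nonnegative. *)
Lemma measurable_parametric_integral (g : Y * Z -> R) (M : R) :
  measurable_fun setT g -> (forall q, `|g q| <= M) ->
  measurable_fun setT (fun p : X * Z => \int[l p.1]_(y in B) g (y, p.2)).
Proof.
move=> mg gM.
have M0 p : 0 <= g p + M by have := gM p; rewrite ler_norml; lra.
have mgM : measurable_fun setT (fun q => g q + M) by apply: measurable_funD.
have mgz z : measurable_fun setT (fun y => g (y, z)).
  apply: (measurableT_comp mg); exact: measurable_pair1 || exact: measurable_fun_pair.
pose k (q : (X * Z) * Y) : \bar R := (g (q.2, q.1.2) + M)%:E.
have mk : measurable_fun setT k.
  apply/measurable_EFinP; apply: (measurableT_comp mgM).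
  by apply: measurable_fun_pair; [exact: measurable_snd|apply: (measurableT_comp measurable_snd); exact: measurable_fst].
have k0 q : (0 <= k q)%E by rewrite lee_fin.
have H := measurable_fun_integral_finite_kernel k bounded_kernel k0 mk.
have E p : \int[l p.1]_(y in B) g (y, p.2) =
    (1 + mass p.1) * fine (\int[bounded_kernel p]_y k (p, y))%E - M * mass p.1.
  have lBp := lB p.1.
  have Ek : (\int[bounded_kernel p]_y k (p, y) = (1 + mass p.1)^-1%:E * \int[l p.1]_(y in B) (g (y, p.2) + M)%:E)%E.
    have mky : measurable_fun setT (fun y => k (p, y)).
      by apply/measurable_EFinP; apply: measurable_funD; [exact: mgz|exact: measurable_cst].
    rewrite ge0_integral_mscale//; congr (_ * _)%E.
    rewrite (@ge0_integral_density _ _ _ (l p.1) _ (\1_B))//.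
    - rewrite [RHS]integral_mkcond; apply: eq_integral => y _.
      rewrite patchE indicE; case: ifPn => _; by rewrite ?mule1 ?mule0.
    - by move=> A mA; rewrite integral_indic// setIC.
  have gb y : `|g (y, p.2)| <= M by exact: gM.
  have ig := bounded_integrable_on mB lBp (mgz p.2) gb.
  have iM : (l p.1).-integrable B (EFin \o cst M) by exact: (@bounded_integrable_on _ _ _ _ _ _ `|M|).
  rewrite Ek fineM//; last first.
    by have := integrable_fin_num mB (integrableD mB ig iM); under eq_integral do rewrite -EFinD.
  have -> : fine (\int[l p.1]_(y in B) (g (y, p.2) + M)%:E) = \int[l p.1]_(y in B) (g (y, p.2) + M) by [].
  rewrite RintegralD// Rintegral_cst// mulVKf; last by rewrite gt_eqF// ltr_wpDr.
  by rewrite addrK.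
under eq_fun do rewrite E.
have mm : measurable_fun setT (fun p : X * Z => mass p.1).
  by apply: (measurableT_comp measurable_mass); exact: measurable_fst.
apply: measurable_funB; last exact: measurable_funM.
apply: measurable_funM; first exact: measurable_funD.
by apply: (@measurableT_comp _ _ _ _ _ _ fine); first exact: fine_measurable.
Qed.

End parametric_integral.

Section unit_law.
Context {R : realType} {d : nat}.
Local Notation lambda := (lebesgue_rV R d).

Let inv_vol_ge0 : 0 <= (fine (lambda (eball 1)))^-1.
Proof. by rewrite invr_ge0 fine_ge0. Qed.

(** The uniform law on the unit ball; the frequencies of the ball of radius a are a times a
    variable of this law. *)
Definition unit_law : set 'rV[R]_d -> \bar R :=
  mscale (NngNum inv_vol_ge0) (mrestr lambda (measurable_eball 1)).

HB.instance Definition _ := Measure.on unit_law.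

Lemma unit_lawE A : unit_law A = ((fine (lambda (eball 1)))^-1%:E * lambda (A `&` eball 1))%E.
Proof. by []. Qed.

Let unit_lawT : unit_law setT = 1%E.
Proof.
rewrite unit_lawE setTI -[X in (_ * X)%E]fineK; last first.
  by rewrite ge0_fin_numE// lebesgue_rV_eball_lty.
by rewrite -EFinM mulVf// gt_eqF// fine_eball1_gt0.
Qed.

HB.instance Definition _ := Measure_isProbability.Build _ _ _ unit_law unit_lawT.

Lemma measurable_preimage_scale (a : R) (C : set 'rV[R]_d) : measurable C ->
  measurable ((fun x => a *: x) @^-1` C).
Proof.
move=> mC; rewrite -[X in measurable X]setTI.
rewrite (_ : (fun x => a *: x) = (fun x => a *: x + 0)); last by apply/funext => x; rewrite addr0.
exact: measurable_rV_affine.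
Qed.

Lemma unit_law_scale (a : R) (C : set 'rV[R]_d) : 0 < a -> measurable C ->
  unit_law ((fun x => a *: x) @^-1` C) =
  (fine (lambda (C `&` eball a)) / fine (lambda (eball a)))%:E.
Proof.
move=> a0 mC; have mCa : measurable (C `&` eball a) by apply: measurableI => //; exact: measurable_eball.
have Coo : (lambda (C `&` eball a) < +oo)%E.
  by apply: le_lt_trans (lebesgue_rV_eball_lty a); apply: le_measure; rewrite ?inE//; exact: measurable_eball.
have mi : measurable_fun setT (EFin \o (\1_(C `&` eball a) : 'rV[R]_d -> R)).
  by apply/measurable_EFinP; exact: measurable_indic.
have i0 (t : 'rV[R]_d) : (0 <= (EFin \o (\1_(C `&` eball a) : 'rV[R]_d -> R)) t)%E by rewrite lee_fin.
have H := ge0_integral_rV_affine 0 a0 mi i0.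
rewrite [in RHS]integral_indic// setIT in H.
rewrite unit_lawE.
have -> : lambda ((fun x => a *: x) @^-1` C `&` eball 1) = ((a ^- d)%:E * lambda (C `&` eball a))%E.
  rewrite -H -integral_indic//; last first.
  - exact: measurable_preimage_scale.
  - exact: measurable_eball.
  rewrite [LHS]integral_mkcond; apply: eq_integral => x _.
  have -> : (EFin \o \1_(C `&` eball a)) (a *: x + 0) =
      (((x \in (fun x => a *: x) @^-1` C) && (x \in eball 1))%:R : R)%:E.
    rewrite /= addr0 indicE; congr ((nat_of_bool _)%:R%:E).
    have [H1 H2] := eballZ 1 (a *: x) a0; rewrite scalerA mulVf ?gt_eqF// scale1r mulr1 in H1 H2.
    apply/idP/idP => [|/andP[]]; rewrite !inE; last by move=> ? ?; split=> //; exact: H1.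
    by move=> [? ?]; apply/andP; rewrite !inE; split=> //; exact: H2.
  by rewrite patchE; case: (x \in eball 1); rewrite ?andbT ?andbF.
rewrite [in RHS]lebesgue_eballE// -[X in (_ * (_ * X))%E]fineK ?ge0_fin_numE// -!EFinM; congr EFin.
by rewrite invfM mulrA [LHS]mulrC; congr (_ * _); exact: mulrC.
Qed.

End unit_law.

Section conditioning.
Context {R : realType} {d : nat} {dO : measure_display} {Omega : measurableType dO}.
Variables (P : probability Omega R) (eta : R.-ker Omega ~> 'rV[R]_d).

(** The sigma-algebra on Omega generated by the point process. Independence of the
    frequencies from the process is an identity on these events only, so the periodogram has
    to be shown measurable with respect to them. *)
Definition eta_events : set (set Omega) :=
  [set A | exists2 E, configuration_events E & A = [set w | E (eta w)]].

Lemma eta_events_sigma_algebra : sigma_algebra setT eta_events.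
Proof.
split.
- by exists set0 => //; exact: sigma_algebra0.
- move=> _ [E HE ->]; exists (setT `\` E); first exact: sigma_algebraCD.
  by rewrite !setTD.
- move=> F HF; pose E n := sval (cid2 (HF n)).
  exists (\bigcup_n E n).
    by apply: sigma_algebra_bigcup => n; rewrite /E; case: cid2.
  apply/seteqP; split=> w [n _ Fnw]; exists n => //; move: Fnw; rewrite /E; case: cid2 => /= ? _ ->//.
Qed.

Lemma measurable_configuration_event E : configuration_events E -> measurable [set w | E (eta w)].
Proof.
rewrite /configuration_events => HE.
suff : <<s [set E | exists (B : set 'rV[R]_d) (Y : set (\bar R)),
        [/\ measurable B, measurable Y & E = [set mu : {measure set 'rV[R]_d -> \bar R} | Y (mu B)]]] >>
   `<=` [set E | measurable [set w | E (eta w)]] by apply.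
apply: smallest_sub.
  split => /=.
  - by rewrite (_ : [set w | _] = set0)//.
  - move=> A mA; rewrite (_ : [set w | _] = ~` [set w | A (eta w)]); first exact: measurableC.
    by apply/seteqP; split=> w //= [].
  - move=> F mF; rewrite (_ : [set w | _] = \bigcup_n [set w | F n (eta w)]).
      exact: bigcup_measurable.
    by [].
move=> _ [B [Y [mB mY ->]]] /=.
have H := measurable_kernel eta B mB measurableT Y mY.
by rewrite -[X in measurable X]setTI.
Qed.

Definition eta_space := g_sigma_algebraType eta_events.

Definition to_eta_space (w : Omega) : eta_space := w.

Lemma measurable_eta_spaceP (A : set eta_space) : measurable A -> eta_events A.
Proof.
by move=> mA; rewrite -(sigma_algebra_id eta_events_sigma_algebra).
Qed.

Lemma measurable_to_eta_space : measurable_fun setT to_eta_space.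
Proof.
move=> _ A /measurable_eta_spaceP[E HE ->]; rewrite setTI.
exact: measurable_configuration_event.
Qed.

Definition eta_law := pushforward P to_eta_space.

Let eta_measure : {measure set _ -> \bar R} :=
  measure_function_pushforward__canonical__measure_function_Measure P measurable_to_eta_space.

Let eta_law0 : eta_law set0 = 0%E.
Proof. exact: (measure0 eta_measure). Qed.

Let eta_law_ge0 A : (0 <= eta_law A)%E.
Proof. exact: (measure_ge0 eta_measure). Qed.

Let eta_law_additive : semi_sigma_additive eta_law.
Proof. exact: (@measure_semi_sigma_additive _ _ _ eta_measure). Qed.

HB.instance Definition _ := isMeasure.Build _ _ _ eta_law eta_law0 eta_law_ge0 eta_law_additive.

Let eta_lawT : eta_law setT = 1%E.
Proof. exact: probability_setT. Qed.

HB.instance Definition _ := Measure_isProbability.Build _ _ _ eta_law eta_lawT.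

Lemma measurable_eta_kernel U : measurable U -> measurable_fun setT (fun w : eta_space => eta w U).
Proof.
move=> mU _ Y mY; rewrite setTI; apply: sub_sigma_algebra.
by exists [set mu : {measure set 'rV[R]_d -> \bar R} | Y (mu U)] => //; apply: sub_sigma_algebra; exists U, Y.
Qed.


Section frequencies.
Variables (m : nat) (U : bool -> 'I_m -> {RV P >-> 'rV[R]_d}).

Definition index_bool (i : 'I_(m + m)) : bool * 'I_m :=
  match fintype.split i with inl j => (false, j) | inr j => (true, j) end.

(** The two families of frequencies as one tuple: the indices below m belong to the radius r
    and the others to kappa r. *)
Definition freq_tuple (w : Omega) : (m + m).-tuple 'rV[R]_d :=
  [tuple U (index_bool i).1 (index_bool i).2 w | i < m + m].

Lemma measurable_freq_tuple : measurable_fun setT freq_tuple.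
Proof.
apply/measurable_fun_tnthP => i.
rewrite (_ : _ \o _ = U (index_bool i).1 (index_bool i).2); first exact: measurable_funPT.
by apply/funext => w /=; rewrite tnth_mktuple.
Qed.


Definition freq_law := pushforward P freq_tuple.

Let freq_measure : {measure set _ -> \bar R} :=
  measure_function_pushforward__canonical__measure_function_Measure P measurable_freq_tuple.

Let freq_law0 : freq_law set0 = 0%E.
Proof. exact: (measure0 freq_measure). Qed.

Let freq_law_ge0 A : (0 <= freq_law A)%E.
Proof. exact: (measure_ge0 freq_measure). Qed.

Let freq_law_additive : semi_sigma_additive freq_law.
Proof. exact: (@measure_semi_sigma_additive _ _ _ freq_measure). Qed.

HB.instance Definition _ := isMeasure.Build _ _ _ freq_law freq_law0 freq_law_ge0 freq_law_additive.

Let freq_lawT : freq_law setT = 1%E.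
Proof. exact: probability_setT. Qed.

HB.instance Definition _ := Measure_isProbability.Build _ _ _ freq_law freq_lawT.

Variables (kappa r : R).
Hypothesis U_freq : random_frequencies eta kappa r U.

Lemma indep_rect A (C : 'I_(m + m) -> set 'rV[R]_d) : eta_events A -> (forall i, measurable (C i)) ->
  P (A `&` freq_tuple @^-1` [set t | forall i, C i (tnth t i)]) =
  (P A * \prod_(i < m + m) P (U (index_bool i).1 (index_bool i).2 @^-1` C i))%E.
Proof.
move=> [E HE ->] mC; have [_ H] := U_freq.
pose C' a j := C (if a then rshift m j else lshift m j).
have := H E C' HE (fun a j => mC _).
rewrite big_bool /= big_split_ord /= muleC => H2.
have I1 j : index_bool (lshift m j) = (false, j) by rewrite /index_bool -[lshift m j]/(unsplit (inl j)) unsplitK.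
have I2 j : index_bool (rshift m j) = (true, j) by rewrite /index_bool -[rshift m j]/(unsplit (inr j)) unsplitK.
under [X in (_ * (X * _))%E]eq_bigr do rewrite I1.
under [X in (_ * (_ * X))%E]eq_bigr do rewrite I2.
rewrite [X in (_ * X)%E]muleC [RHS]muleC -H2; congr (P _).
apply/seteqP; split=> w /= [Ew Cw]; split=> //.
  move=> a j; rewrite /C'; have := Cw (if a then rshift m j else lshift m j).
  by rewrite tnth_mktuple; case: a; rewrite ?I1 ?I2.
move=> i; rewrite tnth_mktuple; case: (split_ordP i) => j ->; rewrite ?I1 ?I2 /=.
  exact: (Cw false j).
exact: (Cw true j).
Qed.

Lemma freq_law_rect (C : 'I_(m + m) -> set 'rV[R]_d) : (forall i, measurable (C i)) ->
  freq_law [set t | forall i, C i (tnth t i)] =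
  (\prod_(i < m + m) P (U (index_bool i).1 (index_bool i).2 @^-1` C i))%E.
Proof.
move=> mC; have := @indep_rect setT C _ mC; rewrite setTI probability_setT mul1e; apply.
exists setT => //; rewrite -(setD0 setT); apply: sigma_algebraCD; exact: sigma_algebra0.
Qed.

(** Both sides are finite measures in B and agree on rectangles. *)
Lemma indep_event A B : eta_events A -> measurable B ->
  P (A `&` freq_tuple @^-1` B) = (P A * freq_law B)%E.
Proof.
move=> HA; have mA : measurable A by case: HA => E HE ->; exact: measurable_configuration_event.
pose m1 := measure_function_pushforward__canonical__measure_function_Measure (mrestr P mA) measurable_freq_tuple.
have c0 : 0 <= fine (P A) by exact: fine_ge0.
pose m2 := mscale (NngNum c0) freq_law : {measure set _ -> \bar R}.
have PA : (fine (P A))%:E = P A by rewrite fineK// fin_num_measure.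
have E1 X : m1 X = P (A `&` freq_tuple @^-1` X) by exact: (congr1 P (setIC _ _)).
have E2 X : m2 X = (P A * freq_law X)%E by exact: (congr1 (fun z => z * freq_law X)%E PA).
move=> mB; rewrite -E1 -E2; apply: tuple_measure_unique => //.
  by rewrite E1 preimage_setT setIT; exact: le_lt_trans (probability_le1 P mA) (ltry 1).
by move=> C mC; rewrite E1 E2 indep_rect// -freq_law_rect.
Qed.

(** By independence, the joint law of the configuration and the frequencies is a product
    law, so the frequencies can be frozen: this is where the limit at deterministic
    frequencies becomes usable for random ones. *)
Lemma conditioning (F : (eta_space * (m + m).-tuple 'rV[R]_d)%type -> \bar R) :
  measurable_fun setT F -> (forall p, (0 <= F p)%E) ->
  (\int[P]_w F (w, freq_tuple w) = \int[freq_law]_u \int[P]_w F (w, u))%E.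
Proof.
move=> mF F0.
pose J (w : Omega) : (eta_space * (m + m).-tuple 'rV[R]_d)%type := (to_eta_space w, freq_tuple w).
have mJ : measurable_fun setT J by apply: measurable_fun_pair; [exact: measurable_to_eta_space|exact: measurable_freq_tuple].
pose j := measure_function_pushforward__canonical__measure_function_Measure P mJ.
have uniq X : measurable X -> (eta_law \x freq_law)%E X = j X.
  apply: product_measure_unique => A B mA mB.
  exact: (indep_event (measurable_eta_spaceP mA) mB).
transitivity (\int[j]_p F p)%E.
  by rewrite ge0_integral_pushforward.
transitivity (\int[(eta_law \x freq_law)%E]_p F p)%E.
  by apply: eq_measure_integral => A mA _; exact/esym/uniq.
rewrite fubini_tonelli2//; apply: eq_integral => u _.
rewrite /fubini_G ge0_integral_pushforward//; first exact: measurable_to_eta_space.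
by apply: (measurableT_comp mF); exact: measurable_fun_pair.
Qed.


Hypothesis r_gt0 : 0 < r.
Hypothesis kappa_gt0 : 0 < kappa.

Let radius (i : 'I_(m + m)) := array_radius kappa r (index_bool i).1.

Let radius_gt0 i : 0 < radius i.
Proof. by rewrite /radius /array_radius; case: ifP => // _; exact: mulr_gt0. Qed.

Lemma freq_law_rectE (C : 'I_(m + m) -> set 'rV[R]_d) : (forall i, measurable (C i)) ->
  freq_law [set t | forall i, C i (tnth t i)] =
  (\prod_(i < m + m) (fine (lebesgue_rV R d (C i `&` eball (radius i))) /
                      fine (lebesgue_rV R d (eball (radius i))))%:E)%E.
Proof.
move=> mC; rewrite freq_law_rect//; apply: eq_bigr => i _.
by have [-> //] := U_freq.
Qed.

(** The law of the frequencies is a multiple of the restriction of Lebesgue measure to a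
    product of balls. *)
Lemma freq_law_ac A : measurable A -> tuple_measure (lebesgue_rV R d) (m + m) A = 0%E ->
  freq_law A = 0%E.
Proof.
move=> mA A0; pose c i := (fine (lebesgue_rV R d (eball (radius i))))^-1.
pose Ball := [set t : (m + m).-tuple 'rV[R]_d | forall i, eball (radius i) (tnth t i)].
have mB : measurable Ball by apply: (@measurable_rect _ _ _ (fun i => eball (radius i))) => i; exact: measurable_eball.
have c0 : 0 <= \prod_i c i by apply: prodr_ge0 => i _; rewrite invr_ge0 fine_ge0.
pose m2 := mscale (NngNum c0) (mrestr (tuple_measure (lebesgue_rV R d) (m + m)) mB).
have m2E X : m2 X = ((\prod_i c i)%:E * tuple_measure (lebesgue_rV R d) (m + m) (X `&` Ball))%E by [].
rewrite (@tuple_measure_unique _ _ _ _ (freq_law : {measure set _ -> \bar R}) m2 _ _ A mA).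
- have : mrestr (tuple_measure (lebesgue_rV R d) (m + m)) mB A = 0%E.
    by apply: (subset_measure0 _ mA _ A0) => //; exact: measurableI.
  by move=> E; exact: (eq_trans (congr1 (fun z => _ * z)%E E) (mule0 _)).
- exact: le_lt_trans (probability_le1 freq_law measurableT) (ltry 1).
- move=> C mC; apply: (eq_trans (freq_law_rectE mC)); apply: esym; apply: (eq_trans (m2E _)); apply: esym.
  rewrite (_ : _ `&` Ball = [set t | forall i, (fun i => C i `&` eball (radius i)) i (tnth t i)]); last first.
    apply/seteqP; split=> t /=; first by move=> [H1 H2] i; split; [exact: H1|exact: H2].
    by move=> H; split=> i; have [] := H i.
  rewrite (@tuple_measure_rect _ _ _ _ _ (fun i => C i `&` eball (radius i))); last first.
    by move=> i; apply: measurableI => //; exact: measurable_eball.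
  rewrite -prodEFin -big_split /=; apply: eq_bigr => i _.
  rewrite EFinM muleC fineK// ge0_fin_numE//.
  apply: le_lt_trans (lebesgue_rV_eball_lty (radius i)); apply: le_measure; rewrite ?inE//.
  - by apply: measurableI => //; exact: measurable_eball.
  - exact: measurable_eball.
Qed.

Definition scale_tuple (t : (m + m).-tuple 'rV[R]_d) : (m + m).-tuple 'rV[R]_d :=
  [tuple radius i *: tnth t i | i < m + m].

Lemma measurable_scale_tuple : measurable_fun setT scale_tuple.
Proof.
apply/measurable_fun_tnthP => i.
rewrite (_ : _ \o _ = (fun x => radius i *: x + 0) \o (fun t => tnth t i)).
  by apply: measurableT_comp; [exact: measurable_rV_affine|exact: measurable_tnth].
by apply/funext => w /=; rewrite tnth_mktuple addr0.
Qed.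

(** Writing each frequency as a multiple of a uniform point of the unit ball makes all of
    them identically distributed. *)
Lemma integral_freq_law (F : (m + m).-tuple 'rV[R]_d -> \bar R) : measurable_fun setT F ->
  (forall t, (0 <= F t)%E) ->
  (\int[freq_law]_u F u = \int[iid (@unit_law R d) (m + m)]_t F (scale_tuple t))%E.
Proof.
move=> mF F0.
pose j := measure_function_pushforward__canonical__measure_function_Measure
  (iid (@unit_law R d) (m + m)) measurable_scale_tuple.
transitivity (\int[j]_u F u)%E; last by rewrite ge0_integral_pushforward//; exact: measurable_scale_tuple.
apply: eq_measure_integral => A mA _; apply: tuple_measure_unique => //.
  exact: le_lt_trans (probability_le1 freq_law measurableT) (ltry 1).
move=> C mC; apply: (eq_trans (freq_law_rectE mC)).
rewrite [RHS](_ : _ = tuple_measure (@unit_law R d) (m + m)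
    [set t | forall i, (fun i => (fun x => radius i *: x) @^-1` C i) i (tnth t i)]); last first.
  congr (tuple_measure _ _ _); apply/seteqP; split=> t /= H i; have := H i; by rewrite tnth_mktuple.
apply: esym; apply: (eq_trans (@tuple_measure_rect _ _ _ _ _ (fun i => (fun x => radius i *: x) @^-1` C i) _)).
  by move=> i; exact: measurable_preimage_scale.
by apply: eq_bigr => i _; exact: unit_law_scale.
Qed.

End frequencies.

End conditioning.

Section joint_periodogram.
Context {R : realType} {d : nat} {dO : measure_display} {Omega : measurableType dO}.
Variables (eta : R.-ker Omega ~> 'rV[R]_d) (h : 'rV[R]_d -> R[i]).
Hypotheses (eta_pp : point_process eta) (h_test : test_function h).

Lemma measurable_dotr_pair : measurable_fun setT (fun q : ('rV[R]_d * 'rV[R]_d)%type => dotr q.1 q.2).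
Proof.
apply: measurable_sum => i; apply: measurable_funM.
  by apply: (measurableT_comp (measurable_coord i)); exact: measurable_fst.
by apply: (measurableT_comp (measurable_coord i)); exact: measurable_snd.
Qed.

Lemma measurable_waves T (th th' : R) : 0 < T -> measurable_fun setT (fun q : ('rV[R]_d * 'rV[R]_d)%type =>
  complex.Re (h (T^-1 *: q.1)) * cos (2 * pi * dotr q.1 q.2 + th) +
  complex.Im (h (T^-1 *: q.1)) * cos (2 * pi * dotr q.1 q.2 + th')).
Proof.
move=> T0; have [M _ bM] := Re_h_bsupp h_test; have [N _ bN] := Im_h_bsupp h_test.
have [m1 _ _] := bsupp_dilate T0 bM; have [m2 _ _] := bsupp_dilate T0 bN.
have mc (t : R) : measurable_fun setT (fun q : ('rV[R]_d * 'rV[R]_d)%type => cos (2 * pi * dotr q.1 q.2 + t)).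
  apply: (measurableT_comp (continuous_measurable_fun (@continuous_cos R))).
  by apply: measurable_funD => //; apply: measurable_funM => //; exact: measurable_dotr_pair.
apply: measurable_funD; apply: measurable_funM; try exact: mc.
- by apply: (measurableT_comp m1); exact: measurable_fst.
- by apply: (measurableT_comp m2); exact: measurable_fst.
Qed.

Lemma waves_bound T : exists M : R, forall x u (th th' : R),
  `|complex.Re (h (T^-1 *: x)) * cos (2 * pi * dotr x u + th) +
    complex.Im (h (T^-1 *: x)) * cos (2 * pi * dotr x u + th')| <= M.
Proof.
have [M _ [_ bM _]] := Re_h_bsupp h_test; have [N _ [_ bN _]] := Im_h_bsupp h_test.
exists (M + N) => x u th th'; apply: le_trans (ler_normD _ _) _; rewrite !normrM lerD//.
  by rewrite (le_trans _ (bM (T^-1 *: x)))// ler_piMr// abs_cos_le1.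
by rewrite (le_trans _ (bN (T^-1 *: x)))// ler_piMr// abs_cos_le1.
Qed.

Lemma measurable_joint_waves T (th th' : R) : 0 < T -> measurable_fun setT (fun p : (eta_space eta * 'rV[R]_d)%type =>
  \int[eta p.1]_(x in eball T) (complex.Re (h (T^-1 *: x)) * cos (2 * pi * dotr x p.2 + th) +
    complex.Im (h (T^-1 *: x)) * cos (2 * pi * dotr x p.2 + th'))).
Proof.
move=> T0; have [M HM] := waves_bound T.
exact: (@measurable_parametric_integral _ _ _ (eta_space eta) _ _ R (fun w => eta w) (eball T)
  (@measurable_eta_kernel _ _ _ _ eta) (measurable_eball T) (fun w => eta_eball_lty eta_pp w T) _ M
  (measurable_waves th th' T0) (fun q => HM q.1 q.2 th th')).
Qed.

(** The periodogram at a fixed frequency is a function of the configuration, and at a fixed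
    configuration a function of the frequency; joint measurability is an instance of
    measurable_parametric_integral, because the windowed waves are bounded. *)
Lemma measurable_joint_periodogram T : 0 < T ->
  measurable_fun setT (fun p : (eta_space eta * 'rV[R]_d)%type => periodogram eta h T p.2 p.1).
Proof.
move=> T0.
have me : measurable_fun setT (fun p : (eta_space eta * 'rV[R]_d)%type => empirical_intensity eta T p.1).
  apply: measurable_funM => //; apply: (@measurableT_comp _ _ _ _ _ _ fine); first exact: fine_measurable.
  exact: (@measurableT_comp _ _ _ _ _ _ _ _ fst (@measurable_eta_kernel _ _ _ _ eta _ (measurable_eball T)) measurable_fst).
have e0 w : 0 <= empirical_intensity eta T w by rewrite divr_ge0// fine_ge0.
apply: measurable_fun_ifT.
- exact: measurable_fun_ltr.
- apply: measurable_funM; first by apply: measurable_funM => //; exact: measurable_pos_inv.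
  apply: measurable_funD; apply: measurable_funX.
    apply: eq_measurable_fun (measurable_joint_waves 0 (pi / 2) T0) => p _.
    by apply: eq_Rintegral => x _; rewrite -hreE.
  apply: eq_measurable_fun (measurable_joint_waves (- (pi / 2)) 0 T0) => p _.
  by apply: eq_Rintegral => x _; rewrite -himE.
- exact: measurable_cst.
Qed.

End joint_periodogram.

(** * Periodograms at fixed frequencies *)

Section clamp.
Context {R : realType}.

(** The projection onto [0, 1], in closed form so that its continuity is that of the
    absolute value. *)
Definition clamp (t : R) : R := (1 + `|t| - `|t - 1|) / 2.

Lemma clamp_continuous : continuous clamp.
Proof.
move=> t; apply: (@continuousM _ _ (fun t : R => 1 + `|t| - `|t - 1|) (fun=> 2^-1)); last exact: cst_continuous.
apply: continuousB.
  by apply: continuousD; [exact: cst_continuous|exact: norm_continuous].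
apply: (@continuous_comp _ _ _ (fun t : R => t - 1) (fun t : R => `|t|)); last exact: norm_continuous.
apply: (@continuousB _ _ _ (fun t : R => t) (fun=> 1)); first by move=> ?; exact: cvg_id.
exact: cst_continuous.
Qed.

Lemma clamp_ge0 t : 0 <= clamp t.
Proof. by rewrite /clamp; have := ler_normB t 1; rewrite normr1 => ?; lra. Qed.

Lemma clamp_le1 t : clamp t <= 1.
Proof. by rewrite /clamp; have := ler_normD (t - 1) 1; rewrite subrK normr1 => ?; lra. Qed.

Lemma clamp_norm t : `|clamp t| <= 1.
Proof. by rewrite ger0_norm ?clamp_ge0 ?clamp_le1. Qed.

Lemma clamp_eq0 t : t <= 0 -> clamp t = 0.
Proof. by move=> t0; rewrite /clamp (ler0_norm t0) ler0_norm; lra. Qed.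

Lemma clamp_eq1 t : 1 <= t -> clamp t = 1.
Proof. by move=> t0; rewrite /clamp ger0_norm ?(ger0_norm (_ : 0 <= t - 1)); lra. Qed.

End clamp.

Lemma row_continuous (R : realType) (T : topologicalType) n (f : T -> 'rV[R]_n) :
  (forall j, continuous (fun x => f x ord0 j)) -> continuous f.
Proof.
move=> cf x; apply/cvgrPdist_le => e e0.
have H : \forall t \near x, forall j, `|f x ord0 j - f t ord0 j| <= e.
  by apply: filter_forall => j; have /cvgrPdist_le/(_ _ e0) := cf j x.
apply: filterS H => t H; rewrite [leLHS]mx_normrE; apply/bigmax_leP; split; first exact: ltW.
by move=> [i j] _ /=; rewrite ord1 !mxE.
Qed.

Section slutsky.
Context {R : realType}.

(** Uniform continuity at the points of a compact box; the second point may lie outside. *)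
Lemma heine_box k (phi : 'rV[R]_k -> R) (K e : R) : continuous phi -> 0 < e ->
  exists2 dl : R, 0 < dl & forall x y, `|x| <= K -> `|x - y| < dl -> `|phi x - phi y| <= e.
Proof.
move=> cphi e0.
have e20 : 0 < e / 2 by rewrite divr_gt0.
pose Q (dl : R) (x : 'rV[R]_k) := forall y, `|x - y| < dl -> `|phi x - phi y| <= e.
have : \forall dl \near 0^'+, forall x, `|x| <= K -> Q dl x.
  apply: (proj1 (compact_near_coveringP _) (@box_compact R k K)) => x xK.
  have /cvgrPdist_le/(_ _ e20) := cphi x.
  rewrite -nbhs_ballE => -[dl /= dl0 Hdl].
  have d20 : 0 < dl / 2 by rewrite divr_gt0.
  exists (ball x (dl / 2), [set t | t < dl / 2]) => /=.
    split; first exact: nbhsx_ballx.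
    exact: nbhs_right_lt.
  move=> [x' t] [/= x'x tdl] y x'y.
  have xx' : ball x dl x' by apply: le_ball x'x; lra.
  have xy : ball x dl y.
    rewrite (_ : dl = dl / 2 + dl / 2); last by field.
    apply: ball_triangle x'x _; rewrite -ball_normE /=; lra.
  have := Hdl _ xx'; have := Hdl _ xy => /= H1 H2.
  rewrite (_ : phi x' - phi y = (phi x - phi y) - (phi x - phi x')); last by ring.
  apply: le_trans (ler_normB _ _) _; lra.
move=> H; have : \forall dl \near 0^'+, 0 < dl /\ forall x, `|x| <= K -> Q dl x.
  by near=> dl; split; [near: dl; exact: nbhs_right_gt|near: dl].
move=> /filter_ex[dl [dl0 Hdl]]; exists dl => // x y xK; exact: Hdl.
Unshelve. all: by end_near. Qed.

(** A continuous function that vanishes on the ball of radius K and is equal to 1 off the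
    ball of radius K + 1; testing convergence in law against it gives tightness. *)
Definition outside n (K : R) (z : 'rV[R]_n) : R := clamp (`|z| - K).

Lemma outside_continuous n K : continuous (@outside n K).
Proof.
move=> z; apply: (@continuous_comp _ _ _ (fun z : 'rV[R]_n => `|z| - K) clamp); last exact: clamp_continuous.
by apply: continuousB; [exact: norm_continuous|exact: cst_continuous].
Qed.

Lemma measurable_outside n K : measurable_fun setT (@outside n K).
Proof. by apply: continuous_rV_measurable; exact: outside_continuous. Qed.

Lemma outside_ge0 n K z : 0 <= @outside n K z.
Proof. exact: clamp_ge0. Qed.

Lemma outside_le1 n K z : @outside n K z <= 1.
Proof. exact: clamp_le1. Qed.

Lemma outside_eq1 n K z : K + 1 <= `|z| -> @outside n K z = 1.
Proof. by move=> H; apply: clamp_eq1; lra. Qed.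

Lemma outside_eq0 n K z : `|z| <= K -> @outside n K z = 0.
Proof. by move=> H; apply: clamp_eq0; lra. Qed.

Context dO (Omega : measurableType dO) (P : probability Omega R)
  dO' (Omega' : measurableType dO') (Q : probability Omega' R) (n : nat)
  (Z : R -> Omega -> 'rV[R]_n) (G : Omega' -> 'rV[R]_n)
  (phi : 'rV[R]_n -> R) (X : R -> Omega -> R) (C : R).
Hypotheses (mZ : \forall T \near +oo, measurable_fun setT (Z T)) (mG : measurable_fun setT G)
  (mX : \forall T \near +oo, measurable_fun setT (X T)) (XC : forall T w, `|X T w| <= C)
  (phi_cont : continuous phi) (phiC : forall z, `|phi z| <= C)
  (Z_cvg : cvg_in_distribution P Z Q G).

Lemma tight e : 0 < e -> exists K : R, \int[Q]_t outside K (G t) <= e.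
Proof.
move=> e0.
have H : \int[Q]_t outside k%:R (G t) @[k --> \oo] --> \int[Q]_t (0 : R).
  apply: (@Rintegral_dct _ _ _ Q _ _ (cst 1)).
  - move=> k; by apply: (measurableT_comp _ mG); exact: measurable_outside.
  - move=> t; apply: (@cvg_near_cst _ _ _ _ _ _).
    near=> k; apply: outside_eq0; near: k; exact: nbhs_infty_ger.
  - exact: (prob_cst_integrable Q 1).
  - by move=> k t; rewrite ger0_norm ?outside_ge0 ?outside_le1.
rewrite (_ : \int[Q]_t (0 : R) = 0) in H; last by rewrite /Rintegral integral0.
have /cvgrPdist_le/(_ _ e0)[k _ /(_ k (leqnn k))] := H.
rewrite sub0r normrN ger0_norm; last by apply: Rintegral_ge0 => t _; exact: outside_ge0.
by move=> Hk; exists k%:R.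
Unshelve. all: by end_near. Qed.

(** The variables X T are not functions of the Z T, but are uniformly close to phi (Z T)
    outside events of small probability, as long as Z T stays in a bounded set. Tightness of
    the limit law, transported to Z T by the test function outside, bounds the contribution
    of the complement. *)
Lemma slutsky : (forall K e : R, 0 < e -> exists A : R -> set Omega,
    [/\ forall T, measurable (A T), fine (P (A T)) @[T --> +oo] --> 0 &
     \forall T \near +oo, forall w, ~ A T w -> `|Z T w| <= K -> `|X T w - phi (Z T w)| <= e]) ->
  \int[P]_w X T w @[T --> +oo] --> \int[Q]_t phi (G t).
Proof.
move=> H; apply/cvgrPdist_le => e e0.
have C0 : 0 <= C := le_trans (normr_ge0 _) (phiC 0).
pose e' := e / (2 + 8 * C).
have cc : 0 < 2 + 8 * C by lra.
have e'0 : 0 < e' by rewrite divr_gt0.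
have e'E : e' * (2 + 8 * C) = e by rewrite divfK// gt_eqF.
have [K HK] := tight e'0.
have [A [mA PA HA]] := H (K + 1) e' e'0.
have /cvgrPdist_le/(_ _ e'0) Zphi := Z_cvg phi_cont (ex_intro _ C phiC).
have obd : exists D : R, forall z, `|@outside n K z| <= D by exists 1 => z; rewrite ger0_norm ?outside_ge0 ?outside_le1.
have /cvgrPdist_le/(_ _ e'0) Zout := Z_cvg (@outside_continuous n K) obd.
have /cvgrPdist_le/(_ _ e'0) PA' := PA.
near=> T.
have mXT : measurable_fun setT (X T) by near: T.
have mZT : measurable_fun setT (Z T) by near: T.
have mphi : measurable_fun setT phi by exact: continuous_rV_measurable.
have iX : P.-integrable setT (EFin \o X T) by apply: prob_bounded_integrable => //; exact: XC.
have iphi : P.-integrable setT (EFin \o (fun w => phi (Z T w))).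
  by apply: (@prob_bounded_integrable _ _ _ _ _ C) => //; exact: (measurableT_comp mphi).
have mout : measurable_fun setT (fun w => outside K (Z T w)).
  by apply: (measurableT_comp _ mZT); exact: measurable_outside.
have iout : P.-integrable setT (EFin \o (fun w => outside K (Z T w))).
  by apply: (@prob_bounded_integrable _ _ _ _ _ 1) => // w; rewrite ger0_norm ?outside_ge0 ?outside_le1.
have iA : P.-integrable setT (EFin \o (\1_(A T) : Omega -> R)).
  by apply: indic_integrable => //; exact: le_lt_trans (probability_le1 P (mA T)) (ltry 1).
pose B w := e' + 2 * C * (\1_(A T) w + outside K (Z T w)).
have iAo : P.-integrable setT (EFin \o (fun w => \1_(A T) w + outside K (Z T w))).
  by have := integrableD measurableT iA iout.
have iB2 : P.-integrable setT (EFin \o (fun w => 2 * C * (\1_(A T) w + outside K (Z T w)))).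
  by under [X in _.-integrable _ X]eq_fun do rewrite /= EFinM; exact: integrableZl.
have iB : P.-integrable setT (EFin \o B) by have := integrableD measurableT (prob_cst_integrable P e') iB2.
have bound w : `|X T w - phi (Z T w)| <= B w.
  have o0 := outside_ge0 K (Z T w); rewrite /B indicE.
  case: (boolP (w \in A T)) => wA /=.
    have := ler_normB (X T w) (phi (Z T w)); have := XC T w; have := phiC (Z T w).
    by have : 0 <= C * outside K (Z T w); [rewrite mulr_ge0|move=> ? ? ? ?; lra].
  have [Zk|Zk] := leP `|Z T w| (K + 1).
    apply: (@le_trans _ _ e').
      have HT : forall w, ~ A T w -> `|Z T w| <= K + 1 -> `|X T w - phi (Z T w)| <= e' by near: T.
      by apply: HT => //; rewrite notin_setE in wA.
    by rewrite lerDl; apply: mulr_ge0; [exact: mulr_ge0|rewrite add0r].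
  have := ler_normB (X T w) (phi (Z T w)); have := XC T w; have := phiC (Z T w).
  by rewrite outside_eq1 ?(ltW Zk)// => ? ? ?; lra.
have intB : \int[P]_w B w = e' + 2 * C * (fine (P (A T)) + \int[P]_w outside K (Z T w)).
  rewrite /B RintegralD//; last exact: (prob_cst_integrable P e').
  rewrite RintegralZl// RintegralD// Rintegral_prob_cst; congr (_ + _ * (_ + _)).
  by rewrite /Rintegral integral_indic// setIT.
have PAT : fine (P (A T)) <= e'.
  have : `|0 - fine (P (A T))| <= e' by near: T; exact: PA'.
  by rewrite sub0r normrN ger0_norm ?fine_prob_ge0.
have outT : \int[P]_w outside K (Z T w) <= 2 * e'.
  have : `|\int[Q]_t outside K (G t) - \int[P]_w outside K (Z T w)| <= e' by near: T; exact: Zout.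
  rewrite ler_norml => /andP[+ _]; lra.
have phiT : `|\int[Q]_t phi (G t) - \int[P]_w phi (Z T w)| <= e' by near: T; exact: Zphi.
have XT : `|\int[P]_w phi (Z T w) - \int[P]_w X T w| <= e' + 6 * C * e'.
  rewrite distrC -RintegralB//.
  have iXp := integrableB measurableT iX iphi.
  apply: le_trans (le_normr_Rintegral measurableT iXp) _.
  apply: (@le_trans _ _ (\int[P]_w B w)).
    have iaX : P.-integrable setT (EFin \o (fun w => `|X T w - phi (Z T w)|)) := integrable_abse iXp.
    exact: le_Rintegral measurableT iaX iB (fun w _ => bound w).
  rewrite intB lerD2l -mulrA (_ : 6 * C * e' = 2 * C * (3 * e')); last by ring.
  by rewrite mulrA ler_wpM2l ?mulr_ge0//; lra.
rewrite -(subrKA (\int[P]_w phi (Z T w))); apply: le_trans (ler_normD _ _) _.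
have Ce' : 0 <= C * e' by rewrite mulr_ge0// ltW.
rewrite -e'E; nra.
Unshelve. all: by end_near. Qed.

End slutsky.

Section frequency_limit.
Context {R : realType} {d : nat} {dO : measure_display} {Omega : measurableType dO}.
Variables (P : probability Omega R) (eta : R.-ker Omega ~> 'rV[R]_d) (h : 'rV[R]_d -> R[i]).
Variables (rho : R) (S : 'rV[R]_d -> R).
Hypotheses (eta_pp : point_process eta) (h_test : test_function h) (rho_gt0 : 0 < rho)
  (mS : measurable_fun setT S) (S_ge0 : forall xi, 0 <= S xi)
  (lln : forall e : R, 0 < e ->
    fine (P [set w | e <= `|empirical_intensity eta T w - rho|]) @[T --> +oo] --> 0).

Definition fsums n T (u : n.-tuple 'rV[R]_d) (w : Omega) : 'rV[R]_(n + n) :=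
  complex_row (fun j => scaled_sum eta rho h T (tnth u j) w).

Definition periodograms n T (u : n.-tuple 'rV[R]_d) (w : Omega) : 'rV[R]_n :=
  \row_j periodogram eta h T (tnth u j) w.

(** The limit of the periodograms as a function of the limit of the exponential sums. *)
Definition powers n (z : 'rV[R]_(n + n)) : 'rV[R]_n :=
  \row_j (rho^-1 * (z ord0 (lshift n j) ^+ 2 + z ord0 (rshift n j) ^+ 2)).

Lemma measurable_fsums n T u : 0 < T -> measurable_fun setT (@fsums n T u).
Proof.
move=> T0.
have mw th th' j : measurable_fun setT (fun w : Omega =>
  \int[eta w]_(x in eball T) (complex.Re (h (T^-1 *: x)) * cos (2 * pi * dotr x (tnth u j) + th) +
    complex.Im (h (T^-1 *: x)) * cos (2 * pi * dotr x (tnth u j) + th'))).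
  apply: (measurableT_comp (measurable_joint_waves eta_pp h_test th th' T0) (g := fun w : Omega => (w : eta_space eta, tnth u j))).
  by apply: measurable_fun_pair; [exact: measurable_to_eta_space|exact: measurable_cst].
have re_ j : measurable_fun setT (fun w => complex.Re (scaled_sum eta rho h T (tnth u j) w)).
  rewrite (_ : (fun w => _) = (fun w => T `^ (- (d%:R / 2)) * \int[eta w]_x hre h T (tnth u j) x - drift_re h rho T (tnth u j))).
    apply: measurable_funB => //; apply: measurable_funM => //.
    apply: eq_measurable_fun (mw 0 (pi / 2) j) => w _.
    rewrite -(@Rintegral_support _ _ _ _ (eball T)); last by move=> x; exact: hre_out.
    by apply: eq_Rintegral => x _; rewrite hreE.
  by apply/funext => w; rewrite -(@scaled_sum_Re _ _ h _ _ eta rho) addrK.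
have im_ j : measurable_fun setT (fun w => complex.Im (scaled_sum eta rho h T (tnth u j) w)).
  rewrite (_ : (fun w => _) = (fun w => T `^ (- (d%:R / 2)) * \int[eta w]_x him h T (tnth u j) x - drift_im h rho T (tnth u j))).
    apply: measurable_funB => //; apply: measurable_funM => //.
    apply: eq_measurable_fun (mw (- (pi / 2)) 0 j) => w _.
    rewrite -(@Rintegral_support _ _ _ _ (eball T)); last by move=> x; exact: him_out.
    by apply: eq_Rintegral => x _; rewrite himE.
  by apply/funext => w; rewrite -(@scaled_sum_Im _ _ h _ _ eta rho) addrK.
apply: measurable_fun_rVP => i; case: (split_ordP i) => j ->.
  by under eq_fun do rewrite row_mxEl mxE; exact: re_.
by under eq_fun do rewrite row_mxEr mxE; exact: im_.
Qed.

Lemma powers_continuous n : continuous (@powers n).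
Proof.
apply: row_continuous => j.
have -> : (fun z => @powers n z ord0 j) = (fun z : 'rV[R]_(n + n) => rho^-1 * (z ord0 (lshift n j) ^+ 2 + z ord0 (rshift n j) ^+ 2)).
  by apply/funext => z; rewrite mxE.
move=> z; apply: (@continuousM _ _ (fun=> rho^-1) (fun z : 'rV[R]_(n + n) => z ord0 (lshift n j) ^+ 2 + z ord0 (rshift n j) ^+ 2)).
  exact: cst_continuous.
apply: (@continuousD _ _ _ (fun z : 'rV[R]_(n + n) => z ord0 (lshift n j) ^+ 2) (fun z : 'rV[R]_(n + n) => z ord0 (rshift n j) ^+ 2)).
  apply: (@continuous_comp _ _ _ (fun z : 'rV[R]_(n + n) => z ord0 (lshift n j)) (fun t => t ^+ 2)).
    exact: coord_continuous.
  exact: exprn_continuous.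
apply: (@continuous_comp _ _ _ (fun z : 'rV[R]_(n + n) => z ord0 (rshift n j)) (fun t => t ^+ 2)).
  exact: coord_continuous.
exact: exprn_continuous.
Qed.

Lemma measurable_periodograms n T u : 0 < T -> measurable_fun setT (@periodograms n T u).
Proof.
move=> T0; apply: measurable_fun_rVP => j; under eq_fun do rewrite mxE.
apply: (measurableT_comp (measurable_joint_periodogram eta_pp h_test T0) (g := fun w : Omega => (w : eta_space eta, tnth u j))).
by apply: measurable_fun_pair; [exact: measurable_to_eta_space|exact: measurable_cst].
Qed.

(** An explicit modulus of continuity for the map that sends an exponential sum a + i b, its
    drift a1 + i b1 and the empirical intensity e to the periodogram. *)
Lemma periodogram_close (K dl a b a1 b1 e : R) : 0 < rho -> 0 <= K -> 0 < dl -> dl <= 1 -> dl <= rho / 2 ->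
  `|a| <= K -> `|b| <= K -> `|a1| <= dl -> `|b1| <= dl -> `|e - rho| < dl ->
  `|rho^-1 * (a ^+ 2 + b ^+ 2) - e^-1 * ((a + a1) ^+ 2 + (b + b1) ^+ 2)| <=
  dl * (4 * K ^+ 2 / rho ^+ 2 + 4 * (2 * K + 1) / rho).
Proof.
move=> r0 K0 d0 d1 d2 aK bK a1d b1d ed.
have e2 : rho / 2 <= e by move: ed; rewrite ltr_norml => /andP[? ?]; lra.
have e0 : 0 < e by apply: lt_le_trans e2; rewrite divr_gt0.
have sq (x y : R) : `|x| <= K -> `|y| <= dl -> `|x ^+ 2 - (x + y) ^+ 2| <= dl * (2 * K + 1).
  move=> xK yd; rewrite (_ : _ - _ = - (y * (2 * x + y))); last by ring.
  rewrite normrN normrM ler_pM//; apply: le_trans (ler_normD _ _) _.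
  by rewrite normrM (@ger0_norm _ 2)//; lra.
have sK (x : R) : `|x| <= K -> x ^+ 2 <= K ^+ 2.
  by move=> xK; rewrite -real_normK ?num_real// lerXn2r ?nnegrE.
have -> : rho^-1 * (a ^+ 2 + b ^+ 2) - e^-1 * ((a + a1) ^+ 2 + (b + b1) ^+ 2) =
    (rho^-1 - e^-1) * (a ^+ 2 + b ^+ 2) +
    e^-1 * ((a ^+ 2 - (a + a1) ^+ 2) + (b ^+ 2 - (b + b1) ^+ 2)) by ring.
rewrite [leRHS]mulrDr; apply: le_trans (ler_normD _ _) _; apply: lerD; rewrite normrM.
  have -> : rho^-1 - e^-1 = (e - rho) / (e * rho) by field; rewrite !gt_eqF.
  rewrite (_ : dl * (4 * K ^+ 2 / rho ^+ 2) = (dl * (2 / rho ^+ 2)) * (2 * K ^+ 2)); last by ring.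
  rewrite ler_pM//; last by rewrite ger0_norm ?addr_ge0 ?sqr_ge0//; have := sK a aK; have := sK b bK; lra.
  have er0 : 0 < e * rho by rewrite mulr_gt0.
  rewrite normrM; apply: ler_pM => //; first exact: ltW.
  rewrite gtr0_norm ?invr_gt0//.
  rewrite -[leLHS]div1r ler_pdivrMr// mulrAC ler_pdivlMr ?exprn_gt0// mul1r expr2.
  nra.
rewrite (_ : dl * (4 * (2 * K + 1) / rho) = (2 / rho) * (2 * (dl * (2 * K + 1)))); last by ring.
rewrite ler_pM//.
  rewrite gtr0_norm ?invr_gt0// -[leLHS]div1r ler_pdivrMr// mulrAC ler_pdivlMr// mul1r; lra.
apply: le_trans (ler_normD _ _) _.
by have := sq a a1 aK a1d; have := sq b b1 bK b1d; lra.
Qed.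

Lemma powersE n (z : 'rV[R]_(n + n)) j :
  powers z ord0 j = rho^-1 * (z ord0 (lshift n j) ^+ 2 + z ord0 (rshift n j) ^+ 2).
Proof. by rewrite mxE. Qed.

Lemma periodogramsE n T u w j : @periodograms n T u w ord0 j = periodogram eta h T (tnth u j) w.
Proof. by rewrite mxE. Qed.

Lemma fsums_l n T u w j : @fsums n T u w ord0 (lshift n j) = complex.Re (scaled_sum eta rho h T (tnth u j) w).
Proof. by rewrite /fsums /complex_row row_mxEl mxE. Qed.

Lemma fsums_r n T u w j : @fsums n T u w ord0 (rshift n j) = complex.Im (scaled_sum eta rho h T (tnth u j) w).
Proof. by rewrite /fsums /complex_row row_mxEr mxE. Qed.

(** The periodograms are continuous functions of the compensated sums, the drifts, which
    tend to 0, and the empirical intensity, which tends to rho. The power of a circular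
    Gaussian variable of second moment rho S (u) is rho S (u) times half the sum of the
    squares of two standard Gaussian variables. *)
Lemma frequency_limit n (u : n.-tuple 'rV[R]_d) (phi : 'rV[R]_n -> R) (C : R) :
  (forall i, tnth u i != 0) ->
  cvg_in_distribution P (fun T => fsums T u) (tuple_measure (normal_prob (0 : R) 1) (n + n))
    (circular_gaussian (fun j => rho * S (tnth u j))) ->
  continuous phi -> (forall v, `|phi v| <= C) ->
  \int[P]_w phi (periodograms T u w) @[T --> +oo] -->
  \int[iid (normal_prob (0 : R) 1) (n + n)]_t
    phi (\row_j (S (tnth u j) * ((tnth t (lshift n j) ^+ 2 + tnth t (rshift n j) ^+ 2) / 2))).
Proof.
move=> u0 cvgZ cphi phiC.
have cpp : continuous (phi \o @powers n).
  by move=> z; apply: continuous_comp; [exact: powers_continuous|exact: cphi].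
have v0 j : 0 <= rho * S (tnth u j) / 2 by rewrite divr_ge0// mulr_ge0// ltW.
have EG t : powers (circular_gaussian (fun j => rho * S (tnth u j)) t) =
    \row_j (S (tnth u j) * ((tnth t (lshift n j) ^+ 2 + tnth t (rshift n j) ^+ 2) / 2)).
  apply/rowP => j; rewrite [LHS]mxE [RHS]mxE /circular_gaussian /complex_row row_mxEl row_mxEr !mxE /=.
  rewrite !exprMn !sqr_sqrtr//; field; exact: lt0r_neq0.
under eq_Rintegral do rewrite -EG.
have mG : measurable_fun setT (@circular_gaussian R n (fun j => rho * S (tnth u j))).
  apply: measurable_fun_rVP => i; case: (split_ordP i) => j ->.
    under eq_fun do rewrite row_mxEl mxE /=; apply: measurable_funM => //; exact: measurable_tnth.
  under eq_fun do rewrite row_mxEr mxE /=; apply: measurable_funM => //; exact: measurable_tnth.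
have mphi : measurable_fun setT phi by exact: continuous_rV_measurable.
apply: (@slutsky _ _ _ P _ _ (iid (normal_prob (0 : R) 1) (n + n)) _ (fun T => fsums T u) _ (phi \o @powers n)
  (fun T w => phi (periodograms T u w)) C) => //.
- by near=> T; apply: measurable_fsums; near: T; exact: nbhs_pinfty_gt.
- near=> T; apply: (measurableT_comp mphi); apply: measurable_periodograms; near: T; exact: nbhs_pinfty_gt.
- by move=> z; exact: phiC.
move=> K' e e0; pose K := `|K'|.
have K0 : 0 <= K by rewrite normr_ge0.
have [dl dl0 Hdl] := heine_box (rho^-1 * (2 * K ^+ 2)) cphi e0.
pose c := 4 * K ^+ 2 / rho ^+ 2 + 4 * (2 * K + 1) / rho.
have c0 : 0 <= c.
  by rewrite addr_ge0// divr_ge0 ?mulr_ge0 ?sqr_ge0 ?addr_ge0 ?mulr_ge0 ?(ltW rho_gt0).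
pose et : R := Num.min (Num.min 1 (rho / 2)) (dl / (2 * (c + 1))).
have cc : 0 < 2 * (c + 1) by lra.
have et0 : 0 < et by rewrite !lt_min ltr01 !divr_gt0.
have et1 : et <= 1 by rewrite !ge_min lexx.
have et2 : et <= rho / 2 by rewrite !ge_min lexx orbT.
have et3 : et * c < dl.
  apply: (@le_lt_trans _ _ (dl / (2 * (c + 1)) * c)).
    by rewrite ler_wpM2r// ge_min lexx orbT.
  by rewrite mulrAC ltr_pdivrMr// ltr_pM2l//; lra.
exists (fun T => [set w | et <= `|empirical_intensity eta T w - rho|]); split.
- by move=> T; apply: measurable_norm_ge; apply: measurable_funB => //; exact: measurable_empirical.
- exact: lln.
have dr : \forall T \near +oo, forall j, `|drift_re h rho T (tnth u j)| <= et.
  apply: filter_forall => j; have /cvgr0Pnorm_le/(_ _ et0) := drift_re_cvg0 h_test rho (u0 j); exact.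
have di : \forall T \near +oo, forall j, `|drift_im h rho T (tnth u j)| <= et.
  apply: filter_forall => j; have /cvgr0Pnorm_le/(_ _ et0) := drift_im_cvg0 h_test rho (u0 j); exact.
near=> T => w /negP; rewrite -ltNge => wT ZK.
have T0 : 0 < T by near: T; exact: nbhs_pinfty_gt.
have drT : forall j, `|drift_re h rho T (tnth u j)| <= et by near: T.
have diT : forall j, `|drift_im h rho T (tnth u j)| <= et by near: T.
have {}ZK : `|fsums T u w| <= K by rewrite (le_trans ZK)// ler_norm.
have e1 : 0 < empirical_intensity eta T w.
  by move: wT; rewrite ltr_norml => /andP[? ?]; lra.
have re_K j : `|complex.Re (scaled_sum eta rho h T (tnth u j) w)| <= K.
  by apply: le_trans ZK; apply: le_trans (coord_le_norm _ (lshift n j)); rewrite fsums_l.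
have im_K j : `|complex.Im (scaled_sum eta rho h T (tnth u j) w)| <= K.
  by apply: le_trans ZK; apply: le_trans (coord_le_norm _ (rshift n j)); rewrite fsums_r.
have sK (x : R) : `|x| <= K -> x ^+ 2 <= K ^+ 2.
  by move=> xK; rewrite -real_normK ?num_real// lerXn2r ?nnegrE.
rewrite distrC /=; apply: Hdl.
  rewrite [leLHS]mx_normrE; apply/bigmax_leP; split.
    by rewrite mulr_ge0 ?invr_ge0 ?(ltW rho_gt0)// mulr_ge0// sqr_ge0.
  move=> [i j] _; rewrite [(i, j).1]ord1 [(i, j).2]/= powersE fsums_l fsums_r.
  rewrite ger0_norm; last by rewrite mulr_ge0 ?invr_ge0 ?(ltW rho_gt0)// addr_ge0// sqr_ge0.
  rewrite ler_wpM2l ?invr_ge0 ?(ltW rho_gt0)//.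
  by have := sK _ (re_K j); have := sK _ (im_K j); lra.
apply: le_lt_trans et3; rewrite [leLHS]mx_normrE; apply/bigmax_leP; split; first by rewrite mulr_ge0// ltW.
move=> [i j] _; rewrite [(i, j).1]ord1 [(i, j).2]/= mxE [X in _ + X]mxE powersE fsums_l fsums_r periodogramsE (periodogramE h_test rho _ T0 e1).
exact: periodogram_close.
Unshelve. all: by end_near. Qed.

End frequency_limit.

(** * Regrouping the coordinates of a product measure *)

Section regroup.
Context (R : realType).

Lemma integral_tuple0 dA (A : measurableType dA) (mu : {sigma_finite_measure set A -> \bar R})
    (F : 0.-tuple A -> \bar R) : measurable_fun setT F ->
  (\int[tuple_measure mu 0]_t F t = F [tuple])%E.
Proof.
by move=> mF; rewrite [LHS](integral_dirac _ measurableT mF) diracE in_setT mul1e.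
Qed.

Section zip.
Context dA dB (A : measurableType dA) (B : measurableType dB).
Variables (mu : probability A R) (nu : probability B R).

Definition pair_tuple n (s : n.-tuple A) (t : n.-tuple B) : n.-tuple (A * B)%type :=
  [tuple (tnth s i, tnth t i) | i < n].

Lemma measurable_pair_tuple n dX (X : measurableType dX) (f : X -> n.-tuple A) (g : X -> n.-tuple B) :
  measurable_fun setT f -> measurable_fun setT g -> measurable_fun setT (fun x => pair_tuple (f x) (g x)).
Proof.
move=> mf mg; apply/measurable_fun_tnthP => i.
rewrite (_ : _ \o _ = fun x => (tnth (f x) i, tnth (g x) i)); last first.
  by apply/funext => x; rewrite /= tnth_mktuple.
by apply: measurable_fun_pair; [exact: (measurableT_comp (measurable_tnth i) mf)|exact: (measurableT_comp (measurable_tnth i) mg)].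
Qed.

Lemma pair_tuple_cons n x y (s : n.-tuple A) (t : n.-tuple B) :
  pair_tuple (cons_pair (x, s)) (cons_pair (y, t)) = cons_pair ((x, y), pair_tuple s t).
Proof.
apply: eq_from_tnth => i; rewrite tnth_mktuple; case: (unliftP ord0 i) => [j|] ->.
  by rewrite /cons_pair /= !tnthS tnth_mktuple.
by rewrite !tnth0.
Qed.

(** By induction on n, exchanging the tail of the first tuple with the head of the second
    one. *)
Lemma integral_zip n (F : n.-tuple (A * B)%type -> \bar R) :
  measurable_fun setT F -> (forall p, (0 <= F p)%E) ->
  (\int[tuple_measure mu n]_s \int[tuple_measure nu n]_t F (pair_tuple s t) =
   \int[tuple_measure ((mu \x nu)%E : probability (A * B)%type R) n]_p F p)%E.
Proof.
elim: n F => [|n IH] F mF F0.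
  rewrite integral_tuple0; last first.
    rewrite (_ : (fun s => _) = fun=> (\int[tuple_measure nu 0]_t F (pair_tuple [tuple] t))%E); last first.
      by apply/funext => s; rewrite (tuple0 s).
    exact: measurable_cst.
  rewrite !integral_tuple0//; last by apply: (measurableT_comp mF); apply: measurable_pair_tuple.
  by congr F; rewrite [LHS]tuple0.
have mF2 : measurable_fun setT (fun q : (n.+1.-tuple A * n.+1.-tuple B)%type => F (pair_tuple q.1 q.2)).
  by apply: (measurableT_comp mF); apply: measurable_pair_tuple; [exact: measurable_fst|exact: measurable_snd].
rewrite ge0_integral_tupleS; last 2 first.
- exact: (@measurable_fun_fubini_tonelli_F _ _ _ _ R (tuple_measure nu n.+1) (fun q => F (pair_tuple q.1 q.2))).
- by move=> s; exact: integral_ge0.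
have mFc : measurable_fun setT (fun q : ((A * B) * n.-tuple (A * B)%type)%type => F (cons_pair q)).
  by apply: (measurableT_comp mF); exact: measurable_cons_pair.
rewrite [RHS]ge0_integral_tupleS//.
rewrite [RHS](@fubini_tonelli1 _ _ _ _ R mu nu (fun z => \int[tuple_measure ((mu \x nu)%E : probability (A * B)%type R) n]_p F (cons_pair (z, p)))%E); last 2 first.
- exact: (@measurable_fun_fubini_tonelli_F _ _ _ _ R (tuple_measure ((mu \x nu)%E : probability (A * B)%type R) n) (fun q => F (cons_pair q))).
- by move=> z; exact: integral_ge0.
apply: eq_integral => x _; rewrite /fubini_F.
transitivity (\int[tuple_measure mu n]_s \int[nu]_y \int[tuple_measure nu n]_t
    F (cons_pair ((x, y), pair_tuple s t)))%E.
  apply: eq_integral => s _.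
  rewrite (@ge0_integral_tupleS _ _ R nu n (fun t => F (pair_tuple (cons_pair (x, s)) t))); last 2 first.
  - by apply: (measurableT_comp mF); apply: measurable_pair_tuple.
  - by move=> t; exact: F0.
  by apply: eq_integral => y _; apply: eq_integral => t _; rewrite pair_tuple_cons.
pose H (q : ((n.-tuple A * B) * n.-tuple B)%type) := F (cons_pair ((x, q.1.2), pair_tuple q.1.1 q.2)).
have mH : measurable_fun setT H.
  apply: (measurableT_comp mFc); apply: measurable_fun_pair.
    apply: measurable_fun_pair => //; exact: (measurableT_comp measurable_snd measurable_fst).
  apply: measurable_pair_tuple; last exact: measurable_snd.
  exact: (measurableT_comp measurable_fst measurable_fst).
rewrite (@fubini_tonelli _ _ _ _ R (tuple_measure mu n) nu
   (fun q => \int[tuple_measure nu n]_t H (q, t))%E); last 2 first.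
- exact: (@measurable_fun_fubini_tonelli_F _ _ _ _ R (tuple_measure nu n) H mH (fun q => F0 _)).
- by move=> z; apply: integral_ge0 => t _; exact: F0.
apply: eq_integral => y _; apply: (IH (fun p => F (cons_pair ((x, y), p)))) => //.
by apply: (measurableT_comp mFc); exact: measurable_fun_pair.
Qed.

End zip.

Section cat.
Context dA (A : measurableType dA) (mu : {sigma_finite_measure set A -> \bar R}).

Lemma measurable_cat m n dX (X : measurableType dX) (f : X -> m.-tuple A) (g : X -> n.-tuple A) :
  measurable_fun setT f -> measurable_fun setT g ->
  measurable_fun setT (fun x => [tuple of f x ++ g x]).
Proof.
move=> mf mg; apply/measurable_fun_tnthP => i; case: (split_ordP i) => j ->.
  rewrite (_ : _ \o _ = fun x => tnth (f x) j); first exact: (measurableT_comp (measurable_tnth j) mf).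
  by apply/funext => x; rewrite /= tnth_lshift.
rewrite (_ : _ \o _ = fun x => tnth (g x) j); first exact: (measurableT_comp (measurable_tnth j) mg).
by apply/funext => x; rewrite /= tnth_rshift.
Qed.

Lemma integral_cat m n (F : (m + n).-tuple A -> \bar R) :
  measurable_fun setT F -> (forall p, (0 <= F p)%E) ->
  (\int[tuple_measure mu (m + n)]_t F t =
   \int[tuple_measure mu m]_s \int[tuple_measure mu n]_t F [tuple of s ++ t])%E.
Proof.
elim: m F => [|m IH] F mF F0.
  rewrite integral_tuple0; last first.
    rewrite (_ : (fun s => _) = fun=> (\int[tuple_measure mu n]_t F [tuple of [tuple] ++ t])%E); last first.
      by apply/funext => s; rewrite (tuple0 s).
    exact: measurable_cst.
  by apply: eq_integral => t _; congr F; apply/val_inj.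
have mF2 : measurable_fun setT (fun q : (m.+1.-tuple A * n.-tuple A)%type => F [tuple of q.1 ++ q.2]).
  by apply: (measurableT_comp mF); apply: measurable_cat; [exact: measurable_fst|exact: measurable_snd].
rewrite [RHS]ge0_integral_tupleS; last 2 first.
- exact: (@measurable_fun_fubini_tonelli_F _ _ _ _ R (tuple_measure mu n) (fun q : (m.+1.-tuple A * n.-tuple A)%type => F [tuple of q.1 ++ q.2]) mF2 (fun q => F0 _)).
- by move=> s; exact: integral_ge0.
rewrite [LHS](@ge0_integral_tupleS _ _ _ mu (m + n) F)//.
have mFx x : measurable_fun setT (fun t : (m + n).-tuple A => F (cons_pair (x, t))).
  by apply: (measurableT_comp mF); apply: (measurableT_comp (@measurable_cons_pair _ _ _)); exact: measurable_fun_pair.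
apply: eq_integral => x _; apply: (eq_trans (IH _ (mFx x) (fun t => F0 _))).
apply: eq_integral => s _; apply: eq_integral => t _; congr F; exact/val_inj.
Qed.

End cat.

End regroup.

(** * Averaging over the random frequencies *)

Section limit_law.
Context {R : realType} {d : nat}.
Variables (S : 'rV[R]_d -> R) (kappa r : R) (m : nat).
Hypotheses (mS : measurable_fun setT S).

Local Notation gauss1 := (normal_prob (0 : R) 1).

(** A uniform point of the unit ball together with two independent standard Gaussian
    variables: the randomness of one limiting observation. *)
Definition point_law : probability ('rV[R]_d * (measurableTypeR R * measurableTypeR R))%type R :=
  ((@unit_law R d : probability 'rV[R]_d R) \x
   ((gauss1 : probability (measurableTypeR R) R) \x (gauss1 : probability (measurableTypeR R) R))%E)%E.

(** One observation for each of the two radii. *)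
Definition pair_law : probability (('rV[R]_d * (measurableTypeR R * measurableTypeR R)) *
    ('rV[R]_d * (measurableTypeR R * measurableTypeR R)))%type R :=
  (point_law \x point_law)%E.

(** The limit of the periodogram at a uniform frequency of the ball of radius a: the
    structure factor at this frequency times an exponential variable of mean 1. *)
Definition exp_power (a : R) (x : 'rV[R]_d * (measurableTypeR R * measurableTypeR R)) : R :=
  S (a *: x.1) * (((x.2.1 : R) ^+ 2 + (x.2.2 : R) ^+ 2) / 2).

Lemma measurable_exp_power a : measurable_fun setT (exp_power a).
Proof.
apply: measurable_funM.
  apply: (measurableT_comp mS).
  rewrite (_ : (fun x => _) = (fun x : 'rV[R]_d => a *: x + 0) \o fst); last first.
    by apply/funext => x /=; rewrite addr0.
  by apply: measurableT_comp; [exact: measurable_rV_affine|exact: measurable_fst].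
apply: measurable_funM => //; apply: measurable_funD; apply: measurable_funX.
  exact: (measurableT_comp measurable_fst measurable_snd).
exact: (measurableT_comp measurable_snd measurable_snd).
Qed.

Definition limit_row (p : m.-tuple (('rV[R]_d * (measurableTypeR R * measurableTypeR R)) *
    ('rV[R]_d * (measurableTypeR R * measurableTypeR R)))%type) : 'rV[R]_(m + m) :=
  row_mx (\row_j exp_power (array_radius kappa r false) (tnth p j).1)
         (\row_j exp_power (array_radius kappa r true) (tnth p j).2).

Definition gauss_row (u : (m + m).-tuple 'rV[R]_d) (t : ((m + m) + (m + m)).-tuple (measurableTypeR R)) : 'rV[R]_(m + m) :=
  \row_j (S (tnth u j) * (((tnth t (lshift (m + m) j) : R) ^+ 2 + (tnth t (rshift (m + m) j) : R) ^+ 2) / 2)).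

Lemma measurable_gauss_row dX (X : measurableType dX) (f : X -> (m + m).-tuple 'rV[R]_d)
    (g : X -> ((m + m) + (m + m)).-tuple (measurableTypeR R)) :
  measurable_fun setT f -> measurable_fun setT g -> measurable_fun setT (fun x => gauss_row (f x) (g x)).
Proof.
move=> mf mg; apply: measurable_fun_rVP => j; under eq_fun do rewrite mxE.
apply: measurable_funM; first exact: (measurableT_comp mS (measurableT_comp (measurable_tnth j) mf)).
apply: measurable_funM => //; apply: measurable_funD; apply: measurable_funX.
  exact: (measurableT_comp (measurable_tnth (lshift (m + m) j)) mg).
exact: (measurableT_comp (measurable_tnth (rshift (m + m) j)) mg).
Qed.

Context {dO : measure_display} {Omega : measurableType dO}.
Variables (P : probability Omega R) (eta : R.-ker Omega ~> 'rV[R]_d)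
  (U : bool -> 'I_m -> {RV P >-> 'rV[R]_d}).
Hypotheses (U_freq : random_frequencies eta kappa r U) (r_gt0 : 0 < r) (kappa_gt0 : 0 < kappa).

(** The frequencies and the Gaussian variables are first integrated separately, the latter
    given the former. Regrouping the coordinates observation by observation exhibits the
    limiting array as a sample of m independent pairs. *)
Lemma limit_integral (phi : 'rV[R]_(m + m) -> R) : measurable_fun setT phi -> (forall v, 0 <= phi v) ->
  (\int[freq_law U]_u \int[iid gauss1 ((m + m) + (m + m))]_t (phi (gauss_row u t))%:E =
   \int[iid pair_law m]_p (phi (limit_row p))%:E)%E.
Proof.
move=> mphi phi0.
pose yy (j : 'I_(m + m)) := exp_power (array_radius kappa r (index_bool j).1).
pose F3 (q : (m + m).-tuple ('rV[R]_d * (measurableTypeR R * measurableTypeR R))%type) := (phi (\row_j yy j (tnth q j)))%:E.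
have mF3 : measurable_fun setT F3.
  apply/measurable_EFinP; apply: (measurableT_comp mphi); apply: measurable_fun_rVP => j.
  under eq_fun do rewrite mxE; exact: (measurableT_comp (measurable_exp_power _) (measurable_tnth j)).
have F30 q : (0 <= F3 q)%E by rewrite lee_fin.
rewrite (@integral_freq_law _ _ _ _ P eta m U kappa r U_freq r_gt0 kappa_gt0 (fun u => \int[iid gauss1 ((m + m) + (m + m))]_t (phi (gauss_row u t))%:E)%E); last 2 first.
- apply: (@measurable_fun_fubini_tonelli_F _ _ _ _ R (iid gauss1 ((m + m) + (m + m))) (fun q => (phi (gauss_row q.1 q.2))%:E)).
    apply/measurable_EFinP; apply: (measurableT_comp mphi); apply: measurable_gauss_row; [exact: measurable_fst|exact: measurable_snd].
  by move=> q; rewrite lee_fin.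
- by move=> u; apply: integral_ge0 => t _; rewrite lee_fin.
transitivity (\int[iid (@unit_law R d) (m + m)]_v
    \int[tuple_measure ((gauss1 : probability (measurableTypeR R) R) \x (gauss1 : probability (measurableTypeR R) R) : probability (measurableTypeR R * measurableTypeR R)%type R)%E (m + m)]_p F3 (pair_tuple v p))%E.
  apply: eq_integral => v _.
  rewrite [LHS](@integral_cat R _ _ gauss1 (m + m) (m + m) (fun t => (phi (gauss_row (scale_tuple kappa r v) t))%:E)); last 2 first.
  - by apply/measurable_EFinP; apply: (measurableT_comp mphi); exact: measurable_gauss_row.
  - by move=> t; rewrite lee_fin.
  rewrite -[RHS](@integral_zip R _ _ _ _ (gauss1 : probability (measurableTypeR R) R) (gauss1 : probability (measurableTypeR R) R) _
    (fun p => F3 (pair_tuple v p))); last 2 first.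
  - by apply: (measurableT_comp mF3); exact: measurable_pair_tuple.
  - by move=> p; exact: F30.
  apply: eq_integral => s _; apply: eq_integral => t _; congr ((phi _)%:E).
  by apply/rowP => j; rewrite !mxE !tnth_mktuple /= tnth_lshift tnth_rshift.
rewrite [LHS](@integral_zip R _ _ _ _ (@unit_law R d : probability 'rV[R]_d R) _ _ F3)//.
rewrite [LHS](@integral_cat R _ _ point_law m m F3)//.
rewrite [LHS](_ : _ = \int[tuple_measure point_law m]_s \int[tuple_measure point_law m]_t (phi (limit_row (pair_tuple s t)))%:E)%E.
  apply: (@integral_zip R _ _ _ _ point_law point_law _ (fun p => (phi (limit_row p))%:E)).
    apply/measurable_EFinP; apply: (measurableT_comp mphi).
    apply: measurable_fun_rVP => i; case: (split_ordP i) => j ->.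
      under eq_fun do rewrite row_mxEl mxE.
      apply: (measurableT_comp (measurable_exp_power _)); exact: (measurableT_comp measurable_fst (measurable_tnth j)).
    under eq_fun do rewrite row_mxEr mxE.
    apply: (measurableT_comp (measurable_exp_power _)); exact: (measurableT_comp measurable_snd (measurable_tnth j)).
  by move=> p; rewrite lee_fin.
apply: eq_integral => s _; apply: eq_integral => t _; congr ((phi _)%:E).
apply/rowP => i; rewrite mxE /limit_row; case: (split_ordP i) => j ->.
  by rewrite row_mxEl mxE tnth_lshift tnth_mktuple /yy /index_bool -[lshift m j]/(unsplit (inl j)) unsplitK.
by rewrite row_mxEr mxE tnth_rshift tnth_mktuple /yy /index_bool -[rshift m j]/(unsplit (inr j)) unsplitK.
Qed.

End limit_law.

Lemma upper_arith (R : realType) (b c d e : R) : `|c - b| <= e -> c <= d + 0 -> b <= d + e.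
Proof. by rewrite ler_norml => /andP[? ?] ?; lra. Qed.

Lemma lower_arith (R : realType) (a b c d e : R) : b <= d + 0 -> `|c - b| <= e -> a <= c -> a - e <= d.
Proof. by rewrite ler_norml => ? /andP[? ?] ?; lra. Qed.

Section rejection_limit.
Context {R : realType} {d : nat} {dO : measure_display} {Omega : measurableType dO}.
Variables (P : probability Omega R) (eta : R.-ker Omega ~> 'rV[R]_d) (h : 'rV[R]_d -> R[i]).
Variables (rho : R) (S : 'rV[R]_d -> R).
Hypotheses (eta_pp : point_process eta) (h_test : test_function h) (rho_gt0 : 0 < rho)
  (mS : measurable_fun setT S) (S_ge0 : forall xi, 0 <= S xi)
  (lln : forall e : R, 0 < e ->
    fine (P [set w | e <= `|empirical_intensity eta T w - rho|]) @[T --> +oo] --> 0)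
  (hF : fourier_condition P eta rho S h).
Variables (kappa r : R) (m : nat) (U : bool -> 'I_m -> {RV P >-> 'rV[R]_d}).
Hypotheses (U_freq : random_frequencies eta kappa r U) (r_gt0 : 0 < r) (kappa_gt0 : 0 < kappa)
  (m_gt0 : (0 < m)%N).

Local Notation gauss1 := (normal_prob (0 : R) 1).

Definition observed T w : 'rV[R]_(m + m) := periodograms eta h T (freq_tuple U w) w.

Lemma measurable_periodograms_joint T : 0 < T ->
  measurable_fun setT (fun p : (eta_space eta * (m + m).-tuple 'rV[R]_d)%type => periodograms eta h T p.2 p.1).
Proof.
move=> T0; apply: measurable_fun_rVP => j; under eq_fun do rewrite mxE.
apply: (measurableT_comp (measurable_joint_periodogram eta_pp h_test T0)
  (g := fun p : (eta_space eta * (m + m).-tuple 'rV[R]_d)%type => (p.1, tnth p.2 j))).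
apply: measurable_fun_pair; first exact: measurable_fst.
exact: (measurableT_comp (measurable_tnth j) measurable_snd).
Qed.

Lemma measurable_observed T : 0 < T -> measurable_fun setT (observed T).
Proof.
move=> T0.
apply: (measurableT_comp (measurable_periodograms_joint T0) (g := fun w : Omega => (w : eta_space eta, freq_tuple U w))).
by apply: measurable_fun_pair; [exact: measurable_to_eta_space|exact: measurable_freq_tuple].
Qed.

Lemma measurable_limit_row : measurable_fun setT (@limit_row R d S kappa r m).
Proof.
apply: measurable_fun_rVP => i; case: (split_ordP i) => j ->.
  under eq_fun do rewrite row_mxEl mxE.
  apply: (measurableT_comp (measurable_exp_power mS _)); exact: (measurableT_comp measurable_fst (measurable_tnth j)).
under eq_fun do rewrite row_mxEr mxE.
apply: (measurableT_comp (measurable_exp_power mS _)); exact: (measurableT_comp measurable_snd (measurable_tnth j)).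
Qed.

(** For frozen frequencies this is frequency_limit, which holds at almost all of them since
    their law has a density; the frequencies are then integrated out by dominated
    convergence. *)
Lemma rejection_limit (phi : 'rV[R]_(m + m) -> R) : continuous phi -> (forall v, 0 <= phi v) ->
  (forall v, phi v <= 1) ->
  \int[P]_w phi (observed T w) @[T --> +oo] -->
  \int[iid (@pair_law R d) m]_p phi (limit_row S kappa r p).
Proof.
move=> cphi phi0 phi1; apply/cvg_pinftyP => u uoo.
have mphi : measurable_fun setT phi by exact: continuous_rV_measurable.
have phiN v : `|phi v| <= 1 by rewrite ger0_norm.
pose v k := Num.max 1 (u k).
have v0 k : 0 < v k by rewrite lt_max ltr01.
have uv : \forall k \near \oo, v k = u k.
  have : \forall k \near \oo, 1 <= u k by move: (1 : R); apply/cvgryPge.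
  by apply: filterS => k; rewrite /v => /max_idPr.
have voo : v k @[k --> \oo] --> +oo.
  by apply: cvg_trans uoo; apply: near_eq_cvg; apply: filterS uv => n ->.
suff H : \int[P]_w phi (observed (v k) w) @[k --> \oo] --> \int[iid (@pair_law R d) m]_p phi (limit_row S kappa r p).
  by apply: cvg_trans H; apply: near_eq_cvg; apply: filterS uv => n ->.
pose g k x := \int[P]_w phi (periodograms eta h (v k) x w).
have mF k : measurable_fun setT (fun p : (eta_space eta * (m + m).-tuple 'rV[R]_d)%type =>
    (phi (periodograms eta h (v k) p.2 p.1))%:E).
  by apply/measurable_EFinP; apply: (measurableT_comp mphi); exact: measurable_periodograms_joint.
have pF k (p : (eta_space eta * (m + m).-tuple 'rV[R]_d)%type) : (0 <= (phi (periodograms eta h (v k) p.2 p.1))%:E)%E.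
  by rewrite lee_fin.
have ig k x : P.-integrable setT (EFin \o (fun w => phi (periodograms eta h (v k) x w))).
  apply: (@prob_bounded_integrable _ _ _ _ _ 1) => //.
  by apply: (measurableT_comp mphi); exact: measurable_periodograms.
have gE k x : (g k x)%:E = (\int[P]_w (phi (periodograms eta h (v k) x w))%:E)%E.
  by rewrite /g EFin_Rintegral.
have mg k : measurable_fun setT (EFin \o g k).
  have := @measurable_fun_fubini_tonelli_G _ _ _ _ R (@eta_law _ _ _ _ P eta : probability (eta_space eta) R) _ (mF k) (pF k).
  apply: eq_measurable_fun => x _; rewrite /= gE /fubini_G ge0_integral_pushforward//.
  - exact: measurable_to_eta_space.
  - by apply: (measurableT_comp (mF k)); exact: measurable_fun_pair.
have Eg k : (\int[P]_w phi (observed (v k) w))%:E = (\int[freq_law U]_x (g k x)%:E)%E.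
  have io : P.-integrable setT (EFin \o (fun w => phi (observed (v k) w))).
    apply: (@prob_bounded_integrable _ _ _ _ _ 1) => //.
    by apply: (measurableT_comp mphi); exact: measurable_observed.
  apply: (eq_trans (EFin_Rintegral io)); apply: (eq_trans (conditioning U_freq (mF k) (pF k))).
  by apply: eq_integral => x _; rewrite gE.
have mm0 : (0 < m + m)%N by rewrite addn_gt0 m_gt0.
have [D [mD D0 Dne DF]] := hF mm0.
pose G x := \int[iid gauss1 ((m + m) + (m + m))]_t phi (gauss_row S x t).
have iG x : (iid gauss1 ((m + m) + (m + m))).-integrable setT (EFin \o (fun t => phi (gauss_row S x t))).
  apply: (@prob_bounded_integrable _ _ _ _ _ 1) => //.
  by apply: (measurableT_comp mphi); exact: measurable_gauss_row.
have GE x : (G x)%:E = (\int[iid gauss1 ((m + m) + (m + m))]_t (phi (gauss_row S x t))%:E)%E.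
  by rewrite /G EFin_Rintegral.
have mG : measurable_fun setT (EFin \o G).
  rewrite (_ : _ \o _ = fun x => (\int[iid gauss1 ((m + m) + (m + m))]_t (phi (gauss_row S x t))%:E)%E); last first.
    by apply/funext => x; exact: GE.
  apply: (@measurable_fun_fubini_tonelli_F _ _ _ _ R (iid gauss1 ((m + m) + (m + m))) (fun q => (phi (gauss_row S q.1 q.2))%:E)).
    by apply/measurable_EFinP; apply: (measurableT_comp mphi); apply: measurable_gauss_row; [|exact: measurable_fst|exact: measurable_snd].
  by move=> q; rewrite lee_fin.
have ae : \forall x \ae freq_law U, setT x -> (EFin \o g k) x @[k --> \oo] --> (EFin \o G) x.
  exists (~` D); split; first exact: measurableC.
    by apply: (freq_law_ac U_freq) => //; exact: measurableC.
  move=> x /=; apply: contra_not => Dx _.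
  apply: cvg_EFin; first exact: nearW.
  have H := frequency_limit eta_pp h_test rho_gt0 S_ge0 lln (Dne x Dx).1 (DF x Dx) cphi phiN.
  by move/cvg_pinftyP : H; apply.
have bnd : \forall x \ae freq_law U, forall k, setT x -> (`|(EFin \o g k) x| <= cst 1%:E x)%E.
  apply: aeW => x k _; rewrite /= lee_fin ger0_norm; last by apply: Rintegral_ge0 => w _; exact: phi0.
  rewrite -[leRHS](Rintegral_prob_cst P 1); exact: (le_Rintegral measurableT (ig k x) (prob_cst_integrable P 1) (fun w _ => phi1 _)).
have [_ _] := dominated_convergence measurableT mg mG ae (prob_cst_integrable (freq_law U) 1) bnd.
have -> : (\int[freq_law U]_x (EFin \o G) x = (\int[iid (@pair_law R d) m]_p phi (limit_row S kappa r p))%:E)%E.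
  have il : (iid (@pair_law R d) m).-integrable setT (EFin \o (fun p => phi (limit_row S kappa r p))).
    apply: (@prob_bounded_integrable _ _ _ _ _ 1) => //.
    by apply: (measurableT_comp mphi); exact: measurable_limit_row.
  apply: esym; apply: (eq_trans (EFin_Rintegral il)); apply: esym.
  rewrite -(limit_integral mS U_freq r_gt0 kappa_gt0 mphi phi0).
  by apply: eq_integral => x _; exact: GE.
move=> /fine_cvg; apply: cvg_trans; apply: near_eq_cvg; near=> k.
by rewrite /= -Eg.
Unshelve. all: by end_near. Qed.

(** Convergence in law gives no limit for the probability of an event whose boundary may be
    charged; the event W > 0 is enclosed between continuous functions of W, at the price of
    the margin dl. *)
Lemma rejection_upper (W : 'rV[R]_(m + m) -> R) (dl e : R) : continuous W -> 0 < dl -> 0 < e ->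
  \forall T \near +oo, fine (P [set w | 0 < W (observed T w)]) <=
    fine (iid (@pair_law R d) m [set p | - dl <= W (limit_row S kappa r p)]) + e.
Proof.
move=> cW dl0 e0; pose phi v := clamp (1 + W v / dl).
have cphi : continuous phi.
  move=> v; apply: (@continuous_comp _ _ _ (fun v => 1 + W v / dl) clamp); last exact: clamp_continuous.
  apply: (@continuousD _ _ _ (fun=> 1 : R) (fun v : 'rV[R]_(m + m) => W v / dl)); first exact: cst_continuous.
  by apply: (@continuousM _ _ W (fun=> dl^-1)); [exact: cW|exact: cst_continuous].
have mW : measurable_fun setT W by exact: continuous_rV_measurable.
have mphi : measurable_fun setT phi by exact: continuous_rV_measurable.
have /cvgrPdist_le/(_ _ e0) H := rejection_limit cphi (fun v => clamp_ge0 _) (fun v => clamp_le1 _).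
near=> T.
have T0 : 0 < T by near: T; exact: nbhs_pinfty_gt.
have mo := measurable_observed T0.
apply: (@le_trans _ _ (\int[P]_w phi (observed T w))).
  apply: prob_le_Rintegral.
  - rewrite (_ : [set w | _] = (fun w => W (observed T w)) @^-1` `]0, +oo[%classic); last first.
      by apply/seteqP; split=> w /=; rewrite in_itv /= andbT.
    by rewrite -[X in measurable X]setTI; apply: (measurableT_comp mW mo).
  - apply: (@prob_bounded_integrable _ _ _ _ _ 1); first exact: (measurableT_comp mphi mo).
    by move=> w; exact: clamp_norm.
  - by move=> w; exact: clamp_ge0.
  - by move=> w /= W0; rewrite /phi clamp_eq1// lerDl divr_ge0// ltW.
have HT : `|\int[iid (@pair_law R d) m]_p phi (limit_row S kappa r p) - \int[P]_w phi (observed T w)| <= e by near: T.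
have ub : \int[iid (@pair_law R d) m]_p phi (limit_row S kappa r p) <=
    fine (iid (@pair_law R d) m [set p | - dl <= W (limit_row S kappa r p)]) + 0.
  apply: prob_ge_Rintegral => //.
  - by apply: measurable_ge; apply: (measurableT_comp mW); exact: measurable_limit_row.
  - apply: (@prob_bounded_integrable _ _ _ _ _ 1); last by move=> p; exact: clamp_norm.
    by apply: (measurableT_comp mphi); exact: measurable_limit_row.
  - by move=> p _; exact: clamp_le1.
  - by move=> p; exact: clamp_le1.
  - move=> p /= /negP; rewrite -ltNge => Wp; rewrite /phi clamp_eq0//.
    have : W (limit_row S kappa r p) / dl <= -1 by rewrite ler_pdivrMr// mulN1r ltW.
    lra.
exact: upper_arith HT ub.
Unshelve. all: by end_near. Qed.

Lemma rejection_lower (W : 'rV[R]_(m + m) -> R) (dl e : R) : continuous W -> 0 < dl -> 0 < e ->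
  \forall T \near +oo, fine (iid (@pair_law R d) m [set p | dl <= W (limit_row S kappa r p)]) - e <=
    fine (P [set w | 0 < W (observed T w)]).
Proof.
move=> cW dl0 e0; pose phi v := clamp (W v / dl).
have cphi : continuous phi.
  move=> v; apply: (@continuous_comp _ _ _ (fun v => W v / dl) clamp); last exact: clamp_continuous.
  by apply: (@continuousM _ _ W (fun=> dl^-1)); [exact: cW|exact: cst_continuous].
have mW : measurable_fun setT W by exact: continuous_rV_measurable.
have mphi : measurable_fun setT phi by exact: continuous_rV_measurable.
have /cvgrPdist_le/(_ _ e0) H := rejection_limit cphi (fun v => clamp_ge0 _) (fun v => clamp_le1 _).
near=> T.
have T0 : 0 < T by near: T; exact: nbhs_pinfty_gt.
have mo := measurable_observed T0.
have ub : \int[P]_w phi (observed T w) <= fine (P [set w | 0 < W (observed T w)]) + 0.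
  apply: prob_ge_Rintegral => //.
  - rewrite (_ : [set w | _] = (fun w => W (observed T w)) @^-1` `]0, +oo[%classic); last first.
      by apply/seteqP; split=> w /=; rewrite in_itv /= andbT.
    by rewrite -[X in measurable X]setTI; apply: (measurableT_comp mW mo).
  - apply: (@prob_bounded_integrable _ _ _ _ _ 1); first exact: (measurableT_comp mphi mo).
    by move=> w; exact: clamp_norm.
  - by move=> p _; exact: clamp_le1.
  - by move=> p; exact: clamp_le1.
  - move=> w /= /negP; rewrite -leNgt => Wp; rewrite /phi clamp_eq0//.
    by rewrite ler_pdivrMr// mul0r.
have HT : `|\int[iid (@pair_law R d) m]_p phi (limit_row S kappa r p) - \int[P]_w phi (observed T w)| <= e by near: T.
have lb : fine (iid (@pair_law R d) m [set p | dl <= W (limit_row S kappa r p)]) <=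
    \int[iid (@pair_law R d) m]_p phi (limit_row S kappa r p).
  apply: prob_le_Rintegral.
  - by apply: measurable_ge; apply: (measurableT_comp mW); exact: measurable_limit_row.
  - apply: (@prob_bounded_integrable _ _ _ _ _ 1); last by move=> p; exact: clamp_norm.
    by apply: (measurableT_comp mphi); exact: measurable_limit_row.
  - by move=> p; exact: clamp_ge0.
  - by move=> p /= Wp; rewrite /phi clamp_eq1// ler_pdivlMr// mul1r.
exact: lower_arith ub HT lb.
Unshelve. all: by end_near. Qed.

End rejection_limit.

(** * The rejection rule for independent identically distributed samples *)

Section array_statistics.
Context {R : realType}.
Implicit Types (alpha kappa : R).

Lemma array_varE m (y : bool -> 'I_m -> R) a : (1 < m)%N ->
  array_var y a = m%:R / (m%:R - 1) * ((\sum_(j < m) y a j ^+ 2) / m%:R - array_mean y a ^+ 2).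
Proof.
move=> m1; have m0 : m%:R != 0 :> R by rewrite pnatr_eq0 -lt0n (ltn_trans _ m1).
have m1' : m%:R - 1 != 0 :> R by rewrite subr_eq0 (eqr_nat R m 1) gtn_eqF.
rewrite /array_var; have E : \sum_(j < m) y a j = m%:R * array_mean y a by rewrite /array_mean mulrC divfK.
set ybar := array_mean y a in E *.
have -> : \sum_(j < m) (y a j - ybar) ^+ 2 = (\sum_(j < m) y a j ^+ 2) - m%:R * ybar ^+ 2.
  rewrite (eq_bigr (fun j => y a j ^+ 2 + (- (2 * ybar) * y a j + ybar ^+ 2))); last by move=> j _; ring.
  rewrite !big_split /= -mulr_sumr E sumr_const card_ord -[ybar ^+ 2 *+ m]mulr_natl; ring.
field; by rewrite m1' m0.
Qed.

Lemma array_var_ge0 m (y : bool -> 'I_m -> R) a : (1 < m)%N -> 0 <= array_var y a.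
Proof.
move=> m1; apply: divr_ge0; first by apply: sumr_ge0 => j _; exact: sqr_ge0.
by rewrite subr_ge0 ler1n ltnW.
Qed.

Definition pooled_var alpha kappa m (y : bool -> 'I_m -> R) : R :=
  (kappa `^ alpha) ^+ 2 * array_var y false + array_var y true.

Lemma pooled_var_ge0 alpha kappa m (y : bool -> 'I_m -> R) : (1 < m)%N -> 0 <= pooled_var alpha kappa y.
Proof.
move=> m1; apply: addr_ge0; last exact: array_var_ge0.
by apply: mulr_ge0; [exact: sqr_ge0|exact: array_var_ge0].
Qed.

Lemma standard_errorE alpha kappa m (y : bool -> 'I_m -> R) : 1 < kappa `^ alpha -> (1 < m)%N ->
  standard_error alpha kappa y = Num.sqrt (pooled_var alpha kappa y) / (Num.sqrt m%:R * (kappa `^ alpha - 1)).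
Proof.
move=> K1 m1; rewrite /standard_error /pooled_var.
have -> : kappa `^ (2 * alpha) = (kappa `^ alpha) ^+ 2 by rewrite mulrC powRrM powR_mulrn ?powR_ge0.
have q0 : 0 < kappa `^ alpha - 1 by rewrite subr_gt0.
rewrite sqrtrM; last exact: (pooled_var_ge0 alpha kappa y m1).
congr (_ * _); rewrite sqrtrV; last by apply: mulr_ge0; [exact: ler0n|exact: sqr_ge0].
by rewrite sqrtrM ?ler0n// sqrtr_sqr (gtr0_norm q0).
Qed.

Lemma abs_sqrtB (V s : R) : 0 <= V -> 0 < s -> `|Num.sqrt V - s| <= `|V - s ^+ 2| / s.
Proof.
move=> V0 s0; rewrite ler_pdivlMr//.
have -> : V - s ^+ 2 = (Num.sqrt V - s) * (Num.sqrt V + s) by rewrite -{1}(sqr_sqrtr V0); ring.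
rewrite normrM ler_wpM2l// ger0_norm ?addr_ge0 ?sqrtr_ge0 ?(ltW s0)//.
by rewrite lerDr sqrtr_ge0.
Qed.

End array_statistics.

Section two_sample_rule.
Context {R : realType} {dT : measure_display} {T : measurableType dT} (mu : probability T R).
Local Notation gauss := (normal_prob (0 : R) 1).
Variables (f g : T -> R) (alpha kappa a a' b z : R).
Hypotheses (mf : measurable_fun setT f) (mg : measurable_fun setT g)
  (if2 : mu.-integrable setT (fun t => (f t ^+ 2)%:E)) (ig2 : mu.-integrable setT (fun t => (g t ^+ 2)%:E))
  (Ef : \int[mu]_t f t = a) (Eg : \int[mu]_t g t = a')
  (K1 : 1 < kappa `^ alpha).

Let K := kappa `^ alpha.
Let q := K - 1.
Let q_gt0 : 0 < q.
Proof. by rewrite subr_gt0. Qed.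

Let F2 := \int[mu]_t (f t ^+ 2).
Let G2 := \int[mu]_t (g t ^+ 2).

Definition sample m (t : m.-tuple T) (c : bool) (j : 'I_m) : R := if c then g (tnth t j) else f (tnth t j).

(** The rule rejects when this quantity is positive. *)
Definition margin m (t : m.-tuple T) : R :=
  intercept_estimate alpha kappa (sample t) - (b + z * standard_error alpha kappa (sample t)).

Let s1 := extrapolate alpha kappa a a'.

(** On this event the margin is controlled deterministically (typical_mean, typical_var). *)
Definition typical (et : R) m (t : m.-tuple T) : Prop :=
  [/\ `|(\sum_(j < m) f (tnth t j)) / m%:R - a| < et, `|(\sum_(j < m) g (tnth t j)) / m%:R - a'| < et,
      `|(\sum_(j < m) f (tnth t j) ^+ 2) / m%:R - F2| < et & `|(\sum_(j < m) g (tnth t j) ^+ 2) / m%:R - G2| < et].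

(** The limit of the pooled variance, which is also the variance of the contrast K f - g
    when f and g are uncorrelated. *)
Definition limit_var := K ^+ 2 * (F2 - a ^+ 2) + (G2 - a' ^+ 2).

Lemma measurable_sum_tuple (u : T -> R) m : measurable_fun setT u ->
  measurable_fun setT (fun t : m.-tuple T => \sum_(j < m) u (tnth t j)).
Proof.
by move=> mu_; apply: measurable_sum => j; exact: (measurableT_comp mu_ (measurable_tnth j)).
Qed.

Lemma measurable_sample m c j : measurable_fun setT (fun t : m.-tuple T => sample t c j).
Proof.
rewrite /sample; case: c; first exact: (measurableT_comp mg (measurable_tnth j)).
exact: (measurableT_comp mf (measurable_tnth j)).
Qed.

Lemma measurable_margin m : measurable_fun setT (@margin m).
Proof.
have mm c : measurable_fun setT (fun t : m.-tuple T => array_mean (sample t) c).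
  by apply: measurable_funM => //; apply: measurable_sum => j; exact: measurable_sample.
have mv c : measurable_fun setT (fun t : m.-tuple T => array_var (sample t) c).
  apply: measurable_funM => //; apply: measurable_sum => j; apply: measurable_funX.
  by apply: measurable_funB => //; exact: measurable_sample.
apply: measurable_funB.
  by apply: measurable_funM => //; apply: measurable_funB => //; apply: measurable_funM.
apply: measurable_funD => //; apply: measurable_funM => //.
apply: (measurableT_comp (continuous_measurable_fun (@sqrt_continuous R))).
by apply: measurable_funM => //; apply: measurable_funD => //; apply: measurable_funM.
Qed.

Lemma typical_likely (et e : R) : 0 < et -> 0 < e -> exists A : forall m, set (m.-tuple T),
  [/\ forall m, measurable (A m), (forall m (t : m.-tuple T), ~ A m t -> typical et t) &
   \forall m \near \oo, fine (iid mu m (A m)) <= e].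
Proof.
move=> et0 e0; have e4 : 0 < e / 4 by rewrite divr_gt0.
have i1 := sqr_integrable_integrable mf if2.
have i2 := sqr_integrable_integrable mg ig2.
have mf2 : measurable_fun setT (fun t => f t ^+ 2) by exact: measurable_funX.
have mg2 : measurable_fun setT (fun t => g t ^+ 2) by exact: measurable_funX.
pose B (u : T -> R) (c : R) m := [set t : m.-tuple T | et <= `|(\sum_(j < m) u (tnth t j)) / m%:R - c|].
have mB u c m : measurable_fun setT u -> measurable (B u c m).
  move=> mu_; apply: (@measurable_ge _ _ _ (fun t : m.-tuple T => `|(\sum_(j < m) u (tnth t j)) / m%:R - c|)).
  apply: measurableT_comp => //; apply: measurable_funB => //; apply: measurable_funM => //.
  exact: measurable_sum_tuple.
exists (fun m => (B f a m `|` B g a' m) `|` (B (fun t => f t ^+ 2) F2 m `|` B (fun t => g t ^+ 2) G2 m)).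
split.
- by move=> m; apply: measurableU; apply: measurableU; exact: mB.
- move=> m t /not_orP[/not_orP[/negP H1 /negP H2] /not_orP[/negP H3 /negP H4]].
  by rewrite -!ltNge in H1 H2 H3 H4; split.
have H1 := wlln mf i1 et0 e4; rewrite Ef in H1.
have H2 := wlln mg i2 et0 e4; rewrite Eg in H2.
have H3 := wlln mf2 if2 et0 e4.
have H4 := wlln mg2 ig2 et0 e4.
near=> m.
apply: le_trans (fine_probU (iid mu m) (measurableU _ _ (mB _ _ _ mf) (mB _ _ _ mg)) (measurableU _ _ (mB _ _ _ mf2) (mB _ _ _ mg2))) _.
have U1 := fine_probU (iid mu m) (mB f a m mf) (mB g a' m mg).
have U2 := fine_probU (iid mu m) (mB _ F2 m mf2) (mB _ G2 m mg2).
have h1 : fine (iid mu m (B f a m)) <= e / 4 by near: m; exact: H1.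
have h2 : fine (iid mu m (B g a' m)) <= e / 4 by near: m; exact: H2.
have h3 : fine (iid mu m (B (fun t => f t ^+ 2) F2 m)) <= e / 4 by near: m; exact: H3.
have h4 : fine (iid mu m (B (fun t => g t ^+ 2) G2 m)) <= e / 4 by near: m; exact: H4.
have -> : e = (e / 4 + e / 4) + (e / 4 + e / 4) by field.
by apply: lerD; [apply: le_trans U1 _|apply: le_trans U2 _]; exact: lerD.
Unshelve. all: by end_near. Qed.


(** The sensitivity of the pooled variance to errors on the empirical moments. *)
Definition var_modulus := K ^+ 2 * (F2 - a ^+ 2 + 4 * `|a| + 4) + (G2 - a' ^+ 2 + 4 * `|a'| + 4).

Lemma var_dev (c u x et x2 a0 V : R) : V = x2 - a0 ^+ 2 -> 0 <= V -> 0 < et -> et <= 1 -> 0 <= c - 1 -> c - 1 <= et ->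
  `|u - x2| < et -> `|x - a0| < et -> `|c * (u - x ^+ 2) - V| <= et * (V + 4 * `|a0| + 4).
Proof.
move=> -> V0 et0 et1 c0 c1 ux xa.
set W := u - x ^+ 2; set V1 := x2 - a0 ^+ 2 in V0 *.
have n0 : 0 <= `|a0| := normr_ge0 a0.
have WV : `|W - V1| <= et * (2 * `|a0| + 2).
  rewrite (_ : W - V1 = (u - x2) - (x - a0) * ((x - a0) + 2 * a0)); last by rewrite /W /V1; ring.
  apply: le_trans (ler_normB _ _) _.
  apply: (@le_trans _ _ (et + et * (et + 2 * `|a0|))); last by nra.
  apply: lerD; first exact: ltW.
  rewrite normrM; apply: ler_pM => //; first exact: ltW.
  by apply: le_trans (ler_normD _ _) _; rewrite normrM (@ger0_norm _ 2)// lerD// ltW.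
have W1 : `|W| <= V1 + 2 * `|a0| + 2.
  rewrite -(subrK V1 W); apply: le_trans (ler_normD _ _) _; rewrite (ger0_norm V0).
  by nra.
rewrite (_ : c * W - V1 = (c - 1) * W + (W - V1)); last by ring.
apply: le_trans (ler_normD _ _) _; rewrite normrM (ger0_norm c0).
have : (c - 1) * `|W| <= et * (V1 + 2 * `|a0| + 2) by apply: ler_pM.
lra.
Qed.

Hypotheses (Vf_ge0 : a ^+ 2 <= F2) (Vg_ge0 : a' ^+ 2 <= G2).

Lemma typical_mean et m (t : m.-tuple T) : typical et t ->
  `|intercept_estimate alpha kappa (sample t) - s1| <= (K + 1) * et / q.
Proof.
move=> [H1 H2 _ _]; rewrite /intercept_estimate /s1 /extrapolate -/K -/q -mulrBl normrM.
rewrite (@gtr0_norm _ q^-1) ?invr_gt0// ler_wpM2r ?invr_ge0 ?(ltW q_gt0)//.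
set x := array_mean _ false; set y := array_mean _ true.
rewrite (_ : _ - _ - _ = K * (x - a) - (y - a')); last by ring.
have K0 : 0 < K := lt_trans ltr01 K1.
apply: le_trans (ler_normB _ _) _; rewrite normrM (gtr0_norm K0) mulrDl mul1r lerD//; last exact: ltW.
by rewrite ler_wpM2l// ltW.
Qed.

Lemma typical_var et m (t : m.-tuple T) : (1 < m)%N -> 0 < et -> et <= 1 -> (m%:R - 1)^-1 <= et ->
  typical et t -> `|pooled_var alpha kappa (sample t) - limit_var| <= et * var_modulus.
Proof.
move=> m1 et0 et1 mt [H1 H2 H3 H4]; rewrite /pooled_var !array_varE//.
have m10 : 0 < m%:R - 1 :> R by rewrite subr_gt0 ltr1n.
have ce : m%:R / (m%:R - 1) - 1 = (m%:R - 1)^-1 :> R by field; rewrite gt_eqF.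
have c0 : 0 <= m%:R / (m%:R - 1) - 1 :> R by rewrite ce invr_ge0 ltW.
have c1 : m%:R / (m%:R - 1) - 1 <= et by rewrite ce.
have Vf0 : 0 <= F2 - a ^+ 2 by rewrite subr_ge0.
have Vg0 : 0 <= G2 - a' ^+ 2 by rewrite subr_ge0.
have Df := var_dev erefl Vf0 et0 et1 c0 c1 H3 H1.
have Dg := var_dev erefl Vg0 et0 et1 c0 c1 H4 H2.
rewrite /limit_var -/K.
set Xf := m%:R / (m%:R - 1) * _ in Df *; set Xg := m%:R / (m%:R - 1) * _ in Dg *.
rewrite (_ : _ - _ = K ^+ 2 * (Xf - (F2 - a ^+ 2)) + (Xg - (G2 - a' ^+ 2))); last by ring.
apply: le_trans (ler_normD _ _) _; rewrite /var_modulus [leRHS]mulrDr; apply: lerD => //.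
rewrite normrM (ger0_norm (sqr_ge0 K)) mulrCA; exact: ler_wpM2l (sqr_ge0 _) _ _ Df.
Qed.

Lemma limit_var_ge0 : 0 <= limit_var.
Proof.
by apply: addr_ge0; [apply: mulr_ge0; [exact: sqr_ge0|]|]; rewrite subr_ge0.
Qed.

Lemma var_modulus_ge0 : 0 <= var_modulus.
Proof.
have n1 := normr_ge0 a; have n2 := normr_ge0 a'.
have := Vf_ge0; have := Vg_ge0 => ? ?.
by apply: addr_ge0; [apply: mulr_ge0; [exact: sqr_ge0|lra]|lra].
Qed.

(** Away from the boundary the law of large numbers decides: the standard error tends to 0
    and the extrapolated mean tends to s1. *)
Lemma margin_lln (e tau : R) : 0 < e -> 0 < tau -> exists A : forall m, set (m.-tuple T),
  [/\ forall m, measurable (A m), \forall m \near \oo, fine (iid mu m (A m)) <= e &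
   \forall m \near \oo, forall t : m.-tuple T, ~ A m t -> `|margin t - (s1 - b)| <= tau].
Proof.
move=> e0 tau0.
have K0 : 0 < K + 1 by rewrite addr_gt0// (lt_trans ltr01 K1).
pose et : R := Num.min 1 (tau / 2 * q / (K + 1)).
have et0 : 0 < et.
  by rewrite lt_min ltr01 /=; apply: divr_gt0 => //; apply: mulr_gt0 => //; exact: divr_gt0.
have et1 : et <= 1 by rewrite ge_min lexx.
have et2 : (K + 1) * et / q <= tau / 2.
  by rewrite ler_pdivrMr// mulrC -ler_pdivlMr// ge_min lexx orbT.
have [A [mA At PA]] := typical_likely et0 e0.
exists A; split => //.
pose C := Num.sqrt (limit_var + var_modulus).
have lim : (Num.sqrt m%:R)^-1 * (`|z| * C / q) @[m --> \oo] --> (0 : R).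
  rewrite -(mul0r (`|z| * C / q)); apply: cvgM; last exact: cvg_cst.
  exact: cvg_inv_sqrtn.
have /cvgrPdist_le/(_ (tau / 2)) := lim; rewrite divr_gt0// => /(_ isT) {}lim.
have inv : \forall m \near \oo, ((m%:R : R) - 1)^-1 <= et.
  near=> m.
  have m1 : et^-1 + 1 <= m%:R by near: m; exact: nbhs_infty_ger.
  have i0 : 0 < et^-1 by rewrite invr_gt0.
  rewrite -[leRHS]invrK lef_pV2 ?posrE//; last lra.
  lra.
near=> m => t /At tt.
have m1 : (1 < m)%N by near: m; exact: nbhs_infty_gt.
have mt : ((m%:R : R) - 1)^-1 <= et by near: m.
have V1 := typical_var m1 et0 et1 mt tt.
have V0 := pooled_var_ge0 alpha kappa (sample t) m1.
have VC : pooled_var alpha kappa (sample t) <= limit_var + var_modulus.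
  have := var_modulus_ge0; move: V1; rewrite ler_norml => /andP[_ ?] ?; nra.
have se : `|z * standard_error alpha kappa (sample t)| <= tau / 2.
  have L : `|0 - (Num.sqrt m%:R)^-1 * (`|z| * C / q)| <= tau / 2 by near: m.
  have m0 : 0 <= (Num.sqrt (m%:R : R))^-1 by rewrite invr_ge0 sqrtr_ge0.
  have qi : 0 <= q^-1 by rewrite invr_ge0 ltW.
  have C0 : 0 <= `|z| * C / q by apply: mulr_ge0 => //; apply: mulr_ge0 => //; exact: sqrtr_ge0.
  move: L; rewrite sub0r normrN (ger0_norm (mulr_ge0 m0 C0)); apply: le_trans.
  rewrite standard_errorE// -/K -/q; set sV := Num.sqrt (pooled_var _ _ _).
  have -> : z * (sV / (Num.sqrt m%:R * q)) = (Num.sqrt m%:R)^-1 * (z * sV / q) by rewrite invfM; ring.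
  rewrite normrM (ger0_norm m0); apply: ler_wpM2l => //; rewrite normrM (ger0_norm qi).
  apply: ler_wpM2r => //.
  rewrite normrM; apply: ler_wpM2l => //; rewrite (ger0_norm (sqrtr_ge0 _)).
  by rewrite ler_sqrt// addr_ge0 ?limit_var_ge0 ?var_modulus_ge0.
have M := typical_mean tt.
rewrite /margin; set x := intercept_estimate _ _ _ in M *; set w := z * _ in se *.
rewrite (_ : x - (b + w) - (s1 - b) = (x - s1) - w); last by ring.
apply: le_trans (ler_normB _ _) _; lra.
Unshelve. all: by end_near. Qed.

Hypothesis Efg : \int[mu]_t (f t * g t) = a * a'.

Let X t := K * f t - g t - (K * a - a').

Lemma contrast_mean : \int[mu]_t X t = 0.
Proof.
have i1 := sqr_integrable_integrable mf if2.
have i2 := sqr_integrable_integrable mg ig2.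
have j1 : mu.-integrable setT (EFin \o (fun t => K * f t)) by exact: (integrableZl measurableT K i1).
have j : mu.-integrable setT (EFin \o (fun t => K * f t - g t)) by exact: (integrableB measurableT j1 i2).
rewrite (RintegralB measurableT j (prob_cst_integrable mu _)) Rintegral_prob_cst (RintegralB measurableT j1 i2).
by rewrite RintegralZl// Ef Eg subrr.
Qed.

(** The cross term is the covariance of f and g, which vanishes by hypothesis. *)
Lemma contrast_sqr : mu.-integrable setT (fun t => (X t ^+ 2)%:E) /\ \int[mu]_t (X t ^+ 2) = limit_var.
Proof.
have i1 := sqr_integrable_integrable mf if2.
have i2 := sqr_integrable_integrable mg ig2.
have ifg : mu.-integrable setT (EFin \o (fun t => f t * g t)).
  have ifs : mu.-integrable setT (EFin \o (fun t => f t ^+ 2 + g t ^+ 2)) by exact: (integrableD measurableT if2 ig2).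
  apply: (@le_integrable _ _ _ mu setT measurableT _ _ _ _ ifs).
    by apply/measurable_EFinP; exact: measurable_funM.
  move=> t _ /=; rewrite lee_fin (ger0_norm (addr_ge0 (sqr_ge0 _) (sqr_ge0 _))).
  have h1 := sqr_ge0 (f t - g t); have h2 := sqr_ge0 (f t + g t).
  rewrite ler_norml; apply/andP; split; nra.
pose k := K * a - a'.
have E : X = (fun t => K * f t - g t - k) by [].
have XE t : X t ^+ 2 = (K ^+ 2 * f t ^+ 2 + g t ^+ 2) + ((- (2 * K)) * (f t * g t) + ((- (2 * k * K)) * f t + (2 * k * g t + k ^+ 2))).
  by rewrite E; ring.
have j1 : mu.-integrable setT (EFin \o (fun t => K ^+ 2 * f t ^+ 2)) by exact: (integrableZl measurableT _ if2).
have j12 : mu.-integrable setT (EFin \o (fun t => K ^+ 2 * f t ^+ 2 + g t ^+ 2)) by exact: (integrableD measurableT j1 ig2).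
have j3 : mu.-integrable setT (EFin \o (fun t => (- (2 * K)) * (f t * g t))) by exact: (integrableZl measurableT _ ifg).
have j4 : mu.-integrable setT (EFin \o (fun t => (- (2 * k * K)) * f t)) by exact: (integrableZl measurableT _ i1).
have j5 : mu.-integrable setT (EFin \o (fun t => 2 * k * g t)) by exact: (integrableZl measurableT _ i2).
have jk := prob_cst_integrable mu (k ^+ 2).
have j56 : mu.-integrable setT (EFin \o (fun t => 2 * k * g t + k ^+ 2)) by exact: (integrableD measurableT j5 jk).
have j456 : mu.-integrable setT (EFin \o (fun t => (- (2 * k * K)) * f t + (2 * k * g t + k ^+ 2))) by exact: (integrableD measurableT j4 j56).
have j3456 : mu.-integrable setT (EFin \o (fun t => (- (2 * K)) * (f t * g t) + ((- (2 * k * K)) * f t + (2 * k * g t + k ^+ 2)))) by exact: (integrableD measurableT j3 j456).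
split.
  by under eq_fun do rewrite XE; exact: (integrableD measurableT j12 j3456).
under eq_Rintegral do rewrite XE.
rewrite (RintegralD measurableT j12 j3456) (RintegralD measurableT j1 ig2) (RintegralD measurableT j3 j456).
rewrite (RintegralD measurableT j4 j56) (RintegralD measurableT j5 jk) Rintegral_prob_cst.
rewrite !RintegralZl// Ef Eg Efg -/F2 -/G2 /limit_var /k; ring.
Qed.

(** On the boundary s1 = b the statistic, multiplied by sqrt m, is the normalized sum of the
    centered contrast compared with z times the empirical deviation, so that the central
    limit theorem gives the level gamma. The threshold - 1 / m is negligible after
    multiplication by sqrt m. *)
Lemma margin_boundary (gamma e : R) : 0 < gamma -> gamma < 1 -> 0 < e -> s1 = b -> 0 < limit_var ->
  z = normal_quantile (1 - gamma) ->
  \forall m \near \oo, fine (iid mu m [set t | - (m%:R)^-1 <= margin t]) <= gamma + e.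
Proof.
move=> gamma0 gamma1 e0 sb lv0 zE.
have g1 : 0 < 1 - gamma < 1 by apply/andP; split; lra.
pose s := Num.sqrt limit_var.
have s0 : 0 < s by rewrite sqrtr_gt0.
have s2 : s ^+ 2 = limit_var by rewrite sqr_sqrtr// ltW.
have [iX2 EX2] := contrast_sqr; rewrite -s2 in EX2.
have mX : measurable_fun setT X.
  by apply: measurable_funB => //; apply: measurable_funB => //; exact: measurable_funM.
(* three margins dl, divided by s, move the quantile by e / 4, which costs e / 2 *)
pose dl := s * e / 12.
have dl0 : 0 < dl by rewrite divr_gt0// mulr_gt0.
have h4 : [set y | z * s - 2 * dl - dl <= s * y] = [set y | normal_quantile (1 - gamma) - e / 4 <= y].
  apply/seteqP; rewrite -zE (_ : z * s - 2 * dl - dl = s * (z - e / 4)); last by rewrite /dl; field.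
  by split => y /=; rewrite ler_pM2l.
(* et is so small that z times the error on the deviation is at most dl *)
pose M := (`|z| + 1) * (var_modulus + 1).
have M0 : 0 < M by rewrite mulr_gt0// ltr_wpDl// var_modulus_ge0.
pose et : R := Num.min 1 (dl * s / M).
have et0 : 0 < et by rewrite lt_min ltr01 /=; apply: divr_gt0 => //; exact: mulr_gt0.
have et1 : et <= 1 by rewrite ge_min lexx.
have etM : et * M <= dl * s by rewrite -ler_pdivlMr// ge_min lexx orbT.
have e4 : 0 < e / 4 by rewrite divr_gt0.
have [A [mA At PA]] := typical_likely et0 e4.
have clt := clt_tail (z * s - 2 * dl) mX iX2 contrast_mean s0 EX2 dl0 e4.
have lim : (Num.sqrt m%:R)^-1 * q @[m --> \oo] --> (0 : R).
  by rewrite -(mul0r q); apply: cvgM; [exact: cvg_inv_sqrtn|exact: cvg_cst].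
have /cvgrPdist_le/(_ dl dl0) {}lim := lim.
have inv : \forall m \near \oo, ((m%:R : R) - 1)^-1 <= et.
  near=> m.
  have m1 : et^-1 + 1 <= m%:R by near: m; exact: nbhs_infty_ger.
  have i0 : 0 < et^-1 by rewrite invr_gt0.
  rewrite -[leRHS]invrK lef_pV2 ?posrE//; last lra.
  lra.
near=> m.
have m1 : (1 < m)%N by near: m; exact: nbhs_infty_gt.
have mt : ((m%:R : R) - 1)^-1 <= et by near: m.
have mB : measurable [set t : m.-tuple T | - (m%:R)^-1 <= margin t] by apply: measurable_ge; exact: measurable_margin.
have mC : measurable [set t : m.-tuple T | z * s - 2 * dl <= (\sum_(i < m) X (tnth t i)) / Num.sqrt m%:R].
  apply: (@measurable_ge _ _ _ (fun t : m.-tuple T => (\sum_(i < m) X (tnth t i)) / Num.sqrt m%:R)).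
  by apply: measurable_funM => //; exact: measurable_sum_tuple.
have qm0 : `|0 - (Num.sqrt m%:R)^-1 * q| <= dl by near: m; exact: lim.
have sub : [set t : m.-tuple T | - (m%:R)^-1 <= margin t] `<=`
    A m `|` [set t | z * s - 2 * dl <= (\sum_(i < m) X (tnth t i)) / Num.sqrt m%:R].
  move=> t /= Bt; have [?|nA] := pselect (A m t); [by left|right].
  have tt := At _ _ nA.
  have V1 := typical_var m1 et0 et1 mt tt.
  have V0 := pooled_var_ge0 alpha kappa (sample t) m1.
  rewrite -s2 in V1.
  have sV := abs_sqrtB V0 s0.
  set w := Num.sqrt (pooled_var _ _ _) in sV.
  have ws : `|z| * `|w - s| <= dl.
    have h1 : `|w - s| * s <= et * var_modulus.
      by apply: le_trans V1; rewrite -ler_pdivlMr.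
    have n0 := normr_ge0 z; have v0 := var_modulus_ge0.
    rewrite -(ler_pM2r s0); apply: le_trans etM.
    rewrite -mulrA; apply: (@le_trans _ _ (`|z| * (et * var_modulus))); first exact: ler_wpM2l.
    by rewrite /M; nra.
  have qm : (Num.sqrt m%:R)^-1 * q <= dl.
    by apply: le_trans (ler_norm _) _; rewrite -normrN -sub0r.
  set r := Num.sqrt (m%:R : R) in qm *.
  have m0 : 0 < (m%:R : R) by rewrite ltr0n ltnW.
  have r0 : 0 < r by rewrite sqrtr_gt0.
  have rr : r * r = m%:R by rewrite -expr2 sqr_sqrtr// ltW.
  have SX : \sum_(i < m) X (tnth t i) = m%:R * q * (intercept_estimate alpha kappa (sample t) - s1).
    rewrite /intercept_estimate /s1 /extrapolate /array_mean /sample -/K -/q.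
    have -> : \sum_(i < m) X (tnth t i) = K * (\sum_(i < m) f (tnth t i)) - \sum_(i < m) g (tnth t i) - m%:R * (K * a - a').
      by rewrite /X sumrB sumrB -mulr_sumr sumr_const card_ord -[_ *+ m]mulr_natl.
    by field; rewrite !gt_eqF.
  move: Bt; rewrite /margin standard_errorE// -/w -/r -/K -/q -sb SX.
  set x := intercept_estimate _ _ _ => Bt.
  have Bt' : z * w - r^-1 * q <= r * q * (x - s1).
    have h : 0 <= (x - (s1 + z * (w / (r * q))) + m%:R^-1) * (r * q).
      by apply: mulr_ge0; [lra|rewrite mulr_ge0 ?ltW].
    rewrite -subr_ge0; apply: le_trans h _; rewrite le_eqVlt; apply/orP; left; apply/eqP.
    by rewrite -rr; field; rewrite !gt_eqF.
  have -> : m%:R * q * (x - s1) / r = r * q * (x - s1) by rewrite -rr; field; rewrite gt_eqF.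
  apply: le_trans Bt'.
  have : - (z * (w - s)) <= dl.
    by apply: le_trans ws; rewrite -normrM -normrN ler_norm.
  lra.
apply: le_trans (fine_prob_le (iid mu m) mB (measurableU _ _ (mA m) mC) sub) _.
apply: le_trans (fine_probU (iid mu m) (mA m) mC) _.
have h1 : fine (iid mu m (A m)) <= e / 4 by near: m.
have h2 : fine (iid mu m [set t | z * s - 2 * dl <= (\sum_(i < m) X (tnth t i)) / Num.sqrt m%:R]) <=
    fine (gauss [set y | z * s - 2 * dl - dl <= s * y]) + e / 4 by near: m; exact: clt.
have h3 := gauss_quantile g1 e4.
rewrite h4 in h2; lra.
Unshelve. all: by end_near. Qed.

End two_sample_rule.

(** * Moments of the limiting observations *)

Section product_moments.
Context {R : realType} {d1 d2 : measure_display} {T1 : measurableType d1} {T2 : measurableType d2}.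
Variables (m1 : probability T1 R) (m2 : probability T2 R) (f : T1 -> R) (g : T2 -> R).
Hypotheses (f0 : forall x, 0 <= f x) (g0 : forall x, 0 <= g x)
  (fi : m1.-integrable setT (EFin \o f)) (gi : m2.-integrable setT (EFin \o g)).

Let mf : measurable_fun setT f.
Proof. by apply/measurable_EFinP; case/integrableP: fi. Qed.

Let mg : measurable_fun setT g.
Proof. by apply/measurable_EFinP; case/integrableP: gi. Qed.

Let mfg : measurable_fun setT (fun x : (T1 * T2)%type => f x.1 * g x.2).
Proof.
by apply: measurable_funM; [exact: (measurableT_comp mf measurable_fst)|exact: (measurableT_comp mg measurable_snd)].
Qed.

Let prodE : (\int[(m1 \x m2)%E]_x (f x.1 * g x.2)%:E = (\int[m1]_x f x * \int[m2]_x g x)%:E)%E.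
Proof.
rewrite fubini_tonelli1//; last 2 first.
- exact/measurable_EFinP.
- by move=> x; rewrite lee_fin mulr_ge0.
rewrite EFinM (EFin_Rintegral fi) (EFin_Rintegral gi).
rewrite -ge0_integralZr//; last 3 first.
- exact/measurable_EFinP.
- by move=> x _; rewrite lee_fin.
- by apply: integral_ge0 => x _; rewrite lee_fin.
apply: eq_integral => x _; rewrite /fubini_F /=.
under eq_integral do rewrite EFinM.
rewrite ge0_integralZl//; first exact/measurable_EFinP.
- by move=> y _; rewrite lee_fin.
- by rewrite lee_fin.
Qed.

Lemma prod_integrable : ((m1 \x m2)%E : probability (T1 * T2)%type R).-integrable setT
  (EFin \o (fun x => f x.1 * g x.2)).
Proof.
apply/integrableP; split; first exact/measurable_EFinP.
rewrite (eq_integral (fun x => (f x.1 * g x.2)%:E)).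
  by apply: (@eq_ind_r _ _ (fun x => x < +oo)%E _ _ prodE); exact: ltry.
by move=> x _ /=; rewrite ger0_norm// mulr_ge0.
Qed.

Lemma prod_Rintegral :
  \int[((m1 \x m2)%E : probability (T1 * T2)%type R)]_x (f x.1 * g x.2) = \int[m1]_x f x * \int[m2]_x g x.
Proof. by apply: EFin_inj; rewrite (EFin_Rintegral prod_integrable); exact: prodE. Qed.

End product_moments.

Section marginals.
Context {R : realType} {d1 d2 : measure_display} {T1 : measurableType d1} {T2 : measurableType d2}.
Variables (m1 : probability T1 R) (m2 : probability T2 R).
Local Notation mu := ((m1 \x m2)%E : probability (T1 * T2)%type R).

Lemma marginal1 (f : T1 -> R) : (forall x, 0 <= f x) -> m1.-integrable setT (EFin \o f) ->
  mu.-integrable setT (EFin \o (fun x => f x.1)) /\ \int[mu]_x f x.1 = \int[m1]_x f x.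
Proof.
move=> f0 fi; have g0 (x : T2) : 0 <= (1 : R) by [].
have gi := prob_cst_integrable m2 1.
have E : (fun x : T1 * T2 => f x.1) = (fun x => f x.1 * 1) by apply/funext => x; rewrite mulr1.
rewrite E; split; first exact: (prod_integrable f0 g0 fi gi).
by rewrite (prod_Rintegral f0 g0 fi gi) Rintegral_prob_cst mulr1.
Qed.

Lemma marginal2 (f : T2 -> R) : (forall x, 0 <= f x) -> m2.-integrable setT (EFin \o f) ->
  mu.-integrable setT (EFin \o (fun x => f x.2)) /\ \int[mu]_x f x.2 = \int[m2]_x f x.
Proof.
move=> f0 fi; have g0 (x : T1) : 0 <= (1 : R) by [].
have gi := prob_cst_integrable m1 1.
have E : (fun x : T1 * T2 => f x.2) = (fun x => 1 * f x.2) by apply/funext => x; rewrite mul1r.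
rewrite E; split; first exact: (prod_integrable g0 f0 gi fi).
by rewrite (prod_Rintegral g0 f0 gi fi) Rintegral_prob_cst mul1r.
Qed.

End marginals.

Lemma sqr_near_one (R : realType) (z : R) : (z ^+ 2 - 1) ^+ 2 < 64^-1 ->
  (0 <= z -> z \in `[7/8, 9/8]) /\ (z < 0 -> z \in `[-9/8, -7/8]).
Proof.
set w := z ^+ 2 - 1 => h.
have w1 : w < 8^-1 by have [hw|//] := leP 8^-1 w; exfalso; nra.
have w2 : - 8^-1 < w by have [hw|//] := leP w (- 8^-1); exfalso; nra.
rewrite /w in w1 w2.
by split=> z0; rewrite in_itv /=; apply/andP; split; nra.
Qed.

Section gaussian_moments.
Context {R : realType}.
Local Notation gauss := (normal_prob (0 : R) 1 : probability (measurableTypeR R) R).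
Local Notation gauss2 := ((gauss \x gauss)%E : probability (measurableTypeR R * measurableTypeR R)%type R).

(** Otherwise z^2 - 1 would have mean square 0, that is z^2 = 1 almost surely; but by
    gauss_itv the law gives at most 1/2 to the two intervals on which z^2 is within 1/8 of
    1. *)
Lemma gauss_pow4_gt1 : 1 < \int[gauss]_z (z ^+ 4).
Proof.
have l2 : (7/8 : R) <= 9/8 by lra.
have l3 : (-9/8 : R) <= -7/8 by lra.
have arith (p v w x y m : R) : 1 <= p -> p <= v + w -> w <= x + y -> x <= 9/8 - 7/8 ->
  y <= -7/8 - (-9/8) -> v <= (m - 1) * 64 -> 1 < m by move=> *; lra.
have i2 : gauss.-integrable setT (EFin \o (fun z : R => z ^+ 2)) := gauss_pow2_integrable.
have i4 : gauss.-integrable setT (EFin \o (fun z : R => z ^+ 4)) := gauss_pow4_integrable.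
have iZ : gauss.-integrable setT (EFin \o (fun z : R => (-2) * z ^+ 2)) by exact: (integrableZl measurableT (-2) i2).
have i1 := prob_cst_integrable gauss 1.
have iZ1 : gauss.-integrable setT (EFin \o (fun z : R => (-2) * z ^+ 2 + 1)) by exact: (integrableD measurableT iZ i1).
have iX0 : gauss.-integrable setT (EFin \o (fun z : R => z ^+ 4 + ((-2) * z ^+ 2 + 1))) by exact: (integrableD measurableT i4 iZ1).
pose X (z : R) := z ^+ 4 + ((-2) * z ^+ 2 + 1).
have XE z : X z = (z ^+ 2 - 1) ^+ 2 by rewrite /X; ring.
have X0 z : 0 <= X z by rewrite XE sqr_ge0.
have EX : \int[gauss]_z X z = \int[gauss]_z (z ^+ 4) - 1.
  rewrite (RintegralD measurableT i4 iZ1) (RintegralD measurableT iZ i1) Rintegral_prob_cst.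
  by rewrite RintegralZl// gauss_variance; ring.
have e0 : 0 < 64^-1 :> R by rewrite invr_gt0.
have H := markov_ge e0 iX0 X0.
have mX : measurable_fun setT X by apply/measurable_EFinP; case/integrableP: iX0.
have m1 : measurable [set z | 64^-1 <= X z] by exact: measurable_ge.
have m2 : measurable (`[7/8, 9/8] : set R) by exact: measurable_itv.
have m3 : measurable (`[-9/8, -7/8] : set R) by exact: measurable_itv.
have T1 : fine (gauss setT) = 1 by rewrite (_ : gauss setT = 1%E)//; exact: probability_setT.
have sub : setT `<=` ([set z | 64^-1 <= X z] `|` (`[7/8, 9/8] `|` `[-9/8, -7/8])).
  move=> z _; have [h|h] := leP 64^-1 (X z); [by left|right].
  rewrite XE in h; have [h1 h2] := sqr_near_one h.
  by have [z0|z0] := leP 0 z; [left; exact: h1|right; exact: h2].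
have := fine_prob_le gauss measurableT (measurableU _ _ m1 (measurableU _ _ m2 m3)) sub.
have U1 := fine_probU gauss m1 (measurableU _ _ m2 m3).
have U2 := fine_probU gauss m2 m3.
have G2 := gauss_itv l2.
have G3 := gauss_itv l3.
rewrite EX invrK in H; rewrite T1 => h; exact: arith h U1 U2 G2 G3 H.
Qed.

(** Half the sum of the squares of two independent standard Gaussian variables is an
    exponential variable of mean 1. *)
Definition half_chi_square (x : measurableTypeR R * measurableTypeR R) : R := ((x.1 : R) ^+ 2 + (x.2 : R) ^+ 2) / 2.

Lemma half_chi_square_ge0 x : 0 <= half_chi_square x.
Proof. by rewrite divr_ge0// addr_ge0// sqr_ge0. Qed.

Lemma half_chi_square_mean : gauss2.-integrable setT (EFin \o half_chi_square) /\ \int[gauss2]_x half_chi_square x = 1.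
Proof.
have i2 : gauss.-integrable setT (EFin \o (fun z : measurableTypeR R => (z : R) ^+ 2)) := gauss_pow2_integrable.
have p2 (z : measurableTypeR R) : 0 <= (z : R) ^+ 2 by exact: sqr_ge0.
have [j1 E1] := marginal1 gauss p2 i2.
have [j2 E2] := marginal2 gauss p2 i2.
have j12 : gauss2.-integrable setT (EFin \o (fun x : measurableTypeR R * measurableTypeR R => (x.1 : R) ^+ 2 + (x.2 : R) ^+ 2)).
  exact: (integrableD measurableT j1 j2).
split; first by exact: (integrableZr measurableT 2^-1 j12).
rewrite /half_chi_square RintegralZr// (RintegralD measurableT j1 j2) E1 E2 gauss_variance; lra.
Qed.

Lemma half_chi_square_sqr : gauss2.-integrable setT (EFin \o (fun x => half_chi_square x ^+ 2)) /\
  1 < \int[gauss2]_x (half_chi_square x ^+ 2).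
Proof.
have i2 : gauss.-integrable setT (EFin \o (fun z : measurableTypeR R => (z : R) ^+ 2)) := gauss_pow2_integrable.
have i4 : gauss.-integrable setT (EFin \o (fun z : measurableTypeR R => (z : R) ^+ 4)) := gauss_pow4_integrable.
have p2 (z : measurableTypeR R) : 0 <= (z : R) ^+ 2 by exact: sqr_ge0.
have p4 (z : measurableTypeR R) : 0 <= (z : R) ^+ 4 by rewrite (exprM _ 2 2) sqr_ge0.
have [j1 E1] := marginal1 gauss p4 i4.
have [j2 E2] := marginal2 gauss p4 i4.
have j3 := prod_integrable p2 p2 i2 i2.
have E3 := prod_Rintegral p2 p2 i2 i2.
have j12 : gauss2.-integrable setT (EFin \o (fun x : measurableTypeR R * measurableTypeR R => (x.1 : R) ^+ 4 + (x.2 : R) ^+ 4)).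
  exact: (integrableD measurableT j1 j2).
have k12 : gauss2.-integrable setT (EFin \o (fun x : measurableTypeR R * measurableTypeR R => 4^-1 * ((x.1 : R) ^+ 4 + (x.2 : R) ^+ 4))).
  exact: (integrableZl measurableT _ j12).
have k3 : gauss2.-integrable setT (EFin \o (fun x : measurableTypeR R * measurableTypeR R => 2^-1 * ((x.1 : R) ^+ 2 * (x.2 : R) ^+ 2))).
  exact: (integrableZl measurableT _ j3).
have XE : (fun x => half_chi_square x ^+ 2) = (fun x : measurableTypeR R * measurableTypeR R => 4^-1 * ((x.1 : R) ^+ 4 + (x.2 : R) ^+ 4) + 2^-1 * ((x.1 : R) ^+ 2 * (x.2 : R) ^+ 2)).
  by apply/funext => x; rewrite /half_chi_square; field.
rewrite XE; split; first exact: (integrableD measurableT k12 k3).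
rewrite (RintegralD measurableT k12 k3) !RintegralZl// (RintegralD measurableT j1 j2) E1 E2 E3 gauss_variance.
have := gauss_pow4_gt1; lra.
Qed.

End gaussian_moments.

Lemma measurable_scale (R : realType) d (a : R) : measurable_fun setT (fun x : 'rV[R]_d => a *: x).
Proof. by move=> _ Y mY; rewrite setTI; exact: measurable_preimage_scale. Qed.

Section exp_power_moments.
Context {R : realType} {d : nat}.
Variables (sigma : {measure set 'rV[R]_d -> \bar R}) (rho : R) (S : 'rV[R]_d -> R) (a : R).
Hypotheses (rho_gt0 : 0 < rho) (S_factor : structure_factor rho sigma S) (a_gt0 : 0 < a)
  (S2 : (\int[lebesgue_rV R d]_(xi in eball a) (S xi ^+ 2)%:E < +oo)%E).

Local Notation lambda := (lebesgue_rV R d).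
Local Notation A := (ball_average rho sigma a).

Let mS : measurable_fun setT S. Proof. by case: S_factor. Qed.
Let S_ge0 x : 0 <= S x. Proof. by case: S_factor. Qed.

Lemma integral_unit_law (F : 'rV[R]_d -> R) : measurable_fun setT F -> (forall x, 0 <= F x) ->
  (\int[@unit_law R d]_x (F (a *: x))%:E = (fine (lambda (eball a)))^-1%:E * \int[lambda]_(x in eball a) (F x)%:E)%E.
Proof.
move=> mF F0.
have mb r : measurable (eball r : set 'rV[R]_d) := measurable_eball r.
have mFa : measurable_fun setT (fun x : 'rV[R]_d => (F (a *: x))%:E).
  apply/measurable_EFinP; apply: (measurableT_comp mF).
  exact: measurable_scale.
rewrite ge0_integral_mscale//; last by move=> x _; rewrite lee_fin.
rewrite (@ge0_integral_density _ _ _ lambda _ (\1_(eball 1)))//; last 2 first.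
- by move=> B mB; rewrite integral_indic// setIC.
- by move=> x; rewrite lee_fin.
have mi : measurable_fun setT (fun x => (F x)%:E * (\1_(eball a : set 'rV[R]_d) x)%:E)%E.
  by apply: emeasurable_funM; apply/measurable_EFinP => //; exact: measurable_indic.
have i0 x : (0 <= (F x)%:E * (\1_(eball a : set 'rV[R]_d) x)%:E)%E by rewrite -EFinM lee_fin mulr_ge0.
have H := ge0_integral_rV_affine 0 a_gt0 mi i0.
rewrite [X in (_ * X = _)%E](_ : _ = (a ^- d)%:E * \int[lambda]_(x in eball a) (F x)%:E)%E; last first.
  apply: (eq_trans _ (eq_trans H _)).
    apply: eq_integral => x _; rewrite addr0; congr (_ * _%:E)%E; rewrite !indicE; congr (nat_of_bool _)%:R.
    have [H1 H2] := eballZ 1 (a *: x) a_gt0; rewrite scalerA mulVf ?gt_eqF// scale1r mulr1 in H1 H2.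
    by apply/idP/idP; rewrite !inE.
  rewrite [in RHS]integral_mkcond.
  by congr (_ * _)%E; apply: eq_integral => x _; rewrite patchE indicE; case: ifPn; rewrite ?mule1 ?mule0.
rewrite muleA -EFinM [in RHS]lebesgue_eballE// invfM [in LHS]mulrC//.
Qed.

Local Notation phi := (fun x : 'rV[R]_d => S (a *: x)).
Local Notation mu1 := (@unit_law R d : probability 'rV[R]_d R).

Lemma uniform_power_sqr_integrable : mu1.-integrable setT (EFin \o (fun x => phi x ^+ 2)).
Proof.
have mphi : measurable_fun setT (fun x => phi x ^+ 2).
  apply: measurable_funX; apply: (measurableT_comp mS).
  exact: measurable_scale.
apply/integrableP; split; first exact/measurable_EFinP.
rewrite (eq_integral (fun x => (phi x ^+ 2)%:E)); last by move=> x _ /=; rewrite ger0_norm// sqr_ge0.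
have mS2 : measurable_fun setT (fun x => S x ^+ 2) by exact: measurable_funX.
have S20 x : 0 <= S x ^+ 2 by exact: sqr_ge0.
apply: (@eq_ind_r _ _ (fun x => x < +oo)%E _ _ (integral_unit_law mS2 S20)).
by apply: lte_mul_pinfty => //; rewrite lee_fin invr_ge0 fine_ge0.
Qed.

Lemma uniform_power_integrable : mu1.-integrable setT (EFin \o phi).
Proof.
apply: sqr_integrable_integrable; last exact: uniform_power_sqr_integrable.
apply: (measurableT_comp mS).
exact: measurable_scale.
Qed.

(** The intensity cancels: the ball average of the Bartlett measure is the mean of the
    structure factor over the ball. Finiteness of this mean comes from square integrability. *)
Lemma uniform_power_mean : \int[mu1]_x phi x = A.
Proof.
have I := integral_unit_law mS S_ge0.
have v0 : 0 < fine (lambda (eball a)).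
  by rewrite lebesgue_eballE// mulr_gt0 ?exprn_gt0// fine_eball1_gt0.
have fin : (\int[lambda]_(x in eball a) (S x)%:E)%E \is a fin_num.
  have := integrable_fin_num measurableT uniform_power_integrable.
  move=> H; have {H} : ((fine (lambda (eball a)))^-1%:E * \int[lambda]_(x in eball a) (S x)%:E)%E \is a fin_num by rewrite -I.
  have : (0 <= \int[lambda]_(x in eball a) (S x)%:E)%E by apply: integral_ge0 => x _; rewrite lee_fin.
  case: (\int[lambda]_(x in eball a) _)%E => // _.
  by rewrite gt0_muley// lte_fin invr_gt0.
rewrite /Rintegral I fineM//.
rewrite /ball_average; case: S_factor => _ _ ->; last exact: measurable_eball.
under [in RHS]eq_integral do rewrite EFinM.
rewrite ge0_integralZl//; last 4 first.
- exact: measurable_eball.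
- by apply/measurable_EFinP; exact: measurable_funTS.
- by move=> x _; rewrite lee_fin.
- by rewrite lee_fin ltW.
rewrite fineM//=; field; by rewrite !gt_eqF.
Qed.

Lemma exp_powerE x : exp_power S a x = phi x.1 * half_chi_square x.2.
Proof. by []. Qed.

Lemma exp_power_ge0 x : 0 <= exp_power S a x.
Proof. by rewrite exp_powerE mulr_ge0// half_chi_square_ge0. Qed.

Lemma exp_power_mean : (@point_law R d).-integrable setT (EFin \o exp_power S a) /\
  \int[@point_law R d]_x exp_power S a x = A.
Proof.
have [i E] := @half_chi_square_mean R.
have p0 x : 0 <= phi x by [].
split; first exact: (prod_integrable p0 half_chi_square_ge0 uniform_power_integrable i).
by rewrite [LHS](prod_Rintegral p0 half_chi_square_ge0 uniform_power_integrable i) E mulr1 uniform_power_mean.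
Qed.

(** The second moment is that of S at a uniform frequency times that of the exponential
    variable. The former is at least the square of the mean by Jensen's inequality and the
    latter is larger than 1, so that the variance vanishes only if the mean does. *)
Lemma exp_power_sqr : [/\ (@point_law R d).-integrable setT (EFin \o (fun x => exp_power S a x ^+ 2)),
  A ^+ 2 <= \int[@point_law R d]_x (exp_power S a x ^+ 2) &
  0 < A -> A ^+ 2 < \int[@point_law R d]_x (exp_power S a x ^+ 2)].
Proof.
have [i E] := @half_chi_square_sqr R.
have p0 x : 0 <= phi x ^+ 2 by exact: sqr_ge0.
have q0 x : 0 <= half_chi_square x ^+ 2 :> R by exact: sqr_ge0.
have XE : (fun x => exp_power S a x ^+ 2) = (fun x => phi x.1 ^+ 2 * half_chi_square x.2 ^+ 2).
  by apply/funext => x; rewrite exp_powerE exprMn.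
have J : A ^+ 2 <= \int[mu1]_x (phi x ^+ 2).
  have k1 : mu1.-integrable setT (EFin \o (fun x => (- (2 * A)) * phi x)) by exact: (integrableZl measurableT _ uniform_power_integrable).
  have kc := prob_cst_integrable mu1 (A ^+ 2).
  have k2 : mu1.-integrable setT (EFin \o (fun x => (- (2 * A)) * phi x + A ^+ 2)) by exact: (integrableD measurableT k1 kc).
  have : 0 <= \int[mu1]_x (phi x ^+ 2 + ((- (2 * A)) * phi x + A ^+ 2)).
    apply: Rintegral_ge0 => x _; rewrite (_ : _ + _ = (phi x - A) ^+ 2) ?sqr_ge0//; ring.
  rewrite (RintegralD measurableT uniform_power_sqr_integrable k2) (RintegralD measurableT k1 kc) Rintegral_prob_cst.
  rewrite RintegralZl//; last exact: uniform_power_integrable.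
  rewrite uniform_power_mean; set Q := Rintegral _ _ _; nra.
rewrite XE; split; first exact: (prod_integrable p0 q0 uniform_power_sqr_integrable i).
- rewrite [leRHS](prod_Rintegral p0 q0 uniform_power_sqr_integrable i); set c := Rintegral _ _ (fun x => half_chi_square x ^+ 2) in E *.
  have := sqr_ge0 A; move: J; set Q := Rintegral _ _ _; nra.
- move=> A0; rewrite [ltRHS](prod_Rintegral p0 q0 uniform_power_sqr_integrable i); set c := Rintegral _ _ (fun x => half_chi_square x ^+ 2) in E *.
  have A2 : 0 < A ^+ 2 by rewrite exprn_gt0.
  move: J; set Q := Rintegral _ _ _; nra.
Qed.

Lemma ball_average_ge0 : 0 <= A.
Proof. by rewrite -uniform_power_mean; apply: Rintegral_ge0. Qed.

End exp_power_moments.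

(** * The rejection rule at a fixed radius *)

Section extended_limits.
Context {R : realType} {X : choiceType} {V : filteredType X}.
Implicit Types (f : V -> \bar R) (F : set_system V) (c : \bar R).

Lemma limf_esup_le f F c : (\forall x \near F, (f x <= c)%E) -> (limf_esup f F <= c)%E.
Proof.
move=> H; rewrite limf_esupE; apply: (@le_trans _ _ (ereal_sup (f @` [set x | (f x <= c)%E]))).
  by apply: ereal_inf_lbound; exists [set x | (f x <= c)%E].
by apply: ge_ereal_sup => _ [x h <-].
Qed.

Lemma limf_einf_ge f F c : Filter F -> (\forall x \near F, (c <= f x)%E) -> (c <= limf_einf f F)%E.
Proof.
move=> FF H; rewrite /limf_einf leeNr; apply: limf_esup_le.
by apply: filterS H => x; rewrite leeN2.
Qed.

Lemma limf_einf_le f F c : ProperFilter F -> (\forall x \near F, (f x <= c)%E) -> (limf_einf f F <= c)%E.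
Proof.
move=> PF H; rewrite /limf_einf leeNl limf_esupE; apply: le_ereal_inf_tmp => _ [B FB <-].
have [x [Bx Hx]] := filter_ex (filterI FB H).
apply: (@le_trans _ _ (- f x)%E); first by rewrite leeN2.
by apply: ereal_sup_ubound; exists x.
Qed.

End extended_limits.

Section split_array.
Context {R : realType}.

Definition split_array m (v : 'rV[R]_(m + m)) (a : bool) (j : 'I_m) : R :=
  v ord0 (if a then rshift m j else lshift m j).

(** The margin as a function of the row of all the observations, to which convergence in
    distribution applies. *)
Definition margin_row (alpha kappa b z : R) m (v : 'rV[R]_(m + m)) : R :=
  intercept_estimate alpha kappa (split_array v) - (b + z * standard_error alpha kappa (split_array v)).

Lemma sum_continuous (V : topologicalType) m (F : 'I_m -> V -> R) : (forall i, continuous (F i)) ->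
  continuous (fun v => \sum_i F i v).
Proof.
move=> cF; elim: m F cF => [|m IH] F cF.
  by under eq_fun do rewrite big_ord0; exact: cst_continuous.
under eq_fun do rewrite big_ord_recl.
move=> v; apply: (@continuousD _ _ _ (F ord0) (fun v => \sum_i F (lift ord0 i) v)); first exact: cF.
by apply: IH.
Qed.

Lemma margin_row_continuous alpha kappa b z m : continuous (@margin_row alpha kappa b z m).
Proof.
have cc a j : continuous (fun v : 'rV[R]_(m + m) => split_array v a j) by exact: coord_continuous.
have cM (f g : 'rV[R]_(m + m) -> R) : continuous f -> continuous g -> continuous (fun v => f v * g v).
  by move=> cf cg v; apply: (@continuousM _ _ f g); [exact: cf|exact: cg].
have cB (f g : 'rV[R]_(m + m) -> R) : continuous f -> continuous g -> continuous (fun v => f v - g v).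
  by move=> cf cg v; apply: (@continuousB _ _ _ f g); [exact: cf|exact: cg].
have cD (f g : 'rV[R]_(m + m) -> R) : continuous f -> continuous g -> continuous (fun v => f v + g v).
  by move=> cf cg v; apply: (@continuousD _ _ _ f g); [exact: cf|exact: cg].
have c0 (k : R) : continuous (fun _ : 'rV[R]_(m + m) => k) by exact: cst_continuous.
have cm a : continuous (fun v : 'rV[R]_(m + m) => array_mean (split_array v) a).
  by apply: (cM) => //; exact: sum_continuous.
have cv a : continuous (fun v : 'rV[R]_(m + m) => array_var (split_array v) a).
  apply: (cM) => //; apply: (@sum_continuous _ _ (fun j v => (split_array v a j - array_mean (split_array v) a) ^+ 2)) => j.
  by under eq_fun do rewrite expr2; apply: (cM); exact: cB.
apply: (cB); first by apply: (cM) => //; apply: (cB) => //; exact: cM.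
apply: (cD) => //; apply: (cM) => // v.
apply: (@continuous_comp _ _ _ (fun v => (kappa `^ (2 * alpha) * array_var (split_array v) false + array_var (split_array v) true) /
            (m%:R * (kappa `^ alpha - 1) ^+ 2)) Num.sqrt); last exact: sqrt_continuous.
by apply: (cM) => //; apply: (cD) => //; exact: cM.
Qed.

End split_array.

Lemma lebesgue_origin (R : realType) d : (0 < d)%N -> lebesgue_rV R d [set 0] = 0%E.
Proof.
move=> d0; apply/eqP; rewrite eq_le measure_ge0 andbT; apply/lee_addgt0Pr => e e0; rewrite add0e.
(* the origin lies in a box of side at most e and at most 1 *)
pose r : R := Num.min 1 e / 2.
have m0 : 0 < Num.min 1 e by rewrite lt_min ltr01.
have r0 : 0 < r by rewrite divr_gt0.
apply: (@le_trans _ _ (lebesgue_rV R d [set x | `|x| <= r])).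
  apply: le_measure.
  - by rewrite inE; exact: measurable_rV_set0.
  - by rewrite inE; apply: measurable_normbox; exact: ltW.
  - by move=> x /= ->; rewrite normr0 ltW.
rewrite lebesgue_normbox// lee_fin; have -> : 2 * r = Num.min 1 e by rewrite /r; field.
apply: (@le_trans _ _ (Num.min 1 e)); last by rewrite ge_min lexx orbT.
by rewrite -[leRHS]expr1 ler_wiXn2l// ?ge_min ?lexx// ltW.
Qed.

Lemma sigma_origin (R : realType) d (sigma : {measure set 'rV[R]_d -> \bar R}) : (0 < d)%N ->
  sigma `<< lebesgue_rV R d -> sigma [set 0] = 0%E.
Proof.
move=> d0 /null_content_dominatesP; apply; first exact: measurable_rV_set0.
exact: lebesgue_origin.
Qed.

Section fixed_radius.
Context {R : realType} {d : nat} {dO : measure_display} {Omega : measurableType dO}.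
Variables (P : probability Omega R) (eta : R.-ker Omega ~> 'rV[R]_d) (rho : R)
  (sigma : {measure set 'rV[R]_d -> \bar R}) (S : 'rV[R]_d -> R) (h : 'rV[R]_d -> R[i]).
Hypotheses (eta_pp : point_process eta) (h_test : test_function h) (rho_gt0 : 0 < rho)
  (S_factor : structure_factor rho sigma S)
  (lln : forall e : R, 0 < e ->
    fine (P [set w | e <= `|empirical_intensity eta T w - rho|]) @[T --> +oo] --> 0)
  (hF : fourier_condition P eta rho S h).
Variables (alpha beta L gamma kappa r0 r : R) (U : forall m, bool -> 'I_m -> {RV P >-> 'rV[R]_d}).
Hypotheses (alpha_gt0 : 0 < alpha) (L_gt0 : 0 < L)
  (S_square_integrable : (\int[lebesgue_rV R d]_(xi in eball r0) (S xi ^+ 2)%:E < +oo)%E)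
  (gamma_gt0 : 0 < gamma) (gamma_lt1 : gamma < 1) (kappa_gt1 : 1 < kappa)
  (r_gt0 : 0 < r) (r_le : kappa * r <= r0)
  (U_freq : forall m : nat, (2 <= m)%N -> random_frequencies eta kappa r (@U m)).

Local Notation A := (ball_average rho sigma).
Local Notation b := (bias_bound alpha beta L kappa r).
Local Notation z := (normal_quantile (1 - gamma)).
Local Notation s_r := (extrapolate alpha kappa (A r) (A (kappa * r))).
Local Notation mu := (@pair_law R d).

Let f (p : ('rV[R]_d * (measurableTypeR R * measurableTypeR R)) *
    ('rV[R]_d * (measurableTypeR R * measurableTypeR R))) : R := exp_power S r p.1.
Let g (p : ('rV[R]_d * (measurableTypeR R * measurableTypeR R)) *
    ('rV[R]_d * (measurableTypeR R * measurableTypeR R))) : R := exp_power S (kappa * r) p.2.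

Let kappa_gt0 : 0 < kappa. Proof. exact: lt_trans ltr01 kappa_gt1. Qed.
Let kr_gt0 : 0 < kappa * r. Proof. exact: mulr_gt0. Qed.
Let mS : measurable_fun setT S. Proof. by case: S_factor. Qed.
Let S_ge0 x : 0 <= S x. Proof. by case: S_factor. Qed.
Let K_gt1 : 1 < kappa `^ alpha.
Proof.
rewrite (_ : 1 = 1 `^ alpha); last by rewrite powR1.
apply: (gt0_ltr_powR alpha_gt0 _ _ kappa_gt1); rewrite nnegrE//.
exact: (ltW kappa_gt0).
Qed.

Let S2 a : a <= kappa * r -> (\int[lebesgue_rV R d]_(xi in eball a) (S xi ^+ 2)%:E < +oo)%E.
Proof.
move=> ar; apply: le_lt_trans S_square_integrable.
apply: ge0_subset_integral; try exact: measurable_eball.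
- by apply/measurable_EFinP/measurable_funX; exact: measurable_funTS.
- by move=> x _; rewrite lee_fin sqr_ge0.
- by move=> x /= h1; apply: lt_le_trans h1 _; exact: le_trans ar r_le.
Qed.

Let S2r : (\int[lebesgue_rV R d]_(xi in eball r) (S xi ^+ 2)%:E < +oo)%E.
Proof. by apply: S2; rewrite ler_peMl// ltW. Qed.
Let S2kr : (\int[lebesgue_rV R d]_(xi in eball (kappa * r)) (S xi ^+ 2)%:E < +oo)%E.
Proof. exact: S2. Qed.

Let mf : measurable_fun setT f.
Proof. exact: (measurableT_comp (measurable_exp_power mS r) measurable_fst). Qed.
Let mg : measurable_fun setT g.
Proof. exact: (measurableT_comp (measurable_exp_power mS (kappa * r)) measurable_snd). Qed.

Let f_sqr : mu.-integrable setT (fun p => (f p ^+ 2)%:E) /\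
  \int[mu]_p (f p ^+ 2) = \int[@point_law R d]_x (exp_power S r x ^+ 2).
Proof.
have [i _ _] := exp_power_sqr rho_gt0 S_factor r_gt0 S2r.
exact: (marginal1 (@point_law R d) (fun x => sqr_ge0 (exp_power S r x)) i).
Qed.

Let g_sqr : mu.-integrable setT (fun p => (g p ^+ 2)%:E) /\
  \int[mu]_p (g p ^+ 2) = \int[@point_law R d]_x (exp_power S (kappa * r) x ^+ 2).
Proof.
have [i _ _] := exp_power_sqr rho_gt0 S_factor kr_gt0 S2kr.
exact: (marginal2 (@point_law R d) (fun x => sqr_ge0 (exp_power S (kappa * r) x)) i).
Qed.

Let Ef : \int[mu]_p f p = A r.
Proof.
have [i E] := exp_power_mean rho_gt0 S_factor r_gt0 S2r.
by have [_ ->] := marginal1 (@point_law R d) (exp_power_ge0 r S_factor) i.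
Qed.

Let Eg : \int[mu]_p g p = A (kappa * r).
Proof.
have [i E] := exp_power_mean rho_gt0 S_factor kr_gt0 S2kr.
by have [_ ->] := marginal2 (@point_law R d) (exp_power_ge0 (kappa * r) S_factor) i.
Qed.

Let Efg : \int[mu]_p (f p * g p) = A r * A (kappa * r).
Proof.
have [i E] := exp_power_mean rho_gt0 S_factor r_gt0 S2r.
have [i' E'] := exp_power_mean rho_gt0 S_factor kr_gt0 S2kr.
rewrite -E -E'; exact: (prod_Rintegral (exp_power_ge0 r S_factor) (exp_power_ge0 (kappa * r) S_factor) i i').
Qed.

Let Vf : A r ^+ 2 <= \int[mu]_p (f p ^+ 2).
Proof. by have [_ ->] := f_sqr; have [] := exp_power_sqr rho_gt0 S_factor r_gt0 S2r. Qed.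
Let Vg : A (kappa * r) ^+ 2 <= \int[mu]_p (g p ^+ 2).
Proof. by have [_ ->] := g_sqr; have [] := exp_power_sqr rho_gt0 S_factor kr_gt0 S2kr. Qed.

Lemma bias_bound_gt0 : 0 < b.
Proof.
apply: mulr_gt0; last by apply: powR_gt0; exact: r_gt0.
apply: mulr_gt0 => //; apply: divr_gt0; last by rewrite subr_gt0 K_gt1.
by apply: addr_gt0; apply: powR_gt0; exact: kappa_gt0.
Qed.

(** If the limiting variance vanished, both ball averages would vanish by exp_power_sqr,
    hence also the extrapolated value, whereas the bias bound is positive. *)
Lemma limit_var_gt0 : s_r = b -> 0 < limit_var mu f g alpha kappa (A r) (A (kappa * r)).
Proof.
move=> sb; have K0 : 0 < kappa `^ alpha := lt_trans ltr01 K_gt1.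
have a0 := ball_average_ge0 rho_gt0 S_factor r_gt0 S2r.
have a'0 := ball_average_ge0 rho_gt0 S_factor kr_gt0 S2kr.
have Vf' : 0 <= \int[mu]_p (f p ^+ 2) - A r ^+ 2 by rewrite subr_ge0.
have Vg' : 0 <= \int[mu]_p (g p ^+ 2) - A (kappa * r) ^+ 2 by rewrite subr_ge0.
have [Ar|Ar] := ltP 0 (A r).
  apply: ltr_pwDl => //; apply: mulr_gt0; first exact: exprn_gt0.
  rewrite subr_gt0; have [_ ->] := f_sqr; have [_ _] := exp_power_sqr rho_gt0 S_factor r_gt0 S2r; exact.
have [Akr|Akr] := ltP 0 (A (kappa * r)).
  apply: ltr_wpDl; first by apply: mulr_ge0 => //; exact: sqr_ge0.
  rewrite subr_gt0; have [_ ->] := g_sqr; have [_ _] := exp_power_sqr rho_gt0 S_factor kr_gt0 S2kr; exact.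
have Z1 : A r = 0 by apply/eqP; rewrite eq_le Ar a0.
have Z2 : A (kappa * r) = 0 by apply/eqP; rewrite eq_le Akr a'0.
have := bias_bound_gt0; rewrite -sb Z1 Z2 /extrapolate mulr0 subrr mul0r ltxx//.
Qed.

Local Notation W := (@margin_row R alpha kappa b z).
Local Notation mrg := (margin f g alpha kappa b z).

Lemma margin_limit_row m (p : m.-tuple _) : W (limit_row S kappa r p) = mrg p.
Proof.
rewrite /margin_row /margin; suff -> : split_array (limit_row S kappa r p) = sample f g p by [].
apply/funext => -[]; apply/funext => j; by rewrite /split_array /limit_row /sample ?row_mxEl ?row_mxEr mxE.
Qed.

Lemma rejects_margin m T w :
  rejects alpha beta L kappa (fun a (j : 'I_m) => periodogram eta h T (U a j w) w) gamma r <->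
  0 < W (observed eta h (@U m) T w).
Proof.
rewrite /rejects /margin_row subr_gt0.
suff -> : split_array (observed eta h (@U m) T w) = (fun a (j : 'I_m) => periodogram eta h T (U a j w) w) by [].
apply/funext => a; apply/funext => j; rewrite /split_array /observed mxE tnth_mktuple /index_bool.
case: a; first by rewrite (unsplitK (inr j)).
by rewrite (unsplitK (inl j)).
Qed.

Let prob T m := P [set w | rejects alpha beta L kappa
    (fun a (j : 'I_m) => periodogram eta h T (U a j w) w) gamma r].

Lemma measurable_rejection m T : (1 < m)%N -> 0 < T -> measurable [set w | 0 < W (observed eta h (@U m) T w)].
Proof.
move=> m1 T0.
rewrite (_ : [set w | _] = (@margin_row R alpha kappa b z m \o observed eta h (@U m) T) @^-1` `]0, +oo[%classic); last first.
  by apply/seteqP; split=> w /=; rewrite in_itv /= andbT.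
rewrite -[X in measurable X]setTI; apply: measurableT_comp => //.
  by apply: continuous_rV_measurable; exact: margin_row_continuous.
exact: measurable_observed.
Qed.

Lemma rejection_fin m T : (1 < m)%N -> 0 < T -> prob T m = (fine (P [set w | 0 < W (observed eta h (@U m) T w)]))%:E.
Proof.
move=> m1 T0; have -> : prob T m = P [set w | 0 < W (observed eta h (@U m) T w)].
  by congr (P _); apply/seteqP; split=> w /= /rejects_margin.
by rewrite fineK// fin_num_measure//; exact: measurable_rejection.
Qed.

Let inv_small (tau : R) : 0 < tau -> \forall m \near \oo, (m%:R : R)^-1 <= tau.
Proof.
move=> tau0; near=> m.
have m1 : tau^-1 <= m%:R by near: m; exact: nbhs_infty_ger.
by rewrite -[leRHS]invrK lef_pV2 ?posrE ?invr_gt0//; apply: lt_le_trans m1; rewrite invr_gt0.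
Unshelve. all: by end_near. Qed.

(** Below the boundary the law of large numbers makes the probability tend to 0. On the
    boundary the central limit theorem applies, because the limiting variance is positive
    there. *)
Lemma limit_upper (e : R) : 0 < e -> s_r <= b ->
  \forall m \near \oo, fine (iid mu m [set p | - (m%:R)^-1 <= mrg p]) <= gamma + e.
Proof.
move=> e0; rewrite le_eqVlt => /orP[/eqP sb|sb].
  exact: (margin_boundary mf mg f_sqr.1 g_sqr.1 Ef Eg K_gt1 Vf Vg Efg gamma_gt0 gamma_lt1 e0 sb (limit_var_gt0 sb) erefl).
have tau0 : 0 < (b - s_r) / 2 by rewrite divr_gt0// subr_gt0.
have [B [mB PB HB]] := margin_lln b z mf mg f_sqr.1 g_sqr.1 Ef Eg K_gt1 Vf Vg e0 tau0.
have tau4 : 0 < (b - s_r) / 4 by rewrite divr_gt0// subr_gt0.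
have sm := inv_small tau4.
near=> m.
have h1 : fine (iid mu m (B m)) <= e by near: m.
have h2 : (m%:R : R)^-1 <= (b - s_r) / 4 by near: m.
have h3 : forall p : m.-tuple _, ~ B m p -> `|mrg p - (s_r - b)| <= (b - s_r) / 2 by near: m.
apply: le_trans (_ : e <= _); last by rewrite lerDr ltW.
apply: le_trans h1; apply: fine_prob_le; [|exact: mB|].
  by apply: measurable_ge; apply: measurable_margin; [exact: mf|exact: mg].
move=> p /= hp; have [//|nB] := pselect (B m p).
by move: (h3 p nB); rewrite ler_norml => /andP[_ ?]; lra.
Unshelve. all: by end_near. Qed.

Lemma limit_lower (e : R) : 0 < e -> b < s_r ->
  \forall m \near \oo, 1 - e <= fine (iid mu m [set p | (m%:R)^-1 <= mrg p]).
Proof.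
move=> e0 sb.
have tau0 : 0 < (s_r - b) / 2 by rewrite divr_gt0// subr_gt0.
have [B [mB PB HB]] := margin_lln b z mf mg f_sqr.1 g_sqr.1 Ef Eg K_gt1 Vf Vg e0 tau0.
have sm := inv_small tau0.
near=> m.
have h1 : fine (iid mu m (B m)) <= e by near: m.
have h2 : (m%:R : R)^-1 <= (s_r - b) / 2 by near: m.
have h3 : forall p : m.-tuple _, ~ B m p -> `|mrg p - (s_r - b)| <= (s_r - b) / 2 by near: m.
have mM : measurable [set p : m.-tuple _ | (m%:R)^-1 <= mrg p] by apply: measurable_ge; apply: measurable_margin; [exact: mf|exact: mg].
have sub : setT `<=` [set p : m.-tuple _ | (m%:R)^-1 <= mrg p] `|` B m.
  move=> p _; have [?|nB] := pselect (B m p); [by right|left] => /=.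
  by move: (h3 p nB); rewrite ler_norml => /andP[? _]; lra.
have := fine_prob_le (iid mu m) measurableT (measurableU _ _ mM (mB m)) sub.
have := fine_probU (iid mu m) mM (mB m).
have -> : fine (iid mu m setT) = 1 by rewrite (_ : iid mu m setT = 1%E)//; exact: probability_setT.
move=> h4 h5; rewrite lerBlDr; apply: le_trans h5 (le_trans h4 _).
by rewrite lerD2l.
Unshelve. all: by end_near. Qed.

(** The limit in T is taken for fixed m with the margin dl = 1 / m, which then disappears in
    the limit in m. *)
Lemma level_fixed : s_r <= b ->
  (limn_esup (fun m => limf_esup (fun T => prob T m) (pinfty_nbhs R)) <= gamma%:E)%E.
Proof.
move=> sb; apply/lee_addgt0Pr => e e0; apply: limf_esup_le.
have e2 : 0 < e / 2 by rewrite divr_gt0.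
have lu := limit_upper e2 sb.
near=> m.
have m1 : (1 < m)%N by near: m; exact: nbhs_infty_gt.
have m0 : (0 < m)%N by exact: ltnW.
have hm : fine (iid mu m [set p | - (m%:R)^-1 <= mrg p]) <= gamma + e / 2 by near: m.
have dm : 0 < (m%:R : R)^-1 by rewrite invr_gt0 ltr0n.
have ru := rejection_upper eta_pp h_test rho_gt0 mS S_ge0 lln hF (U_freq m1) r_gt0 kappa_gt0 m0 (@margin_row_continuous R alpha kappa b z m) dm e2.
apply: limf_esup_le; near=> T.
have T0 : 0 < T by near: T; exact: nbhs_pinfty_gt.
rewrite rejection_fin// -EFinD lee_fin.
have : fine (P [set w | 0 < W (observed eta h (@U m) T w)]) <=
  fine (iid mu m [set p | - (m%:R)^-1 <= W (limit_row S kappa r p)]) + e / 2 by near: T.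
have -> : [set p | - (m%:R)^-1 <= W (limit_row S kappa r p)] = [set p : m.-tuple _ | - (m%:R)^-1 <= mrg p].
  by apply/seteqP; split=> p /=; rewrite margin_limit_row.
by move=> ?; lra.
Unshelve. all: by end_near. Qed.

Lemma power_fixed : b < s_r ->
  limn_einf (fun m => limf_einf (fun T => prob T m) (pinfty_nbhs R)) = 1%E.
Proof.
move=> sb; apply/eqP; rewrite eq_le; apply/andP; split.
  apply: (@limf_einf_le R nat nat); near=> m.
  have m1 : (1 < m)%N by near: m; exact: nbhs_infty_gt.
  apply: limf_einf_le; near=> T.
  have T0 : 0 < T by near: T; exact: nbhs_pinfty_gt.
  by rewrite rejection_fin// lee_fin fine_prob_le1//; exact: measurable_rejection.
apply/lee_addgt0Pr => e e0; rewrite -leeBlDr//; apply: limf_einf_ge.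
have e2 : 0 < e / 2 by rewrite divr_gt0.
have ll := limit_lower e2 sb.
near=> m.
have m1 : (1 < m)%N by near: m; exact: nbhs_infty_gt.
have m0 : (0 < m)%N by exact: ltnW.
have hm : 1 - e / 2 <= fine (iid mu m [set p | (m%:R)^-1 <= mrg p]) by near: m.
have dm : 0 < (m%:R : R)^-1 by rewrite invr_gt0 ltr0n.
have rl := rejection_lower eta_pp h_test rho_gt0 mS S_ge0 lln hF (U_freq m1) r_gt0 kappa_gt0 m0 (@margin_row_continuous R alpha kappa b z m) dm e2.
apply: limf_einf_ge; near=> T.
have T0 : 0 < T by near: T; exact: nbhs_pinfty_gt.
rewrite rejection_fin// -EFinB lee_fin.
have : fine (iid mu m [set p | (m%:R)^-1 <= W (limit_row S kappa r p)]) - e / 2 <=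
  fine (P [set w | 0 < W (observed eta h (@U m) T w)]) by near: T.
have -> : [set p | (m%:R)^-1 <= W (limit_row S kappa r p)] = [set p : m.-tuple _ | (m%:R)^-1 <= mrg p].
  by apply/seteqP; split=> p /=; rewrite margin_limit_row.
by move=> ?; lra.
Unshelve. all: by end_near. Qed.

End fixed_radius.

(** * Bias of the extrapolated intercept and conclusion *)

Section bias.
Context {R : realType}.
Variables (alpha beta L kappa r0 s c : R) (A eps : R -> R).
Hypotheses (alpha_gt0 : 0 < alpha) (L_gt0 : 0 < L) (kappa_gt1 : 1 < kappa)
  (A_expansion : forall r : R, 0 < r -> r <= r0 -> A r = s + c * r `^ alpha + eps r)
  (eps_bound : forall r : R, 0 < r -> r <= r0 -> `|eps r| <= L * r `^ beta).

(** The extrapolation is built to cancel the term of order alpha; what remains is a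
    combination of the two remainders, and the bias bound is the sum of their bounds. *)
Lemma extrapolation_bias r : 0 < r -> kappa * r <= r0 ->
  `|extrapolate alpha kappa (A r) (A (kappa * r)) - s| <= bias_bound alpha beta L kappa r.
Proof.
move=> r_gt0 kr.
have k0 : 0 < kappa := lt_trans ltr01 kappa_gt1.
have rr : r <= r0 by apply: le_trans kr; rewrite ler_peMl// ltW.
have kr0 : 0 < kappa * r by exact: mulr_gt0.
have K1 : 1 < kappa `^ alpha.
  rewrite (_ : 1 = 1 `^ alpha); last by rewrite powR1.
  by apply: (gt0_ltr_powR alpha_gt0 _ _ kappa_gt1); rewrite nnegrE// ltW.
have q0 : 0 < kappa `^ alpha - 1 by rewrite subr_gt0.
have e1 := eps_bound r_gt0 rr.
have e2 := eps_bound kr0 kr.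
rewrite powRM ?(ltW k0) ?(ltW r_gt0)// in e2.
rewrite /extrapolate (A_expansion r_gt0 rr) (A_expansion kr0 kr) powRM ?(ltW k0) ?(ltW r_gt0)//.
set K := kappa `^ alpha in K1 q0 *.
rewrite (_ : _ - s = (K * eps r - eps (kappa * r)) / (K - 1)); last by field; rewrite gt_eqF.
have qi : 0 < (K - 1)^-1 by rewrite invr_gt0.
rewrite normrM (gtr0_norm qi).
rewrite /bias_bound -/K (_ : L * _ * _ = (K * (L * r `^ beta) + L * (kappa `^ beta * r `^ beta)) / (K - 1)); last by ring.
rewrite (ler_pM2r qi); apply: le_trans (ler_normB _ _) _; apply: lerD => //.
rewrite normrM (gtr0_norm (lt_trans ltr01 K1)); apply: ler_wpM2l => //.
exact: ltW (lt_trans ltr01 K1).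
Qed.

End bias.

Lemma bias_bound_cvg0 (R : realType) (alpha beta L kappa : R) (rn : nat -> R) : 0 < beta ->
  (forall n, 0 < rn n) -> rn @ \oo --> 0 -> bias_bound alpha beta L kappa (rn n) @[n --> \oo] --> 0.
Proof.
move=> b0 rn0 H; rewrite /bias_bound; set D := L * _.
rewrite -[X in _ --> X](mulr0 D); apply: cvgM; first exact: cvg_cst.
apply/cvgrPdist_le => e e0; near=> n.
rewrite sub0r normrN ger0_norm ?powR_ge0//.
have h : `|0 - rn n| <= e `^ beta^-1.
  by near: n; move/cvgrPdist_le : H; apply; exact: powR_gt0.
rewrite sub0r normrN (gtr0_norm (rn0 n)) in h.
rewrite (_ : e = (e `^ beta^-1) `^ beta); last by rewrite -powRrM mulVf ?gt_eqF// powRr1// ltW.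
by apply: ge0_ler_powR => //; rewrite ?nnegrE ?powR_ge0// ltW.
Unshelve. all: by end_near. Qed.

Theorem theorem1 (R : realType) (d : nat) (d_gt0 : (0 < d)%N)
    (dO : measure_display) (Omega : measurableType dO) (P : probability Omega R)
    (eta : R.-ker Omega ~> 'rV[R]_d)
    (eta_pp : point_process eta)
    (eta_stationary : stationary P eta) (eta_ergodic : ergodic P eta)
    (rho : R) (rho_gt0 : 0 < rho) (eta_intensity : has_intensity P eta rho)
    (eta_moments : local_second_moments P eta)
    (sigma : {measure set 'rV[R]_d -> \bar R})
    (sigma_bartlett : bartlett_measure P eta rho sigma)
    (sigma_ac : sigma `<< lebesgue_rV R d)
    (S : 'rV[R]_d -> R) (S_factor : structure_factor rho sigma S)
    (h : 'rV[R]_d -> R[i]) (h_test : test_function h)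
    (hF : fourier_condition P eta rho S h)
    (alpha beta L r0 : R) (alpha_gt0 : 0 < alpha) (alpha_lt_beta : alpha < beta)
    (L_gt0 : 0 < L) (r0_gt0 : 0 < r0)
    (s c : R) (s_ge0 : 0 <= s) (eps : R -> R)
    (A_expansion : forall r : R, 0 < r -> r <= r0 ->
      ball_average rho sigma r = s + c * r `^ alpha + eps r)
    (eps_bound : forall r : R, 0 < r -> r <= r0 -> `|eps r| <= L * r `^ beta)
    (S_square_integrable :
      (\int[lebesgue_rV R d]_(xi in eball r0) (S xi ^+ 2)%:E < +oo)%E)
    (gamma kappa : R) (gamma_gt0 : 0 < gamma) (gamma_lt1 : gamma < 1)
    (kappa_gt1 : 1 < kappa)
    (U : R -> forall m, bool -> 'I_m -> {RV P >-> 'rV[R]_d})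
    (U_freq : forall (r : R) (m : nat), 0 < r -> r <= r0 / kappa -> (2 <= m)%N ->
      random_frequencies eta kappa r (U r m)) :
  let A := ball_average rho sigma in
  let s_ r := extrapolate alpha kappa (A r) (A (kappa * r)) in
  let b := bias_bound alpha beta L kappa in
  let prob T m r := rejection_probability eta h alpha beta L kappa gamma U T m r in
  (forall r : R, 0 < r -> r <= r0 / kappa ->
    [/\ s = 0 ->
          (limn_esup (fun m => limf_esup (fun T => prob T m r) (pinfty_nbhs R))
             <= gamma%:E)%E,
        b r < s_ r ->
          limn_einf (fun m => limf_einf (fun T => prob T m r) (pinfty_nbhs R)) = 1%E &
        2 * b r < s -> b r < s_ r]) /\
  (forall rn : nat -> R, (forall n, 0 < rn n) -> nonincreasing_seq rn ->
    rn @ \oo --> 0 -> (forall n, kappa * rn n <= r0) ->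
    (s = 0 ->
      (limn_esup (fun n => limn_esup (fun m =>
         limf_esup (fun T => prob T m (rn n)) (pinfty_nbhs R))) <= gamma%:E)%E) /\
    (0 < s ->
      limn_einf (fun m =>
        limf_einf (fun T => prob T m (rn n)) (pinfty_nbhs R)) @[n --> \oo] --> 1%E)).
Proof.
move=> A s_ b prob.
have kappa_gt0 : 0 < kappa := lt_trans ltr01 kappa_gt1.
have sigma0 := sigma_origin d_gt0 sigma_ac.
have lln (e : R) : 0 < e -> fine (P [set w | e <= `|empirical_intensity eta T w - rho|]) @[T --> +oo] --> 0.
  exact: (empirical_lln rho_gt0 eta_pp eta_moments sigma_bartlett sigma0).
have kr r : r <= r0 / kappa -> kappa * r <= r0 by rewrite ler_pdivlMr// mulrC.
have bias r : 0 < r -> kappa * r <= r0 -> `|s_ r - s| <= b r.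
  exact: (extrapolation_bias alpha_gt0 kappa_gt1 A_expansion eps_bound).
have level r : 0 < r -> r <= r0 / kappa -> s = 0 ->
    (limn_esup (fun m => limf_esup (fun T => prob T m r) (pinfty_nbhs R)) <= gamma%:E)%E.
  move=> r_gt0 rr s0.
  apply: (level_fixed eta_pp h_test rho_gt0 S_factor lln hF alpha_gt0 L_gt0 S_square_integrable gamma_gt0 gamma_lt1 kappa_gt1 r_gt0 (kr _ rr)).
    by move=> m m2; exact: U_freq.
  by have := bias r r_gt0 (kr _ rr); rewrite s0 subr0; apply: le_trans; exact: ler_norm.
have power r : 0 < r -> r <= r0 / kappa -> b r < s_ r ->
    limn_einf (fun m => limf_einf (fun T => prob T m r) (pinfty_nbhs R)) = 1%E.
  move=> r_gt0 rr sb.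
  apply: (power_fixed eta_pp h_test rho_gt0 S_factor lln hF gamma alpha_gt0 S_square_integrable kappa_gt1 r_gt0 (kr _ rr)) => //.
  by move=> m m2; exact: U_freq.
have large r : 0 < r -> r <= r0 / kappa -> 2 * b r < s -> b r < s_ r.
  move=> r_gt0 rr h1; have := bias r r_gt0 (kr _ rr); rewrite ler_norml => /andP[h2 _]; lra.
split=> [r r_gt0 rr|rn rn0 _ rncvg krn].
  by split; [exact: level|exact: power|exact: large].
have rr n : rn n <= r0 / kappa by rewrite ler_pdivlMr// mulrC.
split=> [s0|s0].
  apply: limf_esup_le; near=> n; exact: level.
have /cvgrPdist_le/(_ (s / 4)) := bias_bound_cvg0 alpha L kappa (lt_trans alpha_gt0 alpha_lt_beta) rn0 rncvg.
rewrite divr_gt0// => /(_ isT) bs.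
apply: cvg_near_cst; near=> n; apply: power => //; apply: large => //.
have : `|0 - b (rn n)| <= s / 4 by near: n.
rewrite sub0r normrN => /(le_trans (ler_norm _)) h1; lra.
Unshelve. all: by end_near. Qed.
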